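(* Let $\alpha\in(0,1)$ be irrational with modified continued fraction expansion $\alpha=\cfrac{1}{e_1-\cfrac{1}{e_2-\cfrac{1}{e_3-\cdots}}}$, and suppose that there is $N$ such that the integers $e_j$ satisfy $3\leq e_j\leq N$ for all $j\geq 1$. Then the toric $4$-manifold $M_\alpha$ (defined in the context) carries a complete self-dual Einstein metric $g_\alpha$ of negative scalar curvature which is preserved by the smooth action of $T^2$ on $M_\alpha$.
   Context: Continued fraction data. Define integer pairs by $(m_0,n_0)=(0,-1)$, $(m_1,n_1)=(1,0)$ and, for $j\geq 2$, $(m_j,n_j)$ coprime with $m_j>0$ and $\frac{n_j}{m_j}=\cfrac{1}{e_1-\cfrac{1}{e_2-\cdots\cfrac{1}{e_{j-1}}}}$. Set $a_j=\frac{n_{j+1}-n_j}{m_{j+1}-m_j}$ for $j\geq 0$ and $a_{-1}=\infty$. The sequence $(a_j)_{j\ge0}$ is strictly decreasing with $a_0=1$ and limit $\alpha$, and $m_jn_{j+1}-m_{j+1}n_j=1$. The manifold $M_\alpha$. Let $T^2=\mathbb{R}^2/(2\pi\mathbb{Z})^2$ with linear coordinates $z=(z_1,z_2)$; $S^1_{(m,n)}$ denotes the circle subgroup generated by $m\partial_{z_1}+n\partial_{z_2}$. Let $D_+=\{(x,y):x>\alpha,\ y>0\}$ and $\overline{D}_+=D_+\cup\{(x,0):x>\alpha\}$. The boundary $\{(x,0):x>\alpha\}$ is the union of the edges $[a_j,a_{j-1}]$, $j\geq 0$ (for $j=0$, the edge is $[1,\infty)$); the points $a_j$, $j\geq0$,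 are the corners. $M_\alpha$ is obtained from $\overline{D}_+\times T^2$ by collapsing the circle $S^1_{(m_j,n_j)}$ over each interior point of the edge $[a_j,a_{j-1}]$ and collapsing all of $T^2$ over each corner. It has a $T^2$-action and a projection $\pi:M_\alpha\to\overline{D}_+$, with $\pi^{-1}(D_+)=D_+\times T^2$. Its smooth structure is the product one over $D_+$. Near an interior point of the edge labelled $(m,n)=(m_j,n_j)$, choose $(p,q)$ so that $(m,n),(p,q)$ is a $\mathbb{Z}$-basis of $\mathbb{Z}^2$ and write $z=s(m,n)+t(p,q)$; then $(x,\,t \bmod 2\pi,\,ye^{is})$ are smooth coordinates. Near the corner $a_j$, write $x-a_j+iy=(r_2+ir_1)^2$ with $r_1,r_2\geq 0$ and $z=s_1(m_j,n_j)+s_2(m_{j+1},n_{j+1})$; then $(r_1e^{is_1},r_2e^{is_2})\in\mathbb{C}^2=\mathbb{R}^4$ are smooth coordinates. A Riemannian metric on a $4$-manifold is self-dual if, for a suitable choice of orientation, the anti-self-dual part of its Weyl curvature vanishes. *)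

(* Defs.v *)
From HB Require Import structures.
From mathcomp Require Import all_boot all_order all_algebra.
From mathcomp Require Import all_classical all_reals all_analysis.

Set Implicit Arguments.
Unset Strict Implicit.
Unset Printing Implicit Defensive.

Import Order.TTheory GRing.Theory Num.Theory.
Import numFieldNormedType.Exports.

Local Open Scope classical_set_scope.
Local Open Scope ring_scope.

(** * Modified continued fractions; [e 0] is never used. *)

(** [cfrac e k = 1 / (e_1 - 1 / (e_2 - ... 1 / e_k))], and [0] for [k = 0]. *)
Definition cfrac (e : nat -> int) (k : nat) : rat :=
  foldr (fun c r => (c%:~R - r)^-1) 0 [seq e i | i <- iota 1 k].

(** The pairs (m_j, n_j).  [numq] and [denq] are coprime and [0 < denq]. *)
Definition mn (e : nat -> int) (j : nat) : int * int :=
  match j with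
  | 0 => (0, -1)
  | 1 => (1, 0)
  | k.+1 => (denq (cfrac e k), numq (cfrac e k))
  end.

Section Toric.
Variable R : realType.

Definition has_modified_cf (alpha : R) (e : nat -> int) : Prop :=
  (fun k => ratr (cfrac e k) : R) @ \oo --> alpha.

Variables (alpha : R) (e : nat -> int).

Definition corner (j : nat) : R :=
  ((mn e j.+1).2 - (mn e j).2)%:~R / ((mn e j.+1).1 - (mn e j).1)%:~R.

(** [prev_corner j] is a_(j-1), with a_(-1) = +oo. *)
Definition prev_corner (j : nat) : \bar R :=
  if j is k.+1 then (corner k)%:E else +oo%E.

Definition edge_interior (j : nat) (x : R) : Prop :=
  corner j < x /\ (x%:E < prev_corner j)%E.

Definition vec (p : int * int) : R * R := (p.1%:~R, p.2%:~R).

(** * The set M_alpha *)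

(** A representative ((x, y), (z_1, z_2)) of a point of the half plane times
    the torus; the angles are taken in R^2. *)
Definition rep : Type := ((R * R) * (R * R))%type.

(** The subspace of R^2 whose image in the torus is collapsed over [b]. *)
Definition collapsed (b : R * R) : set (R * R) :=
  [set w | w = 0 \/
    (b.2 = 0 /\
     ((exists2 j, edge_interior j b.1 & exists s : R, w = s *: vec (mn e j)) \/
      (exists j, b.1 = corner j)))].

(** The points of M_alpha are equivalence classes of representatives. *)
Definition cls (q : rep) : set rep :=
  [set q' | q'.1 = q.1 /\
    exists2 w, collapsed q.1 w &
      exists k l : int, q'.2 = q.2 + w + (2 * pi * k%:~R, 2 * pi * l%:~R)].

Definition Malpha : set (set rep) :=
  cls @` [set q | alpha < q.1.1 /\ 0 <= q.1.2].

(** The action of the element of the torus represented by [w]. *)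
Definition act (w : R * R) (P : set rep) : set rep :=
  [set (q.1, q.2 + w) | q in P].

(** * The smooth structure of M_alpha *)

Inductive chart : Type :=
  | Interior
  | Edge of nat & int * int (* j and the complementary vector (p, q) *)
  | Corner of nat.

Definition row4 (a b c d : R) : 'rV[R]_4 := \row_i [:: a; b; c; d]`_i.

(** [has_coords c r v]: the representative [r] has coordinates [v] in the
    chart [c].  The angles s, t, s_1, s_2 are only defined modulo 2 pi, and are
    arbitrary where the corresponding radius vanishes. *)
Definition has_coords (c : chart) (r : rep) (v : 'rV[R]_4) : Prop :=
  let: ((x, y), z) := r in
  match c with
  | Interior => v = row4 x y z.1 z.2
  | Edge j pq =>
      exists s t : R, z = s *: vec (mn e j) + t *: vec pq /\
        v = row4 x t (y * cos s) (y * sin s)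
  | Corner j =>
      exists r1 r2 s1 s2 : R,
        [/\ 0 <= r1 /\ 0 <= r2,
            (* x - a_j + i y = (r_2 + i r_1)^2 *)
            x - corner j = r2 ^+ 2 - r1 ^+ 2 /\ y = 2 * r1 * r2,
            z = s1 *: vec (mn e j) + s2 *: vec (mn e j.+1) &
            v = row4 (r1 * cos s1) (r1 * sin s1) (r2 * cos s2) (r2 * sin s2)]
  end.

(** The part of the half plane covered by a chart.  The domain of [Edge j pq]
    is empty unless (m_j, n_j), pq is a basis of Z^2. *)
Definition chart_base (c : chart) : set (R * R) :=
  match c with
  | Interior => [set b | alpha < b.1 /\ 0 < b.2]
  | Edge j pq => [set b | [/\ `|(mn e j).1 * pq.2 - (mn e j).2 * pq.1| = 1,
                              edge_interior j b.1 & 0 <= b.2]]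
  | Corner j => [set b | [/\ corner j.+1 < b.1,
                             (b.1%:E < prev_corner j)%E & 0 <= b.2]]
  end.

Definition chart_dom (c : chart) : set 'rV[R]_4 :=
  [set v | exists2 r, has_coords c r v & chart_base c r.1].

(** The point of M_alpha with coordinates [v] in the chart [c], for [v] in
    [chart_dom c]: all the [cls r] in this union are equal. *)
Definition param (c : chart) (v : 'rV[R]_4) : set rep :=
  \bigcup_(r in [set r | has_coords c r v /\ chart_base c r.1]) cls r.

(** Near [v], the map [tau] is the expression in the charts [c] and [c'] of
    the map [F] of M_alpha. *)
Definition represents (F : set rep -> set rep) (c c' : chart)
    (tau : 'rV[R]_4 -> 'rV[R]_4) (v : 'rV[R]_4) : Prop :=
  \forall u \near v, chart_dom c' (tau u) /\ param c' (tau u) = F (param c u).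

(** * Calculus on R^4 *)

Definition partial (i : 'I_4) (f : 'rV[R]_4 -> R) : 'rV[R]_4 -> R :=
  fun v => 'D_(delta_mx 0 i) f v.

(** For open [U]: all iterated partial derivatives exist and are continuous. *)
Definition smooth_on (U : set 'rV[R]_4) (f : 'rV[R]_4 -> R) : Prop :=
  forall (s : seq 'I_4) (v : 'rV[R]_4), U v ->
    {for v, continuous (foldr partial f s)} /\
    forall i, derivable (foldr partial f s) v (delta_mx 0 i).

Definition smooth_map_at (tau : 'rV[R]_4 -> 'rV[R]_4) (v : 'rV[R]_4) : Prop :=
  exists2 U, open_nbhs v U & forall i, smooth_on U (fun u => tau u 0 i).

(** * Riemannian metrics on M_alpha *)

(** A tensor is given by its components in every chart. *)
Definition tensor2 : Type := chart -> 'rV[R]_4 -> 'M[R]_4.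

(** The pullback at [v] by a map with expression [tau] in the charts [c], [c'];
    the rows of ['J tau v] are the partial derivatives of [tau]. *)
Definition pullback (g : tensor2) (c' : chart) (tau : 'rV[R]_4 -> 'rV[R]_4)
    (v : 'rV[R]_4) : 'M[R]_4 :=
  'J tau v *m g c' (tau v) *m ('J tau v)^T.

Record riemannian_metric (g : tensor2) : Prop := RiemannianMetric {
  metric_smooth : forall c i j, smooth_on (chart_dom c) (fun v => g c v i j);
  metric_sym : forall c v, chart_dom c v -> (g c v)^T = g c v;
  metric_pos : forall c v, chart_dom c v ->
    forall w : 'rV[R]_4, w != 0 -> 0 < (w *m g c v *m w^T) 0 0;
  metric_compat : forall c c' tau v, chart_dom c v ->
    represents id c c' tau v -> differentiable tau v ->
    g c v = pullback g c' tau v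
}.

(** [F] is smooth and preserves [g]. *)
Definition smooth_isometric (g : tensor2) (F : set rep -> set rep) : Prop :=
  forall c v, chart_dom c v -> exists c' tau,
    [/\ represents F c c' tau v, smooth_map_at tau v &
        g c v = pullback g c' tau v].

Definition torus_invariant (g : tensor2) : Prop :=
  forall w : R * R, smooth_isometric g (act w).

(** ** Riemannian distance and completeness *)

Definition C1_segment (c : chart) (gam : R -> 'rV[R]_4) : Prop :=
  forall t : R, 0 <= t <= 1 ->
    [/\ chart_dom c (gam t), derivable gam t 1 & {for t, continuous (derive1 gam)}].

Definition segment_length (g : tensor2) (c : chart) (gam : R -> 'rV[R]_4) : R :=
  \int[lebesgue_measure]_(t in `[0, 1])
     Num.sqrt ((derive1 gam t *m g c (gam t) *m (derive1 gam t)^T) 0 0).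

(** Piecewise C^1 paths, subdivided so that every piece lies in a chart. *)
Inductive joined (g : tensor2) : set rep -> set rep -> R -> Prop :=
  | joined_refl P : joined g P P 0
  | joined_cons c gam Q L : C1_segment c gam ->
      joined g (param c (gam 1)) Q L ->
      joined g (param c (gam 0)) Q (segment_length g c gam + L).

Definition rdist (g : tensor2) (P Q : set rep) : \bar R :=
  ereal_inf [set L%:E | L in joined g P Q].

Definition complete_metric (g : tensor2) : Prop :=
  forall P : nat -> set rep, (forall k, Malpha (P k)) ->
    (forall eps : R, 0 < eps -> exists K, forall k l,
       (K <= k)%N -> (K <= l)%N -> (rdist g (P k) (P l) < eps%:E)%E) ->
    exists2 Q, Malpha Q & (fun k => rdist g (P k) Q) @ \oo --> (0%E : \bar R).

(** ** Curvature, in a chart, of [G : 'rV[R]_4 -> 'M[R]_4] *)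

(** Gamma^k_ij *)
Definition christoffel (G : 'rV[R]_4 -> 'M[R]_4) (k i j : 'I_4)
    (v : 'rV[R]_4) : R :=
  2^-1 * \sum_l invmx (G v) k l *
    (partial i (fun u => G u j l) v + partial j (fun u => G u i l) v
     - partial l (fun u => G u i j) v).

(** R^l_kij, where R(d_i, d_j) d_k = R^l_kij d_l and
    R(X, Y) = [nabla_X, nabla_Y] - nabla_[X, Y] *)
Definition riemann_up (G : 'rV[R]_4 -> 'M[R]_4) (l k i j : 'I_4)
    (v : 'rV[R]_4) : R :=
  partial i (christoffel G l j k) v - partial j (christoffel G l i k) v
  + \sum_m (christoffel G l i m v * christoffel G m j k v
            - christoffel G l j m v * christoffel G m i k v).

(** R_lkij = g(R(d_i, d_j) d_k, d_l) *)
Definition riemann (G : 'rV[R]_4 -> 'M[R]_4) (l k i j : 'I_4)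
    (v : 'rV[R]_4) : R :=
  \sum_m G v l m * riemann_up G m k i j v.

Definition ricci (G : 'rV[R]_4 -> 'M[R]_4) (v : 'rV[R]_4) : 'M[R]_4 :=
  \matrix_(j, k) \sum_i riemann_up G i k i j v.

Definition scal (G : 'rV[R]_4 -> 'M[R]_4) (v : 'rV[R]_4) : R :=
  \sum_j \sum_k invmx (G v) j k * ricci G v j k.

Definition weyl (G : 'rV[R]_4 -> 'M[R]_4) (l k i j : 'I_4)
    (v : 'rV[R]_4) : R :=
  let g := G v in let Ric := ricci G v in
  riemann G l k i j v
  - 2^-1 * (Ric j k * g i l - Ric i k * g j l + Ric i l * g j k - Ric j l * g i k)
  + scal G v / 6 * (g j k * g i l - g i k * g j l).

Definition levi_civita (i j k l : 'I_4) : R :=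
  \det (rowsub (tnth [tuple i; j; k; l]) (1%:M : 'M[R]_4)).

(** The Hodge star on 2-forms for the metric [g] and the orientation [o] (1 or
    -1) relative to the coordinates; raising both indices of [om] gives
    [invmx g *m om *m invmx g] as [g] is symmetric. *)
Definition hodge (o : R) (g om : 'M[R]_4) : 'M[R]_4 :=
  \matrix_(i, j) (2^-1 * \sum_k \sum_l
     o * Num.sqrt (\det g) * levi_civita k l i j
       * (invmx g *m om *m invmx g) k l).

(** The anti-self-dual part W^- = W o (1 - star) / 2 of the Weyl curvature. *)
Definition weyl_minus (o : R) (G : 'rV[R]_4 -> 'M[R]_4) (l k : 'I_4)
    (v : 'rV[R]_4) : 'M[R]_4 :=
  let W := \matrix_(i, j) weyl G l k i j v in
  2^-1 *: (W - hodge o (G v) W).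

(** ** The properties of the metric *)

(** [o c v] is the sign of the coordinate frame of [c] at [v]. *)
Record orientation (o : chart -> 'rV[R]_4 -> R) : Prop := Orientation {
  orientation_sign : forall c v, chart_dom c v -> o c v = 1 \/ o c v = -1;
  orientation_locally_constant : forall c v, chart_dom c v ->
    \forall u \near v, o c u = o c v;
  orientation_compat : forall c c' tau v, chart_dom c v ->
    represents id c c' tau v -> differentiable tau v ->
    o c v = Num.sg (\det ('J tau v)) * o c' (tau v)
}.

Definition self_dual (g : tensor2) : Prop :=
  exists2 o, orientation o &
    forall c v, chart_dom c v -> forall l k, weyl_minus (o c v) (g c) l k v = 0.

Definition einstein (g : tensor2) : Prop :=
  exists lam : R, forall c v, chart_dom c v -> ricci (g c) v = lam *: g c v.

Definition negative_scalar_curvature (g : tensor2) : Prop :=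
  forall c v, chart_dom c v -> scal (g c) v < 0.

End Toric.

(* Main.v *)
Require Import Defs.
From HB Require Import structures.
From mathcomp Require Import all_boot all_order all_algebra.
From mathcomp Require Import all_classical all_reals all_analysis.
From mathcomp Require Import ring lra zify.

Set Implicit Arguments.
Unset Strict Implicit.
Unset Printing Implicit Defensive.

Import Order.TTheory GRing.Theory Num.Theory.
Import numFieldNormedType.Exports.

Local Open Scope classical_set_scope.
Local Open Scope ring_scope.

(** The metric is the toric self-dual Einstein metric of Calderbank and Pedersen given on
    the half plane by the eigenfunction
      [f = sum_j w_j (|z - a_j'| - |z - a_j|)],  [2 w_j = m_(j+1) - m_j],
    with [a_j' = 2 alpha - a_j] the reflection of the corner [a_j] in [alpha]; on the edge
    [a_j, a_(j-1)] it reduces to the linear function [m_j x - n_j], which is what makes the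
    metric extend over the collapsed circles.  With [p = f_x], [k = f_y / y] and
    [V = p^2 + y^2 k^2 - f k] the metric is
      [f^-2 (V (dx^2 + dy^2) + (s_1^2 + s_2^2) / V)].
    Off the axis the curvature is read off from a triple of self-dual 2-forms that are the
    curvature forms of an SO(3)-connection: such a metric is Einstein with one half of its
    Weyl tensor zero.  Near the edges and the corners the metric has an explicit smooth
    expression, and everything else extends to the axis by density.  Two charts are compared
    by pulling back to a common chart, and the ambiguity is a deck transformation, which is
    locally constant and isometric.  For completeness, [log f] and [log (f / |z - alpha|)]
    are 1-Lipschitz, so that a Cauchy sequence remains in a compact part of the half plane,
    away from [alpha] and from infinity. *)

(** * Calculus on R^4 *)

(** The weights [w_j] grow and only [w_j (a_j - alpha)] is summable, so the corners alone give a
    divergent series. Subtracting each corner from its mirror image leaves terms of that size and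
    makes [f] tend to 0 at the line x = alpha, which thereby lies at infinite distance. Everything
    is measured by the numbers m_j alpha - n_j, which telescope from 1 to 0. Positivity of [V] comes
    from the two signs f > 0 and k < 0, both termwise: right of alpha a point is nearer to a corner
    than to its mirror image. The obstacle is the axis, where y, the polar angles and the
    orthonormal coframe are not smooth. Functions on the half plane are therefore treated as
    functions on R^4 of x and of y^2 = v_2^2 + v_3^2. Along an edge [f] and [f_x] are a linear
    function and its slope plus y^2 times series smooth across the edge; at a corner its own term is
    split off, where |z - a_j| becomes the polynomial r_1^2 + r_2^2. That the poles in 1 / y cancel
    is then polynomial algebra, which at a corner rests on m_j n_(j+1) - m_(j+1) n_j = 1. *)

Section Calculus.
Variable R : realType.
Local Notation V := 'rV[R]_4.
Local Notation base i := (delta_mx 0 i : V).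

Lemma coord_le_norm (u : V) i : `|u 0 i| <= `|u|.
Proof.
by rewrite [leRHS]/Num.Def.normr/= mx_normrE; exact: (le_bigmax _ _ (0, i)).
Qed.

Lemma norm_le_coord (u : V) (c : R) :
  0 <= c -> (forall i, `|u 0 i| <= c) -> `|u| <= c.
Proof.
move=> c0 H; rewrite [leLHS]/Num.Def.normr/= mx_normrE.
by apply: bigmax_le => // -[i j] _; rewrite (ord1 i) /=.
Qed.

Lemma norm_base i : `|base i| <= 1.
Proof.
apply: norm_le_coord => // j; rewrite mxE eqxx /=.
by case: eqP; rewrite ?normr1 ?normr0.
Qed.

Lemma row_base (u : V) : u = \sum_i u 0 i *: base i.
Proof. exact: row_sum_delta. Qed.

(** Restriction to the line through [v] reduces directional derivatives to one real variable, where
    the chain rule for real functions applies. *)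
Lemma is_derive_lineP (U W : normedModType R) (f : U -> W) (v w : U) (d : W) :
  is_derive v w f d <-> is_derive (0 : R) 1 (fun h : R => f (h *: w + v)) d.
Proof.
have E : (fun h : R => h^-1 *: (((fun s : R => f (s *: w + v)) \o shift 0) (h *: 1)
     - f (0 *: w + v))) = (fun h : R => h^-1 *: ((f \o shift v) (h *: w) - f v)).
  by apply/funext => h /=; rewrite [h *: 1]mulr1 scale0r add0r addr0.
split=> -[D <-]; split; move: D; rewrite /derivable /derive.
- by rewrite E.
- by rewrite E.
- by rewrite E.
- by rewrite -E.
Qed.

Lemma is_derive_line (f : V -> R) (u w : V) (t : R) :
  derivable f (u + t *: w) w ->
  is_derive t 1 (fun s => f (u + s *: w)) ('D_w f (u + t *: w)).
Proof.
have E : (fun h : R => h^-1 *: (((fun s => f (u + s *: w)) \o shift t) (h *: 1) -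
      f (u + t *: w))) =
   (fun h : R => h^-1 *: ((f \o shift (u + t *: w)) (h *: w) - f (u + t *: w))).
  apply/funext => h /=; congr (_ *: (f _ - _)).
  by rewrite [h *: 1]mulr1 scalerDl addrCA.
by move=> df; split; rewrite /derivable /derive E.
Qed.

Lemma mvt_line (f : V -> R) (u w : V) :
  (forall t : R, 0 <= t <= 1 -> derivable f (u + t *: w) w) ->
  exists2 c : R, 0 <= c <= 1 & f (u + w) - f u = 'D_w f (u + c *: w).
Proof.
move=> df.
have Hd (t : R) : 0 <= t <= 1 ->
    is_derive t 1 (fun s => f (u + s *: w)) ('D_w f (u + t *: w)).
  by move=> /df; exact: is_derive_line.
have [||c] := @MVT_segment R (fun s => f (u + s *: w))
    (fun s => 'D_w f (u + s *: w)) 0 1 ler01.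
- move=> x; rewrite in_itv /= => /andP[x0 x1].
  by apply: Hd; rewrite !ltW.
- apply: derivable_within_continuous => x; rewrite in_itv /= => xi.
  by have [] := Hd _ xi.
rewrite in_itv /= => c01; rewrite scale1r scale0r addr0 subr0 mulr1 => ->.
by exists c.
Qed.

Lemma deriveZv (f : V -> R) (u w : V) (h : R) :
  derivable f u w -> is_derive u (h *: w) f (h * 'D_w f u).
Proof.
move=> df.
have [->|h0] := eqVneq h 0.
  by rewrite scale0r mul0r; exact: is_derive0.
have df0 : derivable f (u + 0 *: w) w by rewrite scale0r addr0.
have H1 := is_derive_line df0.
have H2 : is_derive (0:R) 1 (fun s : R => h * s) h.
  have := is_deriveZ h (is_derive_id (0 : R^o) 1).
  by rewrite [h *: 1]mulr1.
have H3 : is_derive (h * 0) 1 (fun s => f (u + s *: w)) ('D_w f u).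
  by rewrite mulr0; move: H1; rewrite scale0r addr0.
have := is_derive1_comp H3 H2; rewrite mulrC => -[D <-].
have E : (fun s => f (u + s *: w)) \o (fun s : R => h * s) =
   fun s => f (s *: (h *: w) + u).
  by apply/funext => s /=; rewrite scalerA [s * h]mulrC addrC.
rewrite E in D *; exact/is_derive_lineP.
Qed.

Lemma mvt_base (f : V -> R) (u : V) (i : 'I_4) (h : R) :
  (forall t : R, 0 <= t <= 1 -> derivable f (u + (t * h) *: base i) (base i)) ->
  exists2 c : R, 0 <= c <= 1 &
    f (u + h *: base i) - f u = h * partial i f (u + (c * h) *: base i).
Proof.
move=> df; have [t /df|c c01 ->] := @mvt_line f u (h *: base i).
  by rewrite -scalerA => /(deriveZv h)[].
exists c => //; rewrite -scalerA /partial; have := df _ c01.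
by rewrite -scalerA => /(deriveZv h)[_ ->].
Qed.

(** Class C^n by recursion on the order. The lists of partial derivatives in [smooth_on] give no
    induction for products, inverses or composites; the order [n] does. *)
Fixpoint Ck (n : nat) (U : set V) (f : V -> R) : Prop :=
  (forall v, U v -> {for v, continuous f}) /\
  if n is m.+1 then
    (forall i v, U v -> derivable f v (base i)) /\
    (forall i, Ck m U (partial i f))
  else True.

Lemma Ck_cont n U f v : Ck n U f -> U v -> {for v, continuous f}.
Proof. by case: n => [|n] [] H _; exact: H. Qed.

Lemma Ck_derivable n U f i v : Ck n.+1 U f -> U v -> derivable f v (base i).
Proof. by move=> [_ [H _]]; exact: H. Qed.

Lemma Ck_partial n U f i : Ck n.+1 U f -> Ck n U (partial i f).
Proof. by move=> [_ [_]]; exact. Qed.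

Lemma Ck_S n U f : Ck n.+1 U f -> Ck n U f.
Proof.
elim: n f => [|n IH] f [c [d p]]; split=> //; split=> // i.
by apply: IH; exact: p.
Qed.

Lemma Ck_le m n U f : (m <= n)%N -> Ck n U f -> Ck m U f.
Proof.
move=> /subnKC <-; elim: (n - m)%N => [|k IH]; first by rewrite addn0.
by rewrite addnS => /Ck_S.
Qed.

Lemma foldr_partial_rcons f s i :
  foldr (@partial R) f (rcons s i) = foldr (@partial R) (partial i f) s.
Proof. by elim: s => //= j s ->. Qed.

Lemma smooth_onP U f : smooth_on U f <-> forall n, Ck n U f.
Proof.
split=> [H n|H s].
  have {}H s : Ck 0 U (foldr (@partial R) f s) /\
     (forall i v, U v -> derivable (foldr (@partial R) f s) v (base i)).
    split; last by move=> i v Uv; exact: (H s v Uv).2.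
    by split=> // v Uv; exact: (H s v Uv).1.
  elim: n f H => [|n IH] f H; first exact: (H [::]).1.
  split; first exact: (H [::]).1.1.
  split; first exact: (H [::]).2.
  by move=> i; apply: IH => s; rewrite -foldr_partial_rcons; exact: H.
(* [foldr] takes the last index of the list first, so the list is peeled from its end. *)
elim/last_ind: s f H => [|s i IH] f H v Uv.
  by split=> [|i]; [exact: Ck_cont (H 0%N) Uv | exact: Ck_derivable (H 1%N) Uv].
rewrite foldr_partial_rcons; apply: IH => // n; exact: Ck_partial (H n.+1).
Qed.

Lemma partial_eq_on (U : set V) f g i v : open U -> U v ->
  (forall u, U u -> f u = g u) -> partial i f v = partial i g v.
Proof.
move=> oU Uv fg; apply: near_eq_derive.
by near=> u; apply: fg; near: u; exact: open_nbhs_nbhs.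
Unshelve. all: by end_near. Qed.

Lemma near_eq_continuous (f g : V -> R) (v : V) :
  {near v, f =1 g} -> {for v, continuous f} -> {for v, continuous g}.
Proof.
move=> fg; rewrite /prop_for /continuous_at -(nbhs_singleton fg) => cf.
by move=> A /cf H; apply: filterS2 fg H => u /= <-.
Qed.

Lemma Ck_ext n (U : set V) f g : open U -> (forall u, U u -> f u = g u) ->
  Ck n U f -> Ck n U g.
Proof.
move=> oU; elim: n f g => [|n IH] f g fg.
  move=> [c _]; split=> // v Uv; apply: near_eq_continuous (c v Uv).
  by near=> u; apply: fg; near: u; exact: open_nbhs_nbhs.
move=> [c [d p]]; split; [|split].
- move=> v Uv; apply: near_eq_continuous (c v Uv).
  by near=> u; apply: fg; near: u; exact: open_nbhs_nbhs.
- move=> i v Uv; apply: near_eq_derivable (d i v Uv).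
  by near=> u; apply: fg; near: u; exact: open_nbhs_nbhs.
- move=> i; apply: IH (p i) => u Uu.
  exact: partial_eq_on oU Uu fg.
Unshelve. all: by end_near. Qed.

Lemma Ck_sub n (U U' : set V) f : U' `<=` U -> Ck n U f -> Ck n U' f.
Proof.
move=> sU; elim: n f => [|n IH] f.
  by move=> [c _]; split=> // v /sU; exact: c.
move=> [c [d p]]; split; [|split].
- by move=> v /sU; exact: c.
- by move=> i v /sU; exact: d.
- by move=> i; exact: IH (p i).
Qed.

(* Moving from [v] to [v + w] one coordinate at a time, the mean value theorem
   gives partial derivatives at points no farther from [v] than [w] is long. *)
Lemma increment_partials (f : V -> R) (v w : V) :
  (forall u, `|u - v| <= `|w| -> forall i, derivable f u (base i)) ->
  exists xi : 'I_4 -> V, (forall i, `|xi i - v| <= `|w|) /\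
    f (v + w) - f v = \sum_i w 0 i * partial i f (xi i).
Proof.
move=> df.
pose P (k : nat) : V := \row_(i < 4) (if (i < k)%N then w 0 i else 0).
have P0 : P 0%N = 0 by apply/rowP => i; rewrite !mxE.
have P4 : P 4%N = w by apply/rowP => i; rewrite !mxE ltn_ord.
have PS (i : 'I_4) : P i.+1 = P i + w 0 i *: base i.
  apply/rowP => j; rewrite !mxE eqxx /= ltnS leq_eqVlt.
  have [->|nij] := eqVneq j i; first by rewrite eqxx ltnn /= mulr1 add0r.
  by rewrite -val_eqE in nij; rewrite (negbTE nij) /= mulr0 addr0.
have bd (i : 'I_4) (t : R) : 0 <= t <= 1 ->
    `|v + P i + (t * w 0 i) *: base i - v| <= `|w|.
  move=> /andP[t0 t1]; rewrite addrAC [v + _]addrC addrK.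
  apply: norm_le_coord => // j; rewrite !mxE eqxx /=.
  have [->|nij] := eqVneq j i.
    rewrite ltnn add0r mulr1 normrM ger0_norm //.
    by apply: le_trans (coord_le_norm w i); rewrite ler_piMl.
  rewrite mulr0 addr0; case: ifP => _; first exact: coord_le_norm.
  by rewrite normr0.
have /choice[c Hc] (i : 'I_4) : exists c : R, 0 <= c <= 1 /\
    f (v + P i.+1) - f (v + P i) =
    w 0 i * partial i f (v + P i + (c * w 0 i) *: base i).
  have [|c c01 E] := @mvt_base f (v + P i) i (w 0 i).
    by move=> t t01; apply: df; exact: bd.
  by exists c; split=> //; rewrite PS addrA.
exists (fun i : 'I_4 => v + P i + (c i * w 0 i) *: base i); split.
  by move=> i; apply: bd; exact: (Hc i).1.
under eq_bigr => i _ do rewrite -(Hc i).2.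
rewrite -(big_mkord xpredT (fun i => f (v + P i.+1) - f (v + P i))) /=.
by rewrite telescope_sumr // P0 P4 addr0.
Qed.

Definition grad (f : V -> R) (v : V) (w : V) : R :=
  \sum_i w 0 i * partial i f v.

Lemma grad_is_linear f v : linear (grad f v).
Proof.
move=> a x y; rewrite /grad scaler_sumr -big_split /=; apply: eq_bigr => i _.
by rewrite !mxE mulrDl -mulrA.
Qed.

HB.instance Definition _ f v :=
  GRing.isLinear.Build R V R _ (grad f v) (grad_is_linear f v).

Lemma grad_continuous f v : continuous (grad f v).
Proof.
have C0 : 0 <= \sum_i `|partial i f v| by apply: sumr_ge0.
apply/linear_bounded_continuous/bounded_funP => r /=.
exists (r * \sum_i `|partial i f v|) => x xr.
rewrite /grad; apply: le_trans (ler_norm_sum _ _ _) _.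
rewrite mulr_sumr; apply: ler_sum => i _; rewrite normrM ler_wpM2r //.
exact: le_trans (coord_le_norm _ _) xr.
Qed.

(** By continuity each of the four partial derivatives in [increment_partials] is within [e / 4] of
    its value at [v], which bounds the remainder by [e] times the norm of the increment. *)
Lemma C1_differentiable (U : set V) f v : open U -> U v -> Ck 1 U f ->
  differentiable f v /\ ('d f v : V -> R) = grad f v.
Proof.
move=> oU Uv Cf.
have key : (f \o shift v : V -> R^o) = cst (f v : R^o) + (grad f v : V -> R^o) +o_ (0 : V) id.
  apply/eqaddoP => e e0 /=.
  have e4 : 0 < e / 4 by rewrite divr_gt0.
  have Hn : \forall u \near v, U u /\
      forall i, `|partial i f v - partial i f u| <= e / 4.
    apply: filterI; first exact: open_nbhs_nbhs.
    apply: (@filter_forall _ _ (fun i u => is_true (`|partial i f v - partial i f u| <= e / 4)) (nbhs v) _) => i.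
    have /cvgrPdist_le/(_ _ e4) := Ck_cont (Ck_partial i Cf) Uv.
    exact.
  have /nbhs_ballP[r /= r0 Hr] := Hn.
  near=> w.
  have wr : `|w| < r.
    near: w; apply/nbhs_ballP; exists r => //= w.
    by rewrite -ball_normE /= sub0r normrN.
  have Br u : `|u - v| <= `|w| -> U u /\
      forall i, `|partial i f v - partial i f u| <= e / 4.
    move=> uw; apply: Hr; rewrite -ball_normE /= distrC.
    exact: le_lt_trans uw wr.
  have [u uw i|xi [xw E]] := @increment_partials f v w.
    by apply: Ck_derivable Cf _; have [] := Br u uw.
  rewrite -[X in `|X|]/(f (w + v) - (f v + grad f v w)) [w + v]addrC opprD addrA E.
  rewrite /grad -sumrB; apply: le_trans (ler_norm_sum _ _ _) _.
  have -> : e * `|w| = \sum_(i < 4) (e / 4 * `|w|).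
    by rewrite sumr_const card_ord -mulr_natr; field.
  apply: ler_sum => i _.
  rewrite -mulrBr normrM mulrC ler_pM // ?coord_le_norm // distrC.
  by have [_] := Br _ (xw i); exact.
have dE := diff_unique (@grad_continuous f v) key.
split=> //; apply/diff_locallyP; rewrite dE; split=> //.
exact: grad_continuous.
Unshelve. all: by end_near. Qed.

Lemma is_derive_comp1 (f : V -> R) (g : R -> R) (v w : V) (df dg : R) :
  is_derive v w f df -> is_derive (f v) 1 g dg ->
  is_derive v w (fun u => g (f u)) (dg * df).
Proof.
move=> /is_derive_lineP Hf Hg; apply/is_derive_lineP.
have Hg' : is_derive ((fun h : R => f (h *: w + v)) 0) 1 g dg.
  by rewrite /= scale0r add0r.
exact: is_derive1_comp Hg' Hf.
Qed.

Lemma is_derive_coord (v w : V) i : is_derive v w (fun u : V => u 0 i) (w 0 i).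
Proof.
apply/is_derive_lineP.
have -> : (fun h : R => (h *: w + v) 0 i) = (fun h : R => w 0 i * h + v 0 i).
  by apply/funext => h; rewrite !mxE mulrC.
have := is_deriveD (is_deriveZ (w 0 i) (is_derive_id (0 : R^o) 1))
  (is_derive_cst (v 0 i : R^o) (0 : R^o) 1).
by rewrite addr0 [_ *: 1]mulr1.
Qed.

Lemma partial_coord i j v : partial i (fun u : V => u 0 j) v = (j == i)%:R.
Proof.
by rewrite /partial; have [_ ->] := is_derive_coord v (base i) j; rewrite mxE eqxx.
Qed.

Lemma is_derive_chain (U : set V) (f : V -> R) (tau : V -> V) (v w : V)
    (dt : 'I_4 -> R) : open U -> U (tau v) -> Ck 1 U f ->
  (forall k, is_derive v w (fun u => tau u 0 k) (dt k)) ->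
  is_derive v w (fun u => f (tau u)) (\sum_k dt k * partial k f (tau v)).
Proof.
move=> oU Ut Cf Ht; apply/is_derive_lineP.
pose phi (h : R) := tau (h *: w + v).
have Hphi k : is_derive (0 : R) 1 (fun h => phi h 0 k) (dt k).
  exact/(is_derive_lineP (fun u => tau u 0 k)).
have dphi : derivable phi 0 1.
  by apply/derivable_mxP => i k; rewrite (ord1 i); have [] := Hphi k.
have phi0 : phi 0 = tau v by rewrite /phi scale0r add0r.
have Dphi : 'D_1 phi 0 = \row_k dt k.
  rewrite derive_mx //; apply/rowP => k; rewrite !mxE.
  by have [_ ->] := Hphi k.
have [dif Edif] := C1_differentiable oU Ut Cf.
have dif' : differentiable f (phi 0) by rewrite phi0.
have dp : differentiable phi 0 by exact/derivable1_diffP.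
have dc : differentiable (f \o phi) 0 by exact: differentiable_comp.
split; first exact/derivable1_diffP.
rewrite -[LHS]/('D_1 (f \o phi) 0) deriveE // diff_comp //= phi0 Edif.
rewrite -deriveE // Dphi /grad; apply: eq_bigr => k _.
by rewrite mxE.
Qed.

Section Closure.
Variable U : set V.
Hypothesis oU : open U.

Lemma Ck_cst n (c : R) : Ck n U (fun=> c).
Proof.
elim: n c => [|n IH] c; first by split=> // v _; exact: cst_continuous.
split; [|split] => [v _|i v _|i]; first exact: cst_continuous.
  exact: derivable_cst.
have -> : partial i (fun=> c) = fun=> 0.
  by apply/funext => v; rewrite /partial; exact: derive_cst.
exact: IH.
Qed.

Lemma Ck_coord n j : Ck n U (fun u : V => u 0 j).
Proof.
have c v : {for v, continuous (fun u : V => u 0 j)}.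
  exact: coord_continuous.
case: n => [|n]; first by split.
split; [|split] => // [i v _|i]; first by have [] := is_derive_coord v (base i) j.
have -> : partial i (fun u : V => u 0 j) = fun=> (j == i)%:R.
  by apply/funext => v; exact: partial_coord.
exact: Ck_cst.
Qed.

Lemma Ck_add n f g : Ck n U f -> Ck n U g -> Ck n U (fun u => f u + g u).
Proof.
elim: n f g => [|n IH] f g Cf Cg.
  by split=> // v Uv; apply: continuousD; [exact: Ck_cont Cf Uv|exact: Ck_cont Cg Uv].
split; [|split].
- by move=> v Uv; apply: continuousD; [exact: Ck_cont Cf Uv|exact: Ck_cont Cg Uv].
- move=> i v Uv.
  by apply: derivableD; [exact: Ck_derivable Cf Uv|exact: Ck_derivable Cg Uv].
- move=> i; apply: Ck_ext oU _ (IH _ _ (Ck_partial i Cf) (Ck_partial i Cg)).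
  move=> u Uu; rewrite /partial -deriveD //.
    exact: Ck_derivable Cf Uu.
  exact: Ck_derivable Cg Uu.
Qed.

Lemma Ck_mul n f g : Ck n U f -> Ck n U g -> Ck n U (fun u => f u * g u).
Proof.
elim: n f g => [|n IH] f g Cf Cg.
  by split=> // v Uv; apply: continuousM; [exact: Ck_cont Cf Uv|exact: Ck_cont Cg Uv].
split; [|split].
- by move=> v Uv; apply: continuousM; [exact: Ck_cont Cf Uv|exact: Ck_cont Cg Uv].
- move=> i v Uv.
  by apply: derivableM; [exact: Ck_derivable Cf Uv|exact: Ck_derivable Cg Uv].
- move=> i; apply: Ck_ext oU _ (Ck_add (IH _ _ (Ck_S Cf) (Ck_partial i Cg))
    (IH _ _ (Ck_S Cg) (Ck_partial i Cf))).
  move=> u Uu; rewrite /partial [in RHS](deriveM (f := f) (g := g)) //.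
    exact: Ck_derivable Cf Uu.
  exact: Ck_derivable Cg Uu.
Qed.

Lemma Ck_opp n f : Ck n U f -> Ck n U (fun u => - f u).
Proof.
move=> Cf; apply: Ck_ext oU _ (Ck_mul (Ck_cst n (-1)) Cf) => u _.
by rewrite mulN1r.
Qed.

Lemma Ck_sub_fun n f g : Ck n U f -> Ck n U g -> Ck n U (fun u => f u - g u).
Proof. by move=> Cf /Ck_opp; exact: Ck_add. Qed.

Lemma Ck_sum n (I : Type) (r : seq I) (P : pred I) (F : I -> V -> R) :
  (forall i, P i -> Ck n U (F i)) -> Ck n U (fun u => \sum_(i <- r | P i) F i u).
Proof.
move=> H; elim: r => [|i r IH].
  by apply: Ck_ext oU _ (Ck_cst n 0) => u _; rewrite big_nil.
have [Pi|nPi] := boolP (P i).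
  by apply: Ck_ext oU _ (Ck_add (H i Pi) IH) => u _; rewrite big_cons Pi.
by apply: Ck_ext oU _ IH => u _; rewrite big_cons (negbTE nPi).
Qed.

Lemma Ck_prod n (I : Type) (r : seq I) (P : pred I) (F : I -> V -> R) :
  (forall i, P i -> Ck n U (F i)) -> Ck n U (fun u => \prod_(i <- r | P i) F i u).
Proof.
move=> H; elim: r => [|i r IH].
  by apply: Ck_ext oU _ (Ck_cst n 1) => u _; rewrite big_nil.
have [Pi|nPi] := boolP (P i).
  by apply: Ck_ext oU _ (Ck_mul (H i Pi) IH) => u _; rewrite big_cons Pi.
by apply: Ck_ext oU _ IH => u _; rewrite big_cons (negbTE nPi).
Qed.

Lemma Ck_exp n f k : Ck n U f -> Ck n U (fun u => f u ^+ k).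
Proof.
move=> Cf; have := @Ck_prod n _ (index_enum 'I_k) xpredT (fun _ => f) (fun _ _ => Cf).
by apply: Ck_ext oU _ => u _; rewrite prodr_const card_ord.
Qed.

(** The derivative of the inverse is a product of the inverse itself with derivatives of [f], so
    order n for the inverse yields order n + 1. The same bootstrap serves [Ck_sqrt] and
    [Ck_sincos]. *)
Lemma Ck_inv n f : (forall u, U u -> f u != 0) -> Ck n U f ->
  Ck n U (fun u => (f u)^-1).
Proof.
move=> f0; elim: n => [|n IH] Cf.
  by split=> // v Uv; apply: continuousV; [exact: f0|exact: Ck_cont Cf Uv].
split; [|split].
- by move=> v Uv; apply: continuousV; [exact: f0|exact: Ck_cont Cf Uv].
- by move=> i v Uv; apply: derivableV; [exact: f0|exact: Ck_derivable Cf Uv].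
- move=> i; have Ci := IH (Ck_S Cf).
  apply: Ck_ext oU _ (Ck_opp (Ck_mul (Ck_exp 2 Ci) (Ck_partial i Cf))).
  move=> u Uu; rewrite /partial [in RHS]deriveV ?f0 //.
    by rewrite scaleNr exprVn.
  exact: Ck_derivable Cf Uu.
Qed.

Lemma Ck_sqrt n f : (forall u, U u -> 0 < f u) -> Ck n U f ->
  Ck n U (fun u => Num.sqrt (f u)).
Proof.
move=> f0; elim: n => [|n IH] Cf.
  split=> // v Uv; apply: (continuous_comp (g := Num.sqrt)).
    exact: Ck_cont Cf Uv.
  exact: sqrt_continuous.
have D i v : U v -> is_derive v (base i) (fun u => Num.sqrt (f u))
    ((2 * Num.sqrt (f v))^-1 * partial i f v).
  move=> Uv; apply: is_derive_comp1; last exact: is_derive1_sqrt (f0 _ Uv).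
  by apply: derivableP; exact: Ck_derivable Cf Uv.
split; [|split].
- move=> v Uv; apply: (continuous_comp (g := Num.sqrt)).
    exact: Ck_cont Cf Uv.
  exact: sqrt_continuous.
- by move=> i v /(D i)[].
- move=> i; have Ci := IH (Ck_S Cf).
  have H2 : Ck n U (fun u => (2 * Num.sqrt (f u))^-1).
    apply: Ck_inv; last exact: Ck_mul (Ck_cst n 2) Ci.
    by move=> u Uu; rewrite mulf_neq0 // sqrtr_eq0 -ltNge f0.
  apply: Ck_ext oU _ (Ck_mul H2 (Ck_partial i Cf)) => u Uu.
  by have [_ <-] := D i u Uu.
Qed.

Lemma Ck_sincos n f : Ck n U f ->
  Ck n U (fun u => sin (f u)) /\ Ck n U (fun u => cos (f u)).
Proof.
have Cs m : Ck m U f -> forall v, U v -> {for v, continuous (fun u => sin (f u))}.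
  move=> Cf v Uv; apply: (continuous_comp (g := sin)); first exact: Ck_cont Cf Uv.
  exact: continuous_sin.
have Cc m : Ck m U f -> forall v, U v -> {for v, continuous (fun u => cos (f u))}.
  move=> Cf v Uv; apply: (continuous_comp (g := cos)); first exact: Ck_cont Cf Uv.
  exact: continuous_cos.
elim: n => [|n IH] Cf; first by split; split=> //; [exact: Cs Cf|exact: Cc Cf].
have Ds i v : U v -> is_derive v (base i) (fun u => sin (f u))
    (cos (f v) * partial i f v).
  move=> Uv; apply: is_derive_comp1 (is_derive_sin _).
  by apply: derivableP; exact: Ck_derivable Cf Uv.
have Dc i v : U v -> is_derive v (base i) (fun u => cos (f u))
    (- sin (f v) * partial i f v).
  move=> Uv; apply: is_derive_comp1 (is_derive_cos _).
  by apply: derivableP; exact: Ck_derivable Cf Uv.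
have [IHs IHc] := IH (Ck_S Cf).
split; (split; [|split]).
- exact: Cs Cf.
- by move=> i v /(Ds i)[].
- move=> i; apply: Ck_ext oU _ (Ck_mul IHc (Ck_partial i Cf)) => u Uu.
  by have [_ <-] := Ds i u Uu.
- exact: Cc Cf.
- by move=> i v /(Dc i)[].
- move=> i; apply: Ck_ext oU _ (Ck_mul (Ck_opp IHs) (Ck_partial i Cf)) => u Uu.
  by have [_ <-] := Dc i u Uu.
Qed.

Lemma Ck_comp n (W : set V) f (tau : V -> V) : open W ->
  (forall u, U u -> W (tau u)) ->
  Ck n W f -> (forall k, Ck n U (fun u => tau u 0 k)) ->
  Ck n U (fun u => f (tau u)).
Proof.
move=> oW UW.
have cont m f' : Ck m W f' -> (forall k, Ck m U (fun u => tau u 0 k)) ->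
    forall v, U v -> {for v, continuous (fun u => f' (tau u))}.
  move=> Cf Ct v Uv; have : tau u @[u --> v] --> (tau v : V); last first.
    by move=> ct; apply: (continuous_comp ct); exact: Ck_cont Cf (UW _ Uv).
  have FF : Filter (nbhs v) by exact: nbhs_filter.
  apply/(@cvgrPdist_le _ _ _ _ FF) => e e0.
  have H : \forall u \near v, forall k, `|tau v 0 k - tau u 0 k| <= e.
    apply: (@filter_forall _ _ (fun k u => is_true (`|tau v 0 k - tau u 0 k| <= e)) (nbhs v) _) => k.
    by have /cvgrPdist_le/(_ _ e0) := Ck_cont (Ct k) Uv.
  near=> u; apply: norm_le_coord; first exact: ltW.
  by move=> k; rewrite !mxE; move: k; near: u.
elim: n f => [|n IH] f Cf Ct; first by split=> //; exact: cont Cf Ct.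
have D i v : U v -> is_derive v (base i) (fun u => f (tau u))
    (\sum_k partial i (fun u => tau u 0 k) v * partial k f (tau v)).
  move=> Uv; apply: is_derive_chain oW (UW _ Uv) (Ck_le _ Cf) _ => // k.
  by apply: derivableP; exact: Ck_derivable (Ct k) Uv.
split; [|split].
- exact: cont Cf Ct.
- by move=> i v /(D i)[].
- move=> i; apply: Ck_ext oU _ (@Ck_sum _ _ (index_enum 'I_4) xpredT
    (fun k u => partial i (fun u => tau u 0 k) u * partial k f (tau u)) _).
    by move=> u Uu; have [_ <-] := D i u Uu.
  move=> k _; apply: Ck_mul; first exact: Ck_partial.
  by apply: IH (Ck_partial k Cf) _ => l; exact: Ck_S (Ct l).
Unshelve. all: by end_near. Qed.

Lemma is_derive_translate (f : V -> R) (v w c : V) d :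
  is_derive (v + c) w f d -> is_derive v w (fun u => f (u + c)) d.
Proof.
move=> /is_derive_lineP H; apply/is_derive_lineP.
by under eq_fun => h do rewrite -addrA.
Qed.

(** The mean value theorem is applied in direction [i] to the increment of [f] in direction [j], and
    then in direction [j] to the partial derivative. *)
Lemma second_difference f i j v (h : R) : 0 < h -> Ck 2 U f ->
  (forall u, `|u - v| <= 2 * h -> U u) ->
  exists2 u, `|u - v| <= 2 * h &
    f (v + h *: base i + h *: base j) - f (v + h *: base i)
    - f (v + h *: base j) + f v = h * h * partial j (partial i f) u.
Proof.
move=> h0 Cf HU.
have close (a b : R) : 0 <= a <= h -> 0 <= b <= h ->
    `|v + a *: base i + b *: base j - v| <= 2 * h.
  move=> /andP[a0 ah] /andP[b0 bh].
  rewrite [v + _ + _ - _]addrAC [v + _]addrC addrK mulrDl !mul1r.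
  apply: le_trans (ler_normD _ _) _; rewrite !normrZ.
  have := norm_base i; have := norm_base j.
  by rewrite !ger0_norm // => n1 n2; apply: lerD;
     [apply: le_trans ah|apply: le_trans bh]; rewrite ler_piMr.
have z0h : 0 <= (0 : R) <= h by rewrite lexx ltW.
have hh : 0 <= h <= h by rewrite lexx ltW.
have th (t : R) : 0 <= t <= 1 -> 0 <= t * h <= h.
  by move=> /andP[t0 t1]; rewrite mulr_ge0 ?(ltW h0) // ler_piMl ?(ltW h0).
pose phi u := f (u + h *: base j) - f u.
have Dphi (a : R) : 0 <= a <= h -> is_derive (v + a *: base i) (base i) phi
    (partial i f (v + a *: base i + h *: base j) - partial i f (v + a *: base i)).
  move=> ah; apply: is_deriveB.
    apply: is_derive_translate; apply: derivableP.
    by apply: Ck_derivable Cf _; apply: HU; exact: close.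
  apply: derivableP; apply: Ck_derivable Cf _; apply: HU.
  by have := close a 0 ah z0h; rewrite scale0r addr0.
have [t t01|c c01] := @mvt_base phi v i h.
  by have [] := Dphi _ (th _ t01).
have [_] := Dphi _ (th _ c01); rewrite -/(partial i phi _) => ->.
have [t t01|d d01 ->] := @mvt_base (partial i f) (v + (c * h) *: base i) j h.
  apply: Ck_derivable (Ck_partial i Cf) _; apply: HU.
  by apply: close; exact: th.
move=> E; exists (v + (c * h) *: base i + (d * h) *: base j).
  by apply: close; exact: th.
by rewrite -mulrA -E /phi; ring.
Qed.

Lemma dist_split (a b c e : R) : `|a - c| <= e / 2 -> `|b - c| <= e / 2 ->
  `|a - b| <= e.
Proof.
move=> ac; rewrite distrC => bc; rewrite (splitr e) -(subrK c a) -addrA.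
exact: le_trans (ler_normD _ _) (lerD ac bc).
Qed.

(** The second difference is symmetric in [i] and [j], so each mixed derivative at [v] is within
    [e / 2] of one common value. *)
Lemma schwarz f i j v : U v -> Ck 2 U f ->
  partial i (partial j f) v = partial j (partial i f) v.
Proof.
move=> Uv Cf; apply/eqP; rewrite -subr_eq0 -normr_le0; apply/ler_addgt0Pl => e e0.
rewrite addr0.
have e2 : 0 < e / 2 by rewrite divr_gt0.
have /cvgrPdist_le/(_ _ e2) H1 := Ck_cont (Ck_partial i (Ck_partial j Cf)) Uv.
have /cvgrPdist_le/(_ _ e2) H2 := Ck_cont (Ck_partial j (Ck_partial i Cf)) Uv.
have Un : nbhs v U by exact: open_nbhs_nbhs.
have Hn : \forall u \near v, U u /\
    (`|partial i (partial j f) v - partial i (partial j f) u| <= e / 2 /\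
     `|partial j (partial i f) v - partial j (partial i f) u| <= e / 2).
  exact: (filterI Un (filterI H1 H2)).
have /nbhs_ballP[r /= r0 Hr] := Hn.
have h0 : 0 < r / 3 by rewrite divr_gt0.
have Br u : `|u - v| <= 2 * (r / 3) -> ball v r u.
  by rewrite -ball_normE /= distrC => ur; apply: le_lt_trans ur _; lra.
have HU u : `|u - v| <= 2 * (r / 3) -> U u by move=> /Br/Hr[].
have [u1 /Br/Hr[_ [+ _]] E1] := second_difference j i h0 Cf HU.
have [u2 /Br/Hr[_ [_ +]] E2] := second_difference i j h0 Cf HU.
have hh : r / 3 * (r / 3) != 0 by rewrite mulf_neq0 // gt_eqF.
have -> : partial i (partial j f) u1 = partial j (partial i f) u2.
  apply: (mulfI hh); apply: (etrans (esym E1)); apply: (etrans _ E2).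
  rewrite [v + _ *: base j + _]addrAC -!addrA.
  by congr (_ + _); rewrite addrCA.
by move=> n1 n2; exact: dist_split n2 n1.
Qed.

End Closure.

End Calculus.

(** * Curvature in coordinates *)

Notation o0 := (@Ordinal 4 0 isT).
Notation o1 := (@Ordinal 4 1 isT).
Notation o2 := (@Ordinal 4 2 isT).
Notation o3 := (@Ordinal 4 3 isT).
Notation c0 := (@Ordinal 3 0 isT).
Notation c1 := (@Ordinal 3 1 isT).
Notation c2 := (@Ordinal 3 2 isT).

(** Cases with literal ordinals, for which matrix entries given by a [match] compute. *)
Lemma ord4_ind (P : 'I_4 -> Prop) : P o0 -> P o1 -> P o2 -> P o3 -> forall i, P i.
Proof.
move=> H0 H1 H2 H3 [[|[|[|[|//]]]] Hi]; [move: H0|move: H1|move: H2|move: H3];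
by congr P; apply/val_inj.
Qed.

Lemma ord3_ind (P : 'I_3 -> Prop) : P c0 -> P c1 -> P c2 -> forall i, P i.
Proof.
move=> H0 H1 H2 [[|[|[|//]]] Hi]; [move: H0|move: H1|move: H2];
by congr P; apply/val_inj.
Qed.

Lemma sum4E (R : nmodType) (F : 'I_4 -> R) :
  \sum_i F i = F o0 + F o1 + F o2 + F o3.
Proof.
rewrite !big_ord_recl big_ord0 addr0 !addrA.
by congr (F _ + F _ + F _ + F _); apply/val_inj.
Qed.

Lemma sum3E (R : nmodType) (F : 'I_3 -> R) : \sum_i F i = F c0 + F c1 + F c2.
Proof.
rewrite !big_ord_recl big_ord0 addr0 !addrA.
by congr (F _ + F _ + F _); apply/val_inj.
Qed.

(** Laplace expansion produces indices [lift a b]; they are replaced by the literal ordinals they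
    denote. *)
Ltac norm_lift3 := repeat match goal with |- context [@lift 3 ?a ?b] =>
  let v := eval compute in (nat_of_ord (@lift 3 a b)) in
  match v with
  | 0%N => rewrite (_ : @lift 3 a b = c0); last by apply/val_inj
  | 1%N => rewrite (_ : @lift 3 a b = c1); last by apply/val_inj
  | 2%N => rewrite (_ : @lift 3 a b = c2); last by apply/val_inj
  end end.

Ltac norm_lift4 := repeat match goal with |- context [@lift 4 ?a ?b] =>
  let v := eval compute in (nat_of_ord (@lift 4 a b)) in
  match v with
  | 0%N => rewrite (_ : @lift 4 a b = o0); last by apply/val_inj
  | 1%N => rewrite (_ : @lift 4 a b = o1); last by apply/val_inj
  | 2%N => rewrite (_ : @lift 4 a b = o2); last by apply/val_inj
  | 3%N => rewrite (_ : @lift 4 a b = o3); last by apply/val_inj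
  end end.

Lemma det3E (R : comPzRingType) (A : 'M[R]_3) : \det A =
  A c0 c0 * (A c1 c1 * A c2 c2 - A c1 c2 * A c2 c1)
  - A c0 c1 * (A c1 c0 * A c2 c2 - A c1 c2 * A c2 c0)
  + A c0 c2 * (A c1 c0 * A c2 c1 - A c1 c1 * A c2 c0).
Proof.
rewrite (expand_det_row _ c0) sum3E /cofactor.
rewrite !(expand_det_row _ ord0) !big_ord_recl !big_ord0 /cofactor !det_mx11 !mxE /=.
norm_lift3; rewrite /bump /= !addn0 !add0n; ring.
Qed.

Lemma det4E (R : comPzRingType) (A : 'M[R]_4) : \det A =
  A o0 o0 * (A o1 o1 * (A o2 o2 * A o3 o3 - A o2 o3 * A o3 o2)
           - A o1 o2 * (A o2 o1 * A o3 o3 - A o2 o3 * A o3 o1)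
           + A o1 o3 * (A o2 o1 * A o3 o2 - A o2 o2 * A o3 o1))
  - A o0 o1 * (A o1 o0 * (A o2 o2 * A o3 o3 - A o2 o3 * A o3 o2)
           - A o1 o2 * (A o2 o0 * A o3 o3 - A o2 o3 * A o3 o0)
           + A o1 o3 * (A o2 o0 * A o3 o2 - A o2 o2 * A o3 o0))
  + A o0 o2 * (A o1 o0 * (A o2 o1 * A o3 o3 - A o2 o3 * A o3 o1)
           - A o1 o1 * (A o2 o0 * A o3 o3 - A o2 o3 * A o3 o0)
           + A o1 o3 * (A o2 o0 * A o3 o1 - A o2 o1 * A o3 o0))
  - A o0 o3 * (A o1 o0 * (A o2 o1 * A o3 o2 - A o2 o2 * A o3 o1)
           - A o1 o1 * (A o2 o0 * A o3 o2 - A o2 o2 * A o3 o0)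
           + A o1 o2 * (A o2 o0 * A o3 o1 - A o2 o1 * A o3 o0)).
Proof.
rewrite (expand_det_row _ o0) sum4E /cofactor !det3E !mxE.
norm_lift4; rewrite /= !add0n; ring.
Qed.

Section RicciAlgebra.
Variables (R : comPzRingType) (A B dA dB : 'I_4 -> 'I_4 -> R).
Variables (om : 'I_3 -> 'I_4 -> 'I_4 -> R) (p q dp dq : 'I_3 -> 'I_3 -> R).

Definition cov_part (C : 'I_4 -> 'I_4 -> R) (r : 'I_3 -> 'I_3 -> R) a k l :=
  \sum_m C m k * om a m l + \sum_m C m l * om a k m + \sum_b r a b * om b k l.

(** [A] and [B] are the connection matrices in two coordinate directions, [p] and [q] those of the
    connection on the index [a]. Equality of the two second derivatives, with the first-order
    equation substituted, is the vanishing of the total curvature acting on [om]; the products of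
    two different connections cancel. *)
Lemma ricci_algebra a k l :
  (\sum_m (dB m k * om a m l + B m k * cov_part A p a m l)
   + \sum_m (dB m l * om a k m + B m l * cov_part A p a k m)
   + \sum_b (dq a b * om b k l + q a b * cov_part A p b k l)) =
  (\sum_m (dA m k * om a m l + A m k * cov_part B q a m l)
   + \sum_m (dA m l * om a k m + A m l * cov_part B q a k m)
   + \sum_b (dp a b * om b k l + p a b * cov_part B q b k l)) ->
  \sum_m (dB m k - dA m k + \sum_n (A m n * B n k - B m n * A n k)) * om a m l
  + \sum_m (dB m l - dA m l + \sum_n (A m n * B n l - B m n * A n l)) * om a k m
  + \sum_b (dq a b - dp a b + \sum_c (q a c * p c b - p a c * q c b)) * om b k l = 0.
Proof.
rewrite /cov_part !(sum3E, sum4E) => /eqP; rewrite -subr_eq0 => /eqP E.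
by rewrite -{}[RHS]E; ring.
Qed.

End RicciAlgebra.

Section Curvature.
Variable R : realType.
Local Notation V := 'rV[R]_4.

Lemma Ck_det n k (U : set V) (M : V -> 'M[R]_k) : open U ->
  (forall i j, Ck n U (fun v => M v i j)) -> Ck n U (fun v => \det (M v)).
Proof.
move=> oU CM; rewrite /determinant.
apply: Ck_sum => // s _; apply: Ck_mul => //; first exact: Ck_cst.
by apply: Ck_prod => // i _; exact: CM.
Qed.

Lemma Ck_invmx n k (U : set V) (M : V -> 'M[R]_k) i j : open U ->
  (forall i j, Ck n U (fun v => M v i j)) -> (forall v, U v -> M v \in unitmx) ->
  Ck n U (fun v => invmx (M v) i j).
Proof.
move=> oU CM uM.
have C : Ck n U (fun v => (\det (M v))^-1 * cofactor (M v) j i).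
  apply: Ck_mul => //.
    apply: Ck_inv => //; last exact: Ck_det.
    by move=> v /uM; rewrite unitmxE unitfE.
  apply: Ck_mul => //; first exact: Ck_cst.
  apply: Ck_det => // a b; have := CM (lift j a) (lift i b).
  by apply: Ck_ext => // v _; rewrite !mxE.
by apply: Ck_ext C => // v Uv; rewrite /invmx uM // !mxE.
Qed.

Variables (U : set V) (G : V -> 'M[R]_4).
Hypothesis oU : open U.
Hypothesis CG : forall n i j, Ck n U (fun v => G v i j).
Hypothesis symG : forall v, U v -> (G v)^T = G v.
Hypothesis unitG : forall v, U v -> G v \in unitmx.

Lemma symGE i j v : U v -> G v i j = G v j i.
Proof. by move=> Uv; rewrite -{1}(symG Uv) mxE. Qed.

Let dG i j k v := partial i (fun u => G u j k) v.

Lemma dG_sym i j k v : U v -> dG i j k v = dG i k j v.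
Proof.
move=> Uv; apply: partial_eq_on oU Uv _ => u Uu.
by rewrite -{1}(symG Uu) mxE.
Qed.

Lemma Ck_christoffel n k i j : Ck n U (christoffel G k i j).
Proof.
apply: Ck_mul => //; first exact: Ck_cst.
apply: Ck_sum => // l _; apply: Ck_mul => //; first exact: Ck_invmx.
apply: Ck_sub_fun => //; first apply: Ck_add => //;
by apply: Ck_partial; exact: CG.
Qed.

Lemma christoffel_sym k i j v : U v ->
  christoffel G k i j v = christoffel G k j i v.
Proof.
move=> Uv; rewrite /christoffel; congr (_ * _); apply: eq_bigr => l _.
by congr (_ * (_ - _)); [rewrite addrC | exact: (dG_sym l i j Uv)].
Qed.

Lemma christoffel_lower i j k v : U v ->
  \sum_m christoffel G m i j v * G v m k =
  2^-1 * (dG i j k v + dG j i k v - dG k i j v).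
Proof.
move=> Uv; pose c l := dG i j l v + dG j i l v - dG l i j v.
rewrite -/(c k); transitivity (2^-1 * \sum_l (\sum_m G v k m * invmx (G v) m l) * c l).
  under [in RHS]eq_bigr => l _ do rewrite mulr_suml.
  rewrite exchange_big /= mulr_sumr; apply: eq_bigr => m _.
  rewrite /christoffel -mulrA; congr (_ * _); rewrite mulr_suml.
  apply: eq_bigr => l _; rewrite -/(c l) (symGE k m Uv); ring.
congr (_ * _); rewrite (bigD1 k) //= [X in _ + X]big1 ?addr0 => [|l lk].
  have := congr1 (fun M => fun_of_matrix M k k) (mulmxV (unitG Uv)).
  by rewrite !mxE eqxx => ->; rewrite mul1r.
have := congr1 (fun M => fun_of_matrix M k l) (mulmxV (unitG Uv)).
by rewrite !mxE eq_sym (negbTE lk) => ->; rewrite mul0r.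
Qed.

Lemma metric_parallel i j k v : U v ->
  partial i (fun u => G u j k) v =
  \sum_m christoffel G m i j v * G v m k + \sum_m christoffel G m i k v * G v j m.
Proof.
move=> Uv; rewrite christoffel_lower //.
have -> : \sum_m christoffel G m i k v * G v j m =
    \sum_m christoffel G m i k v * G v m j.
  by apply: eq_bigr => m _; rewrite (symGE j m Uv).
rewrite christoffel_lower // -/(dG i j k v).
rewrite (dG_sym i k j Uv); by field.
Qed.

Lemma partial_mul (f g : V -> R) i v : U v -> Ck 1 U f -> Ck 1 U g ->
  partial i (fun u => f u * g u) v = partial i f v * g v + f v * partial i g v.
Proof.
move=> Uv Cf Cg; rewrite /partial [LHS](deriveM (f := f) (g := g)).
- by rewrite addrC [_ *: _]mulrC.
- exact: Ck_derivable Cf Uv.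
- exact: Ck_derivable Cg Uv.
Qed.

Lemma partial_add (f g : V -> R) i v : U v -> Ck 1 U f -> Ck 1 U g ->
  partial i (fun u => f u + g u) v = partial i f v + partial i g v.
Proof.
move=> Uv Cf Cg; rewrite /partial [LHS](deriveD (f := f) (g := g)) //.
- exact: Ck_derivable Cf Uv.
- exact: Ck_derivable Cg Uv.
Qed.

Lemma partial_sum n (F : 'I_n -> V -> R) i v : U v ->
  (forall m, Ck 1 U (F m)) ->
  partial i (fun u => \sum_m F m u) v = \sum_m partial i (F m) v.
Proof.
move=> Uv CF; have -> : (fun u => \sum_m F m u) = \sum_m F m.
  by apply/funext => u; rewrite fct_sumE.
rewrite /partial derive_sum // => m; exact: Ck_derivable (CF m) Uv.
Qed.

(* The hypothesis on the derivatives says that the triple [om] is parallel up to the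
   connection [th] on the index [a]. *)
Lemma ricci_identity (om : 'I_3 -> V -> 'M[R]_4) (th : 'I_4 -> 'I_3 -> 'I_3 -> V -> R) :
  (forall a k l, Ck 2 U (fun v => om a v k l)) ->
  (forall i a b, Ck 1 U (th i a b)) ->
  (forall a i k l v, U v -> partial i (fun u => om a u k l) v =
     \sum_m christoffel G m i k v * om a v m l
     + \sum_m christoffel G m i l v * om a v k m + \sum_b th i a b v * om b v k l) ->
  forall a i j k l v, U v ->
  \sum_m riemann_up G m k i j v * om a v m l
  + \sum_m riemann_up G m l i j v * om a v k m
  + \sum_b (partial i (th j a b) v - partial j (th i a b) v
      + \sum_c (th j a c v * th i c b v - th i a c v * th j c b v)) * om b v k l = 0.
Proof.
move=> Com Cth H a i j k l v Uv.
have Com1 a' k' l' : Ck 1 U (fun v => om a' v k' l') by exact: Ck_S.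
have CC k' i' j' : Ck 1 U (christoffel G k' i' j') by exact: Ck_christoffel.
pose Dom i' a' k' l' := cov_part (fun a k l => om a v k l)
    (fun m k => christoffel G m i' k v) (fun a b => th i' a b v) a' k' l'.
have D i' j' : partial i' (partial j' (fun u => om a u k l)) v =
   \sum_m (partial i' (christoffel G m j' k) v * om a v m l
      + christoffel G m j' k v * Dom i' a m l)
   + \sum_m (partial i' (christoffel G m j' l) v * om a v k m
      + christoffel G m j' l v * Dom i' a k m)
   + \sum_b (partial i' (th j' a b) v * om b v k l
      + th j' a b v * Dom i' b k l).
  (* The first-order equation is differentiated, and then used again for the derivatives of [om]
     that appear. *)
  rewrite (@partial_eq_on _ U _ _ i' v oU Uv (H a j' k l)).
  rewrite partial_add // ?partial_add //; last 4 first.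
  - by apply: Ck_sum => // m _; exact: Ck_mul.
  - by apply: Ck_sum => // m _; exact: Ck_mul.
  - by apply: Ck_add => //; apply: Ck_sum => // m _; exact: Ck_mul.
  - by apply: Ck_sum => // m _; exact: Ck_mul.
  rewrite !partial_sum //; try (move=> m; exact: Ck_mul).
  by congr (_ + _ + _); apply: eq_bigr => m _; rewrite partial_mul // H.
have := schwarz oU i j Uv (Com a k l).
rewrite !D /Dom; exact: (@ricci_algebra R
  (fun m k => christoffel G m i k v) (fun m k => christoffel G m j k v)
  (fun m k => partial j (christoffel G m i k) v)
  (fun m k => partial i (christoffel G m j k) v) (fun a k l => om a v k l)
  (fun a b => th i a b v) (fun a b => th j a b v)
  (fun a b => partial j (th i a b) v) (fun a b => partial i (th j a b) v) a k l).
Qed.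

End Curvature.

(** * Self-dual forms and the Hodge star in an orthonormal frame *)

Section QuaternionicForms.
Variable R : realType.
Local Notation M4 := 'M[R]_4.

Definition sqn (a p q : nat) : R :=
  match a, p, q with
  | 0, 0, 1 => 1 | 0, 1, 0 => -1 | 0, 2, 3 => 1 | 0, 3, 2 => -1
  | 1, 0, 2 => 1 | 1, 2, 0 => -1 | 1, 1, 3 => -1 | 1, 3, 1 => 1
  | 2, 0, 3 => 1 | 2, 3, 0 => -1 | 2, 1, 2 => 1 | 2, 2, 1 => -1
  | _, _, _ => 0
  end.

(* A basis of the self-dual 2-forms of R^4 for which the products are those of
   the imaginary quaternions, up to sign: [sq a *m sq (nx a) = - sq (nx (nx a))]. *)
Definition sq (a : 'I_3) : M4 := \matrix_(p, q) sqn a p q.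

Definition nx (a : 'I_3) : 'I_3 :=
  match val a with 0 => c1 | 1 => c2 | _ => c0 end.

Lemma sq_tr a : (sq a)^T = - sq a.
Proof.
apply/matrixP; elim/ord3_ind: a; elim/ord4_ind; elim/ord4_ind;
by rewrite !mxE /= ?oppr0 ?opprK.
Qed.

Lemma sq_sqr a : sq a *m sq a = - 1%:M.
Proof.
apply/matrixP; elim/ord3_ind: a; elim/ord4_ind; elim/ord4_ind;
by rewrite !mxE sum4E !mxE /=; ring.
Qed.

(** Twice the coefficient of [sq b] in the self-dual part of an antisymmetric [m]. *)
Definition pairing (m : M4) (b : 'I_3) : R :=
  2^-1 * \sum_p \sum_q m p q * sq b p q.

Lemma pairingE m b : m^T = - m -> pairing m b =
  match val b with
  | 0 => m o0 o1 + m o2 o3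
  | 1 => m o0 o2 - m o1 o3
  | _ => m o0 o3 + m o1 o2
  end.
Proof.
move=> am; have A p q : m p q = - m q p.
  by have := congr1 (fun M => fun_of_matrix M q p) am; rewrite !mxE.
rewrite /pairing !sum4E (A o1 o0) (A o2 o0) (A o3 o0) (A o2 o1) (A o3 o1) (A o3 o2).
by elim/ord3_ind: b; rewrite !mxE /=; field.
Qed.

(** Anti-self-dual matrices commute with every [sq a], so the commutator sees only the self-dual
    part of [m], where the quaternion relations give it. *)
Lemma comm_sq m a : m^T = - m -> m *m sq a - sq a *m m =
  pairing m (nx a) *: sq (nx (nx a)) - pairing m (nx (nx a)) *: sq (nx a).
Proof.
move=> am; rewrite !pairingE //; have A p q : m p q = - m q p.
  by have := congr1 (fun M => fun_of_matrix M q p) am; rewrite !mxE.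
have D p : m p p = 0.
  by apply/eqP; have := A p p; move/eqP; rewrite -addr_eq0 -mulr2n mulrn_eq0.
apply/matrixP; elim/ord3_ind: a; elim/ord4_ind; elim/ord4_ind;
rewrite !mxE !sum4E !mxE /= ?(A o1 o0) ?(A o2 o0) ?(A o3 o0) ?(A o2 o1) ?(A o3 o1)
  ?(A o3 o2) ?D; ring.
Qed.

(** The map sending [m] to [- (sq a *m m *m sq a)] fixes [sq a] and the anti-self-dual matrices and
    negates the other two generators; the last two terms correct this. *)
Lemma sandwich_sq m a : m^T = - m -> m = - (sq a *m m *m sq a)
  + pairing m (nx a) *: sq (nx a) + pairing m (nx (nx a)) *: sq (nx (nx a)).
Proof.
move=> am; rewrite !pairingE //; have A p q : m p q = - m q p.
  by have := congr1 (fun M => fun_of_matrix M q p) am; rewrite !mxE.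
have D p : m p p = 0.
  by apply/eqP; have := A p p; move/eqP; rewrite -addr_eq0 -mulr2n mulrn_eq0.
apply/matrixP; elim/ord3_ind: a; elim/ord4_ind; elim/ord4_ind;
rewrite !mxE !sum4E !mxE !sum4E !mxE /= ?(A o1 o0) ?(A o2 o0) ?(A o3 o0) ?(A o2 o1) ?(A o3 o1)
  ?(A o3 o2) ?D; ring.
Qed.

Lemma sq_free (x y : R) a : x *: sq (nx (nx a)) - y *: sq (nx a) = 0 -> x = 0 /\ y = 0.
Proof.
move=> H; have E p q := congr1 (fun M => fun_of_matrix M p q) H.
elim/ord3_ind: a H E => H E; split.
- by have := E o0 o3; rewrite !mxE /= => <-; ring.
- by have := E o0 o2; rewrite !mxE /= => /eqP; rewrite ?(mulr0, mulr1, sub0r, oppr_eq0, add0r) => /eqP.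
- by have := E o0 o1; rewrite !mxE /= => <-; ring.
- by have := E o0 o3; rewrite !mxE /= => /eqP; rewrite ?(mulr0, mulr1, sub0r, oppr_eq0, add0r) => /eqP.
- by have := E o0 o2; rewrite !mxE /= => <-; ring.
- by have := E o0 o1; rewrite !mxE /= => /eqP; rewrite ?(mulr0, mulr1, sub0r, oppr_eq0, add0r) => /eqP.
Qed.

(** Three 3-forms with four components each give twelve linear equations for the twelve numbers
    [kap], and the system is invertible. This is the uniqueness of the connection for which the
    self-dual triple is covariantly closed. *)
Lemma wedge_sq_eq0 (kap : 'I_4 -> 'I_3 -> R) :
  let w p a := kap p (nx a) *: sq (nx (nx a)) - kap p (nx (nx a)) *: sq (nx a) in
  (forall a p q r, w p a q r + w q a r p + w r a p q = 0) ->
  forall p a, kap p a = 0.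
Proof.
move=> w H.
have E a p q r := H a p q r.
have E1 a := E a o0 o1 o2; have E2 a := E a o0 o1 o3.
have E3 a := E a o0 o2 o3; have E4 a := E a o1 o2 o3.
have F1 := E1 c0; have F2 := E1 c1; have F3 := E1 c2.
have F4 := E2 c0; have F5 := E2 c1; have F6 := E2 c2.
have F7 := E3 c0; have F8 := E3 c1; have F9 := E3 c2.
have F10 := E4 c0; have F11 := E4 c1; have F12 := E4 c2.
move: F1 F2 F3 F4 F5 F6 F7 F8 F9 F10 F11 F12.
rewrite /w !mxE /= => F1 F2 F3 F4 F5 F6 F7 F8 F9 F10 F11 F12.
clear E E1 E2 E3 E4 H w.
elim/ord4_ind; elim/ord3_ind; lra.
Qed.

(** The Hodge star of Euclidean R^4, entry by entry. *)
Definition dual2 (m : M4) : M4 := \matrix_(p, q)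
  match val p, val q with
  | 0, 1 => m o2 o3 | 1, 0 => - m o2 o3 | 0, 2 => - m o1 o3 | 2, 0 => m o1 o3
  | 0, 3 => m o1 o2 | 3, 0 => - m o1 o2 | 1, 2 => m o0 o3 | 2, 1 => - m o0 o3
  | 1, 3 => - m o0 o2 | 3, 1 => m o0 o2 | 2, 3 => m o0 o1 | 3, 2 => - m o0 o1
  | _, _ => 0
  end.

(** A change of frame multiplies the volume form by the determinant; here this is an identity of
    degree four in the entries of [F]. *)
Lemma dual2_conj (F m : M4) : m^T = - m ->
  F *m dual2 (F^T *m m *m F) *m F^T = \det F *: dual2 m.
Proof.
move=> am; have A p q : m p q = - m q p.
  by have := congr1 (fun M => fun_of_matrix M q p) am; rewrite !mxE.
have D p : m p p = 0.
  by apply/eqP; have := A p p; move/eqP; rewrite -addr_eq0 -mulr2n mulrn_eq0.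
pose X p q := \sum_r \sum_s F r p * m r s * F s q.
have XE p q : (F^T *m m *m F) p q = X p q.
  rewrite !mxE; under eq_bigr => s _ do rewrite !mxE mulr_suml.
  rewrite exchange_big; apply: eq_bigr => r _; apply: eq_bigr => s _.
  by rewrite !mxE.
move: (F^T *m m *m F) XE => Y YE.
apply/matrixP; elim/ord4_ind; elim/ord4_ind;
rewrite det4E !mxE !sum4E !mxE !sum4E !mxE /= !YE /X !sum4E
  ?(A o1 o0) ?(A o2 o0) ?(A o3 o0) ?(A o2 o1) ?(A o3 o1) ?(A o3 o2) ?D; ring.
Qed.

Lemma dual2_asd (m : M4) : m^T = - m -> (forall b, pairing m b = 0) ->
  dual2 m = - m.
Proof.
move=> am P; have A p q : m p q = - m q p.
  by have := congr1 (fun M => fun_of_matrix M q p) am; rewrite !mxE.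
have D p : m p p = 0.
  by apply/eqP; have := A p p; move/eqP; rewrite -addr_eq0 -mulr2n mulrn_eq0.
have P0 := P c0; have P1 := P c1; have P2 := P c2.
rewrite !pairingE //= in P0 P1 P2.
apply/matrixP; elim/ord4_ind; elim/ord4_ind;
rewrite !mxE /= ?(A o1 o0) ?(A o2 o0) ?(A o3 o0) ?(A o2 o1) ?(A o3 o1) ?(A o3 o2) ?D; lra.
Qed.

(** A table on natural numbers, which computes on literal indices, unlike the determinant in
    [levi_civita]. *)
Definition lcn (a b c d : nat) : R :=
  match a, b, c, d with
  | 0, 1, 2, 3 => 1
  | 0, 1, 3, 2 => -1
  | 0, 2, 1, 3 => -1
  | 0, 2, 3, 1 => 1
  | 0, 3, 1, 2 => 1
  | 0, 3, 2, 1 => -1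
  | 1, 0, 2, 3 => -1
  | 1, 0, 3, 2 => 1
  | 1, 2, 0, 3 => 1
  | 1, 2, 3, 0 => -1
  | 1, 3, 0, 2 => -1
  | 1, 3, 2, 0 => 1
  | 2, 0, 1, 3 => 1
  | 2, 0, 3, 1 => -1
  | 2, 1, 0, 3 => -1
  | 2, 1, 3, 0 => 1
  | 2, 3, 0, 1 => 1
  | 2, 3, 1, 0 => -1
  | 3, 0, 1, 2 => -1
  | 3, 0, 2, 1 => 1
  | 3, 1, 0, 2 => 1
  | 3, 1, 2, 0 => -1
  | 3, 2, 0, 1 => -1
  | 3, 2, 1, 0 => 1
  | _, _, _, _ => 0
  end.

Lemma levi_civitaE a b c d : levi_civita R a b c d = lcn a b c d.
Proof.
have -> : levi_civita R a b c d =
    \det (\matrix_(p < 4, q < 4) ((tnth [tuple a; b; c; d] p == q)%:R : R)).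
  by congr (\det _); apply/matrixP => p q; rewrite !mxE.
rewrite det4E !mxE !(tnth_nth o0) /=.
rewrite -!val_eqE /=.
have S := (@mul0r R, @mulr0 R, @mul1r R, @mulr1 R, @addr0 R, @add0r R, @subr0 R,
           @sub0r R, @oppr0 R, @opprK R).
elim/ord4_ind: a; rewrite /= ?S; elim/ord4_ind: b; rewrite /= ?S //;
elim/ord4_ind: c; rewrite /= ?S //; by elim/ord4_ind: d; rewrite /= ?S.
Qed.

Lemma dual2E (m : M4) i j : m^T = - m ->
  2^-1 * (\sum_k \sum_l levi_civita R k l i j * m k l) = dual2 m i j.
Proof.
move=> am; have A p q : m p q = - m q p.
  by have := congr1 (fun M => fun_of_matrix M q p) am; rewrite !mxE.
have D p : m p p = 0.
  by apply/eqP; have := A p p; move/eqP; rewrite -addr_eq0 -mulr2n mulrn_eq0.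
rewrite !sum4E !levi_civitaE !mxE.
elim/ord4_ind: i; elim/ord4_ind: j; 
rewrite /= ?(A o1 o0) ?(A o2 o0) ?(A o3 o0) ?(A o2 o1) ?(A o3 o1) ?(A o3 o2) ?D; by field.
Qed.

Lemma sgr_det_norm (x : R) : `|x| = Num.sg x * x.
Proof. by rewrite normrEsg. Qed.

(** The columns of [E] are an orthonormal coframe of the metric, and [m] contains the components of
    the form in it; the sign of [\det E] compares the orientation of this coframe with that of the
    coordinates. *)
Lemma hodge_asd (o : R) (E m : M4) : E \in unitmx -> m^T = - m ->
  (forall b, pairing m b = 0) ->
  hodge o (E *m E^T) (E *m m *m E^T) = (- (o * Num.sg (\det E))) *: (E *m m *m E^T).
Proof.
move=> uE am pm; set F := invmx E.
have uET : E^T \in unitmx by rewrite unitmx_tr.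
have detE0 : \det E != 0 by rewrite -unitfE -unitmxE.
have inv : invmx (E *m E^T) = F^T *m F.
  have uG : E *m E^T \in unitmx by rewrite unitmx_mul uE.
  apply: (can_inj (mulmxK uG)); rewrite mulVmx // mulmxA -(mulmxA _ F) mulVmx //.
  by rewrite mulmx1 -trmx_mul mulmxV // trmx1.
have X : invmx (E *m E^T) *m (E *m m *m E^T) *m invmx (E *m E^T) = F^T *m m *m F.
  rewrite inv !mulmxA -(mulmxA F^T F E) mulVmx // mulmx1.
  by rewrite -(mulmxA _ E^T F^T) -trmx_mul mulVmx // trmx1 mulmx1.
have aX : (F^T *m m *m F)^T = - (F^T *m m *m F).
  by rewrite !trmx_mul trmxK am mulNmx mulmxN mulmxA.
have -> : hodge o (E *m E^T) (E *m m *m E^T) =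
    (o * Num.sqrt (\det (E *m E^T))) *: dual2 (F^T *m m *m F).
  apply/matrixP => i j; rewrite mxE X [RHS]mxE -(dual2E _ _ aX) mulrCA; congr (_ * _).
  rewrite mulr_sumr; apply: eq_bigr => k _; rewrite mulr_sumr; apply: eq_bigr => l _.
  by rewrite mulrA.
have -> : dual2 (F^T *m m *m F) = \det F *: (E *m (- m) *m E^T).
  have := dual2_conj F am; rewrite (dual2_asd am pm).
  move=> /(congr1 (fun M => E *m M *m E^T)).
  rewrite !mulmxA mulmxV // mul1mx -(mulmxA _ F^T) -trmx_mul mulmxV // trmx1 mulmx1.
  by rewrite -scalemxAr -scalemxAl.
rewrite det_mulmx det_tr -expr2 sqrtr_sqr sgr_det_norm det_inv mulmxN mulNmx.
rewrite scalerA scalerN -scaleNr; congr (_ *: _).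
by rewrite -!mulrA mulfV // mulr1.
Qed.

End QuaternionicForms.

Lemma nx3 a : nx (nx (nx a)) = a.
Proof. by elim/ord3_ind: a. Qed.

Lemma addr_parts_cancel (Z : zmodType) (a b c d : Z) :
  a + c = a + b + (c + d) -> b + d = 0.
Proof. by move=> H; apply: (addrI (a + c)); rewrite addr0 [RHS]H addrACA. Qed.

Lemma subr_regroup (Z : zmodType) (a b c d : Z) : a + b - (c + d) = a - c - (d - b).
Proof. by rewrite opprD opprB addrACA. Qed.

Lemma mx_subE (R : zmodType) m n (M N : 'M[R]_(m, n)) i j : (M - N) i j = M i j - N i j.
Proof. by rewrite !mxE. Qed.

Lemma mx_addE (R : nmodType) m n (M N : 'M[R]_(m, n)) i j : (M + N) i j = M i j + N i j.
Proof. by rewrite !mxE. Qed.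

Lemma mx_oppE (R : zmodType) m n (M : 'M[R]_(m, n)) i j : (- M) i j = - M i j.
Proof. by rewrite !mxE. Qed.

Lemma mx_scaleE (R : pzRingType) m n (x : R) (M : 'M[R]_(m, n)) i j : (x *: M) i j = x * M i j.
Proof. by rewrite !mxE. Qed.

Lemma cyclic_cancel (K : comPzRingType) (x1 x2 x3 z1 z2 z3 t1 t2 t3 : K) :
  x1 + x2 + x3 = 0 -> z1 + z2 + z3 = t1 + t2 + t3 ->
  (z1 - x1 - t1) + (z2 - x2 - t2) + (z3 - x3 - t3) = 0.
Proof.
move=> H1 H2; transitivity ((z1 + z2 + z3) - (t1 + t2 + t3) - (x1 + x2 + x3)).
  by ring.
by rewrite H1 H2 subrr subr0.
Qed.

Lemma bianchi_pair_algebra (K : comPzRingType) (r1 r2 r3 r4 r5 : K) :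
  r1 = - r2 -> r3 = - r4 -> r5 + r2 + r3 = 0 -> r5 - r4 = r1.
Proof.
move=> -> -> /eqP; rewrite addrAC addr_eq0 => /eqP; exact.
Qed.

Lemma subr_swap (Z : zmodType) (a b c d : Z) : a - b - (c - d) = a - c - (b - d).
Proof. by rewrite !opprB addrACA [RHS]addrACA [- b - c]addrC. Qed.

Section CurvatureAlgebra.
Variable R : comPzRingType.

(** The Bianchi identity of an SO(3)-connection, with all derivatives as free symbols: the second
    derivatives cancel by their symmetry and the cubic terms cancel among themselves. *)
Lemma bianchi_forms_algebra (d d' d'' : 'I_4 -> 'I_4 -> R) (b b' b'' : 'I_4 -> R)
    (dd : 'I_4 -> 'I_4 -> 'I_4 -> R) (i k l : 'I_4) :
  (forall i k l, dd i k l = dd k i l) ->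
  let D i k l := dd i k l - dd i l k + (d' i k * b'' l + b' k * d'' i l)
     - (d' i l * b'' k + b' l * d'' i k) in
  let O' k l := d' k l - d' l k + b'' k * b l - b'' l * b k in
  let O'' k l := d'' k l - d'' l k + b k * b' l - b l * b' k in
  let T i k l := b'' i * O' k l - b' i * O'' k l in
  D i k l + D k l i + D l i k = T i k l + T k l i + T l i k.
Proof.
move=> S D O' O'' T; rewrite /D /T /O' /O'' (S l i k) (S k i l) (S l k i).
ring.
Qed.

(** [P] stands for the derivatives of the Christoffel symbols, [L] and [N] for the symbols
    themselves; only symmetry in the lower indices enters. *)
Lemma riemann_bianchi_algebra (P : 'I_4 -> 'I_4 -> 'I_4 -> R) (L : 'I_4 -> 'I_4 -> R)
    (N : 'I_4 -> 'I_4 -> 'I_4 -> R) (i j k : 'I_4) :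
  (forall a b c, P a b c = P a c b) -> (forall a b c, N a b c = N a c b) ->
  P i j k - P j i k + \sum_m (L i m * N m j k - L j m * N m i k)
  + (P j k i - P k j i + \sum_m (L j m * N m k i - L k m * N m j i))
  + (P k i j - P i k j + \sum_m (L k m * N m i j - L i m * N m k j)) = 0.
Proof.
move=> SP SN; rewrite (SP i k j) (SP j k i) (SP k j i).
have E (a b c x y z : R) : a - b + x + (b - c + y) + (c - a + z) = x + y + z by ring.
rewrite E -!big_split big1 // => m _ /=.
by rewrite (SN m k i) (SN m j i) (SN m k j); ring.
Qed.

(** A torsion-free connection drops out of the exterior derivative of a 2-form: symmetric symbols
    meet an antisymmetric form in a cyclic sum. *)
Lemma christoffel_cyclic_algebra (N : 'I_4 -> 'I_4 -> 'I_4 -> R)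
    (O : 'I_4 -> 'I_4 -> R) (i k l : 'I_4) :
  (forall a b c, N a b c = N b a c) -> (forall a b, O a b = - O b a) ->
  let T i k l := \sum_m N i k m * O m l + \sum_m O k m * N i l m in
  T i k l + T k l i + T l i k = 0.
Proof.
move=> SN AO T; rewrite /T -!big_split big1 // => m _ /=.
rewrite (SN k i m) (SN l i m) (SN l k m) (AO m l) (AO m i) (AO m k); ring.
Qed.

End CurvatureAlgebra.

Lemma partialE (R : realType) i (f : 'rV[R]_4 -> R) v : partial i f v = 'D_(delta_mx 0 i) f v.
Proof. by []. Qed.

Lemma partial_cst (R : realType) i (c : R) v : partial i (fun _ => c) v = 0.
Proof. exact: derive_cst. Qed.

Lemma partial_opp (R : realType) i (f : 'rV[R]_4 -> R) (U : set 'rV[R]_4) v : U v -> Ck 1 U f ->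
  partial i (fun u => - f u) v = - partial i f v.
Proof. by move=> Uv Cf; apply: deriveN; exact: Ck_derivable Cf Uv. Qed.

Arguments Ck : simpl never.
Local Opaque christoffel partial.

(** * Metrics whose self-dual forms are curvature forms *)

Section SelfDualEinstein.
Variable R : realType.
Local Notation V := 'rV[R]_4.

Section Symmetries.
Variables (U : set V) (G : V -> 'M[R]_4).
Hypothesis oU : open U.
Hypothesis CG : forall n i j, Ck n U (fun v => G v i j).
Hypothesis symG : forall v, U v -> (G v)^T = G v.
Hypothesis unitG : forall v, U v -> G v \in unitmx.

Lemma riemann_up_antisym l k i j v : riemann_up G l k i j v = - riemann_up G l k j i v.
Proof.
rewrite /riemann_up !opprD !opprK -sumrN; congr (_ + _); first by rewrite addrC.
by apply: eq_bigr => m _; rewrite opprB.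
Qed.

Lemma riemann_up_bianchi l k i j v : U v ->
  riemann_up G l k i j v + riemann_up G l i j k v + riemann_up G l j k i v = 0.
Proof.
move=> Uv.
apply: (@riemann_bianchi_algebra R (fun a b c => partial a (christoffel G l b c) v)
  (fun a m => christoffel G l a m v) (fun m b c => christoffel G m b c v)) => a b c.
  by apply: partial_eq_on oU Uv _ => u Uu; exact: (christoffel_sym oU symG).
exact: (christoffel_sym oU symG).
Qed.

Lemma riemann_antisym_ij l k i j v : riemann G l k i j v = - riemann G l k j i v.
Proof.
rewrite /riemann -sumrN; apply: eq_bigr => m _.
by rewrite riemann_up_antisym mulrN.
Qed.

Lemma riemann_antisym_lk l k i j v : U v -> riemann G l k i j v = - riemann G k l i j v.
Proof.
move=> Uv.
(* The Ricci identity is applied to the symmetric tensor [G] in place of each form, with zero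
   connection on the index: the metric is parallel. *)
have H := @ricci_identity R U G oU CG unitG (fun _ => G) (fun _ _ _ _ => 0).
have H1 (a : 'I_3) p q : Ck 2 U (fun u => G u p q) by exact: CG.
have H2 (p : 'I_4) (a b : 'I_3) : Ck 1 U (fun _ : V => 0 : R) by exact: Ck_cst.
have H3 (a : 'I_3) r p q u : U u -> partial r (fun u => G u p q) u =
    \sum_m christoffel G m r p u * G u m q + \sum_m christoffel G m r q u * G u p m
    + \sum_(b < 3) 0 * G u p q.
  move=> Uu; rewrite [X in _ + _ + X]big1 ?addr0 => [|b _]; last by rewrite mul0r.
  exact: (metric_parallel oU symG unitG).
have {H} := H H1 H2 H3 c0 i j k l v Uv.
rewrite [X in _ + _ + X]big1 ?addr0 => [|b _].
  rewrite /riemann => /eqP; rewrite addr_eq0 => /eqP E.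
  transitivity (\sum_m riemann_up G m k i j v * G v m l).
    by apply: eq_bigr => m _; rewrite mulrC (symGE symG l m Uv).
  by rewrite E; congr (- _); apply: eq_bigr => m _; rewrite mulrC.
rewrite !partial_cst subrr add0r big1 ?mul0r // => c _.
by rewrite ?mul0r subr0.
Qed.

Lemma riemann_bianchi l k i j v : U v ->
  riemann G l k i j v + riemann G l i j k v + riemann G l j k i v = 0.
Proof.
move=> Uv; rewrite /riemann -!big_split big1 // => m _ /=.
by rewrite -!mulrDr riemann_up_bianchi // mulr0.
Qed.

(** The four Bianchi identities, one for each index in first place, combine to twice the asserted
    difference after the antisymmetries identify their terms. *)
Lemma pair_symmetry_algebra (K : realFieldType) (T : 'I_4 -> 'I_4 -> 'I_4 -> 'I_4 -> K) :
  (forall l k i j, T l k i j = - T l k j i) ->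
  (forall l k i j, T l k i j = - T k l i j) ->
  (forall l k i j, T l k i j + T l i j k + T l j k i = 0) ->
  forall l k i j, T l k i j = T i j l k.
Proof.
move=> A1 A2 B l k i j.
have := B l k i j; have := B k i j l; have := B i j l k; have := B j l k i.
have := A1 k i j l; have := A1 j l k i.
have := A1 i j l k; have := A2 l i j k; have := A2 l j k i; have := A2 k j l i.
have := A2 i l k j; have := A2 l k i j; have := A1 l k i j; have := A2 i j k l.
have := A1 k l i j; have := A1 k i l j; have := A1 k j l i; have := A1 i l k j.
have := A1 i k j l; have := A1 j i k l; have := A1 j k i l; have := A2 i k j l.
have := A2 j i l k; have := A2 j k i l; have := A1 j l i k; have := A2 j l i k.
lra.
Qed.

Lemma riemann_pair l k i j v : U v -> riemann G l k i j v = riemann G i j l k v.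
Proof.
move=> Uv.
apply: (@pair_symmetry_algebra R (fun l k i j => riemann G l k i j v)) => *.
- exact: riemann_antisym_ij.
- exact: riemann_antisym_lk.
- exact: riemann_bianchi.
Qed.

End Symmetries.

Variables (U : set V) (G E : V -> 'M[R]_4) (be : 'I_3 -> 'I_4 -> V -> R).
Hypothesis oU : open U.
Hypothesis CG : forall n i j, Ck n U (fun v => G v i j).
Hypothesis CE : forall i j, Ck 1 U (fun v => E v i j).
Hypothesis Cbe : forall n a i, Ck n U (be a i).
Hypothesis uE : forall v, U v -> E v \in unitmx.
Hypothesis GE : forall v, U v -> G v = E v *m (E v)^T.

(** The curvature of the SO(3)-connection [be]. As the columns of [E] are an orthonormal coframe,
    [curvE] says that the curvature forms are the standard self-dual triple of this coframe. *)
Definition curv a v : 'M[R]_4 := \matrix_(i, j)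
  (partial i (be a j) v - partial j (be a i) v
   + be (nx a) i v * be (nx (nx a)) j v - be (nx a) j v * be (nx (nx a)) i v).

Hypothesis curvE : forall a v, U v -> curv a v = E v *m sq R a *m (E v)^T.

Lemma symG v : U v -> (G v)^T = G v.
Proof. by move=> Uv; rewrite GE // trmx_mul trmxK. Qed.

Lemma unitG v : U v -> G v \in unitmx.
Proof. by move=> Uv; rewrite GE // unitmx_mul unitmx_tr uE. Qed.

(** The smoothness comes from [be]. Through [curvE] the forms would only be C^1, and
    [ricci_identity] takes two derivatives. *)
Lemma Ck_curv n a k l : Ck n U (fun v => curv a v k l).
Proof.
have C x y i j : Ck n U (fun v => be x i v * be y j v) by exact: Ck_mul.
have D x i j : Ck n U (partial i (be x j)) by exact/Ck_partial/Cbe.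
have := Ck_sub_fun oU (Ck_add oU (Ck_sub_fun oU (D a k l) (D a l k)) (C (nx a) (nx (nx a)) k l))
  (C (nx a) (nx (nx a)) l k).
by apply: Ck_ext => // v _; rewrite mxE.
Qed.

Lemma partial_curv a i k l v : U v -> partial i (fun u => curv a u k l) v =
  partial i (partial k (be a l)) v - partial i (partial l (be a k)) v
  + (partial i (be (nx a) k) v * be (nx (nx a)) l v
     + be (nx a) k v * partial i (be (nx (nx a)) l) v)
  - (partial i (be (nx a) l) v * be (nx (nx a)) k v
     + be (nx a) l v * partial i (be (nx (nx a)) k) v).
Proof.
move=> Uv.
have D x p q : is_derive v (delta_mx 0 i) (partial p (be x q)) (partial i (partial p (be x q)) v).
  by apply: derivableP; exact: Ck_derivable (Ck_partial p (Cbe 2%N x q)) Uv.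
have D1 x q : is_derive v (delta_mx 0 i) (be x q) (partial i (be x q) v).
  by apply: derivableP; exact: Ck_derivable (Cbe 1%N x q) Uv.
have M x y p q : is_derive v (delta_mx 0 i) (fun u => be x p u * be y q u)
   (partial i (be x p) v * be y q v + be x p v * partial i (be y q) v).
  apply: is_derive_eq.
  by rewrite addrC [_ *: _]mulrC.
have := is_deriveB (is_deriveD (is_deriveB (D a k l) (D a l k)) (M (nx a) (nx (nx a)) k l))
  (M (nx a) (nx (nx a)) l k).
move=> [_ <-]; apply: partial_eq_on oU Uv _ => u _; by rewrite mxE.
Qed.

(** The Bianchi identity of [be], with the exterior derivative written as a cyclic sum. *)
Lemma curv_closed a i k l v : U v ->
  let T i k l := be (nx (nx a)) i v * curv (nx a) v k l
                 - be (nx a) i v * curv (nx (nx a)) v k l in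
  partial i (fun u => curv a u k l) v + partial k (fun u => curv a u l i) v
  + partial l (fun u => curv a u i k) v = T i k l + T k l i + T l i k.
Proof.
move=> Uv T; rewrite !partial_curv // /T !mxE !nx3.
apply: (@bianchi_forms_algebra R (fun i k => partial i (be a k) v)
  (fun i k => partial i (be (nx a) k) v) (fun i k => partial i (be (nx (nx a)) k) v)
  (fun i => be a i v) (fun i => be (nx a) i v) (fun i => be (nx (nx a)) i v)
  (fun i k l => partial i (partial k (be a l)) v)) => p q r.
exact: (schwarz oU p q Uv (Cbe 2%N a r)).
Qed.

Lemma partial_conj i (S : 'M[R]_4) v : U v ->
  let dE := \matrix_(k, p) partial i (fun u => E u k p) v in
  \matrix_(k, l) partial i (fun u => (E u *m S *m (E u)^T) k l) v =
  dE *m S *m (E v)^T + E v *m S *m dE^T.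
Proof.
move=> Uv dE; apply/matrixP => k l.
have D p q : is_derive v (delta_mx 0 i) (fun u => E u p q) (dE p q).
  by rewrite mxE; apply: derivableP; exact: Ck_derivable (CE p q) Uv.
have D1 q : is_derive v (delta_mx 0 i) (fun u => \sum_p E u k p * S p q)
    (\sum_p dE k p * S p q).
  have -> : (fun u => \sum_p E u k p * S p q) = \sum_p (fun u => E u k p * S p q).
    by apply/funext => u; rewrite fct_sumE.
  apply: is_derive_sum => p; apply: is_derive_eq.
  by rewrite scaler0 add0r [_ *: _]mulrC.
have D2 : is_derive v (delta_mx 0 i)
    (\sum_q (fun u => (\sum_p E u k p * S p q) * E u l q))
    (\sum_q ((\sum_p E v k p * S p q) * dE l q + E v l q * (\sum_p dE k p * S p q))).
  by apply: is_derive_sum => q; exact: (is_deriveM (D1 q) (D l q)).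
have -> : (\matrix_(k, l) partial i (fun u => (E u *m S *m (E u)^T) k l) v) k l =
   \sum_q ((\sum_p E v k p * S p q) * dE l q + E v l q * (\sum_p dE k p * S p q)).
  rewrite mxE; case: D2 => _ <-; rewrite partialE; congr ('D_ _ _ _).
  apply/funext => u; rewrite fct_sumE mxE; apply: eq_bigr => q _.
  by rewrite !mxE.
rewrite big_split /= addrC [RHS]mxE; congr (_ + _).
  by rewrite mxE; apply: eq_bigr => q _; rewrite !mxE mulrC.
by rewrite mxE; apply: eq_bigr => q _; rewrite !mxE.
Qed.

(** The connection [be] in the adjoint representation, as an antisymmetric matrix acting on the
    index of the triple. *)
Definition thc (i : 'I_4) (a b : 'I_3) : V -> R :=
  match val a, val b with
  | 0, 1 => be c2 i | 0, 2 => fun v => - be c1 i v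
  | 1, 2 => be c0 i | 1, 0 => fun v => - be c2 i v
  | 2, 0 => be c1 i | 2, 1 => fun v => - be c0 i v
  | _, _ => fun _ => 0
  end.

Lemma thcE i a v (x : 'I_3 -> R) : \sum_b thc i a b v * x b =
  be (nx (nx a)) i v * x (nx a) - be (nx a) i v * x (nx (nx a)).
Proof.
rewrite sum3E; elim/ord3_ind: a; rewrite /thc /nx /=;
move: (be c0 i v) (be c1 i v) (be c2 i v) => y0 y1 y2; ring.
Qed.

(** Passes from the coordinate components of a 3-form to its components in the coframe. *)
Lemma contract_cyclic (T : 'I_4 -> 'I_4 -> 'I_4 -> R) (F : 'M[R]_4) :
  (forall i k l, T i k l + T k l i + T l i k = 0) ->
  let ct p q r := \sum_i \sum_k \sum_l F p i * F q k * F r l * T i k l in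
  forall p q r, ct p q r + ct q r p + ct r p q = 0.
Proof.
move=> H ct p q r.
have -> : ct q r p = \sum_i \sum_k \sum_l F p i * F q k * F r l * T k l i.
  rewrite /ct; under eq_bigr => i _ do rewrite exchange_big /=.
  rewrite exchange_big /=; apply: eq_bigr => i _; apply: eq_bigr => k _.
  by apply: eq_bigr => l _; ring.
have -> : ct r p q = \sum_i \sum_k \sum_l F p i * F q k * F r l * T l i k.
  rewrite /ct exchange_big /=; apply: eq_bigr => i _.
  rewrite exchange_big /=; apply: eq_bigr => k _; apply: eq_bigr => l _; ring.
rewrite -!big_split big1 // => i _ /=; rewrite -!big_split big1 // => k _ /=.
by rewrite -!big_split big1 // => l _ /=; rewrite -!mulrDr H mulr0.
Qed.

Section AtPoint.
Variable v : V.
Hypothesis Uv : U v.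

Let F := invmx (E v).
Let A i : 'M[R]_4 := \matrix_(j, k) christoffel G k i j v.
Let dE i : 'M[R]_4 := \matrix_(k, p) partial i (fun u => E u k p) v.
Variable B : 'I_4 -> 'M[R]_4.
Hypothesis frame_connection : forall i, dE i = A i *m E v + E v *m B i.

(** [B i] is the Levi-Civita connection in the orthonormal coframe. Differentiating [G = E E^T] and
    comparing with the parallelism of [G] leaves the symmetric part of [B i], which must vanish. *)
Lemma frame_connection_antisym i : (B i)^T = - B i.
Proof.
have E1 : \matrix_(k, l) partial i (fun u => G u k l) v =
    dE i *m (E v)^T + E v *m (dE i)^T.
  have : _ = dE i *m 1%:M *m (E v)^T + E v *m 1%:M *m (dE i)^T := partial_conj i 1%:M Uv.
  rewrite (mulmx1 (dE i)) (mulmx1 (E v)) => <-.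
  apply/matrixP => k l; rewrite !mxE; apply: partial_eq_on oU Uv _ => u Uu.
  by rewrite mulmx1 GE.
have E2 : \matrix_(k, l) partial i (fun u => G u k l) v = A i *m G v + G v *m (A i)^T.
  apply/matrixP => k l; rewrite mxE (metric_parallel oU symG unitG) // [RHS]mxE.
  congr (_ + _); rewrite mxE; apply: eq_bigr => m _; rewrite !mxE //.
  by rewrite mulrC.
move: E1; rewrite {}E2 !frame_connection GE // linearD /= !trmx_mul mulmxDl mulmxDr !mulmxA.
move=> /addr_parts_cancel E0.
have uET : (E v)^T \in unitmx by rewrite unitmx_tr uE.
apply/eqP; rewrite -addr_eq0; apply/eqP.
apply: (can_inj (mulmxK uET)); apply: (can_inj (mulKmx (uE Uv))).
by rewrite mul0mx mulmx0 mulmxDl mulmxDr !mulmxA addrC.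
Qed.

Lemma curv_antisym a : (curv a v)^T = - curv a v.
Proof. by rewrite curvE // !trmx_mul trmxK sq_tr mulNmx mulmxN mulmxA. Qed.

Lemma christoffel_cyclic a i k l :
  (A i *m curv a v + curv a v *m (A i)^T) k l
  + (A k *m curv a v + curv a v *m (A k)^T) l i
  + (A l *m curv a v + curv a v *m (A l)^T) i k = 0.
Proof.
have TE i' k' l' : (A i' *m curv a v + curv a v *m (A i')^T) k' l' =
    \sum_m christoffel G m i' k' v * curv a v m l'
    + \sum_m curv a v k' m * christoffel G m i' l' v.
  by rewrite !mxE; congr (_ + _); apply: eq_bigr => m _; rewrite [A i']lock !mxE -lock mxE.
have SN x y z : christoffel G z x y v = christoffel G z y x v.
  exact: (christoffel_sym oU symG).
have AO x y : curv a v x y = - curv a v y x.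
  by have := congr1 (fun M => fun_of_matrix M y x) (curv_antisym a); rewrite !mxE.
have := @christoffel_cyclic_algebra R (fun a b c => christoffel G c a b v)
  (fun x y => curv a v x y) i k l SN AO.
cbv zeta beta => H.
exact: (etrans (f_equal2 +%R (f_equal2 +%R (TE i k l) (TE k l i)) (TE l i k)) H).
Qed.

Lemma partial_curv_frame a i :
  \matrix_(k, l) partial i (fun u => curv a u k l) v =
  A i *m curv a v + curv a v *m (A i)^T
  + E v *m (B i *m sq R a - sq R a *m B i) *m (E v)^T.
Proof.
have -> : \matrix_(k, l) partial i (fun u => curv a u k l) v =
    dE i *m sq R a *m (E v)^T + E v *m sq R a *m (dE i)^T.
  have : _ = dE i *m sq R a *m (E v)^T + _ := partial_conj i (sq R a) Uv.
  move=> <-; apply/matrixP => k l; rewrite !mxE; apply: partial_eq_on oU Uv _ => u Uu.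
  by rewrite curvE.
rewrite frame_connection linearD /= !trmx_mul frame_connection_antisym curvE //.
by rewrite !(mulmxDl, mulmxDr, mulNmx, mulmxN, mulmxA) addrACA.
Qed.

(** The self-dual part of the Levi-Civita connection is [be] up to sign. Both connections make the
    triple covariantly closed, one because it is torsion-free and the other by the Bianchi identity,
    and [wedge_sq_eq0] leaves room for only one such connection. *)
Lemma pairing_connection i b : pairing (B i) b + be b i v = 0.
Proof.
pose kap i b := pairing (B i) b + be b i v.
pose W i a := kap i (nx a) *: sq R (nx (nx a)) - kap i (nx (nx a)) *: sq R (nx a).
have WE i' a : W i' a = B i' *m sq R a - sq R a *m B i'
    - (be (nx (nx a)) i' v *: sq R (nx a) - be (nx a) i' v *: sq R (nx (nx a))).
  rewrite comm_sq ?frame_connection_antisym // /W /kap !scalerDl.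
  exact: subr_regroup.
(* [christoffel_cyclic] and [curv_closed] remove all but the difference [W] of the two connections
   from the exterior derivative of the triple. *)
have cyc a i' k l : (E v *m W i' a *m (E v)^T) k l + (E v *m W k a *m (E v)^T) l i'
    + (E v *m W l a *m (E v)^T) i' k = 0.
  have X x y z : (E v *m W x a *m (E v)^T) y z = partial x (fun u => curv a u y z) v
     - (A x *m curv a v + curv a v *m (A x)^T) y z
     - (be (nx (nx a)) x v * curv (nx a) v y z - be (nx a) x v * curv (nx (nx a)) v y z).
    have Q := partial_curv_frame a x.
    have {}Q : E v *m W x a *m (E v)^T =
      \matrix_(k, l) partial x (fun u => curv a u k l) v
      - (A x *m curv a v + curv a v *m (A x)^T)
      - (be (nx (nx a)) x v *: curv (nx a) v - be (nx a) x v *: curv (nx (nx a)) v).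
      rewrite Q [X in _ = X - _ - _]addrC addrK WE mulmxBr mulmxBl; congr (_ - _).
      by rewrite !curvE // mulmxBr mulmxBl -!scalemxAr -!scalemxAl.
    rewrite Q !mx_subE !mx_scaleE; congr (_ - _ - _); by rewrite mxE.
  have C1 := christoffel_cyclic a i' k l; have C2 := curv_closed a i' k l Uv.
  by rewrite !X; exact: cyclic_cancel C1 C2.
(* The difference is expressed in the coframe, where the forms are the constant matrices [sq]. *)
pose kap' p b := \sum_i F p i * kap i b.
have k0 : forall p b, kap' p b = 0.
  apply: wedge_sq_eq0 => a p q r.
  have := contract_cyclic F (cyc a) p q r.
  have H x y z : \sum_i \sum_k \sum_l F x i * F y k * F z l * (E v *m W i a *m (E v)^T) k l
     = (kap' x (nx a) *: sq R (nx (nx a)) - kap' x (nx (nx a)) *: sq R (nx a)) y z.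
    transitivity (\sum_i F x i * W i a y z).
      apply: eq_bigr => i' _.
      have WM : W i' a = F *m (E v *m W i' a *m (E v)^T) *m F^T.
        by rewrite !mulmxA mulVmx ?uE // mul1mx -mulmxA -trmx_mul mulVmx ?uE // trmx1 mulmx1.
      move: WM; move: (E v *m W i' a *m (E v)^T) => M ->.
      rewrite !mxE mulr_sumr exchange_big /=; apply: eq_bigr => l _.
      rewrite !mxE mulr_suml mulr_sumr; apply: eq_bigr => k _.
      by move: (M k l) => t; ring.
    rewrite /W /kap' !mxE !mulr_suml -sumrB; apply: eq_bigr => i' _.
    rewrite !mxE; move: (kap i' _) (kap i' _) => t1 t2; ring.
  by rewrite !H.
have -> : pairing (B i) b + be b i v = \sum_p E v i p * kap' p b.
  rewrite /kap'; under eq_bigr => p _ do rewrite mulr_sumr.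
  rewrite exchange_big /= -/(kap i b) (bigD1 i) //= [X in _ + X]big1 ?addr0 => [|j ji].
    have := congr1 (fun M => fun_of_matrix M i i) (mulmxV (uE Uv)).
    rewrite !mxE eqxx => S; rewrite -[LHS]mul1r -[1]/(true%:R) -S mulr_suml.
    by apply: eq_bigr => p _; rewrite mulrA.
  have := congr1 (fun M => fun_of_matrix M i j) (mulmxV (uE Uv)).
  rewrite !mxE eq_sym (negbTE ji) => S.
  by under eq_bigr => p _ do rewrite mulrA; rewrite -mulr_suml S mul0r.
by rewrite big1 // => p _; rewrite k0 mulr0.
Qed.

(** The quaternionic Kahler condition: parallel transport preserves the triple up to a rotation,
    which is that of [be]. *)
Lemma curv_parallel a i k l : partial i (fun u => curv a u k l) v =
  \sum_m christoffel G m i k v * curv a v m l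
  + \sum_m christoffel G m i l v * curv a v k m + \sum_b thc i a b v * curv b v k l.
Proof.
have := congr1 (fun M => fun_of_matrix M k l) (partial_curv_frame a i).
rewrite [LHS]mxE => ->; rewrite [LHS]mxE; congr (_ + _).
  rewrite mxE; congr (_ + _); rewrite mxE; apply: eq_bigr => m _; rewrite !mxE //.
  by rewrite mulrC.
have P c : pairing (B i) c = - be c i v.
  by apply/eqP; rewrite -addr_eq0 pairing_connection.
rewrite comm_sq ?frame_connection_antisym // !P (thcE i a v (fun b => curv b v k l)).
rewrite !curvE // mulmxBr mulmxBl -!scalemxAr -!scalemxAl !scaleNr opprK addrC.
by rewrite mx_subE !mx_scaleE.
Qed.

End AtPoint.

Section Conclusions.
Variable v : V.
Hypothesis Uv : U v.

Lemma curvature_commutator a i j k l :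
  \sum_m riemann_up G m k i j v * curv a v m l
  + \sum_m riemann_up G m l i j v * curv a v k m
  + (curv (nx (nx a)) v i j * curv (nx a) v k l
     - curv (nx a) v i j * curv (nx (nx a)) v k l) = 0.
Proof.
have Cth (p : 'I_4) (x y : 'I_3) : Ck 1 U (thc p x y).
  elim/ord3_ind: x; elim/ord3_ind: y; rewrite /thc /=;
  by [exact: Cbe | exact: Ck_cst | exact: (Ck_opp oU (Cbe 1%N _ _))].
have P x p q r u : U u -> partial p (fun u => curv x u q r) u =
  \sum_m christoffel G m p q u * curv x u m r
  + \sum_m christoffel G m p r u * curv x u q m + \sum_b thc p x b u * curv b u q r.
  (* As [E] is invertible, the equation [frame_connection] is solved for its matrix [B]. *)
  move=> Uu; apply: (curv_parallel Uu
    (B := fun i => invmx (E u) *m (\matrix_(k, p) partial i (fun w => E w k p) u -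
      (\matrix_(j, k) christoffel G k i j u) *m E u))) => t.
  by rewrite mulmxA mulmxV ?uE // mul1mx addrC subrK.
have := ricci_identity oU CG unitG (fun x => Ck_curv 2 x) Cth P a i j k l Uv.
move=> {P} H; rewrite -[RHS]H; congr (_ + _).
clear H; elim/ord3_ind: a; rewrite sum3E /nx /=;
move: (curv c0 v k l) (curv c1 v k l) (curv c2 v k l) => x0 x1 x2;
rewrite !sum3E /thc /= ?(partial_opp _ Uv (Cbe 1%N _ _)) ?partial_cst !mxE /nx /=;
ring.
Qed.

Let F := invmx (E v).
Let P i j : 'M[R]_4 := \matrix_(k, l) riemann G l k i j v.
Let p i j : 'M[R]_4 := F *m P i j *m F^T.

Lemma P_frame i j : P i j = E v *m p i j *m (E v)^T.
Proof.
rewrite /p !mulmxA mulmxV ?uE // mul1mx -mulmxA -trmx_mul mulmxV ?uE // trmx1.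
by rewrite mulmx1.
Qed.

Lemma p_antisym i j : (p i j)^T = - p i j.
Proof.
rewrite /p !trmx_mul trmxK mulmxA -mulNmx -mulmxN; congr (_ *m _ *m _).
by apply/matrixP => k l; rewrite !mxE (riemann_antisym_lk oU CG symG unitG).
Qed.

Lemma P_up i j : P i j = (\matrix_(k, m) riemann_up G m k i j v) *m G v.
Proof.
apply/matrixP => k l; rewrite !mxE; apply: eq_bigr => m _.
by rewrite mxE mulrC (symGE symG l m Uv).
Qed.

(** By [curvature_commutator] the commutators of [p i j] with the [sq a] are those of a matrix whose
    self-dual coordinates are the curvature forms, and [sq_free] separates these coordinates. Thus
    the curvature operator is a multiple of the identity on self-dual forms, which contains both the
    Einstein equation and the vanishing of half of the Weyl tensor. *)
Lemma p_pairing i j b : pairing (p i j) b = curv b v i j.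
Proof.
have key a : p i j *m sq R a - sq R a *m p i j =
    curv (nx a) v i j *: sq R (nx (nx a)) - curv (nx (nx a)) v i j *: sq R (nx a).
  pose Ru : 'M[R]_4 := \matrix_(k, m) riemann_up G m k i j v.
  have PRu : P i j = Ru *m G v := P_up i j.
  have Rup : Ru = E v *m p i j *m F.
    have : P i j *m F^T *m F = E v *m p i j *m F by rewrite P_frame -(mulmxA _ _ F^T)
       -trmx_mul mulVmx ?uE // trmx1 mulmx1.
    move=> <-; rewrite PRu GE // !mulmxA -(mulmxA _ _ F^T) -trmx_mul mulVmx ?uE //.
    by rewrite trmx1 mulmx1 -mulmxA mulmxV ?uE // mulmx1.
  have : Ru *m curv a v + curv a v *m Ru^T = curv (nx a) v i j *: curv (nx (nx a)) v
     - curv (nx (nx a)) v i j *: curv (nx a) v.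
    apply/matrixP => k l; apply/eqP; rewrite -subr_eq0; apply/eqP.
    rewrite -[RHS](curvature_commutator a i j k l) mx_subE !mx_scaleE opprB.
    rewrite mx_addE !mxE; congr (_ + _ + _); apply: eq_bigr => m _; rewrite !mxE //.
    by rewrite mulrC.
  move: (p i j) (p_antisym i j) Rup => q aq ->.
  rewrite !(curvE _ Uv) trmx_mul (trmx_mul (E v)) aq => H.
  apply: (can_inj (mulmxK (_ : (E v)^T \in unitmx))); first by rewrite unitmx_tr uE.
  apply: (can_inj (mulKmx (uE Uv))).
  move: H; rewrite !mulmxA -(mulmxA _ F) mulVmx ?uE // mulmx1.
  rewrite -(mulmxA _ _ F^T) -trmx_mul mulVmx ?uE // trmx1 mulmx1 => H.
  rewrite !mulmxBr !mulmxBl -!scalemxAr -!scalemxAl !mulmxA -{}H.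
  by rewrite mulmxN mulNmx.
have [x Ex] : exists x, nx x = b.
  by elim/ord3_ind: b; [exists c2|exists c0|exists c1].
have := key x; rewrite comm_sq ?p_antisym // => /eqP; rewrite -subr_eq0 => /eqP H.
have [] := @sq_free R (pairing (p i j) (nx x) - curv (nx x) v i j)
   (pairing (p i j) (nx (nx x)) - curv (nx (nx x)) v i j) x.
  by rewrite !scalerBl -[RHS]H subr_swap.
by rewrite Ex => /eqP; rewrite subr_eq0 => /eqP.
Qed.

(** The Bianchi identity turns the contraction over one index of each pair into half the contraction
    over a whole pair, which is [pairing] and known from [p_pairing]. *)
Lemma contraction_with_form a j k :
  \sum_i \sum_l riemann G l k i j v * (F^T *m sq R a *m F) l i = curv a v j k.
Proof.
set Y := F^T *m sq R a *m F.
have AY x y : Y x y = - Y y x.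
  have := congr1 (fun M => fun_of_matrix M y x) (_ : Y^T = - Y); rewrite !mxE; apply.
  by rewrite /Y !trmx_mul trmxK sq_tr mulNmx mulmxN mulmxA.
pose S := \sum_i \sum_l riemann G l k i j v * Y l i.
have S2 : S = - \sum_i \sum_l riemann G i k l j v * Y l i.
  rewrite /S exchange_big /= -sumrN; apply: eq_bigr => l _; rewrite -sumrN.
  by apply: eq_bigr => i _; rewrite AY mulrN.
have S3 : S + S = - \sum_i \sum_l riemann G i l j k v * - Y l i.
  rewrite {2}S2 /S -sumrB -sumrN; apply: eq_bigr => i _; rewrite -sumrB -sumrN.
  apply: eq_bigr => l _; rewrite -mulrBl mulrN opprK; congr (_ * _).
  rewrite (riemann_pair oU CG symG unitG i k l j Uv).
  exact: (bianchi_pair_algebra (riemann_antisym_lk oU CG symG unitG i l j k Uv)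
    (riemann_antisym_ij G l j k i v) (riemann_bianchi oU symG l k i j Uv)).
have PY : \sum_i \sum_l riemann G i l j k v * - Y l i = - (2 * pairing (p j k) a).
  have -> : 2 * pairing (p j k) a = \sum_x \sum_y p j k x y * sq R a x y.
    by rewrite /pairing mulrA mulfV ?mul1r.
  have E1 : \sum_x \sum_y p j k x y * sq R a x y = \tr (p j k *m (sq R a)^T).
    rewrite /mxtrace; apply: eq_bigr => x _; rewrite mxE; apply: eq_bigr => y _.
    by rewrite [(sq R a)^T _ _]mxE.
  have E2 : \sum_i \sum_l riemann G i l j k v * - Y l i = - \tr (P j k *m Y^T).
    rewrite /mxtrace -sumrN exchange_big /=; apply: eq_bigr => x _; rewrite mxE -sumrN.
    apply: eq_bigr => y _; rewrite mulrN (_ : P j k x y = riemann G y x j k v) ?mxE //.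
  rewrite E1 E2; congr (- _); rewrite /p /Y !trmx_mul trmxK.
  by rewrite -!mulmxA [RHS]mxtrace_mulC -!mulmxA.
rewrite -/S; move: S3; rewrite {}PY opprK p_pairing => S3.
by apply: (mulfI (_ : 2 != 0 :> R)) => //; rewrite -S3; ring.
Qed.

(** [sandwich_sq] with the complex structure of [sq c0] splits the curvature operator into three
    terms, and the trace of each is [- G]: the first by [contraction_with_form], the other two
    because the forms square to minus the identity. This is where the constant -3 arises. *)
Lemma ricci_frame : ricci G v = (- 3) *: G v.
Proof.
pose K : 'M[R]_4 := E v *m sq R c0 *m F.
have sand i j : P i j = - (K *m P i j *m (F^T *m sq R c0 *m (E v)^T))
   + curv c1 v i j *: curv c1 v + curv c2 v i j *: curv c2 v.
  rewrite {1}P_frame {1}(sandwich_sq c0 (p_antisym i j)) !p_pairing /=.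
  rewrite !mulmxDr !mulmxDl !mulmxN !mulNmx -!scalemxAr -!scalemxAl -!curvE //.
  congr (- _ + _ + _); by rewrite /p /K !mulmxA.
apply/matrixP => j k; rewrite mx_scaleE.
have inv : invmx (G v) = F^T *m F.
  apply: (can_inj (mulmxK (unitG Uv))); rewrite mulVmx ?unitG // GE // mulmxA.
  by rewrite -(mulmxA _ F) mulVmx ?uE // mulmx1 -trmx_mul mulmxV ?uE // trmx1.
pose Y := F^T *m sq R c0 *m F.
have LY : F^T *m sq R c0 *m (E v)^T *m (F^T *m F) = Y.
  by rewrite !mulmxA -(mulmxA _ _ F^T) -trmx_mul mulVmx ?uE // trmx1 mulmx1.
have up i : riemann_up G i k i j v = (P i j *m invmx (G v)) k i.
  by rewrite P_up -mulmxA mulmxV ?unitG // mulmx1 mxE.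
have PG i : P i j *m invmx (G v) = - (K *m (P i j *m Y))
    + curv c1 v i j *: (curv c1 v *m invmx (G v))
    + curv c2 v i j *: (curv c2 v *m invmx (G v)).
  rewrite {1}sand !mulmxDl mulNmx -!scalemxAl; congr (- _ + _ + _).
  by rewrite -!mulmxA -LY inv !mulmxA.
have KO : K *m curv c0 v = - G v.
  rewrite curvE // /K GE // !mulmxA -(mulmxA _ F) mulVmx ?uE // mulmx1.
  by rewrite -(mulmxA (E v) (sq R c0) (sq R c0)) sq_sqr mulmxN mulmx1 mulNmx.
have OO b : curv b v *m invmx (G v) *m curv b v = - G v.
  rewrite inv curvE // GE // !mulmxA -(mulmxA _ _ F^T) -trmx_mul mulVmx ?uE //.
  rewrite trmx1 mulmx1 -(mulmxA _ F) mulVmx ?uE // mulmx1.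
  by rewrite -(mulmxA (E v) (sq R b) (sq R b)) sq_sqr mulmxN mulmx1 mulNmx.
have S1 : \sum_i (K *m (P i j *m Y)) k i = G v k j.
  transitivity (\sum_x K k x * \sum_i (P i j *m Y) x i).
    under [RHS]eq_bigr => x _ do rewrite mulr_sumr.
    by rewrite exchange_big; apply: eq_bigr => i _; rewrite [LHS]mxE.
  transitivity (- (K *m curv c0 v) k j); last by rewrite KO !mxE opprK.
  rewrite [X in - X]mxE -sumrN; apply: eq_bigr => x _; rewrite -mulrN; congr (_ * _).
  have -> : - curv c0 v x j = curv c0 v j x.
    by have := congr1 (fun M => fun_of_matrix M j x) (curv_antisym Uv c0);
       rewrite [LHS]mxE [RHS]mxE => ->; rewrite opprK.
  rewrite -(contraction_with_form c0 j x); apply: eq_bigr => i _.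
  by rewrite mxE; apply: eq_bigr => l _; rewrite [P i j x l]mxE.
have S2 b : \sum_i curv b v i j * (curv b v *m invmx (G v)) k i = - G v k j.
  rewrite -[RHS]mx_oppE -(OO b) [RHS]mxE; apply: eq_bigr => i _; exact: mulrC.
rewrite mxE; under eq_bigr => i _ do rewrite up PG !mx_addE mx_oppE !mx_scaleE.
rewrite !big_split /= sumrN S1 !S2 (symGE symG j k Uv); ring.
Qed.

Lemma scal_frame : scal G v = - 12.
Proof.
rewrite /scal ricci_frame.
transitivity (\tr (invmx (G v) *m ((- 3) *: G v))).
  rewrite /mxtrace; apply: eq_bigr => j _; rewrite mxE; apply: eq_bigr => k _.
  by rewrite !mx_scaleE (symGE symG j k Uv).
rewrite -scalemxAr mulVmx ?unitG // linearZ /= mxtrace1; ring.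
Qed.

(** With Ricci tensor [-3 G] and scalar curvature -12, the Weyl tensor is the Riemann tensor plus
    the curvature of constant curvature 1; pair symmetry lets it be read as a 2-form in [i], [j] for
    fixed [l], [k]. *)
Lemma weyl_frame l k :
  \matrix_(i, j) weyl G l k i j v =
  E v *m (- p l k + ((row l (E v))^T *m row k (E v) - (row k (E v))^T *m row l (E v)))
    *m (E v)^T.
Proof.
have -> : E v *m (- p l k + ((row l (E v))^T *m row k (E v)
     - (row k (E v))^T *m row l (E v))) *m (E v)^T =
   - P l k + ((row l (G v))^T *m row k (G v) - (row k (G v))^T *m row l (G v)).
  rewrite mulmxDr mulmxDl mulmxN mulNmx -P_frame; congr (- _ + _).
  rewrite mulmxBr mulmxBl GE // !row_mul !trmx_mul !trmxK !mulmxA; by [].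
apply/matrixP => i j.
have rG a b : ((row a (G v))^T *m row b (G v)) i j = G v a i * G v b j.
  by rewrite mxE big_ord1 !mxE.
rewrite mx_addE mx_subE mx_oppE !rG mxE /weyl ricci_frame scal_frame !mx_scaleE.
rewrite (_ : P l k i j = riemann G j i l k v) ?mxE //.
rewrite (riemann_pair oU CG symG unitG l k i j Uv).
rewrite (riemann_antisym_lk oU CG symG unitG i j l k Uv).
rewrite (symGE symG i l Uv) (symGE symG i k Uv) (symGE symG j k Uv) (symGE symG j l Uv).
by field.
Qed.

(** The self-dual coordinates of [- p l k] and of the wedge of rows [l] and [k] are opposite, so the
    form is anti-self-dual for the orientation of the coframe. Reversing the orientation makes it
    self-dual, hence the sign. *)
Lemma weyl_minus_frame l k : weyl_minus (- Num.sg (\det (E v))) G l k v = 0.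
Proof.
rewrite /weyl_minus weyl_frame; set m := - p l k + _.
have am : m^T = - m.
  rewrite /m linearD linearB linearN /= p_antisym !trmx_mul !trmxK.
  by rewrite opprD !opprK opprB.
have pm b : pairing m b = 0.
  have pD (x y : 'M[R]_4) : pairing (x + y) b = pairing x b + pairing y b.
    rewrite /pairing -mulrDr -big_split; congr (_ * _); apply: eq_bigr => q _ /=.
    by rewrite -big_split; apply: eq_bigr => r _ /=; rewrite mx_addE mulrDl.
  have pN (x : 'M[R]_4) : pairing (- x) b = - pairing x b.
    rewrite /pairing -mulrN -sumrN; congr (_ * _); apply: eq_bigr => q _ /=.
    by rewrite -sumrN; apply: eq_bigr => r _ /=; rewrite mx_oppE mulNr.
  rewrite /m !pD !pN p_pairing.
  have pr x y : pairing ((row x (E v))^T *m row y (E v)) b = 2^-1 * curv b v x y.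
    rewrite curvE // /pairing; congr (_ * _); rewrite [RHS]mxE exchange_big /=.
    apply: eq_bigr => r _; rewrite mxE mulr_suml; apply: eq_bigr => q _.
    rewrite [_ q r]mxE big_ord1 !mxE; ring.
  rewrite !pr (_ : curv b v k l = - curv b v l k); first by field.
  by have := congr1 (fun M => fun_of_matrix M l k) (curv_antisym Uv b);
       rewrite [LHS]mxE [RHS]mxE.
have dE0 : \det (E v) != 0 by rewrite -unitfE -unitmxE uE.
rewrite GE // hodge_asd ?uE // mulNr opprK.
have -> : Num.sg (\det (E v)) * Num.sg (\det (E v)) = 1 by rewrite -expr2 sqr_sg dE0.
by rewrite scale1r subrr scaler0.
Qed.

End Conclusions.

End SelfDualEinstein.

Local Transparent christoffel.

(** * Toric metrics *)

Section PartialRules.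
Variables (R : realType) (U : set 'rV[R]_4).
Hypothesis oU : open U.
Implicit Types (g h : 'rV[R]_4 -> R) (i : 'I_4) (v : 'rV[R]_4).

Lemma partial_mulE g h i v : U v -> Ck 1 U g -> Ck 1 U h ->
  partial i (fun u => g u * h u) v = partial i g v * h v + g v * partial i h v.
Proof. exact: partial_mul. Qed.

Lemma partial_addE g h i v : U v -> Ck 1 U g -> Ck 1 U h ->
  partial i (fun u => g u + h u) v = partial i g v + partial i h v.
Proof. exact: partial_add. Qed.

Lemma partial_subE g h i v : U v -> Ck 1 U g -> Ck 1 U h ->
  partial i (fun u => g u - h u) v = partial i g v - partial i h v.
Proof.
move=> Uv Cg Ch.
by rewrite (partial_addE i Uv Cg (Ck_opp oU Ch)) (partial_opp i Uv Ch).
Qed.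

Lemma partial_invE h i v : U v -> Ck 1 U h -> h v != 0 ->
  partial i (fun u => (h u)^-1) v = - (partial i h v) / h v ^+ 2.
Proof.
move=> Uv Ch h0; have dh : derivable h v (delta_mx 0 i) by exact: Ck_derivable Ch Uv.
rewrite partialE (deriveV h0 dh) -partialE /GRing.scale /=.
by rewrite mulNr mulrC mulNr.
Qed.

Lemma partial_divE g h i v : U v -> Ck 1 U g -> Ck 1 U h ->
  (forall u, U u -> h u != 0) ->
  partial i (fun u => g u / h u) v = (partial i g v * h v - g v * partial i h v) / h v ^+ 2.
Proof.
move=> Uv Cg Ch h0; rewrite (partial_mulE i Uv Cg (Ck_inv oU h0 Ch)).
by rewrite (partial_invE i Uv Ch (h0 _ Uv)); field; exact: h0.
Qed.

End PartialRules.

Section ToricAlgebra.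
Variable R : realType.
Variables (x y f p k s p1 p2 q1 q2 : R).
Hypotheses (f0 : f != 0) (s0 : s != 0) (Vs : s ^+ 2 = p ^+ 2 + y ^+ 2 * k ^+ 2 - f * k)
  (lap : p1 + q2 = k).

Let q := y * k.
Let df xi yi := p * xi + q * yi.
Let s1 (ph ps : R) := (f - y * q - x * p) * ph - p * ps.
Let s2 (ph ps : R) := y * ((x * k - p) * ph + k * ps).

(** This and the next two lemmas are the components of [td_curv] at a point. The symbols [xi], [yi],
    [phi], [psi] are the components of dx, dy and of the two angle forms, [xij] and [yij] second
    derivatives of x and y; [p1], [p2], [q1], [q2] are the second derivatives of [f], and [lap] is
    the equation f_xx + f_yy = f_y / y. *)
Lemma curv_algebra0 (xi yi phi psi xj yj phj psj xij yij : R) :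
  (((q1 * xi + q2 * yi) * xj + q * xij - ((p1 * xi + p2 * yi) * yj + p * yij)) * f
    - (q * xj - p * yj) * df xi yi) / f ^+ 2
  - (((q1 * xj + q2 * yj) * xi + q * xij - ((p1 * xj + p2 * yj) * yi + p * yij)) * f
    - (q * xi - p * yi) * df xj yj) / f ^+ 2
  + (psi + x * phi) / f * (y * phj / f) - (psj + x * phj) / f * (y * phi / f)
  = (s / f * xi) * (s / f * yj) - (s / f * yi) * (s / f * xj)
    + (s1 phi psi / (f * s)) * (s2 phj psj / (f * s))
    - (s2 phi psi / (f * s)) * (s1 phj psj / (f * s)).
Proof.
have -> : (s / f * xi) * (s / f * yj) - (s / f * yi) * (s / f * xj) =
   s ^+ 2 * (xi * yj - yi * xj) / f ^+ 2 by field.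
rewrite -[RHS]addrA.
have -> : (s1 phi psi / (f * s)) * (s2 phj psj / (f * s))
    - (s2 phi psi / (f * s)) * (s1 phj psj / (f * s)) =
    - y * (phi * psj - psi * phj) / f ^+ 2.
  (* The coefficients of [s1] and [s2] in [phi] and [psi] have determinant [- y * V], and [V] is
     [s ^+ 2]. *)
  have -> : (s1 phi psi / (f * s)) * (s2 phj psj / (f * s))
    - (s2 phi psi / (f * s)) * (s1 phj psj / (f * s)) =
    (- y * (phi * psj - psi * phj) * (p ^+ 2 + y ^+ 2 * k ^+ 2 - f * k)) / (f ^+ 2 * s ^+ 2).
    by rewrite /s1 /s2 /q; field; rewrite f0 s0.
  by rewrite -Vs; field; rewrite f0 s0.
rewrite Vs /df /q -lap; field; exact: f0.
Qed.

Lemma curv_algebra1 (xi yi phi psi xj yj phj psj dps dph : R) :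
  ((dps + (xi * phj + x * dph)) * f - (psj + x * phj) * df xi yi) / f ^+ 2
  - ((dps + (xj * phi + x * dph)) * f - (psi + x * phi) * df xj yj) / f ^+ 2
  + (y * phi / f) * ((q * xj - p * yj) / f) - (y * phj / f) * ((q * xi - p * yi) / f)
  = (s / f * xi) * (s1 phj psj / (f * s)) - (s1 phi psi / (f * s)) * (s / f * xj)
    - ((s / f * yi) * (s2 phj psj / (f * s)) - (s2 phi psi / (f * s)) * (s / f * yj)).
Proof. by rewrite /s1 /s2 /df /q; field; rewrite f0 s0. Qed.

Lemma curv_algebra2 (xi yi phi psi xj yj phj psj dph : R) :
  ((yi * phj + y * dph) * f - (y * phj) * df xi yi) / f ^+ 2
  - ((yj * phi + y * dph) * f - (y * phi) * df xj yj) / f ^+ 2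
  + ((q * xi - p * yi) / f) * ((psj + x * phj) / f) - ((q * xj - p * yj) / f) * ((psi + x * phi) / f)
  = (s / f * xi) * (s2 phj psj / (f * s)) - (s2 phi psi / (f * s)) * (s / f * xj)
    + ((s / f * yi) * (s1 phj psj / (f * s)) - (s1 phi psi / (f * s)) * (s / f * yj)).
Proof. by rewrite /s1 /s2 /df /q; field; rewrite f0 s0. Qed.

End ToricAlgebra.

Section ToricMetric.
Variable R : realType.
Local Notation V := 'rV[R]_4.

Lemma gram_pos (E : 'M[R]_4) (w : V) : E \in unitmx -> w != 0 ->
  0 < (w *m (E *m E^T) *m w^T) 0 0.
Proof.
move=> uE w0; have -> : w *m (E *m E^T) *m w^T = (w *m E) *m (w *m E)^T.
  by rewrite trmx_mul !mulmxA.
have u0 : w *m E != 0.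
  by apply: contra_neq w0 => H; apply: (can_inj (mulmxK uE)); rewrite H mul0mx.
rewrite mxE; under eq_bigr => i _ do rewrite [(w *m E)^T _ _]mxE -expr2.
rewrite lt0r sumr_ge0 ?andbT => [|i _]; last exact: sqr_ge0.
apply: contra u0; rewrite psumr_eq0 => [/allP H|i _]; last exact: sqr_ge0.
apply/eqP/rowP => i; rewrite [RHS]mxE; apply/eqP; rewrite -sqrf_eq0.
by apply: H; rewrite mem_index_enum.
Qed.

(** All data are pulled back to R^4: [td_phi] and [td_psi] are the components of the two closed
    angle forms, [td_p] is f_x and [td_k] is f_y / y, which unlike 1 / y has a smooth extension to
    the edges. *)
Record toric_data := ToricData {
  td_x : V -> R; td_y : V -> R; td_phi : 'I_4 -> V -> R; td_psi : 'I_4 -> V -> R;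
  td_f : V -> R; td_p : V -> R; td_k : V -> R }.

Variables (U : set V) (d : toric_data).
Let x := td_x d. Let y := td_y d. Let phi := td_phi d. Let psi := td_psi d.
Let f := td_f d. Let p := td_p d. Let k := td_k d.

Definition td_V v := p v ^+ 2 + y v ^+ 2 * k v ^+ 2 - f v * k v.

Definition td_s1 i v := (f v - y v * (y v * k v) - x v * p v) * phi i v - p v * psi i v.
Definition td_s2 i v := y v * ((x v * k v - p v) * phi i v + k v * psi i v).

Definition td_metric v : 'M[R]_4 := \matrix_(i, j)
  ((td_V v * (partial i x v * partial j x v + partial i y v * partial j y v)
   + (td_s1 i v * td_s1 j v + td_s2 i v * td_s2 j v) / td_V v) / f v ^+ 2).

Definition td_coframe v : 'M[R]_4 := \matrix_(i, j)
  match val j with 0 => partial i x v | 1 => partial i y v | 2 => phi i v | _ => psi i v end.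

(** [td_ddf] is the eigenfunction equation in chain-rule form: the four numbers are the second
    derivatives of [f] in the half plane, and the trace condition is f_xx + f_yy = f_y / y. *)
Record toric_axioms : Prop := ToricAxioms {
  td_smooth : forall n, [/\ Ck n U x, Ck n U y, Ck n U f, Ck n U p & Ck n U k];
  td_smooth_forms : forall n i, Ck n U (phi i) /\ Ck n U (psi i);
  td_closed : forall i j v, U v -> partial i (phi j) v = partial j (phi i) v /\
     partial i (psi j) v = partial j (psi i) v;
  td_pos : forall v, U v -> [/\ 0 < y v, 0 < f v & 0 < td_V v];
  td_df : forall i v, U v -> partial i f v = p v * partial i x v + y v * k v * partial i y v;
  td_ddf : forall v, U v -> exists p1 p2 q1 q2 : R, p1 + q2 = k v /\
     forall i, partial i p v = p1 * partial i x v + p2 * partial i y v /\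
       partial i (fun u => y u * k u) v = q1 * partial i x v + q2 * partial i y v;
  td_indep : forall v, U v -> td_coframe v \in unitmx
}.

Hypothesis oU : open U.
Hypothesis ax : toric_axioms.

Definition td_frame v : 'M[R]_4 := \matrix_(i, j)
  match val j with
  | 0 => Num.sqrt (td_V v) / f v * partial i x v
  | 1 => Num.sqrt (td_V v) / f v * partial i y v
  | 2 => td_s1 i v / (f v * Num.sqrt (td_V v))
  | _ => td_s2 i v / (f v * Num.sqrt (td_V v))
  end.

(** The connection forms (f_y dx - f_x dy) / f, (psi + x phi) / f and y phi / f. They contain no
    square root of [V], in contrast to the frame. *)
Definition td_conn (a : 'I_3) (i : 'I_4) : V -> R :=
  match val a with
  | 0 => fun v => (y v * k v * partial i x v - p v * partial i y v) / f v
  | 1 => fun v => (psi i v + x v * phi i v) / f v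
  | _ => fun v => y v * phi i v / f v
  end.

Let Cx n : Ck n U x. Proof. by have [] := td_smooth ax n. Qed.
Let Cy n : Ck n U y. Proof. by have [] := td_smooth ax n. Qed.
Let Cf n : Ck n U f. Proof. by have [] := td_smooth ax n. Qed.
Let Cp n : Ck n U p. Proof. by have [] := td_smooth ax n. Qed.
Let Ckk n : Ck n U k. Proof. by have [] := td_smooth ax n. Qed.
Let Cphi n i : Ck n U (phi i). Proof. by have [] := td_smooth_forms ax n i. Qed.
Let Cpsi n i : Ck n U (psi i). Proof. by have [] := td_smooth_forms ax n i. Qed.
Let f_neq0 v : U v -> f v != 0. Proof. by move=> /(td_pos ax)[_ f0 _]; rewrite gt_eqF. Qed.

Lemma Ck_div n g h : Ck n U g -> Ck n U h -> (forall v, U v -> h v != 0) ->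
  Ck n U (fun v => g v / h v).
Proof. by move=> Cg Ch h0; apply: Ck_mul => //; exact: Ck_inv. Qed.

Lemma Ck_td_V n : Ck n U td_V.
Proof.
apply: Ck_sub_fun => //; last exact: Ck_mul.
by apply: Ck_add => //; [exact: Ck_exp|apply: Ck_mul => //; exact: Ck_exp].
Qed.

Lemma Ck_td_s1 n i : Ck n U (td_s1 i).
Proof.
apply: Ck_sub_fun => //; apply: Ck_mul => //.
apply: Ck_sub_fun => //; last exact: Ck_mul.
by apply: Ck_sub_fun => //; apply: Ck_mul => //; exact: Ck_mul.
Qed.

Lemma Ck_td_s2 n i : Ck n U (td_s2 i).
Proof.
apply: Ck_mul => //; apply: Ck_add => //; apply: Ck_mul => //.
by apply: Ck_sub_fun => //; exact: Ck_mul.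
Qed.

Lemma Ck_td_metric n i j : Ck n U (fun v => td_metric v i j).
Proof.
have V0 v : U v -> td_V v != 0 by move=> /(td_pos ax)[_ _ V0]; rewrite gt_eqF.
have D h a : Ck n.+1 U h -> Ck n U (partial a h) by exact: Ck_partial.
have CV := Ck_td_V n; have C1 := Ck_td_s1 n; have C2 := Ck_td_s2 n.
have Dx a : Ck n U (partial a x) by exact: D.
have Dy a : Ck n U (partial a y) by exact: D.
have : Ck n U (fun v => (td_V v * (partial i x v * partial j x v + partial i y v * partial j y v)
   + (td_s1 i v * td_s1 j v + td_s2 i v * td_s2 j v) / td_V v) / f v ^+ 2).
  apply: Ck_div; last by move=> v Uv; rewrite expf_neq0 // f_neq0.
  - apply: Ck_add => //; first apply: Ck_mul => //.
      by apply: Ck_add => //; exact: Ck_mul.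
    by apply: Ck_div => //; apply: Ck_add => //; exact: Ck_mul.
  - exact: Ck_exp.
by apply: Ck_ext => // v _; rewrite mxE.
Qed.

Lemma td_frame_gram v : U v -> td_metric v = td_frame v *m (td_frame v)^T.
Proof.
move=> Uv; have [y0 f0 V0] := td_pos ax Uv.
have s0 : Num.sqrt (td_V v) != 0 by rewrite sqrtr_eq0 -ltNge.
have Vs : Num.sqrt (td_V v) ^+ 2 = td_V v by rewrite sqr_sqrtr // ltW.
apply/matrixP => i j; rewrite !mxE sum4E !mxE /=.
rewrite -[in LHS]Vs; field; by rewrite s0 f_neq0.
Qed.

Lemma Ck_td_frame i j : Ck 1 U (fun v => td_frame v i j).
Proof.
have V0 v : U v -> 0 < td_V v by move=> /(td_pos ax)[].
have Cs : Ck 1 U (fun v => Num.sqrt (td_V v)) by apply: Ck_sqrt => //; exact: Ck_td_V.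
have Csf : Ck 1 U (fun v => Num.sqrt (td_V v) / f v) by apply: Ck_div.
have Dx a : Ck 1 U (partial a x) by exact: Ck_partial (Cx 2%N).
have Dy a : Ck 1 U (partial a y) by exact: Ck_partial (Cy 2%N).
have fs0 v : U v -> f v * Num.sqrt (td_V v) != 0.
  by move=> Uv; rewrite mulf_neq0 ?f_neq0 // sqrtr_eq0 -ltNge V0.
have Cfs : Ck 1 U (fun v => f v * Num.sqrt (td_V v)) by exact: Ck_mul.
have C1 := Ck_td_s1 1%N i; have C2 := Ck_td_s2 1%N i.
elim/ord4_ind: j.
- by apply: Ck_ext (Ck_mul oU Csf (Dx i)) => // v _; rewrite mxE.
- by apply: Ck_ext (Ck_mul oU Csf (Dy i)) => // v _; rewrite mxE.
- by apply: Ck_ext (Ck_div C1 Cfs fs0) => // v _; rewrite mxE.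
- by apply: Ck_ext (Ck_div C2 Cfs fs0) => // v _; rewrite mxE.
Qed.

Lemma Ck_td_conn n a i : Ck n U (td_conn a i).
Proof.
have Dx b : Ck n U (partial b x) by exact: Ck_partial (Cx n.+1).
have Dy b : Ck n U (partial b y) by exact: Ck_partial (Cy n.+1).
elim/ord3_ind: a; apply: Ck_div => //.
- by apply: Ck_sub_fun => //; apply: Ck_mul => //; exact: Ck_mul.
- by apply: Ck_add => //; exact: Ck_mul.
- exact: Ck_mul.
Qed.

(** The factor is the determinant of [T2], which expresses the frame in dx, dy, phi, psi. Its minus
    sign cancels the one in [weyl_minus_frame], so that the orientation of the final metric is that
    of the coframe. *)
Lemma td_frame_det v : U v ->
  \det (td_frame v) = - (y v * td_V v / f v ^+ 4) * \det (td_coframe v).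
Proof.
move=> Uv; have [y0 f0 V0] := td_pos ax Uv.
have s0 : Num.sqrt (td_V v) != 0 by rewrite sqrtr_eq0 -ltNge.
have Vs : Num.sqrt (td_V v) ^+ 2 = td_V v by rewrite sqr_sqrtr // ltW.
pose T2 : 'M[R]_4 := \matrix_(i, j) match val j with
  | 0 => match val i with 0 => Num.sqrt (td_V v) / f v | _ => 0 end
  | 1 => match val i with 1 => Num.sqrt (td_V v) / f v | _ => 0 end
  | 2 => match val i with 2 => (f v - y v * (y v * k v) - x v * p v) / (f v * Num.sqrt (td_V v))
           | 3 => - p v / (f v * Num.sqrt (td_V v)) | _ => 0 end
  | _ => match val i with 2 => y v * (x v * k v - p v) / (f v * Num.sqrt (td_V v))
           | 3 => y v * k v / (f v * Num.sqrt (td_V v)) | _ => 0 end end.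
have -> : td_frame v = td_coframe v *m T2.
  apply/matrixP => i; elim/ord4_ind; rewrite !mxE sum4E !mxE /= /td_s1 /td_s2;
  by field; rewrite ?s0 ?f_neq0.
rewrite det_mulmx mulrC; congr (_ * _); rewrite det4E !mxE /=.
rewrite /td_V; rewrite /td_V in s0; move: (Num.sqrt _) s0 => s s0.
field; by rewrite s0 f_neq0.
Qed.

Lemma td_frame_unit v : U v -> td_frame v \in unitmx.
Proof.
move=> Uv; have [y0 f0 V0] := td_pos ax Uv.
rewrite unitmxE unitfE td_frame_det // mulf_neq0 //.
  by rewrite oppr_eq0 mulf_neq0 ?invr_eq0 ?expf_neq0 ?f_neq0 // mulf_neq0 ?gt_eqF.
by rewrite -unitfE -unitmxE (td_indep ax).
Qed.

Lemma td_frame_sg v : U v -> Num.sg (\det (td_frame v)) = - Num.sg (\det (td_coframe v)).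
Proof.
move=> Uv; have [y0 f0 V0] := td_pos ax Uv.
rewrite td_frame_det // sgrM sgrN gtr0_sg ?mulN1r //.
by rewrite divr_gt0 ?exprn_gt0 // mulr_gt0.
Qed.

Lemma td_curv a v : U v ->
  curv td_conn a v = td_frame v *m sq R a *m (td_frame v)^T.
Proof.
move=> Uv; have [y0 f0 V0] := td_pos ax Uv.
have s0 : Num.sqrt (td_V v) != 0 by rewrite sqrtr_eq0 -ltNge.
have Vs : Num.sqrt (td_V v) ^+ 2 = td_V v by rewrite sqr_sqrtr // ltW.
have [p1 [p2 [q1 [q2 [lap H]]]]] := td_ddf ax Uv.
have Hp i := (H i).1; have Hq i := (H i).2; have Hf i := td_df ax i Uv.
have Dx b : Ck 1 U (partial b x) by exact: Ck_partial (Cx 2%N).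
have Dy b : Ck 1 U (partial b y) by exact: Ck_partial (Cy 2%N).
have Cq : Ck 1 U (fun u => y u * k u) by exact: Ck_mul.
have C0 i : Ck 1 U (fun v => y v * k v * partial i x v - p v * partial i y v).
  by apply: Ck_sub_fun => //; apply: Ck_mul.
have C1 i : Ck 1 U (fun v => psi i v + x v * phi i v).
  by apply: Ck_add => //; apply: Ck_mul.
have C2 i : Ck 1 U (fun v => y v * phi i v) by apply: Ck_mul.
have Cqx i : Ck 1 U (fun v => y v * k v * partial i x v) by exact: Ck_mul.
have Cpy i : Ck 1 U (fun v => p v * partial i y v) by exact: Ck_mul.
have Cxp i : Ck 1 U (fun v => x v * phi i v) by exact: Ck_mul.
have sw i j : partial i (partial j x) v = partial j (partial i x) v.
  exact: (schwarz oU i j Uv (Cx 2%N)).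
have swy i j : partial i (partial j y) v = partial j (partial i y) v.
  exact: (schwarz oU i j Uv (Cy 2%N)).
have clp i j : partial i (phi j) v = partial j (phi i) v by have [] := td_closed ax i j Uv.
have cls i j : partial i (psi j) v = partial j (psi i) v by have [] := td_closed ax i j Uv.
have frE i j : (td_frame v *m sq R a *m (td_frame v)^T) i j =
   let e := td_frame v in
   match val a with
   | 0 => e i o0 * e j o1 - e i o1 * e j o0 + e i o2 * e j o3 - e i o3 * e j o2
   | 1 => e i o0 * e j o2 - e i o2 * e j o0 - (e i o1 * e j o3 - e i o3 * e j o1)
   | _ => e i o0 * e j o3 - e i o3 * e j o0 + (e i o1 * e j o2 - e i o2 * e j o1)
   end.
  move: (td_frame v) => e.
  by elim/ord3_ind: a; rewrite !mxE sum4E !mxE !sum4E !mxE /=; ring.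
have fn := fun u => @f_neq0 u.
have N0 i j : partial i (fun v => y v * k v * partial j x v - p v * partial j y v) v =
   (q1 * partial i x v + q2 * partial i y v) * partial j x v
   + y v * k v * partial i (partial j x) v -
   ((p1 * partial i x v + p2 * partial i y v) * partial j y v
   + p v * partial i (partial j y) v).
  rewrite (partial_subE oU i Uv (Cqx j) (Cpy j)) (partial_mulE i Uv Cq (Dx j)).
  by rewrite (partial_mulE i Uv (Cp 1%N) (Dy j)) Hq Hp.
have N1 i j : partial i (fun v => psi j v + x v * phi j v) v =
   partial i (psi j) v + (partial i x v * phi j v + x v * partial i (phi j) v).
  rewrite (partial_addE i Uv (Cpsi 1%N j) (Cxp j)).
  by rewrite (partial_mulE i Uv (Cx 1%N) (Cphi 1%N j)).
have N2 i j : partial i (fun v => y v * phi j v) v =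
   partial i y v * phi j v + y v * partial i (phi j) v.
  by rewrite (partial_mulE i Uv (Cy 1%N) (Cphi 1%N j)).
have Q (g : 'I_4 -> V -> R) i j : Ck 1 U (g j) -> partial i (fun v => g j v / f v) v =
   (partial i (g j) v * f v - g j v * (p v * partial i x v + y v * k v * partial i y v)) / f v ^+ 2.
  by move=> Cg; rewrite (partial_divE oU i Uv Cg (Cf 1%N) fn) Hf.
have f1 := f_neq0 Uv.
apply/matrixP => i j; rewrite frE {frE} mxE; elim/ord3_ind: a.
- rewrite /td_conn /=.
  rewrite (Q (fun j v => y v * k v * partial j x v - p v * partial j y v) i j (C0 j)).
  rewrite (Q (fun j v => y v * k v * partial j x v - p v * partial j y v) j i (C0 i)).
  rewrite !N0 (sw j i) (swy j i) ![td_frame _ _ _]mxE /=.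
  have Vs' : Num.sqrt (td_V v) ^+ 2 = p v ^+ 2 + y v ^+ 2 * k v ^+ 2 - f v * k v := Vs.
  exact: (@curv_algebra0 R (x v) (y v) (f v) (p v) (k v) (Num.sqrt (td_V v)) p1 p2 q1 q2 f1 s0 Vs' lap).
- rewrite /td_conn /=.
  rewrite (Q (fun j v => psi j v + x v * phi j v) i j (C1 j)).
  rewrite (Q (fun j v => psi j v + x v * phi j v) j i (C1 i)).
  rewrite !N1 (clp j i) (cls j i) ![td_frame _ _ _]mxE /=.
  exact: (@curv_algebra1 R (x v) (y v) (f v) (p v) (k v) (Num.sqrt (td_V v)) f1 s0).
- rewrite /td_conn /=.
  rewrite (Q (fun j v => y v * phi j v) i j (C2 j)).
  rewrite (Q (fun j v => y v * phi j v) j i (C2 i)).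
  rewrite !N2 (clp j i) ![td_frame _ _ _]mxE /=.
  exact: (@curv_algebra2 R (x v) (y v) (f v) (p v) (k v) (Num.sqrt (td_V v)) f1 s0).
Qed.

Theorem toric_self_dual_einstein v : U v ->
  [/\ ricci td_metric v = (- 3) *: td_metric v, scal td_metric v = - 12 &
    forall l k, weyl_minus (Num.sg (\det (td_coframe v))) td_metric l k v = 0].
Proof.
move=> Uv; split.
- exact: (ricci_frame oU Ck_td_metric Ck_td_frame Ck_td_conn td_frame_unit td_frame_gram td_curv Uv).
- exact: (scal_frame oU Ck_td_metric Ck_td_frame Ck_td_conn td_frame_unit td_frame_gram td_curv Uv).
- move=> l m; rewrite -[Num.sg _]opprK -td_frame_sg //.
  exact: (weyl_minus_frame oU Ck_td_metric Ck_td_frame Ck_td_conn td_frame_unit td_frame_gram td_curv Uv).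
Qed.

Lemma td_metric_pos v (w : V) : U v -> w != 0 -> 0 < (w *m td_metric v *m w^T) 0 0.
Proof.
by move=> Uv w0; rewrite td_frame_gram // gram_pos // td_frame_unit.
Qed.

End ToricMetric.

(** * Continued fractions *)

Section ContinuedFraction.
Variable e : nat -> int.

(** Denominators (initial values 0, 1) and numerators (initial values -1, 0) of the convergents obey
    the same recursion. *)
Fixpoint cf_seq (a b : int) (j : nat) : int :=
  match j with
  | 0 => a
  | k.+1 => if k is l.+1 then e k * cf_seq a b k - cf_seq a b l else b
  end.

Lemma cf_seqSS a b j : cf_seq a b j.+2 = e j.+1 * cf_seq a b j.+1 - cf_seq a b j.
Proof. by []. Qed.

Hypothesis e3 : forall j, (1 <= j)%N -> 3 <= e j.

Let M := cf_seq 0 1.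
Let N := cf_seq (-1) 0.

Lemma cf_den_growth j : 0 <= M j /\ 1 <= M j.+1 - M j.
Proof.
elim: j => [|j [M0 D0]]; first by rewrite /M /=.
have e1 := e3 (ltn0Sn j); rewrite /M cf_seqSS -/M; split; [lia|nia].
Qed.

Lemma cf_det j : M j * N j.+1 - M j.+1 * N j = 1.
Proof.
elim: j => [|j IH]; first by rewrite /M /N /=; ring.
rewrite -[RHS]IH /M /N !cf_seqSS; ring.
Qed.

(** The innermost 0 is generalised to a tail [r], on which the continued fraction acts as a Moebius
    map. The induction absorbs the last e_k into the tail, and e_k >= 3 keeps the tail in [0, 1). *)
Lemma cfracE k (r : rat) : 0 <= r < 1 ->
  foldr (fun c r => (c%:~R - r)^-1) r [seq e i | i <- iota 1 k] =
  ((N k.+1)%:~R - r * (N k)%:~R) / ((M k.+1)%:~R - r * (M k)%:~R).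
Proof.
elim: k r => [|k IH] r /andP[r0 r1].
  by rewrite /M /N /=; field.
have e1 : 3 <= (e k.+1)%:~R :> rat by rewrite (ler_int _ 3%:Z) e3.
rewrite -[in X in iota _ X]addn1 iotaD add1n map_cat foldr_cat /= IH; last first.
  by rewrite invr_ge0 invf_lt1; lra.
have [M0 D0] := cf_den_growth k.
have M0' : 0 <= (M k)%:~R :> rat by rewrite ler0z.
have D0' : 1 <= (M k.+1)%:~R - (M k)%:~R :> rat by rewrite -intrB (ler_int _ 1%:Z).
have -> : N k.+2 = e k.+1 * N k.+1 - N k by [].
have -> : M k.+2 = e k.+1 * M k.+1 - M k by [].
rewrite !intrB !intrM.
field; apply/andP; split; last by lra.
by rewrite gt_eqF //; nra.
Qed.

(** Determinant 1 makes the fraction from the recursion reduced, so [numq] and [denq] return its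
    terms. *)
Lemma mnE j : mn e j = (M j, N j).
Proof.
case: j => [//|[//|j]].
have -> : mn e j.+2 = (denq (cfrac e j.+1), numq (cfrac e j.+1)) by [].
rewrite /cfrac cfracE; last by [].
rewrite !mul0r !subr0.
have [M0 D0] := cf_den_growth j.+1.
have Mp : 0 < M j.+2 by lia.
have cop : coprime `|N j.+2| `|M j.+2|.
  apply/coprimezP; exists (M j.+1, - N j.+1); have := cf_det j.+1; rewrite /=; lia.
rewrite coprimeq_num // coprimeq_den // gt_eqF // gtr0_sg // mul1r.
by rewrite gtr0_norm.
Qed.

End ContinuedFraction.

Section Corners.
Variables (R : realType) (alpha : R) (e : nat -> int).
Hypothesis cf : has_modified_cf alpha e.
Hypothesis e3 : forall j, (1 <= j)%N -> 3 <= e j.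

Definition mden j : R := (mn e j).1%:~R.
Definition nnum j : R := (mn e j).2%:~R.
(** The slopes of the linear functions on the two edges at a_j differ by 2 w_j, which is the jump of
    slope of w_j |x - a_j|. *)
Definition wt j : R := (mden j.+1 - mden j) / 2.
Local Notation a := (corner R e).
Local Notation m := mden.
Local Notation n := nnum.

Lemma mden0 : m 0 = 0. Proof. by rewrite /m. Qed.
Lemma nnum0 : n 0 = -1. Proof. by rewrite /n. Qed.

Lemma mden_rec j : m j.+2 = (e j.+1)%:~R * m j.+1 - m j.
Proof. by rewrite /m !mnE // -intrM -intrB. Qed.

Lemma nnum_rec j : n j.+2 = (e j.+1)%:~R * n j.+1 - n j.
Proof. by rewrite /n !mnE // -intrM -intrB. Qed.

Lemma mn_det j : m j * n j.+1 - m j.+1 * n j = 1.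
Proof. by rewrite /m /n !mnE // -!intrM -intrB cf_det. Qed.

Lemma mden_ge0 j : 0 <= m j.
Proof. by rewrite /m mnE // ler0z; have [] := cf_den_growth e3 j. Qed.

Lemma mden_growth j : 1 <= m j.+1 - m j.
Proof. by rewrite /m !mnE // -intrB (ler_int _ 1%:Z); have [] := cf_den_growth e3 j. Qed.

Lemma mden_ge j : j%:R <= m j.
Proof.
elim: j => [|j IH]; first by rewrite mden0.
by have := mden_growth j; rewrite -natr1; lra.
Qed.

Lemma wt_gt0 j : 0 < wt j.
Proof. by have := mden_growth j; rewrite /wt; lra. Qed.

Lemma mden_wt j : m j.+1 - m j = 2 * wt j.
Proof. by rewrite /wt; lra. Qed.

Lemma corner_eq j : 2 * wt j * a j = n j.+1 - n j.
Proof.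
rewrite /corner !intrB -/(m j) -/(m j.+1) -/(n j) -/(n j.+1) mden_wt mulrC divfK //.
by rewrite gt_eqF // mulr_gt0 // wt_gt0.
Qed.

(** The distance of consecutive corners comes from the determinant relation; since e_j >= 3 it is
    positive, and the corners decrease. *)
Lemma corner_step j : (a j - a j.+1) * (4 * wt j * wt j.+1) = (e j.+1)%:~R - 2.
Proof.
have c0 := corner_eq j; have c1 := corner_eq j.+1; have d := mn_det j.
have w0 := mden_wt j; have w1 := mden_wt j.+1.
rewrite nnum_rec in c1; rewrite mden_rec in w1.
have -> : (a j - a j.+1) * (4 * wt j * wt j.+1) =
  (2 * wt j * a j) * (2 * wt j.+1) - (2 * wt j.+1 * a j.+1) * (2 * wt j) by ring.
rewrite c0 c1 -w0 -w1; set E := (e j.+1)%:~R.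
transitivity ((E - 2) * (m j * n j.+1 - m j.+1 * n j)); first by ring.
by rewrite d mulr1.
Qed.

Lemma corner_decr j : a j.+1 < a j.
Proof.
have := corner_step j; have w0 := wt_gt0 j; have w1 := wt_gt0 j.+1.
have : 3 <= (e j.+1)%:~R :> R by rewrite (ler_int _ 3%:Z) e3.
move: (e j.+1)%:~R => E E3 H.
have ww : 0 < 4 * wt j * wt j.+1 by nra.
by rewrite -subr_gt0 -(pmulr_lgt0 (a j - a j.+1) ww) H; lra.
Qed.

Lemma corner_decreasing i j : (i < j)%N -> a j < a i.
Proof.
elim: j => // j IH; rewrite ltnS leq_eqVlt => /orP[/eqP->|/IH]; first exact: corner_decr.
by apply: lt_trans; exact: corner_decr.
Qed.

Lemma corner_noninc i j : (i <= j)%N -> a j <= a i.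
Proof. by rewrite leq_eqVlt => /orP[/eqP->|/corner_decreasing/ltW]. Qed.

Lemma convergent_cvg : (fun k => n k.+1 / m k.+1) @ \oo --> alpha.
Proof.
suff -> : (fun k => n k.+1 / m k.+1) = (fun k => ratr (cfrac e k)) by exact: cf.
apply/funext => k; rewrite /n /m mnE //= /cfrac cfracE; last by [].
by rewrite !mul0r !subr0 fmorph_div /= !ratr_int.
exact: e3.
Qed.

Lemma corner_convergent k : a k.+1 = n k.+1 / m k.+1 + (2 * wt k.+1 * m k.+1)^-1.
Proof.
have m0 : 0 < m k.+1 by have := mden_growth k; have := mden_ge0 k; lra.
have w0 := wt_gt0 k.+1; have c := corner_eq k.+1; have d := mn_det k.+1.
have w := mden_wt k.+1.
have -> : a k.+1 = (n k.+2 - n k.+1) / (2 * wt k.+1).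
  by rewrite -c; field; rewrite gt_eqF.
rewrite -w -[X in _ = _ + X]mul1r -d; field; rewrite w !gt_eqF //.
by rewrite mulr_gt0.
Qed.

Lemma corner_cvg : a @ \oo --> alpha.
Proof.
rewrite -cvg_shiftS /=.
have -> : (fun k => a k.+1) = (fun k => n k.+1 / m k.+1 + (2 * wt k.+1 * m k.+1)^-1).
  by apply/funext => k; rewrite corner_convergent.
suff H : (fun k => n k.+1 / m k.+1 + (2 * wt k.+1 * m k.+1)^-1) @ \oo --> alpha + 0.
  by rewrite addr0 in H.
apply: cvgD; first exact: convergent_cvg.
apply: (@squeeze_cvgr _ _ _ _ (fun=> 0) (fun k => k.+1%:R^-1)); last 2 first.
- exact: cvg_cst.
- exact: cvg_harmonic.
apply: nearW => k; have := mden_ge k.+1; have := mden_growth k.+1; rewrite mden_wt => w0 m0.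
have k0 : 0 < k.+1%:R :> R by rewrite ltr0n.
rewrite invr_ge0; apply/andP; split; first by nra.
by rewrite lef_pV2 ?posrE //; nra.
Qed.

Lemma corner_gt j : alpha < a j.
Proof.
apply: le_lt_trans (corner_decr j).
have ni : nonincreasing_seq a by move=> i k /corner_noninc.
have cv : cvgn a by apply/cvg_ex; exists alpha; exact: corner_cvg.
by have := nonincreasing_cvgn_ge ni cv j.+1; rewrite (cvg_lim _ corner_cvg).
Qed.

(** The value at [alpha] of the linear function m_j x - n_j belonging to edge j. *)
Definition gap j := m j * alpha - n j.

Lemma gap0 : gap 0 = 1.
Proof. by rewrite /gap mden0 nnum0; ring. Qed.

Lemma gap_step j : gap j - gap j.+1 = 2 * wt j * (a j - alpha).
Proof.
by rewrite mulrBr corner_eq -mden_wt /gap; ring.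
Qed.

Lemma gap_decr j : gap j.+1 < gap j.
Proof.
have := wt_gt0 j; have := corner_gt j; have := gap_step j; nra.
Qed.

(** The product is 1 minus [m j] times the decrease of the gap. With the growth of the weights it
    forces the gaps to 0. *)
Lemma gap_bound j : gap j * (2 * wt j) <= 1.
Proof.
have -> : gap j * (2 * wt j) = 1 - m j * (2 * wt j * (a j - alpha)).
  rewrite -gap_step; move: (mden_wt j) (mn_det j); rewrite /gap => <- d.
  rewrite -[X in _ = X - _]d; ring.
by rewrite gerBl mulr_ge0 ?mden_ge0 // -gap_step subr_ge0 ltW ?gap_decr.
Qed.

Lemma wt_ge j : j%:R + 1 <= 2 * wt j.
Proof.
elim: j => [|j IH]; first by rewrite -mden_wt mden0 /m /=; lra.
have := mden_ge j.+1; have := mden_wt j; have := mden_wt j.+1; rewrite mden_rec.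
have : 3 <= (e j.+1)%:~R :> R by rewrite (ler_int _ 3%:Z) e3.
have : 0 <= j%:R :> R by []. 
rewrite -natr1; nra.
Qed.

(** By the determinant relation the convergents n_j / m_j increase, and their limit is [alpha]. *)
Lemma gap_gt0 j : 0 < gap j.
Proof.
apply: le_lt_trans (gap_decr j).
have nd : nondecreasing_seq (fun k => n k.+1 / m k.+1).
  apply/nondecreasing_seqP => k; have := mn_det k.+1.
  have m1 : 0 < m k.+1 by have := mden_growth k; have := mden_ge0 k; lra.
  have m2 : 0 < m k.+2 by have := mden_growth k.+1; have := mden_ge0 k; lra.
  by rewrite ler_pdivrMr // mulrAC ler_pdivlMr //; lra.
have cv : cvgn (fun k => n k.+1 / m k.+1) by apply/cvg_ex; exists alpha; exact: convergent_cvg.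
have := nondecreasing_cvgn_le nd cv j; rewrite (cvg_lim _ convergent_cvg) //.
have m1 : 0 < m j.+1 by have := mden_growth j; have := mden_ge0 j; lra.
by rewrite ler_pdivrMr // /gap; lra.
Qed.

Lemma gap_cvg : gap @ \oo --> (0 : R).
Proof.
apply: (@squeeze_cvgr _ _ _ _ (fun=> 0) (fun k => k.+1%:R^-1)); last 2 first.
- exact: cvg_cst.
- exact: cvg_harmonic.
apply: nearW => k; rewrite ltW ?gap_gt0 //=.
have := gap_bound k; have := wt_ge k; have := gap_gt0 k; rewrite natr1.
move=> g0 w1 gw; rewrite -[_^-1]mul1r ler_pdivlMr ?ltr0n //; nra.
Qed.

(** This telescoping sum gives both the convergence of the series for [f] and its value on the
    axis. *)
Lemma sum_gap J : \sum_(i < J) (2 * wt i * (a i - alpha)) = 1 - gap J.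
Proof.
elim: J => [|J IH]; first by rewrite big_ord0 gap0 subrr.
by rewrite big_ord_recr /= IH -gap_step; ring.
Qed.

Lemma sum_wt J : \sum_(i < J) (2 * wt i) = m J.
Proof.
elim: J => [|J IH]; first by rewrite big_ord0 mden0.
by rewrite big_ord_recr /= IH -mden_wt; ring.
Qed.

End Corners.

(** * Series of smooth functions *)

Section Summable.
Variable R : realType.

Definition bsummable (M : nat -> R) :=
  (forall i, 0 <= M i) /\ exists B, forall n, \sum_(0 <= i < n) M i <= B.

Lemma bsummable_cvg M : bsummable M -> cvgn (series M).
Proof.
move=> [M0 [B HB]]; apply: nondecreasing_is_cvgn.
  by apply/nondecreasing_seqP => n; rewrite /series /= big_nat_recr //= lerDl.
by exists B => _ [n _ <-]; exact: HB.
Qed.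

Lemma bsummable_dominated M (a : nat -> R) : bsummable M -> (forall i, `|a i| <= M i) ->
  cvgn (series a) /\ `|limn (series a)| <= limn (series M).
Proof.
move=> sM aM; have cM := bsummable_cvg sM.
have ca : cvgn [normed series a] by exact: series_le_cvg _ sM.1 aM cM.
split; first exact: normed_cvg.
by apply: le_trans (lim_series_norm ca) _; exact: lim_series_le.
Qed.

Lemma bsummableD M M' : bsummable M -> bsummable M' -> bsummable (fun i => M i + M' i).
Proof.
move=> [M0 [B HB]] [M0' [B' HB']]; split=> [i|]; first by rewrite addr_ge0.
by exists (B + B') => n; rewrite big_split /= lerD.
Qed.

Lemma bsummableZ c M : 0 <= c -> bsummable M -> bsummable (fun i => c * M i).
Proof.
move=> c0 [M0 [B HB]]; split=> [i|]; first by rewrite mulr_ge0.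
by exists (c * B) => n; rewrite -mulr_sumr ler_wpM2l.
Qed.

Lemma bsummable_finite J M : (forall i, 0 <= M i) ->
  bsummable (fun i => if (i < J)%N then M i else 0).
Proof.
move=> M0; split=> [i|]; first by case: ifP.
exists (\sum_(0 <= i < J) M i) => n; rewrite -big_mkcond /=.
rewrite [leLHS]big_mkcond /= !big_mkord.
have -> : \sum_(i < J) M i = \sum_(i < J + n) (if (i < J)%N then M i else 0).
  by rewrite -big_mkcond (big_ord_widen_cond _ xpredT M (leq_addr n J)).
rewrite addnC big_split_ord /= lerDl sumr_ge0 // => i _; by case: ifP.
Qed.

End Summable.

Section FunctionSeries.
Variable R : realType.
Local Notation V := 'rV[R]_4.
Local Notation base i := (delta_mx 0 i : V).

(** A remainder of second order proves differentiability without an exchange of limits. *)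
Lemma is_derive_quadratic (F : V -> R) (v w : V) (D r B : R) : 0 < r -> 0 <= B ->
  (forall h, `|h| <= r -> `|F (h *: w + v) - F v - h * D| <= h ^+ 2 * B) ->
  is_derive v w F D.
Proof.
move=> r0 B0 H.
have C : h^-1 *: ((F \o shift v) (h *: w) - F v) @[h --> 0^'] --> D.
  apply/cvgrPdist_le => eps e0.
  near=> h.
  have h0 : h != 0 by near: h; exact: nbhs_dnbhs_neq.
  have hr : `|h| <= r by near: h; apply: dnbhs0_le.
  have he : `|h| <= eps / (B + 1) by near: h; apply: dnbhs0_le; rewrite divr_gt0 //; lra.
  rewrite distrC /=.
  have -> : h^-1 *: (F (h *: w + v) - F v) - D = h^-1 * (F (h *: w + v) - F v - h * D).
    by rewrite [in RHS]mulrBr mulrA mulVf // mul1r.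
  rewrite normrM normfV ler_pdivrMl ?normr_gt0 //; apply: le_trans (H h hr) _.
  rewrite -[h ^+ 2]real_normK ?num_real //; have := normr_ge0 h.
  rewrite ler_pdivlMr in he; last by lra.
  by move: he; move: `|h| => t; nra.
split; last exact: cvg_lim C.
by apply/cvg_ex; exists D.
Unshelve. all: by end_near. Qed.

Lemma near_dist (v : V) (r : R) : 0 < r -> \forall u \near v, `|u - v| <= r.
Proof.
by move=> r0; apply/nbhs_ballP; exists r => //= u; rewrite -ball_normE /= distrC; exact: ltW.
Qed.

Lemma near_bounded (f : V -> R) v : {for v, continuous f} ->
  \forall u \near v, `|f u| <= `|f v| + 1.
Proof.
move=> /cvgrPdist_le/(_ 1 ltr01); apply: filterS => u.
rewrite distrC => H; rewrite -lerBlDl; apply: le_trans H.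
exact: lerB_dist.
Qed.

Variable U : set V.
Hypothesis oU : open U.

Definition fsum (phi : nat -> V -> R) (v : V) : R := limn (series (fun i => phi i v)).

(** The hypothesis of the Weierstrass test, locally uniform: the majorant may depend on the
    point. *)
Definition dominated (phi : nat -> V -> R) := forall v, U v ->
  exists2 M, bsummable M & \forall u \near v, forall i, `|phi i u| <= M i.

Lemma dominated_ball phi v : U v -> dominated phi -> exists M r,
  [/\ bsummable M, 0 < r & forall u, `|u - v| <= r -> U u /\ forall i, `|phi i u| <= M i].
Proof.
move=> Uv /(_ v Uv)[M sM H].
have : \forall u \near v, U u /\ forall i, `|phi i u| <= M i.
  by apply: filterI => //; exact: open_nbhs_nbhs.
move=> /nbhs_ballP[r /= r0 Br]; exists M, (r / 2); split=> //; first by rewrite divr_gt0.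
move=> u uv; apply: Br; rewrite -ball_normE /= distrC.
by apply: le_lt_trans uv _; lra.
Qed.

Lemma fsum_cvg phi v : U v -> dominated phi -> cvgn (series (fun i => phi i v)).
Proof.
move=> Uv /(dominated_ball Uv)[M [r [sM r0 H]]].
have [_ Hv] : U v /\ forall i, `|phi i v| <= M i by apply: H; rewrite subrr normr0 ltW.
by have [] := bsummable_dominated sM Hv.
Qed.

(** Majorants of the first partial derivatives make the sum Lipschitz near each point. *)
Lemma fsum_cont phi : (forall i, Ck 1 U (phi i)) -> dominated phi ->
  (forall k, dominated (fun i => partial k (phi i))) -> Ck 0 U (fsum phi).
Proof.
move=> Cphi dphi ddphi; split=> // v Uv.
have /choice[M /choice[r HM]] k := dominated_ball Uv (ddphi k).
pose M' i := \sum_k M k i.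
have sM' : bsummable M'.
  have -> : M' = fun i => M o0 i + M o1 i + M o2 i + M o3 i by apply/funext => i; rewrite /M' sum4E.
  have s k : bsummable (M k) by have [] := HM k.
  exact: bsummableD (bsummableD (bsummableD (s o0) (s o1)) (s o2)) (s o3).
pose rho := Num.min (Num.min (r o0) (r o1)) (Num.min (r o2) (r o3)).
have rho0 : 0 < rho by rewrite !lt_min; have [_ -> _] := HM o0; have [_ -> _] := HM o1;
  have [_ -> _] := HM o2; have [_ -> _] := HM o3.
have rhor k : rho <= r k by elim/ord4_ind: k; rewrite !ge_min lexx ?orbT.
have inc w : `|w| <= rho -> `|fsum phi (v + w) - fsum phi v| <= `|w| * limn (series M').
  move=> wr; have Uw u : `|u - v| <= `|w| -> U u.
    move=> uw; have [_ _ H] := HM o0; have [] // := H u.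
    exact: le_trans uw (le_trans wr (rhor o0)).
  have Uvw : U (v + w) by apply: Uw; rewrite addrAC subrr add0r.
  have c1 := fsum_cvg Uv dphi; have c2 := fsum_cvg Uvw dphi.
  rewrite /fsum -(lim_seriesB c2 c1).
  have -> : `|w| * limn (series M') = limn (series (`|w| *: M')).
    by rewrite lim_seriesZ //; exact: bsummable_cvg.
  have sw : bsummable (`|w| *: M') by exact: (bsummableZ (normr_ge0 w) sM').
  apply: (bsummable_dominated sw _).2 => i.
  rewrite -[leLHS]/(`|phi i (v + w) - phi i v|) -[leRHS]/(`|w| * M' i).
  have [xi [xiw ->]] : exists xi : 'I_4 -> V, (forall k, `|xi k - v| <= `|w|) /\
    phi i (v + w) - phi i v = \sum_k w 0 k * partial k (phi i) (xi k).
    by apply: increment_partials => u uw k; exact: Ck_derivable (Cphi i) (Uw _ uw).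
  apply: le_trans (ler_norm_sum _ _ _) _; rewrite [leRHS]mulr_sumr; apply: ler_sum => k _.
  rewrite normrM ler_pM // ?coord_le_norm //.
  have [_ _ H] := HM k; have [] // := H (xi k).
  exact: le_trans (xiw k) (le_trans wr (rhor k)).
rewrite /prop_for /continuous_at.
have FF : Filter (nbhs v) by exact: nbhs_filter.
apply/(@cvgrPdist_le _ _ _ _ FF) => eps e0.
have L0 : 0 <= limn (series M').
  rewrite (le_trans (normr_ge0 (limn (series M')))) //.
  by apply: (bsummable_dominated sM' _).2 => i; rewrite ger0_norm // sM'.1.
set L := limn _ in L0 inc.
near=> u; rewrite distrC -[u in fsum phi u](subrK v) [u - v + v]addrC.
have uv : `|u - v| <= rho.
  by near: u; exact: near_dist.
have uv' : `|u - v| <= eps / (L + 1).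
  by near: u; apply: near_dist; rewrite divr_gt0 //; lra.
apply: le_trans (inc _ uv) _.
rewrite ler_pdivlMr in uv'; last by lra.
by have := normr_ge0 (u - v); nra.
Unshelve. all: by end_near. Qed.

(** A majorant of the second derivatives sums to the quadratic remainder that [is_derive_quadratic]
    asks for. *)
Lemma fsum_derive phi k v : U v -> (forall i, Ck 2 U (phi i)) -> dominated phi ->
  dominated (fun i => partial k (phi i)) ->
  dominated (fun i => partial k (partial k (phi i))) ->
  is_derive v (base k) (fsum phi) (fsum (fun i => partial k (phi i)) v).
Proof.
move=> Uv Cphi d0 d1 d2; have [M [r [sM r0 H]]] := dominated_ball Uv d2.
have L0 : 0 <= limn (series M).
  rewrite (le_trans (normr_ge0 (limn (series M)))) //.
  by apply: (bsummable_dominated sM _).2 => i; rewrite ger0_norm // sM.1.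
rewrite /fsum.
apply: (is_derive_quadratic r0 L0) => h hr.
have Uh t : 0 <= t <= 1 -> `|v + (t * h) *: base k - v| <= r.
  move=> /andP[t0 t1]; rewrite addrAC subrr add0r normrZ.
  apply: le_trans (ler_pM _ _ (lexx _) (norm_base R k)) _ => //; rewrite mulr1.
  by rewrite normrM ger0_norm //; have := normr_ge0 h; move: hr; move: `|h| => x; nra.
have Uvt t : 0 <= t <= 1 -> U (v + (t * h) *: base k) by move=> /Uh/H[].
have Uvh : U (h *: base k + v) by have := Uvt 1; rewrite mul1r addrC; apply; rewrite ler01 lexx.
have c1 := fsum_cvg Uv d0; have c2 := fsum_cvg Uvh d0; have c3 := fsum_cvg Uv d1.
rewrite /fsum -(lim_seriesB c2 c1).
have -> : h * limn (series (fun i => partial k (phi i) v)) =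
  limn (series (h *: (fun i => partial k (phi i) v))) by rewrite lim_seriesZ.
have c3' : cvgn (series (h *: ((fun i => partial k (phi i) v) : R^nat))).
  by exact: is_cvg_seriesZ.
have c12 := is_cvg_seriesB c2 c1.
rewrite -(lim_seriesB c12 c3').
have -> : h ^+ 2 * limn (series M) = limn (series (h ^+ 2 *: M)).
  by rewrite lim_seriesZ //; exact: bsummable_cvg.
have sw : bsummable (h ^+ 2 *: M) by exact: (bsummableZ (sqr_ge0 h) sM).
apply: (bsummable_dominated sw _).2 => i.
rewrite -[leLHS]/(`|phi i (h *: base k + v) - phi i v - h * partial k (phi i) v|).
rewrite -[leRHS]/(h ^+ 2 * M i).
have C1 := Ck_S (Cphi i); have C1' := Ck_partial k (Cphi i).
have [t t01|c c01 E] := @mvt_base R (phi i) v k h; first exact: Ck_derivable C1 (Uvt t t01).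
rewrite [h *: _ + v]addrC E -mulrBr.
have ct s : 0 <= s <= 1 -> 0 <= s * c <= 1 by move: c01 => /andP[? ?] /andP[? ?]; nra.
have [t t01|c' c01' E'] := @mvt_base R (partial k (phi i)) v k (c * h).
  by rewrite mulrA; exact: Ck_derivable C1' (Uvt _ (ct t t01)).
have XM : `|partial k (partial k (phi i)) (v + (c' * (c * h)) *: base k)| <= M i.
  by rewrite mulrA; apply: (H _ (Uh _ (ct c' c01'))).2.
rewrite E'; move: (partial k _ _) XM => X XM.
have -> : h * (c * h * X) = c * h ^+ 2 * X by ring.
have Mi0 := sM.1 i; move: c01 => /andP[c0 c1'].
have h2 := sqr_ge0 h.
have -> : `|c * h ^+ 2 * X| = h ^+ 2 * (c * `|X|).
  by rewrite normrM (ger0_norm (mulr_ge0 c0 h2)); ring.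
rewrite ler_wpM2l //.
by apply: le_trans XM; rewrite ler_piMl.
Qed.

(** Domination of all iterated partial derivatives passes from a series to the series of its partial
    derivatives, which is what the induction on the order consumes. *)
Lemma fsum_smooth phi : (forall n i, Ck n U (phi i)) ->
  (forall s, dominated (fun i => foldr (@partial R) (phi i) s)) ->
  (forall n, Ck n U (fsum phi)) /\
  forall k v, U v -> partial k (fsum phi) v = fsum (fun i => partial k (phi i)) v.
Proof.
move=> Cphi dphi.
have D phi' k v : (forall n i, Ck n U (phi' i)) ->
    (forall s, dominated (fun i => foldr (@partial R) (phi' i) s)) -> U v ->
    is_derive v (base k) (fsum phi') (fsum (fun i => partial k (phi' i)) v).
  move=> C d Uv; apply: fsum_derive Uv (fun i => C 2%N i) (d [::]) (d [:: k]) (d [:: k; k]).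
split; last by move=> k v Uv; have [_ <-] := D phi k v Cphi dphi Uv.
move=> n; elim: n phi Cphi dphi => [|n IH] phi Cphi dphi.
  exact: fsum_cont (Cphi 1%N) (dphi [::]) (fun k => dphi [:: k]).
have [c _] := fsum_cont (Cphi 1%N) (dphi [::]) (fun k => dphi [:: k]).
split=> //; split=> [k v Uv|k]; first by have [] := D phi k v Cphi dphi Uv.
apply: (Ck_ext oU (f := fsum (fun i => partial k (phi i)))).
  by move=> u Uu; have [_ <-] := D phi k u Cphi dphi Uu.
apply: IH => [m i|s]; first exact: Ck_partial (Cphi m.+1 i).
move=> v Uv; have [M sM H] := dphi (rcons s k) v Uv; exists M => //.
by near=> u => i; rewrite -foldr_partial_rcons; move: i; near: u.
Unshelve. all: by end_near. Qed.

End FunctionSeries.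

(** * Series over the corners and their mirror images *)

Section ShiftedSeries.
Variable R : realType.
Local Notation V := 'rV[R]_4.
Local Notation base i := (delta_mx 0 i : V).
Variables (alpha : R) (a w : nat -> R).
Hypothesis a_gt : forall i, alpha < a i.
Hypothesis a_cvg : a @ \oo --> alpha.
Hypothesis w_ge0 : forall i, 0 <= w i.
Hypothesis wb_bsummable : bsummable (fun i => w i * (a i - alpha)).

Definition xshift (c : R) (v : V) : V := v - c *: base o0.
Definition refl_pt i := 2 * alpha - a i.

(** [T'] may vary with the corner: along an edge the smooth continuation of a function is different
    for corners to the right and to the left, and the term of a corner may be left out. *)
Definition pair_series (T : V -> R) (T' : nat -> V -> R) : V -> R :=
  fsum (fun i v => w i * (T (xshift (refl_pt i) v) - T' i (xshift (a i) v))).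

Lemma xshiftE c v k : xshift c v 0 k = v 0 k - c * (k == o0)%:R.
Proof. by rewrite !mxE eqxx. Qed.

Lemma Ck_xshift n U c k : open U -> Ck n U (fun v => xshift c v 0 k).
Proof.
move=> oU; apply: (Ck_ext oU (f := fun v : V => v 0 k - c * (k == o0)%:R)).
  by move=> u _; rewrite xshiftE.
by apply: Ck_sub_fun => //; [exact: Ck_coord|exact: Ck_cst].
Qed.

Lemma partial_xshift k c (O : set V) (T : V -> R) v : O (xshift c v) -> Ck 1 O T ->
  derivable (fun u => T (xshift c u)) v (base k) /\
  partial k (fun u => T (xshift c u)) v = partial k T (xshift c v).
Proof.
move=> Ov CT; have dT : derivable T (xshift c v) (base k) by exact: Ck_derivable CT Ov.
have [? ?] := is_derive_translate (derivableP dT); split=> //.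
Qed.

Variables (U O : set V) (O' : nat -> set V) (I0 : nat).
Hypotheses (oU : open U) (oO : open O) (oO' : forall i, open (O' i)).
Hypothesis UO : forall i v, U v -> O (xshift (refl_pt i) v).
Hypothesis UO' : forall i v, U v -> O' i (xshift (a i) v).
Hypothesis UOalpha : forall v, U v -> O (xshift alpha v).
Hypothesis tailO : forall i, (I0 <= i)%N -> O' i = O.

(** From [I0] on the two templates agree, which the mean value estimate of the tail uses; the
    condition is stable under partial derivatives. *)
Definition admissible (T : V -> R) (T' : nat -> V -> R) :=
  [/\ forall n, Ck n O T, forall n i, Ck n (O' i) (T' i) &
      forall i, (I0 <= i)%N -> {in O, T' i =1 T}].

Lemma admissible_partial T T' k : admissible T T' ->
  admissible (partial k T) (fun i => partial k (T' i)).
Proof.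
move=> [CT CT' E]; split=> [n|n i|i Ii].
- exact: Ck_partial.
- exact: Ck_partial.
- move=> v; rewrite inE => Ov; apply: partial_eq_on oO Ov _ => u Ou.
  by rewrite E // inE.
Qed.

Let phi T T' i v := w i * (T (xshift (refl_pt i) v) - T' i (xshift (a i) v)).

Lemma Ck_pair_term T T' n i : admissible T T' -> Ck n U (phi T T' i).
Proof.
move=> [CT CT' _]; apply: Ck_mul => //; first exact: Ck_cst.
apply: Ck_sub_fun => //.
- by apply: (Ck_comp oU oO (@UO i)) => // k; exact: Ck_xshift.
- exact: (@Ck_comp R U oU n (O' i) (T' i) (xshift (a i)) (@oO' i) (@UO' i) (CT' n i) (fun k => Ck_xshift n (a i) k oU)).
Qed.

Lemma partial_pair_term T T' i k v : admissible T T' -> U v ->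
  partial k (phi T T' i) v = phi (partial k T) (fun i => partial k (T' i)) i v.
Proof.
move=> adm Uv; have [CT CT' _] := adm; rewrite /phi.
have C1 : Ck 1 U (fun v => T (xshift (refl_pt i) v)).
  by apply: (Ck_comp oU oO (@UO i)) => // l; exact: Ck_xshift.
have C2 : Ck 1 U (fun v => T' i (xshift (a i) v)).
  exact: (@Ck_comp R U oU 1 (O' i) (T' i) (xshift (a i)) (@oO' i) (@UO' i) (CT' 1%N i) (fun k => Ck_xshift 1 (a i) k oU)).
rewrite (partial_mulE k Uv (Ck_cst U 1 (w i)) (Ck_sub_fun oU C1 C2)).
rewrite partial_cst mul0r add0r (partial_subE oU k Uv C1 C2).
by rewrite (partial_xshift k (UO i Uv) (CT 1%N)).2 (partial_xshift k (UO' i Uv) (CT' 1%N i)).2.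
Qed.

Lemma admissible_foldr T T' s : admissible T T' ->
  admissible (foldr (@partial R) T s) (fun i => foldr (@partial R) (T' i) s).
Proof. by move=> adm; elim: s => //= k s; exact: admissible_partial. Qed.

Lemma foldr_pair_term T T' s i v : admissible T T' -> U v ->
  foldr (@partial R) (phi T T' i) s v =
  phi (foldr (@partial R) T s) (fun i => foldr (@partial R) (T' i) s) i v.
Proof.
move=> adm; elim: s v => [//|k s IH] v Uv /=.
rewrite (partial_eq_on k oU Uv IH).
exact: partial_pair_term (admissible_foldr s adm) Uv.
Qed.

(** A corner and its mirror image both tend to [alpha], at distance 2 (a_i - alpha) from each other.
    The mean value theorem bounds the difference of the two shifts by this distance times the
    derivative of [T] near the shift by [alpha], and w_i (a_i - alpha) is summable. *)
Lemma dominated_pair T T' : admissible T T' -> dominated U (phi T T').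
Proof.
move=> adm v Uv; have [CT CT' E] := adm.
have Ov := UOalpha Uv.
have C1 := Ck_partial o0 (CT 1%N).
pose C := `|partial o0 T (xshift alpha v)| + 1.
have C0 : 0 <= C by rewrite addr_ge0.
have [r r0 Hr] : exists2 r, 0 < r &
    forall u, `|u - xshift alpha v| <= r -> O u /\ `|partial o0 T u| <= C.
  have : \forall u \near xshift alpha v, O u /\ `|partial o0 T u| <= C.
    by apply: filterI; [exact: open_nbhs_nbhs|exact: near_bounded (Ck_cont C1 Ov)].
  move=> /nbhs_ballP[r /= r0 Br]; exists (r / 2); first by rewrite divr_gt0.
  move=> u uv; apply: Br; rewrite -ball_normE /= distrC.
  by apply: le_lt_trans uv _; lra.
have [I1 HI1] : exists I1, forall i, (I1 <= i)%N -> a i - alpha <= r / 2.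
  have r2 : 0 < r / 2 by rewrite divr_gt0.
  have [I1 _ HI] : \forall i \near \oo, `|alpha - a i| <= r / 2.
    by move/cvgrPdist_le: a_cvg; apply.
  by exists I1 => i /HI /=; rewrite distrC; apply: le_trans; exact: ler_norm.
pose J := maxn I0 I1.
(* The finitely many terms before [J] are bounded near [v] by their value at [v] plus 1. *)
exists (fun i => (if (i < J)%N then `|phi T T' i v| + 1 else 0)
   + 2 * C * (w i * (a i - alpha))).
  apply: bsummableD; first by apply: bsummable_finite => i; rewrite addr_ge0.
  by apply: bsummableZ => //; rewrite mulr_ge0.
have near_small : \forall u \near v, forall i : 'I_J, `|phi T T' i u| <= `|phi T T' i v| + 1.
  apply: (@filter_forall _ _ (fun (i : 'I_J) u => is_true (`|phi T T' i u| <= `|phi T T' i v| + 1)) (nbhs v) _).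
  by move=> i; apply: near_bounded; exact: Ck_cont (Ck_pair_term 0 i adm) Uv.
near=> u => i; have b0 : 0 < a i - alpha by rewrite subr_gt0.
case: ifPn => [iJ|]; last rewrite -leqNgt geq_max => /andP[I0i I1i].
  have H : `|phi T T' i u| <= `|phi T T' i v| + 1.
    suff /(_ (Ordinal iJ)) : forall i : 'I_J, `|phi T T' i u| <= `|phi T T' i v| + 1 by [].
    by near: u.
  by rewrite -[leLHS]addr0 lerD // !mulr_ge0 // ltW.
have Uu : U u by near: u; exact: open_nbhs_nbhs.
have uv : `|u - v| <= r / 2 by near: u; apply: near_dist; rewrite divr_gt0.
rewrite add0r /phi.
have -> : T' i (xshift (a i) u) = T (xshift (a i) u).
  by apply: E => //; rewrite inE -(tailO I0i); exact: UO'.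
have -> : xshift (refl_pt i) u = xshift (a i) u + (2 * (a i - alpha)) *: base o0.
  by apply/rowP => k; rewrite !mxE !eqxx /refl_pt; ring.
have Hb := HI1 i I1i.
have ball t : 0 <= t <= 1 ->
    `|xshift (a i) u + (t * (2 * (a i - alpha))) *: base o0 - xshift alpha v| <= r.
  move=> /andP[t0 t1].
  have -> : xshift (a i) u + (t * (2 * (a i - alpha))) *: base o0 - xshift alpha v =
     (u - v) + ((2 * t - 1) * (a i - alpha)) *: base o0.
    by apply/rowP => k; rewrite !mxE !eqxx; ring.
  apply: le_trans (ler_normD _ _) _; rewrite [r]splitr lerD //.
  apply: le_trans Hb; rewrite normrZ -[leRHS]mulr1 ler_pM // ?norm_base //.
  rewrite normrM (ger0_norm (ltW b0)) ler_piMl ?(ltW b0) // ler_norml; lra.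
have [t t01|t t01 ->] := @mvt_base R T (xshift (a i) u) o0 (2 * (a i - alpha)).
  by have [Ot _] := Hr _ (ball t t01); exact: Ck_derivable (CT 1%N) Ot.
have [_ HC] := Hr _ (ball t t01).
rewrite normrM ger0_norm // normrM [`|2 * _|]ger0_norm; last by rewrite mulr_ge0 // ltW.
have -> : 2 * C * (w i * (a i - alpha)) = w i * (2 * (a i - alpha) * C) by ring.
by rewrite ler_wpM2l // ler_wpM2l // mulr_ge0 // ltW.
Unshelve. all: by end_near. Qed.

Lemma pair_series_smooth T T' : admissible T T' ->
  (forall n, Ck n U (pair_series T T')) /\
  forall k v, U v -> partial k (pair_series T T') v =
    pair_series (partial k T) (fun i => partial k (T' i)) v.
Proof.
move=> adm; have [|s|C D] := @fsum_smooth R U oU (phi T T').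
- by move=> n i; exact: Ck_pair_term.
- move=> v Uv; have [M sM H] := dominated_pair (admissible_foldr s adm) Uv.
  exists M => //; near=> u => i.
  rewrite foldr_pair_term //; first by move: i; near: u.
  by near: u; exact: open_nbhs_nbhs.
split=> // k v Uv; rewrite D // /pair_series /fsum; congr (limn (series _)).
by apply/funext => i; rewrite partial_pair_term.
Unshelve. all: by end_near. Qed.

Lemma pair_series_cvg T T' v : admissible T T' -> U v ->
  cvgn (series (fun i => w i * (T (xshift (refl_pt i) v) - T' i (xshift (a i) v)))).
Proof. by move=> adm Uv; exact: (fsum_cvg oU Uv (dominated_pair adm)). Qed.

End ShiftedSeries.

(** * The eigenfunction *)

Section RadialFunctions.
Variable R : realType.
Local Notation V := 'rV[R]_4.
Implicit Types v : V.

(** The plane of coordinates 2 and 3 is that of y e^(is) in an edge chart, so that y^2 is a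
    polynomial. *)
Definition ysq v : R := v 0 o2 ^+ 2 + v 0 o3 ^+ 2.
Definition radius v : R := Num.sqrt (v 0 o0 ^+ 2 + ysq v).

Definition right_dom : set V := [set v : V | 0 < v 0 o0 \/ 0 < ysq v].
Definition left_dom : set V := [set v : V | v 0 o0 < 0 \/ 0 < ysq v].

Lemma ysq_ge0 v : 0 <= ysq v.
Proof. by rewrite addr_ge0 // sqr_ge0. Qed.

Lemma rad_sqr v : radius v ^+ 2 = v 0 o0 ^+ 2 + ysq v.
Proof. by rewrite sqr_sqrtr // addr_ge0 ?sqr_ge0 ?ysq_ge0. Qed.

Lemma rad_ge0 v : 0 <= radius v. Proof. exact: sqrtr_ge0. Qed.

Lemma rad_ge_coord v : v 0 o0 <= radius v /\ - v 0 o0 <= radius v.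
Proof.
have := rad_sqr v; have := rad_ge0 v; have := ysq_ge0 v => y0 r0 r2; split; nra.
Qed.

Lemma coord_cont (i : 'I_4) : continuous (fun v : V => v 0 i).
Proof. by move=> v; have C := @Ck_coord R setT 0%N i; exact: (Ck_cont C I). Qed.

Lemma Ck_ysq n U : open U -> Ck n U ysq.
Proof. by move=> oU; apply: Ck_add => //; apply: Ck_exp => //; exact: Ck_coord. Qed.

Lemma ysq_cont : continuous ysq.
Proof. by move=> v; have C := Ck_ysq 0%N (@openT V); exact: (Ck_cont C I). Qed.

Lemma open_gt_fun (f : V -> R) (c : R) : continuous f -> open [set v : V | c < f v].
Proof.
move=> cf; have -> : [set v : V | c < f v] = f @^-1` [set x | c < x] by [].
by apply: open_comp; [move=> v _; exact: cf|exact: open_gt].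
Qed.

Lemma open_lt_fun (f : V -> R) (c : R) : continuous f -> open [set v : V | f v < c].
Proof.
move=> cf; have -> : [set v : V | f v < c] = f @^-1` [set x | x < c] by [].
by apply: open_comp; [move=> v _; exact: cf|exact: open_lt].
Qed.

Lemma open_right_dom : open right_dom.
Proof.
have -> : right_dom = [set v : V | 0 < v 0 o0] `|` [set v : V | 0 < ysq v] by [].
by apply: openU; apply: open_gt_fun; [exact: coord_cont|exact: ysq_cont].
Qed.

Lemma open_left_dom : open left_dom.
Proof.
have -> : left_dom = [set v : V | v 0 o0 < 0] `|` [set v : V | 0 < ysq v] by [].
by apply: openU; [apply: open_lt_fun; exact: coord_cont|apply: open_gt_fun; exact: ysq_cont].
Qed.

Lemma rad_gt0 v : right_dom v \/ left_dom v -> 0 < radius v.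
Proof.
move=> H; rewrite sqrtr_gt0; have := ysq_ge0 v; have := sqr_ge0 (v 0 o0).
by move: H => [[]|[]] H; nra.
Qed.

Lemma rad_add_gt0 v : right_dom v -> 0 < radius v + v 0 o0.
Proof.
move=> Rv; have := rad_gt0 (or_introl Rv); have := rad_sqr v; have := rad_ge_coord v.
by move: Rv => [] H [? ?]; nra.
Qed.

Lemma rad_sub_gt0 v : left_dom v -> 0 < radius v - v 0 o0.
Proof.
move=> Rv; have := rad_gt0 (or_intror Rv); have := rad_sqr v; have := rad_ge_coord v.
by move: Rv => [] H [? ?]; nra.
Qed.

Lemma Ck_rad n (U : set V) : open U -> (forall v, U v -> 0 < radius v) -> Ck n U radius.
Proof.
move=> oU U0; apply: Ck_sqrt => // [v /U0|]; first by rewrite sqrtr_gt0.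
by apply: Ck_add => //; [apply: Ck_exp => //; exact: Ck_coord|exact: Ck_ysq].
Qed.

Definition cosr v := v 0 o0 / radius v.
Definition invr_rad v := (radius v)^-1.
Definition invr_cube v := (radius v ^+ 3)^-1.
Definition cos_cube v := v 0 o0 / radius v ^+ 3.
(** With y^2 = (r - x)(r + x) one gets r = x + y^2 [hright] and x / r = 1 + y^2 [kright], smooth
    across the positive axis; [hleft] and [kleft] play the same part across the negative axis. *)
Definition hright v := (radius v + v 0 o0)^-1.
Definition hleft v := (radius v - v 0 o0)^-1.
Definition kright v := - (radius v * (radius v + v 0 o0))^-1.
Definition kleft v := (radius v * (radius v - v 0 o0))^-1.

Section Smooth.
Variable U : set V.
Hypothesis oU : open U.

Section NonZero.
Hypothesis U0 : forall v, U v -> 0 < radius v.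
Let rn v : U v -> radius v != 0. Proof. by move=> /U0; rewrite lt0r => /andP[]. Qed.
Let Cr n : Ck n U radius. Proof. exact: Ck_rad. Qed.
Let Cx n : Ck n U (fun v => v 0 o0). Proof. exact: Ck_coord. Qed.

Lemma Ck_invr_rad n : Ck n U invr_rad. Proof. exact: Ck_inv. Qed.
Lemma Ck_cosr n : Ck n U cosr. Proof. by apply: Ck_mul => //; exact: Ck_invr_rad. Qed.
Lemma Ck_invr_cube n : Ck n U invr_cube.
Proof. by apply: Ck_inv => // [v Uv|]; [rewrite expf_neq0 // rn|exact: Ck_exp]. Qed.
Lemma Ck_cos_cube n : Ck n U cos_cube.
Proof. by apply: Ck_mul => //; exact: Ck_invr_cube. Qed.

Lemma partial_rad i v : U v ->
  partial i radius v = (i != o1)%:R * v 0 i / radius v.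
Proof.
move=> Uv; have r0 := rn Uv; have C1 := Cr 1%N.
have E : partial i (fun u => radius u * radius u) v = 2 * (i != o1)%:R * v 0 i.
  have -> : (fun u => radius u * radius u) = (fun u : V =>
      u 0 o0 * u 0 o0 + (u 0 o2 * u 0 o2 + u 0 o3 * u 0 o3)).
    by apply/funext => u; rewrite -!expr2 rad_sqr.
  have Cc j : Ck 1 U (fun u : V => u 0 j) by exact: Ck_coord.
  have Cs j : Ck 1 U (fun u : V => u 0 j * u 0 j) by exact: Ck_mul.
  rewrite (partial_addE i Uv (Cs o0) (Ck_add oU (Cs o2) (Cs o3))).
  rewrite (partial_addE i Uv (Cs o2) (Cs o3)).
  rewrite !(partial_mulE i Uv (Cc _) (Cc _)) !partial_coord.
  by elim/ord4_ind: i => /=; ring.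
rewrite (partial_mulE i Uv C1 C1) in E; apply: (mulIf r0).
rewrite divfK //; apply: (mulfI (_ : 2 != 0)); first by rewrite pnatr_eq0.
by rewrite [RHS]mulrA -E; ring.
Qed.

Lemma partial_invr_rad i v : U v ->
  partial i invr_rad v = - ((i != o1)%:R * v 0 i) * invr_cube v.
Proof.
move=> Uv; rewrite (partial_invE i Uv (Cr 1%N) (rn Uv)) partial_rad // /invr_cube.
by field; exact: rn.
Qed.

Lemma partial_cosr i v : U v -> partial i cosr v =
  if i == o0 then ysq v * invr_cube v else - ((i != o1)%:R * v 0 i) * cos_cube v.
Proof.
move=> Uv; rewrite (partial_divE oU i Uv (Cx 1%N) (Cr 1%N) rn) partial_rad // partial_coord.
have r2 := rad_sqr v; have -> : ysq v = radius v ^+ 2 - v 0 o0 ^+ 2 by rewrite r2; ring.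
by rewrite /invr_cube /cos_cube; elim/ord4_ind: i => /=; field; exact: rn.
Qed.

End NonZero.
End Smooth.

Lemma Ck_hright n : Ck n right_dom hright /\ Ck n right_dom kright.
Proof.
have o := open_right_dom.
have r0 v : right_dom v -> 0 < radius v by move=> H; apply: rad_gt0; left.
have Cr : Ck n right_dom radius by exact: Ck_rad.
have Cs : Ck n right_dom (fun v => radius v + v 0 o0) by apply: Ck_add => //; exact: Ck_coord.
split; first by apply: Ck_inv => // v /rad_add_gt0; rewrite lt0r => /andP[].
apply: Ck_opp => //; apply: Ck_inv => // [v Rv|]; last exact: Ck_mul.
by rewrite mulf_neq0 // gt_eqF ?rad_add_gt0 ?r0.
Qed.

Lemma Ck_hleft n : Ck n left_dom hleft /\ Ck n left_dom kleft.
Proof.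
have o := open_left_dom.
have r0 v : left_dom v -> 0 < radius v by move=> H; apply: rad_gt0; right.
have Cr : Ck n left_dom radius by exact: Ck_rad.
have Cs : Ck n left_dom (fun v => radius v - v 0 o0) by apply: Ck_sub_fun => //; exact: Ck_coord.
split; first by apply: Ck_inv => // v /rad_sub_gt0; rewrite lt0r => /andP[].
apply: Ck_inv => // [v Rv|]; last exact: Ck_mul.
by rewrite mulf_neq0 // gt_eqF ?rad_sub_gt0 ?r0.
Qed.

Lemma right_expand v : right_dom v ->
  radius v = v 0 o0 + ysq v * hright v /\ cosr v = 1 + ysq v * kright v.
Proof.
move=> Rv; have r0 := rad_gt0 (or_introl Rv); have s0 := rad_add_gt0 Rv.
have -> : ysq v = radius v ^+ 2 - v 0 o0 ^+ 2 by rewrite rad_sqr; ring.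
by rewrite /hright /kright /cosr; split; field; rewrite !gt_eqF.
Qed.

Lemma left_expand v : left_dom v ->
  radius v = - v 0 o0 + ysq v * hleft v /\ cosr v = - 1 + ysq v * kleft v.
Proof.
move=> Rv; have r0 := rad_gt0 (or_intror Rv); have s0 := rad_sub_gt0 Rv.
have -> : ysq v = radius v ^+ 2 - v 0 o0 ^+ 2 by rewrite rad_sqr; ring.
by rewrite /hleft /kleft /cosr; split; field; rewrite !gt_eqF.
Qed.

End RadialFunctions.

Lemma lim_series_affine (R : realType) (s t u : nat -> R) (c l : R) :
  series s @ \oo --> l -> cvgn (series t) -> (forall i, u i = s i + c * t i) ->
  limn (series u) = l + c * limn (series t).
Proof.
move=> sl ct E; apply: cvg_lim => //.
have -> : series u = fun n => series s n + c * series t n.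
  by apply/funext => n; rewrite /series /= mulr_sumr -big_split; apply: eq_bigr => i _.
apply: cvgD => //; apply: cvgM; [exact: cvg_cst|exact: ct].
Qed.

Lemma lim_series_scale (R : realType) (t u : nat -> R) (c : R) :
  cvgn (series t) -> (forall i, u i = c * t i) ->
  limn (series u) = c * limn (series t).
Proof.
move=> ct E; rewrite -[RHS]add0r; apply: (@lim_series_affine _ (fun=> 0)) => //.
  have -> : series (fun=> 0) = (fun=> 0) :> (nat -> R).
    by apply/funext => n; rewrite /series /= big1.
  exact: cvg_cst.
by move=> i; rewrite E add0r.
Qed.

Lemma sum_three_ranges (R : nmodType) (A B C : nat -> R) J1 J2 n : (J1 <= J2 <= n)%N ->
  \sum_(0 <= i < n) (if (i < J1)%N then A i else if (i < J2)%N then B i else C i) =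
  \sum_(0 <= i < J1) A i + \sum_(J1 <= i < J2) B i + \sum_(J2 <= i < n) C i.
Proof.
move=> /andP[J12 Jn]; rewrite (big_cat_nat (n := J2)) //= (big_cat_nat (n := J1)) //=.
congr (_ + _ + _); rewrite big_nat [RHS]big_nat; apply: eq_bigr => i /andP[i1 i2].
- by rewrite i2.
- by rewrite ltnNge i1 i2.
- by rewrite ltnNge (leq_trans J12 i1) /= ltnNge i1.
Qed.

(** * The eigenfunction and its derivatives as series *)

Section BaseFunctions.
Variables (R : realType) (alpha : R) (e : nat -> int).
Hypothesis cf : has_modified_cf alpha e.
Hypothesis e3 : forall j, (1 <= j)%N -> 3 <= e j.
Local Notation V := 'rV[R]_4.
Local Notation a := (corner R e).
Local Notation w := (wt R e).
Local Notation m := (mden R e).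
Local Notation n_ := (nnum R e).
Local Notation gp := (gap alpha e).

Let a_gt i : alpha < a i. Proof. exact: corner_gt. Qed.
Let a_cvg : a @ \oo --> alpha. Proof. exact: corner_cvg. Qed.
Let w_ge0 i : 0 <= w i. Proof. by rewrite ltW // wt_gt0. Qed.

Lemma wb_bsummable : bsummable (fun i => w i * (a i - alpha)).
Proof.
split=> [i|]; first by rewrite mulr_ge0 // subr_ge0 ltW.
exists (1 / 2) => n; rewrite big_mkord ler_pdivlMr // mulr_suml.
have <- : \sum_(i < n) (2 * w i * (a i - alpha)) = \sum_(i < n) (w i * (a i - alpha) * 2).
  by apply: eq_bigr => i _; ring.
by rewrite sum_gap // gerBl ltW // gap_gt0.
Qed.

Definition pser := pair_series alpha a w.

(* Between the edges [J1] and [J2] the corners [a_i] with [i < J1] are to the right and those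
   with [J2 <= i] to the left; the corners in between are left out. *)
Definition fam (T Tm : V -> R) (J1 J2 i : nat) : V -> R :=
  if (i < J1)%N then Tm else if (i < J2)%N then fun=> 0 else T.

Definition fam_dom (J1 J2 i : nat) : set V :=
  if (i < J1)%N then @left_dom R else if (i < J2)%N then setT else @right_dom R.

(** Besides all points off the axis it contains the interior of edge j for J1 = J2 = j, and for J1 =
    j, J2 = j + 1 both edges at the corner a_j together with the corner, whose term is then left
    out. *)
Definition base_dom (J1 J2 : nat) : set V := [set v : V | alpha < v 0 o0 /\
  (0 < ysq v \/ (a J2 < v 0 o0 /\ ((v 0 o0)%:E < prev_corner R e J1)%E))].

Definition off_axis : set V := [set v : V | alpha < v 0 o0 /\ 0 < ysq v].

Lemma lt_prev_corner J x i : (x%:E < prev_corner R e J)%E -> (i < J)%N -> x < a i.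
Proof.
case: J => // J; rewrite /prev_corner lte_fin ltnS => xJ iJ.
exact: lt_le_trans xJ (corner_noninc R e3 iJ).
Qed.

Lemma open_lt_prev J : open [set v : V | ((v 0 o0)%:E < prev_corner R e J)%E].
Proof.
case: J => [|J].
  have -> : [set v : V | ((v 0 o0)%:E < prev_corner R e 0)%E] = setT.
    by apply/seteqP; split=> // v _ /=; rewrite ltry.
  exact: openT.
have -> : [set v : V | ((v 0 o0)%:E < prev_corner R e J.+1)%E] = [set v : V | v 0 o0 < a J].
  by apply/seteqP; split=> v /=; rewrite lte_fin.
by apply: open_lt_fun; exact: coord_cont.
Qed.

Lemma open_base_dom J1 J2 : open (base_dom J1 J2).
Proof.
have -> : base_dom J1 J2 = [set v : V | alpha < v 0 o0] `&` ([set v : V | 0 < ysq v] `|`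
  ([set v : V | a J2 < v 0 o0] `&` [set v : V | ((v 0 o0)%:E < prev_corner R e J1)%E])) by [].
apply: openI; first by apply: open_gt_fun; exact: coord_cont.
apply: openU; first by apply: open_gt_fun; exact: ysq_cont.
apply: openI; last exact: open_lt_prev.
by apply: open_gt_fun; exact: coord_cont.
Qed.

Lemma open_off_axis : open off_axis.
Proof.
have -> : off_axis = [set v : V | alpha < v 0 o0] `&` [set v : V | 0 < ysq v] by [].
by apply: openI; apply: open_gt_fun; [exact: coord_cont|exact: ysq_cont].
Qed.

Lemma ysq_xshift c (v : V) : ysq (xshift c v) = ysq v.
Proof. by rewrite /ysq !xshiftE /= !mulr0 !subr0. Qed.

Lemma xshift_x c (v : V) : xshift c v 0 o0 = v 0 o0 - c.
Proof. by rewrite xshiftE eqxx mulr1. Qed.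

Lemma base_dom_right J1 J2 i v : base_dom J1 J2 v -> right_dom (xshift (refl_pt alpha a i) v).
Proof.
move=> [v0 _]; left; rewrite xshift_x /refl_pt; have := a_gt i; lra.
Qed.

Lemma base_dom_alpha J1 J2 v : base_dom J1 J2 v -> right_dom (xshift alpha v).
Proof. by move=> [v0 _]; left; rewrite xshift_x; lra. Qed.

Lemma base_dom_fam J1 J2 i v : base_dom J1 J2 v -> fam_dom J1 J2 i (xshift (a i) v).
Proof.
move=> [v0 [y0|[H1 H2]]]; rewrite /fam_dom.
  by case: ifP => _; [|case: ifP => _ //]; right; rewrite ysq_xshift.
case: ifPn => [iJ|_]; first by left; rewrite xshift_x subr_lt0; exact: lt_prev_corner H2 iJ.
case: ifPn => // iJ; left; rewrite xshift_x subr_gt0; apply: le_lt_trans H1.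
by apply: (corner_noninc R e3); rewrite leqNgt.
Qed.

Lemma open_fam_dom J1 J2 i : open (fam_dom J1 J2 i).
Proof.
rewrite /fam_dom; case: ifP => _; first exact: open_left_dom.
by case: ifP => _; [exact: openT|exact: open_right_dom].
Qed.

Definition smooth_pair (T Tm : V -> R) :=
  (forall n, Ck n (@right_dom R) T) /\ forall n, Ck n (@left_dom R) Tm.

Lemma fam_admissible T Tm J1 J2 : (J1 <= J2)%N -> smooth_pair T Tm ->
  admissible (@right_dom R) (fam_dom J1 J2) J2 T (fam T Tm J1 J2).
Proof.
move=> J12 [CT CTm]; split=> // [n i|i Ji v _].
  rewrite /fam_dom /fam; case: ifP => // _; case: ifP => // _; exact: Ck_cst.
by rewrite /fam ltnNge (leq_trans J12 Ji) /= ltnNge Ji.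
Qed.

Lemma fam_dom_tail J1 J2 i : (J1 <= J2)%N -> (J2 <= i)%N -> fam_dom J1 J2 i = @right_dom R.
Proof. by move=> J12 Ji; rewrite /fam_dom ltnNge (leq_trans J12 Ji) /= ltnNge Ji. Qed.

Lemma Ck_pser T Tm J1 J2 n : (J1 <= J2)%N -> smooth_pair T Tm ->
  Ck n (base_dom J1 J2) (pser T (fam T Tm J1 J2)).
Proof.
move=> J12 sm; have adm := fam_admissible J12 sm.
have [] // := pair_series_smooth a_gt a_cvg w_ge0 wb_bsummable (@open_base_dom J1 J2)
  (@open_right_dom R) (@open_fam_dom J1 J2) (@base_dom_right J1 J2) (@base_dom_fam J1 J2)
  (@base_dom_alpha J1 J2) (fun i => @fam_dom_tail J1 J2 i J12) adm.
Qed.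

Lemma pser_cvg T Tm J1 J2 v : (J1 <= J2)%N -> smooth_pair T Tm -> base_dom J1 J2 v ->
  cvgn (series (fun i => w i * (T (xshift (refl_pt alpha a i) v)
     - fam T Tm J1 J2 i (xshift (a i) v)))).
Proof.
move=> J12 sm Dv; have adm := fam_admissible J12 sm.
exact: (pair_series_cvg a_gt a_cvg w_ge0 wb_bsummable (@open_base_dom J1 J2)
  (@open_right_dom R) (@open_fam_dom J1 J2) (@base_dom_right J1 J2) (@base_dom_fam J1 J2)
  (@base_dom_alpha J1 J2) (fun i => @fam_dom_tail J1 J2 i J12) adm Dv).
Qed.

Lemma smooth_pairs : [/\ smooth_pair (@radius R) (@radius R), smooth_pair (@cosr R) (@cosr R),
  smooth_pair (@invr_rad R) (@invr_rad R), smooth_pair (@hright R) (@hleft R) &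
  smooth_pair (@kright R) (@kleft R)].
Proof.
have r v : @right_dom R v -> 0 < radius v by move=> H; apply: rad_gt0; left.
have l v : @left_dom R v -> 0 < radius v by move=> H; apply: rad_gt0; right.
have oR := @open_right_dom R; have oL := @open_left_dom R.
split; split=> n; by [exact: Ck_rad|exact: Ck_cosr|exact: Ck_invr_rad|
  have [] := @Ck_hright R n|have [] := @Ck_hleft R n].
Qed.

(** The sum of the series for [f] on the axis. There a corner on the right contributes 2 w_i (x -
    alpha), one on the left 2 w_i (a_i - alpha), and one left out only the distance to its mirror
    image. *)
Definition lin (J1 J2 : nat) (x : R) : R :=
  m J1 * (x - alpha) + \sum_(J1 <= i < J2) w i * (x - refl_pt alpha a i) + gp J2.

Lemma lin_series J1 J2 x : (J1 <= J2)%N ->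
  series (fun i => if (i < J1)%N then 2 * w i * (x - alpha) else
    if (i < J2)%N then w i * (x - refl_pt alpha a i) else 2 * w i * (a i - alpha))
  @ \oo --> lin J1 J2 x.
Proof.
move=> J12.
have H : (fun n => m J1 * (x - alpha) + \sum_(J1 <= i < J2) w i * (x - refl_pt alpha a i)
   + (gp J2 - gp n)) @ \oo --> lin J1 J2 x.
  have -> : lin J1 J2 x = m J1 * (x - alpha)
      + \sum_(J1 <= i < J2) w i * (x - refl_pt alpha a i) + (gp J2 - 0) by rewrite subr0.
  apply: cvgD; first exact: cvg_cst.
  by apply: cvgB; [exact: cvg_cst|exact: gap_cvg].
apply: cvg_trans H; apply: near_eq_cvg; near=> n.
have nJ : (J2 <= n)%N by near: n; exact: nbhs_infty_ge.
rewrite /series /= sum_three_ranges ?J12 //; congr (_ + _ + _).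
- by rewrite -mulr_suml big_mkord sum_wt.
- rewrite (eq_bigr (fun i => - (gp i.+1 - gp i))) => [|i _].
    by rewrite sumrN telescope_sumr // opprB.
  by rewrite -gap_step //; ring.
Unshelve. all: by end_near. Qed.

(** Each distance is expanded by [right_expand] or [left_expand]; the linear parts sum to [lin], and
    the coefficients of y^2 form a series smooth across the edge. *)
Lemma rad_expand J1 J2 v : (J1 <= J2)%N -> base_dom J1 J2 v ->
  pser (@radius R) (fam (@radius R) (@radius R) J1 J2) v =
  lin J1 J2 (v 0 o0) + ysq v * pser (@hright R) (fam (@hright R) (@hleft R) J1 J2) v.
Proof.
move=> J12 Dv; have [_ _ _ s4 _] := smooth_pairs.
apply: lim_series_affine (lin_series J12) (pser_cvg J12 s4 Dv) _ => i.
have [E1 _] := right_expand (base_dom_right i Dv).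
have := base_dom_fam i Dv; rewrite E1 /fam /fam_dom !ysq_xshift !xshift_x.
case: ifP => _; [|case: ifP => _].
- by move=> /left_expand[-> _]; rewrite ysq_xshift xshift_x /refl_pt; ring.
- by move=> _; rewrite /refl_pt; ring.
- by move=> /right_expand[-> _]; rewrite ysq_xshift xshift_x /refl_pt; ring.
Qed.

Definition linc (J1 J2 : nat) : R := m J1 + \sum_(J1 <= i < J2) w i.

Lemma linc_series J1 J2 : (J1 <= J2)%N ->
  series (fun i => if (i < J1)%N then 2 * w i else if (i < J2)%N then w i else 0)
  @ \oo --> linc J1 J2.
Proof.
move=> J12; apply: (@cvg_trans _ ((fun=> linc J1 J2) @ \oo)); last exact: cvg_cst.
apply: near_eq_cvg; near=> n.
have nJ : (J2 <= n)%N by near: n; exact: nbhs_infty_ge.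
rewrite /series /= sum_three_ranges ?J12 // [X in _ + _ + X]big1_eq addr0.
by rewrite big_mkord sum_wt.
Unshelve. all: by end_near. Qed.

Lemma cosr_expand J1 J2 v : (J1 <= J2)%N -> base_dom J1 J2 v ->
  pser (@cosr R) (fam (@cosr R) (@cosr R) J1 J2) v =
  linc J1 J2 + ysq v * pser (@kright R) (fam (@kright R) (@kleft R) J1 J2) v.
Proof.
move=> J12 Dv; have [_ _ _ _ s5] := smooth_pairs.
apply: lim_series_affine (linc_series J12) (pser_cvg J12 s5 Dv) _ => i.
have [_ E1] := right_expand (base_dom_right i Dv).
have := base_dom_fam i Dv; rewrite E1 /fam /fam_dom !ysq_xshift.
case: ifP => _; [|case: ifP => _].
- by move=> /left_expand[_ ->]; rewrite ysq_xshift; ring.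
- by move=> _; ring.
- by move=> /right_expand[_ ->]; rewrite ysq_xshift; ring.
Qed.

Lemma off_axis_base J1 J2 v : off_axis v -> base_dom J1 J2 v.
Proof. by move=> [v0 y0]; split=> //; left. Qed.

Definition plane_compl : set V := [set v : V | 0 < ysq v].

Lemma open_plane_compl : open plane_compl.
Proof. by apply: open_gt_fun; exact: ysq_cont. Qed.

Section OffAxis.
Variable T : V -> R.
Hypothesis CT : forall n, Ck n plane_compl T.

Let sh c v : off_axis v -> plane_compl (xshift c v).
Proof. by move=> [_ y0]; rewrite /plane_compl /= ysq_xshift. Qed.

Let adm : admissible plane_compl (fun=> plane_compl) 0 T (fun=> T). Proof. by []. Qed.

Lemma pser_off_cvg v : off_axis v ->
  cvgn (series (fun i => w i * (T (xshift (refl_pt alpha a i) v) - T (xshift (a i) v)))).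
Proof.
exact: (pair_series_cvg a_gt a_cvg w_ge0 wb_bsummable open_off_axis
  open_plane_compl (fun=> open_plane_compl) (fun i v => @sh _ v) (fun i v => @sh _ v)
  (@sh _) (fun _ _ => erefl) adm).
Qed.

Lemma partial_pser k v : off_axis v -> partial k (pser T (fun=> T)) v =
  pser (partial k T) (fun=> partial k T) v.
Proof.
have [_] := pair_series_smooth a_gt a_cvg w_ge0 wb_bsummable open_off_axis
  open_plane_compl (fun=> open_plane_compl) (fun i v => @sh _ v) (fun i v => @sh _ v)
  (@sh _) (fun _ _ => erefl) adm.
by apply.
Qed.

(** The shifts move only coordinate 0, so a factor in the other coordinates can be taken out of the
    series. *)
Lemma pser_scale (T1 : V -> R) c v : off_axis v ->
  (forall u, plane_compl u -> u 0 o1 = v 0 o1 -> u 0 o2 = v 0 o2 -> u 0 o3 = v 0 o3 ->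
     T1 u = c * T u) ->
  pser T1 (fun=> T1) v = c * pser T (fun=> T) v.
Proof.
move=> Dv H; apply: lim_series_scale (pser_off_cvg Dv) _ => i.
have E t : T1 (xshift t v) = c * T (xshift t v).
  by apply: H; [exact: sh|rewrite xshiftE mulr0 subr0..].
by rewrite !E; ring.
Qed.

End OffAxis.

(** With r the distance from a corner and x measured from it, r_x = x / r and r_y / y = 1 / r give
    f_x and f_y / y; the second derivatives involve the series of 1 / r^3 and x / r^3, which are
    [base_Q] and [base_X]. *)
Definition base_f := pser (@radius R) (fun=> @radius R).
Definition base_p := pser (@cosr R) (fun=> @cosr R).
Definition base_k := pser (@invr_rad R) (fun=> @invr_rad R).
Definition base_Q := pser (@invr_cube R) (fun=> @invr_cube R).
Definition base_X := pser (@cos_cube R) (fun=> @cos_cube R).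

Let rad0 v : plane_compl v -> 0 < radius v.
Proof. by move=> H; apply: rad_gt0; left; right. Qed.

Lemma partial_base_f k v : off_axis v -> partial k base_f v =
  if k == o0 then base_p v else (k != o1)%:R * v 0 k * base_k v.
Proof.
move=> Dv; have o := open_plane_compl.
rewrite partial_pser //; last by move=> n; exact: Ck_rad.
case: eqP => [->|/eqP k0].
  rewrite -[RHS]mul1r; apply: pser_scale => // [n|u Pu _ _ _]; first exact: Ck_cosr.
  by rewrite (partial_rad o rad0) // !mul1r.
apply: pser_scale => // [n|u Pu H1 H2 H3]; first exact: Ck_invr_rad.
rewrite (partial_rad o rad0) //; congr (_ * _ * _).
by move: k k0; elim/ord4_ind.
Qed.

Lemma partial_base_p k v : off_axis v -> partial k base_p v =
  if k == o0 then ysq v * base_Q v else - ((k != o1)%:R * v 0 k) * base_X v.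
Proof.
move=> Dv; have o := open_plane_compl.
rewrite partial_pser //; last by move=> n; exact: Ck_cosr.
case: eqP => [->|/eqP k0].
  apply: pser_scale => // [n|u Pu _ H2 H3]; first exact: Ck_invr_cube.
  by rewrite (partial_cosr o rad0) // /ysq H2 H3.
apply: pser_scale => // [n|u Pu H1 H2 H3]; first exact: Ck_cos_cube.
rewrite (partial_cosr o rad0) // (negbTE k0); congr (- (_ * _) * _).
by move: k k0; elim/ord4_ind.
Qed.

Lemma partial_base_k k v : off_axis v -> partial k base_k v =
  if k == o0 then - base_X v else - ((k != o1)%:R * v 0 k) * base_Q v.
Proof.
move=> Dv; have o := open_plane_compl.
rewrite partial_pser //; last by move=> n; exact: Ck_invr_rad.
case: eqP => [->|/eqP k0].
  rewrite -[RHS]mulN1r; apply: pser_scale => // [n|u Pu _ H2 H3]; first exact: Ck_cos_cube.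
  by rewrite (partial_invr_rad o rad0) //= /cos_cube /invr_cube; ring.
apply: pser_scale => // [n|u Pu H1 H2 H3]; first exact: Ck_invr_cube.
rewrite (partial_invr_rad o rad0) //; congr (- (_ * _) * _).
by move: k k0; elim/ord4_ind.
Qed.

Lemma fam_diag T J : fam T T J J = fun=> T.
Proof. by apply/funext => i; rewrite /fam; case: ifP => // ->. Qed.

Lemma lin_edge j x : lin j j x = m j * x - n_ j.
Proof. by rewrite /lin big_geq // /gap; ring. Qed.

Lemma linc_edge j : linc j j = m j.
Proof. by rewrite /linc big_geq // addr0. Qed.

Lemma lin_corner j x : lin j j.+1 x =
  ((m j * x - n_ j) + (m j.+1 * x - n_ j.+1)) / 2.
Proof.
rewrite /lin big_nat1 /gap; have := corner_eq R e3 j; have := mden_wt R e j.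
rewrite /refl_pt => H1 H2.
have -> : w j * (x - (2 * alpha - a j)) = (2 * w j * x - 2 * (2 * w j) * alpha + 2 * w j * a j) / 2.
  by field.
by rewrite H2 -H1; field.
Qed.

Lemma linc_corner j : linc j j.+1 = (m j + m j.+1) / 2.
Proof. by rewrite /linc big_nat1 /wt; field. Qed.

End BaseFunctions.

(** * Signs and estimates of the eigenfunction *)

Section BaseInequalities.
Variables (R : realType) (alpha : R) (e : nat -> int).
Hypothesis cf : has_modified_cf alpha e.
Hypothesis e3 : forall j, (1 <= j)%N -> 3 <= e j.
Local Notation V := 'rV[R]_4.
Implicit Types v : V.
Local Notation a := (corner R e).
Local Notation w := (wt R e).

Lemma lim_series_gt0 (u : nat -> R) : (forall i, 0 < u i) -> cvgn (series u) ->
  0 < limn (series u).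
Proof.
move=> u0 cu; apply: (lt_le_trans (u0 0%N)).
have nd : nondecreasing_seq (series u).
  by apply/nondecreasing_seqP => n; rewrite /series /= big_nat_recr //= lerDl ltW.
have := nondecreasing_cvgn_le nd cu 1%N.
by rewrite /series /= big_nat1.
Qed.

Let x' i (v : V) := xshift (refl_pt alpha a i) v.
Let xa i (v : V) := xshift (a i) v.

Let sq' i v : radius (x' i v) ^+ 2 = (v 0 o0 - alpha + (a i - alpha)) ^+ 2 + ysq v.
Proof. by rewrite rad_sqr ysq_xshift xshift_x /refl_pt; congr (_ ^+ 2 + _); ring. Qed.

Let sqa i v : radius (xa i v) ^+ 2 = (v 0 o0 - alpha - (a i - alpha)) ^+ 2 + ysq v.
Proof. by rewrite rad_sqr ysq_xshift xshift_x; congr (_ ^+ 2 + _); ring. Qed.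

Let b0 i : 0 < a i - alpha. Proof. by rewrite subr_gt0; exact: corner_gt. Qed.

Lemma rad_refl_lt i v : alpha < v 0 o0 -> radius (xa i v) < radius (x' i v).
Proof.
rewrite -subr_gt0 => v0; have := b0 i; have := sq' i v; have := sqa i v.
have := rad_ge0 (xa i v); have := rad_ge0 (x' i v).
move: (radius _) (radius _) v0 => S' S; move: (v 0 o0 - alpha) (a i - alpha) => x b.
move=> x0 S0 S'0 E1 E2 bb; rewrite ltNge; apply/negP => H.
have : S' ^+ 2 <= S ^+ 2 by nra.
rewrite E1 E2; nra.
Qed.

(** Two triangle inequalities: the corner and its mirror image are 2 (a_i - alpha) apart, and a
    point and its own mirror image 2 (x - alpha). *)
Lemma rad_refl_le i v : alpha < v 0 o0 ->
  radius (x' i v) - radius (xa i v) <= 2 * (v 0 o0 - alpha) /\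
  radius (x' i v) - radius (xa i v) <= 2 * (a i - alpha).
Proof.
move=> v0; have := rad_refl_lt i v0; rewrite -subr_gt0 in v0; have := b0 i.
have := sq' i v; have := sqa i v; have := ysq_ge0 v.
have := rad_ge0 (xa i v); have := rad_ge0 (x' i v).
move: (radius _) (radius _) v0 => S S'; move: (v 0 o0 - alpha) (a i - alpha) (ysq v) => x b Y.
move=> x0 S0 S'0 Y0 E1 E2 bb SS.
have H1 : x + b <= S' by rewrite leNgt; apply/negP => H; nra.
have H2 : x - b <= S by rewrite leNgt; apply/negP => H; nra.
have H3 : b - x <= S by rewrite leNgt; apply/negP => H; nra.
split; rewrite leNgt; apply/negP => H; nra.
Qed.

Lemma base_f_gt0 j v : base_dom alpha e j j v -> 0 < base_f alpha e v.
Proof.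
move=> Dv; have [s1 _ _ _ _] := smooth_pairs R.
have := pser_cvg cf e3 (leqnn j) s1 Dv; rewrite fam_diag => cv.
apply: lim_series_gt0 cv => i; rewrite mulr_gt0 ?wt_gt0 // subr_gt0.
by apply: rad_refl_lt; exact: Dv.1.
Qed.

Lemma base_k_lt0 j v : base_dom alpha e j j v -> base_k alpha e v < 0.
Proof.
move=> Dv; have [_ _ s3 _ _] := smooth_pairs R.
have := pser_cvg cf e3 (leqnn j) s3 Dv; rewrite fam_diag => cv.
rewrite -oppr_gt0 /base_k /pser /pair_series /fsum -lim_seriesN //.
apply: lim_series_gt0; last by rewrite is_cvg_seriesN.
move=> i; rewrite -[ltRHS]/(- (w i * (invr_rad (x' i v) - invr_rad (xa i v)))).
rewrite -mulrN opprB mulr_gt0 ?wt_gt0 // subr_gt0.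
have H := rad_refl_lt i Dv.1.
have r0 : 0 < radius (xa i v).
  have := base_dom_fam e3 i Dv; rewrite /fam_dom => Hd; apply: rad_gt0.
  by case: (ltnP i j) Hd => _ Hd; [right|left].
by rewrite /invr_rad ltf_pV2 ?posrE // (lt_trans r0).
Qed.

(** The first bound of [rad_refl_le] is used for the corners before [j], the second from [j] on.
    Since the gaps tend to 0, these estimates keep points with [f] bounded below away from x =
    alpha. *)
Lemma base_f_le j v : off_axis alpha v ->
  base_f alpha e v <= mden R e j * (v 0 o0 - alpha) + gap alpha e j.
Proof.
move=> Dv.
have cf1 := pser_off_cvg cf e3 (fun n => Ck_rad n (@open_plane_compl R) (fun u (Pu : plane_compl u) =>
  rad_gt0 (or_introl (or_intror Pu : right_dom u)))) Dv.
have L := @lin_series R alpha e cf e3 j j (v 0 o0) (leqnn j).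
have -> : mden R e j * (v 0 o0 - alpha) + gap alpha e j = lin alpha e j j (v 0 o0).
  by rewrite /lin big_geq // addr0.
rewrite -(cvg_lim _ L) //; apply: lim_series_le => //; first exact: cvgP L.
move=> i; have [H1 H2] := rad_refl_le i Dv.1; have w0 := wt_gt0 R e3 i.
rewrite -/(x' i v) -/(xa i v); case: (ltnP i j) => _.
  by rewrite -mulrA mulrCA ler_wpM2l // ltW.
by rewrite -mulrA mulrCA ler_wpM2l // ltW.
Qed.

(** This is exactly what makes log (f / |z - alpha|) 1-Lipschitz in [dbar_bound_off]. *)
Lemma base_radial_ineq v : off_axis alpha v ->
  forall x, x = v 0 o0 - alpha ->
  - 2 * (base_p alpha e v * x + ysq v * base_k alpha e v) + base_f alpha e v
    <= - (x ^+ 2 + ysq v) * base_k alpha e v.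
Proof.
move=> Dv x xE.
have r0 (u : V) : plane_compl u -> 0 < radius u by move=> Pu; apply: rad_gt0; left; right.
have o := @open_plane_compl R.
have := pser_off_cvg cf e3 (fun n => Ck_rad n o r0) Dv.
have := pser_off_cvg cf e3 (fun n => Ck_cosr o r0 n) Dv.
have := pser_off_cvg cf e3 (fun n => Ck_invr_rad o r0 n) Dv.
rewrite -/(base_k alpha e v).
set tk := (fun i => _); set tp := (fun i => _); set tf := (fun i => _) => ck cp cF.
pose T n := - (x ^+ 2 + ysq v) * series tk n + 2 * (series tp n * x + ysq v * series tk n)
   - series tf n.
have cT : T @ \oo --> - (x ^+ 2 + ysq v) * base_k alpha e v
   + 2 * (base_p alpha e v * x + ysq v * base_k alpha e v) - base_f alpha e v.
  apply: cvgB; last exact: cF.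
  apply: cvgD; first by apply: cvgM; [exact: cvg_cst|exact: ck].
  apply: cvgM; first exact: cvg_cst.
  apply: cvgD; first by apply: cvgM; [exact: cp|exact: cvg_cst].
  by apply: cvgM; [exact: cvg_cst|exact: ck].
suff : 0 <= - (x ^+ 2 + ysq v) * base_k alpha e v
   + 2 * (base_p alpha e v * x + ysq v * base_k alpha e v) - base_f alpha e v by lra.
apply: (cvgr_to_ge cT); apply: nearW => n.
rewrite /T /series /= !mulr_sumr !mulr_suml -big_split /= mulr_sumr -!big_split /=.
rewrite -sumrN -big_split /=; apply: sumr_ge0 => i _.
rewrite /tk /tp /tf -/(x' i v) -/(xa i v) /invr_rad /cosr.
have E' := sq' i v; have E := sqa i v.
have S0 : 0 < radius (xa i v) by apply: r0; rewrite /plane_compl /= ysq_xshift; exact: Dv.2.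
have SS := rad_refl_lt i Dv.1; have S'0 := lt_trans S0 SS.
have -> : x' i v 0 o0 = x + (a i - alpha) by rewrite xshift_x /refl_pt xE; ring.
have -> : xa i v 0 o0 = x - (a i - alpha) by rewrite xshift_x xE; ring.
rewrite -xE in E E'; have w0 := wt_gt0 R e3 i.
move: (radius _) (radius _) (ysq v) (a i - alpha) S0 SS S'0 E E' => S' S Y b S0 SS S'0 E E'.
have EY : Y = S ^+ 2 - (x - b) ^+ 2 by rewrite E; ring.
(* Each summand collapses to this, which is nonnegative because the corner is nearer than its mirror
   image. *)
rewrite [X in 0 <= X](_ : _ = w i * (b ^+ 2 * (S^-1 - S'^-1))).
  have SI : S'^-1 <= S^-1 by rewrite lef_pV2 ?posrE // ltW.
  by apply: mulr_ge0; [exact: ltW|apply: mulr_ge0; [exact: sqr_ge0|rewrite subr_ge0]].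
have EY' : Y = S' ^+ 2 - (x + b) ^+ 2 by rewrite E'; ring.
have -> : w i * (S'^-1 - S^-1) = w i * S'^-1 - w i * S^-1 by ring.
have s1 : S^-1 * Y = S - (x - b) ^+ 2 / S by rewrite EY; field; rewrite gt_eqF.
have s2 : S'^-1 * Y = S' - (x + b) ^+ 2 / S' by rewrite EY'; field; rewrite gt_eqF.
transitivity (w i * (- x ^+ 2 * (S'^-1 - S^-1) + (S'^-1 * Y - S^-1 * Y)
  + 2 * ((x + b) / S' - (x - b) / S) * x - (S' - S))); first by ring.
rewrite s1 s2; field; by rewrite !gt_eqF.
Qed.

End BaseInequalities.

(** * The metric in the charts *)

Section EdgeAlgebra.
Variable R : realFieldType.
Variables (x Y m n p' q' h kp k : R).
(* On an edge, [f = l + y^2 h] and [f_x = m + y^2 kp] with [h], [kp] and [k] smooth; the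
   coefficients below, free of [1 / y], are those of [eta^2], [eta dt] and [dt^2], where
   [eta = y^2 ds]. *)
Let l := m * x - n.
Let f := l + Y * h.
Let p := m + Y * kp.
Let Vh := p ^+ 2 + Y * k ^+ 2 - f * k.
Definition edge_c := k ^+ 2 + p * kp - k * h.
Definition edge_d := m * h - kp * l - m * k.
Definition edge_b := k * l - p * m.
Definition edge_s1t := (f - Y * k - x * p) * p' + p * q'.
Definition edge_taut := (x * k - p) * p' - k * q'.
Definition edge_A := - 2 * Vh * edge_c + Y * edge_c ^+ 2 + edge_d ^+ 2.
Definition edge_B := edge_d * edge_s1t + edge_b * edge_taut.
Definition edge_C := edge_s1t ^+ 2 + Y * edge_taut ^+ 2.

(** The term dy^2 contributes -V / y^2 to the coefficient of eta^2, and the square of the second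
    angle form contributes b^2 / (y^2 V). As b = y^2 c - V for [b = edge_b] and [c = edge_c], the
    two poles cancel. *)
Lemma edge_metric_algebra (y xx g et t et' t' yy : R) : Y != 0 -> Vh != 0 -> f != 0 ->
  y ^+ 2 = Y -> yy = g - et * et' / Y ->
  let S1 et t := (f - y * (y * k) - x * p) * (m * (et / Y) + p' * t)
     - p * (- (n * (et / Y) + q' * t)) in
  let S2 et t := y * ((x * k - p) * (m * (et / Y) + p' * t) + k * (- (n * (et / Y) + q' * t))) in
  (Vh * (xx + yy) + (S1 et t * S1 et' t' + S2 et t * S2 et' t') / Vh) / f ^+ 2 =
  (Vh * (xx + g) + (edge_A * (et * et') + edge_B * (et * t' + t * et') + edge_C * (t * t')) / Vh)
    / f ^+ 2.
Proof.
move=> Y0 V0 f0 yY -> S1 S2.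
have E1 e s : S1 e s = edge_d * e + edge_s1t * s.
  rewrite /S1 mulrA -expr2 yY /edge_d /edge_s1t /f /p /l; field; exact: Y0.
have E2 e s : S2 e s = y * (edge_b * e / Y + edge_taut * s).
  by rewrite /S2 /edge_b /edge_taut /f /p /l; field.
have E3 : S2 et t * S2 et' t' =
    Y * ((edge_b * et / Y + edge_taut * t) * (edge_b * et' / Y + edge_taut * t')).
  by rewrite !E2 -yY; ring.
have bV : edge_b = Y * edge_c - Vh by rewrite /edge_b /edge_c /Vh /f /p /l; ring.
rewrite E3 !E1 /edge_A /edge_B /edge_C bV; congr (_ / _).
move: Vh edge_c edge_d edge_s1t edge_taut V0 => W c d s u W0.
field; by rewrite Y0 W0.
Qed.

End EdgeAlgebra.

Section CornerAlgebra.
Variable R : realFieldType.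
Variables (u v w mb lb h kp k : R).
(* With [u = r_1^2] and [v = r_2^2], so that [|z - a_j| = u + v] and [y^2 = 4 u v],
   [crn_f], [crn_p] and [k] are what remains of [f], [f_x] and [f_y / y] without the term
   of the corner; [crn_V] is [(u + v) V]. *)
Definition crn_f := lb + 4 * u * v * h.
Definition crn_p := mb + 4 * u * v * kp.
Definition crn_V := (u + v) * (crn_p ^+ 2 + 4 * u * v * k ^+ 2 - crn_f * k)
  - 2 * w * crn_p * (v - u) - 8 * w * u * v * k + w * crn_f + w * (u + v) ^+ 2 * k.
Definition crn_d := (mb - w) * h - kp * (lb - w * (v - u)) - (mb - w) * k.
Definition crn_b := k * (lb - w * (v - u)) - (mb - w) * crn_p.
Definition crn_T := 4 * v ^+ 2 * (crn_p * kp - k * h) + 4 * w * v * h - w * mb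
  - 4 * w * v ^+ 2 * kp + crn_p ^+ 2 + 4 * v * (u + v) * k ^+ 2 - crn_f * k + 2 * w * crn_p
  - 5 * w * v * k + w * u * k.
Definition crn_A := - 4 * crn_T * (1 - 2 * v * crn_b) - 4 * u * crn_T ^+ 2
  + 4 * v * (crn_b ^+ 2 - 2 * crn_d + 4 * v * (u + v) * crn_d ^+ 2).

(** The hypothesis is the determinant relation of consecutive pairs, see [corner_rel]; the splitting
    isolates the value of [crn_V] on the edge u = 0. *)
Lemma crn_V_split : 2 * w * (lb - (v - u) * mb) = 1 ->
  crn_V = 2^-1 - v * crn_b + u * crn_T.
Proof.
move=> rel; have -> : 2^-1 = w * (lb - (v - u) * mb) by move: rel; rewrite -mulrA; move: (w * _) => z; lra.
rewrite /crn_V /crn_b /crn_T /crn_f /crn_p; ring.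
Qed.

(** At u = 0 the right side vanishes because [crn_V] is 1 / 2 - v b there; [crn_A] is the quotient
    by [u], written as a polynomial. *)
Lemma crn_A_eq : 2 * w * (lb - (v - u) * mb) = 1 ->
  u * crn_A = 1 + v * (- 8 * u * crn_d + 16 * u * v * (u + v) * crn_d ^+ 2
     + 4 * (u + v) * crn_b ^+ 2 - 4 * crn_b) - 4 * crn_V ^+ 2.
Proof.
move=> rel; rewrite (crn_V_split rel) /crn_A.
by move: crn_T crn_b crn_d => T b d; field.
Qed.

End CornerAlgebra.

Section CornerMetric.
Variable R : realFieldType.
Variables (u v w mb lb h kp k : R).
Hypothesis r0 : u + v != 0.
Hypothesis rel : 2 * w * (lb - (v - u) * mb) = 1.
Let f := crn_f u v lb h - w * (u + v).
Let p := crn_p u v mb kp - w * (v - u) / (u + v).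
Let q := k - w / (u + v).

Lemma crn_V_eq : (u + v) * (p ^+ 2 + 4 * u * v * q ^+ 2 - f * q) = crn_V u v w mb lb h kp k.
Proof. by rewrite /f /p /q /crn_V; move: (crn_f _ _ _ _) (crn_p _ _ _ _) => F P; field. Qed.

Let rel' : w * (lb - (v - u) * mb) = 2^-1.
Proof. by move: rel; rewrite -mulrA; move: (w * _) => z; lra. Qed.

(** The left side is the coefficient of e_1 / u in the first angle form; the determinant relation
    produces the factor [u] that removes this pole. *)
Lemma crn_s1 : (mb - w) * (f - 4 * u * v * q) - p * (lb - w * (v - u)) =
  u / (u + v) * (- 1 + 4 * v * (u + v) * crn_d u v w mb lb h kp k).
Proof.
have -> : u / (u + v) = 2 * (w * (lb - (v - u) * mb)) * (u / (u + v)).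
  by rewrite rel'; field.
transitivity (4 * u * v * crn_d u v w mb lb h kp k - 2 * (w * (lb - (v - u) * mb)) * (u / (u + v))).
  by rewrite /f /p /q /crn_f /crn_p /crn_d; field.
by rewrite rel'; field.
Qed.

Lemma crn_t1 : q * (lb - w * (v - u)) - p * (mb - w) =
  crn_b u v w mb lb kp k - (2 * (u + v))^-1.
Proof.
have -> : (2 * (u + v))^-1 = (w * (lb - (v - u) * mb)) / (u + v) by rewrite rel'; field.
by rewrite /p /q /crn_b /crn_p; field.
Qed.

End CornerMetric.

Section CornerMetricSum.
Variable R : realFieldType.
Variables (u v w mb lb h kp k : R).
Hypotheses (u0 : u != 0) (v0 : v != 0) (r0 : u + v != 0).
Hypothesis rel : 2 * w * (lb - (v - u) * mb) = 1.

Let Vt := crn_V u v w mb lb h kp k.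
Let d1 := crn_d u v w mb lb h kp k.
Let b1 := crn_b u v w mb lb kp k.
Let A1 := crn_A u v w mb lb h kp k.
(* The reflection [x - a_j |-> a_j - x] exchanges the two factors of C^2. *)
Let d2 := crn_d v u w (- mb) lb h (- kp) k.
Let b2 := crn_b v u w (- mb) lb (- kp) k.
Let A2 := crn_A v u w (- mb) lb h (- kp) k.
Definition crn_B := 4 * v * d1 + 4 * u * d2 - 16 * u * v * (u + v) * d1 * d2
   + 4 * (u + v) * b1 * b2 - 2 * b1 - 2 * b2.

Let f := crn_f u v lb h - w * (u + v).
Let p := crn_p u v mb kp - w * (v - u) / (u + v).
Let q := k - w / (u + v).

Lemma crn_V_sym : crn_V v u w (- mb) lb h (- kp) k = Vt.
Proof. by rewrite /Vt /crn_V /crn_p /crn_f; ring. Qed.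

Let rel2 : 2 * w * (lb - (u - v) * - mb) = 1.
Proof. by rewrite -[RHS]rel; ring. Qed.

(** The forms r_1^2 ds_1 and r_2^2 ds_2 appear divided by [u] and [v]. The poles cancel as on an
    edge, with quotients [crn_A] for both factors; the mixed term has no pole by [crn_s1] and
    [crn_t1]. *)
Lemma corner_metric_algebra (y x m1 n1 m2 n2 G g e1 e2 e1' e2' F : R) : Vt != 0 -> F != 0 ->
  y ^+ 2 = 4 * u * v -> m1 = mb - w -> m2 = mb + w ->
  m1 * x - n1 = lb - w * (v - u) -> m2 * x - n2 = lb + w * (v - u) ->
  G = 4 * (u + v) * (g - e1 * e1' / u - e2 * e2' / v) ->
  let phi e1 e2 := m1 * (e1 / u) + m2 * (e2 / v) in
  let psi e1 e2 := - (n1 * (e1 / u) + n2 * (e2 / v)) in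
  let S1 e1 e2 := (f - y * (y * q) - x * p) * phi e1 e2 - p * psi e1 e2 in
  let S2 e1 e2 := y * ((x * q - p) * phi e1 e2 + q * psi e1 e2) in
  let Vh := p ^+ 2 + y ^+ 2 * q ^+ 2 - f * q in
  (Vh * G + (S1 e1 e2 * S1 e1' e2' + S2 e1 e2 * S2 e1' e2') / Vh) / F =
  (4 * Vt * g + (A1 * (e1 * e1') + crn_B * (e1 * e2' + e2 * e1') + A2 * (e2 * e2')) / Vt) / F.
Proof.
move=> V0 F0 yY m1E m2E l1 l2 -> phi psi S1 S2 Vh.
have VhE : Vh = Vt / (u + v).
  by rewrite /Vt -crn_V_eq // -/f -/p -/q /Vh yY; field.
have [s11 t1] := (crn_s1 h kp k r0 rel, crn_t1 kp k r0 rel).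
have r0' : v + u != 0 by rewrite addrC.
have [s12 t2] := (crn_s1 h (- kp) k r0' rel2, crn_t1 (- kp) k r0' rel2).
have [fE qE] : crn_f v u lb h = crn_f u v lb h /\ v + u = u + v.
  by rewrite /crn_f; split; ring.
have pE : crn_p v u (- mb) (- kp) = - crn_p u v mb kp by rewrite /crn_p; ring.
rewrite fE pE qE -/f -/q -/d2 -/b2 in s12 t2; rewrite -/f -/p -/q -/d1 -/b1 in s11 t1.
have E1 e e' : S1 e e' = (- 1 + 4 * v * (u + v) * d1) / (u + v) * e
    + (1 - 4 * u * (u + v) * d2) / (u + v) * e'.
  (* The coefficient of the second angle is that of the first for the reflected data, so [crn_s1]
     applies to both. *)
  transitivity (((mb - w) * (f - 4 * u * v * q) - p * (lb - w * (v - u))) / u * e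
    - ((- mb - w) * (f - 4 * v * u * q)
       - (- crn_p u v mb kp - w * (u - v) / (u + v)) * (lb - w * (u - v))) / v * e').
    have -> : - crn_p u v mb kp - w * (u - v) / (u + v) = - p.
      by rewrite /p; field.
    rewrite -l1; have -> : lb - w * (u - v) = m2 * x - n2 by rewrite l2; ring.
    rewrite -m1E; have -> : - mb - w = - m2 by rewrite m2E; ring.
    by rewrite /S1 /phi /psi mulrA -expr2 yY; field; rewrite u0 v0.
  by rewrite s11 s12; field; rewrite u0 v0 r0.
have E2 e e' : S2 e e' = y * ((b1 - (2 * (u + v))^-1) * (e / u) + (b2 - (2 * (u + v))^-1) * (e' / v)).
  rewrite -t1 -t2.
  have -> : - crn_p u v mb kp - w * (u - v) / (u + v) = - p.
    by rewrite /p; field.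
  rewrite -l1; have -> : lb - w * (u - v) = m2 * x - n2 by rewrite l2; ring.
  rewrite -m1E; have -> : - mb - w = - m2 by rewrite m2E; ring.
  by rewrite /S2 /phi /psi; field; rewrite u0 v0.
have A1E := crn_A_eq h kp k rel; have A2E := crn_A_eq h (- kp) k rel2.
rewrite crn_V_sym -/A1 -/A2 -/d1 -/d2 -/b1 -/b2 -/Vt in A1E A2E.
have E3 : S2 e1 e2 * S2 e1' e2' = 4 * u * v *
   (((b1 - (2 * (u + v))^-1) * (e1 / u) + (b2 - (2 * (u + v))^-1) * (e2 / v))
   * ((b1 - (2 * (u + v))^-1) * (e1' / u) + (b2 - (2 * (u + v))^-1) * (e2' / v))).
  by rewrite !E2 -yY; ring.
have A1E' : A1 = (1 + v * (- 8 * u * d1 + 16 * u * v * (u + v) * d1 ^+ 2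
     + 4 * (u + v) * b1 ^+ 2 - 4 * b1) - 4 * Vt ^+ 2) / u by rewrite -A1E; field.
have A2E' : A2 = (1 + u * (- 8 * v * d2 + 16 * v * u * (v + u) * d2 ^+ 2
     + 4 * (v + u) * b2 ^+ 2 - 4 * b2) - 4 * Vt ^+ 2) / v by rewrite -A2E; field.
congr (_ / _); rewrite E3 !E1 VhE A1E' A2E' /crn_B.
move: Vt d1 d2 b1 b2 V0 => V D1 D2 B1 B2 V0.
field; by rewrite u0 v0 V0 r0.
Qed.

End CornerMetricSum.

(** * Pullback of the eigenfunction to a chart *)

Section BaseToric.
Variables (R : realType) (alpha : R) (e : nat -> int).
Hypothesis cf : has_modified_cf alpha e.
Hypothesis e3 : forall j, (1 <= j)%N -> 3 <= e j.
Local Notation V := 'rV[R]_4.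
Implicit Types v : V.

Lemma Ck_base n j : [/\ Ck n (base_dom alpha e j j) (base_f alpha e),
  Ck n (base_dom alpha e j j) (base_p alpha e) & Ck n (base_dom alpha e j j) (base_k alpha e)].
Proof.
have [s1 s2 s3 _ _] := smooth_pairs R.
by split; [have := Ck_pser cf e3 n (leqnn j) s1|have := Ck_pser cf e3 n (leqnn j) s2|
  have := Ck_pser cf e3 n (leqnn j) s3]; rewrite fam_diag.
Qed.

Lemma Ck_base_off n : [/\ Ck n (off_axis alpha) (base_f alpha e),
  Ck n (off_axis alpha) (base_p alpha e) & Ck n (off_axis alpha) (base_k alpha e)].
Proof.
have [Cf Cp Ckk] := Ck_base n 0.
have S : off_axis alpha `<=` base_dom alpha e 0 0 by move=> v; exact: off_axis_base.
by split; [exact: Ck_sub S Cf|exact: Ck_sub S Cp|exact: Ck_sub S Ckk].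
Qed.

Variables (U : set V) (be : V -> V) (phi psi : 'I_4 -> V -> R).
Hypothesis oU : open U.
Hypothesis Cbe : forall n k, Ck n U (fun v => be v 0 k).
Hypothesis beU : forall v, U v -> off_axis alpha (be v).

Definition base_td : toric_data R := ToricData (fun v => be v 0 o0)
  (fun v => Num.sqrt (ysq (be v))) phi psi (fun v => base_f alpha e (be v))
  (fun v => base_p alpha e (be v)) (fun v => base_k alpha e (be v)).

Let oO := @open_off_axis R alpha.

Lemma Ck_base_comp n : [/\ Ck n U (fun v => base_f alpha e (be v)),
  Ck n U (fun v => base_p alpha e (be v)) & Ck n U (fun v => base_k alpha e (be v))].
Proof.
have [Cf Cp Ckk] := Ck_base_off n.
by split; [exact: Ck_comp oO beU Cf (Cbe n)|exact: Ck_comp oO beU Cp (Cbe n)|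
  exact: Ck_comp oO beU Ckk (Cbe n)].
Qed.

Lemma partial_comp_be (F : V -> R) i v : U v -> Ck 1 (off_axis alpha) F ->
  partial i (fun u => F (be u)) v =
  \sum_k partial i (fun u => be u 0 k) v * partial k F (be v).
Proof.
move=> Uv CF.
have D k : is_derive v (delta_mx 0 i) (fun u => be u 0 k) (partial i (fun u => be u 0 k) v).
  by apply: derivableP; exact: (Ck_derivable (Cbe 1 k) Uv).
by rewrite partialE; have [_ ->] := is_derive_chain oO (beU Uv) CF D.
Qed.

Lemma ysq_be_gt0 v : U v -> 0 < ysq (be v). Proof. by move=> /beU[]. Qed.

Lemma Ck_ysq_be n : Ck n U (fun v => ysq (be v)).
Proof. exact: (Ck_comp oU (@openT V) (fun _ _ => I) (Ck_ysq n (@openT V)) (Cbe n)). Qed.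

Lemma Ck_y_be n : Ck n U (fun v => Num.sqrt (ysq (be v))).
Proof. by apply: Ck_sqrt => //; [exact: ysq_be_gt0|exact: Ck_ysq_be]. Qed.

(** The derivative is taken of y^2, which is polynomial in the components of [be]. *)
Lemma partial_y_be i v : U v ->
  Num.sqrt (ysq (be v)) * partial i (fun u => Num.sqrt (ysq (be u))) v =
  be v 0 o2 * partial i (fun u => be u 0 o2) v + be v 0 o3 * partial i (fun u => be u 0 o3) v.
Proof.
move=> Uv; have Cy := Ck_y_be 1; have C k := Cbe 1 k.
have E : partial i (fun u => Num.sqrt (ysq (be u)) * Num.sqrt (ysq (be u))) v =
  partial i (fun u => be u 0 o2 * be u 0 o2 + be u 0 o3 * be u 0 o3) v.
  by apply: (partial_eq_on i oU Uv) => u Uu; rewrite -!expr2 sqr_sqrtr // ysq_ge0.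
have Cs k : Ck 1 U (fun u => be u 0 k * be u 0 k) by exact: (Ck_mul oU (C k) (C k)).
rewrite (partial_mulE i Uv Cy Cy) (partial_addE i Uv (Cs o2) (Cs o3)) in E.
rewrite (partial_mulE i Uv (C o2) (C o2)) (partial_mulE i Uv (C o3) (C o3)) in E.
by move: E; lra.
Qed.

Lemma base_toric_axioms :
  (forall n i, Ck n U (phi i) /\ Ck n U (psi i)) ->
  (forall i j v, U v -> partial i (phi j) v = partial j (phi i) v /\
     partial i (psi j) v = partial j (psi i) v) ->
  (forall v, U v -> td_coframe base_td v \in unitmx) ->
  toric_axioms U base_td.
Proof.
move=> Cph cl un; have [Cf1 Cp1 Ck1] := Ck_base_off 1.
split=> //=.
- move=> n; have [? ? ?] := Ck_base_comp n; split=> //; exact: Ck_y_be.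
- move=> v Uv; have Ov := off_axis_base e 0 0 (beU Uv); split.
  + by rewrite sqrtr_gt0 ysq_be_gt0.
  + exact: base_f_gt0 cf e3 _ _ Ov.
  + rewrite /td_V /=; have f0 := base_f_gt0 cf e3 Ov; have k0 := base_k_lt0 cf e3 Ov.
    have := sqr_ge0 (base_p alpha e (be v)).
    have : 0 <= Num.sqrt (ysq (be v)) ^+ 2 * base_k alpha e (be v) ^+ 2.
      by rewrite mulr_ge0 // sqr_ge0.
    nra.
- move=> i v Uv; have Dv := beU Uv; rewrite (partial_comp_be i Uv Cf1) sum4E.
  rewrite !partial_base_f //=.
  transitivity (base_p alpha e (be v) * partial i (fun u => be u 0 o0) v
    + base_k alpha e (be v) * (Num.sqrt (ysq (be v)) * partial i (fun u => Num.sqrt (ysq (be u))) v)).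
    by rewrite partial_y_be //; ring.
  by ring.
- move=> v Uv; have Dv := beU Uv; set y := Num.sqrt (ysq (be v)).
  have y2 : y * y = ysq (be v) by rewrite -expr2 sqr_sqrtr // ysq_ge0.
  (* f_xx = y^2 Q, f_xy = - y X and f_yy = k - y^2 Q, with trace [k]. *)
  exists (ysq (be v) * base_Q alpha e (be v)), (- (y * base_X alpha e (be v))),
    (- (y * base_X alpha e (be v))),
    (base_k alpha e (be v) - ysq (be v) * base_Q alpha e (be v)).
  split; first by ring.
  move=> i; have yi := partial_y_be i Uv.
  have Hp : partial i (fun u => base_p alpha e (be u)) v =
      ysq (be v) * base_Q alpha e (be v) * partial i (fun u => be u 0 o0) v
      - y * base_X alpha e (be v) * partial i (fun u => Num.sqrt (ysq (be u))) v.
    rewrite (partial_comp_be i Uv Cp1) sum4E !partial_base_p //=.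
    rewrite [y * _]mulrC -[_ * y * _]mulrA yi; ring.
  have Hk : partial i (fun u => base_k alpha e (be u)) v =
      - base_X alpha e (be v) * partial i (fun u => be u 0 o0) v
      - base_Q alpha e (be v) * (y * partial i (fun u => Num.sqrt (ysq (be u))) v).
    rewrite (partial_comp_be i Uv Ck1) sum4E !partial_base_k //= yi; ring.
  have [_ _ Ckb] := Ck_base_comp 1.
  split; first by rewrite Hp; ring.
  rewrite (partial_mulE i Uv (Ck_y_be 1) Ckb) Hk -/y -y2; ring.
Qed.

End BaseToric.

Section AngleForm.
Variable R : realType.
Local Notation V := 'rV[R]_4.

Definition sqlen (k l : 'I_4) (v : V) : R := v 0 k ^+ 2 + v 0 l ^+ 2.

(* The components of the differential of the polar angle in the plane [(v_k, v_l)]. *)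
Definition angle_form (k l i : 'I_4) (v : V) : R :=
  ((i == l)%:R * v 0 k - (i == k)%:R * v 0 l) / sqlen k l v.

Variables (U : set V) (k l : 'I_4).
Hypothesis oU : open U.
Hypothesis U0 : forall v, U v -> 0 < sqlen k l v.

Let q0 v : U v -> sqlen k l v != 0. Proof. by move=> /U0; rewrite lt0r => /andP[]. Qed.
Let C1 n j : Ck n U (fun v : V => v 0 j). Proof. exact: Ck_coord. Qed.

Lemma Ck_sqlen n : Ck n U (sqlen k l).
Proof. by apply: Ck_add => //; apply: Ck_exp. Qed.

Let Cn n i : Ck n U (fun v : V => (i == l)%:R * v 0 k - (i == k)%:R * v 0 l).
Proof. by apply: Ck_sub_fun => //; apply: Ck_mul => //; exact: Ck_cst. Qed.

Lemma Ck_angle_form n i : Ck n U (angle_form k l i).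
Proof. by apply: Ck_div => //; exact: Ck_sqlen. Qed.

Lemma partial_sqlen j v : U v -> partial j (sqlen k l) v =
  2 * ((k == j)%:R * v 0 k + (l == j)%:R * v 0 l).
Proof.
move=> Uv; have -> : sqlen k l = fun v => v 0 k * v 0 k + v 0 l * v 0 l by [].
have Cs i : Ck 1 U (fun v : V => v 0 i * v 0 i) by exact: (Ck_mul oU (C1 1 i) (C1 1 i)).
rewrite (partial_addE j Uv (Cs k) (Cs l)) (partial_mulE j Uv (C1 1 k) (C1 1 k)).
by rewrite (partial_mulE j Uv (C1 1 l) (C1 1 l)) !partial_coord; ring.
Qed.

Lemma angle_form_closed i j v : U v ->
  partial j (angle_form k l i) v = partial i (angle_form k l j) v.
Proof.
move=> Uv.
have P i' j' : partial j' (angle_form k l i') v =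
  (((i' == l)%:R * (k == j')%:R - (i' == k)%:R * (l == j')%:R) * sqlen k l v
   - ((i' == l)%:R * v 0 k - (i' == k)%:R * v 0 l) *
     (2 * ((k == j')%:R * v 0 k + (l == j')%:R * v 0 l))) / sqlen k l v ^+ 2.
  rewrite (partial_divE oU j' Uv (Cn 1 i') (Ck_sqlen 1) q0) partial_sqlen //.
  have Cm (c : R) i1 : Ck 1 U (fun v : V => c * v 0 i1).
    by apply: Ck_mul => //; exact: Ck_cst.
  rewrite (partial_subE oU j' Uv (Cm _ k) (Cm _ l)).
  rewrite (partial_mulE j' Uv (Ck_cst U 1 _) (C1 1 k)).
  rewrite (partial_mulE j' Uv (Ck_cst U 1 _) (C1 1 l)) !partial_cst !partial_coord.
  by congr (_ / _); ring.
rewrite !P (eq_sym k j) (eq_sym l j) (eq_sym k i) (eq_sym l i) /sqlen; congr (_ / _); ring.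
Qed.

End AngleForm.

(** Smoothness follows the syntax of the function down to constants, coordinates and hypotheses. *)
Ltac ck oU :=
  lazymatch goal with
  | |- Ck _ _ (fun u => (@?f u - @?g u)%R) =>
      refine (Ck_sub_fun oU (f := f) (g := g) _ _); cbv beta; ck oU
  | |- Ck _ _ (fun u => (@?f u + @?g u)%R) =>
      refine (Ck_add oU (f := f) (g := g) _ _); cbv beta; ck oU
  | |- Ck _ _ (fun u => (@?f u * @?g u)%R) =>
      refine (Ck_mul oU (f := f) (g := g) _ _); cbv beta; ck oU
  | |- Ck _ _ (fun u => (- @?f u)%R) => refine (Ck_opp oU (f := f) _); cbv beta; ck oU
  | |- Ck _ _ (fun u => (@?f u ^+ ?k)%R) => refine (Ck_exp oU k (f := f) _); cbv beta; ck oU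
  | |- Ck ?n ?U (fun _ => ?c) => exact (@Ck_cst _ U n c)
  | |- Ck ?n ?U (fun u => fun_of_matrix u _ ?j) => exact (@Ck_coord _ U n j)
  | |- _ => try by []
  end.

Section Polar.
Variable R : realType.

Lemma polar (X Y : R) : exists r s, [/\ 0 <= r, X = r * cos s & Y = r * sin s].
Proof.
pose r := Num.sqrt (X ^+ 2 + Y ^+ 2).
have r2 : r ^+ 2 = X ^+ 2 + Y ^+ 2 by rewrite sqr_sqrtr // addr_ge0 // sqr_ge0.
have r0 : 0 <= r by exact: sqrtr_ge0.
have [rz|rn] := eqVneq r 0.
  have [-> ->] : X = 0 /\ Y = 0.
    rewrite rz in r2; have := sqr_ge0 X; have := sqr_ge0 Y => h1 h2.
    by split; apply/eqP; rewrite -sqrf_eq0; apply/eqP; move: r2; rewrite expr0n /=; lra.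
  by exists 0, 0; rewrite !mul0r.
have rp : 0 < r by rewrite lt0r rn.
have c1 : -1 <= X / r <= 1.
  rewrite ler_pdivlMr // ler_pdivrMr // mul1r mulN1r.
  have := sqr_ge0 Y; move: r2 r0; move: (Y ^+ 2) => y2; nra.
have cE : X = r * cos (acos (X / r)) by rewrite acosK ?in_itv //= mulrC divfK.
have sE : (r * sin (acos (X / r))) ^+ 2 = Y ^+ 2.
  by rewrite exprMn sin2cos2 mulrBr mulr1 -exprMn -cE r2; ring.
have := sE; move/eqP; rewrite eqf_sqr => /orP[/eqP E|/eqP E].
- by exists r, (acos (X / r)); split.
- by exists r, (- acos (X / r)); split=> //; rewrite ?cosN ?sinN // mulrN E opprK.
Qed.

End Polar.

(** * Charts, their domains and the density of the open stratum *)

Section Charts.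
Variables (R : realType) (alpha : R) (e : nat -> int).
Hypothesis cf : has_modified_cf alpha e.
Hypothesis e3 : forall j, (1 <= j)%N -> 3 <= e j.
Local Notation V := 'rV[R]_4.
Implicit Types (v : V) (c : chart).
Local Notation a := (corner R e).
Local Notation w := (wt R e).
Local Notation m := (mden R e).
Local Notation n_ := (nnum R e).
Local Notation sq01 := (sqlen o0 o1).
Local Notation sq23 := (sqlen o2 o3).

Lemma row4_eta v : v = row4 (v 0 o0) (v 0 o1) (v 0 o2) (v 0 o3).
Proof. by apply/rowP; elim/ord4_ind; rewrite mxE. Qed.

(** A point with the right x and y^2, which are all that the eigenfunction depends on. At a corner
    the last two components are those of 2 (v_0 + i v_1)(v_2 + i v_3), of modulus 2 r_1 r_2 = y; the
    map is polynomial in every chart. *)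
Definition ch_base c v : V :=
  match c with
  | Interior => row4 (v 0 o0) 0 (v 0 o1) 0
  | Edge j pq => v
  | Corner j => row4 (a j + (sq23 v - sq01 v)) 0 (2 * (v 0 o0 * v 0 o2 - v 0 o1 * v 0 o3))
      (2 * (v 0 o0 * v 0 o3 + v 0 o1 * v 0 o2))
  end.

Definition ch_x c v := ch_base c v 0 o0.
Definition ch_ysq c v := ysq (ch_base c v).

Lemma ch_ysq_corner j v : ch_ysq (Corner j) v = 4 * sq01 v * sq23 v.
Proof. by rewrite /ch_ysq /ysq /ch_base !mxE /= /sqlen; ring. Qed.

Lemma ch_ysq_interior v : ch_ysq Interior v = v 0 o1 ^+ 2.
Proof. by rewrite /ch_ysq /ysq /ch_base !mxE /=; ring. Qed.

Lemma Ck_ch_base c n (U : set V) k : open U -> Ck n U (fun v => ch_base c v 0 k).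
Proof.
move=> oU; case: c => [|j pq|j] /=.
- apply: (Ck_ext oU (f := match val k with 0 => fun v => v 0 o0 | 2 => fun v => v 0 o1 | _ => fun=> 0 end)).
    by move=> u _; rewrite mxE; elim/ord4_ind: k.
  by elim/ord4_ind: k => /=; ck oU.
- exact: Ck_coord.
- apply: (Ck_ext oU (f := match val k with
     | 0 => fun v => a j + ((v 0 o2 ^+ 2 + v 0 o3 ^+ 2) - (v 0 o0 ^+ 2 + v 0 o1 ^+ 2))
     | 1 => fun=> 0 | 2 => fun v => 2 * (v 0 o0 * v 0 o2 - v 0 o1 * v 0 o3)
     | _ => fun v => 2 * (v 0 o0 * v 0 o3 + v 0 o1 * v 0 o2) end)).
    by move=> u _; rewrite mxE; elim/ord4_ind: k.
  by elim/ord4_ind: k => /=; ck oU.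
Qed.

Lemma ch_base_cont c k : continuous (fun v => ch_base c v 0 k).
Proof. by move=> v; have C := Ck_ch_base c 0%N k (@openT V); exact: (Ck_cont C I). Qed.

Lemma Ck_ch_ysq c n (U : set V) : open U -> Ck n U (ch_ysq c).
Proof.
move=> oU; have C k := Ck_ch_base c n k oU.
by have -> : ch_ysq c = fun v => ch_base c v 0 o2 ^+ 2 + ch_base c v 0 o3 ^+ 2 by []; ck oU.
Qed.

Lemma ch_ysq_cont c : continuous (ch_ysq c).
Proof. by move=> v; have C := Ck_ch_ysq c 0%N (@openT V); exact: (Ck_cont C I). Qed.

Definition edge_basis j (pq : int * int) := `|(mn e j).1 * pq.2 - (mn e j).2 * pq.1| = 1 :> int.

Lemma has_coords_base c r v : has_coords e c r v ->
  ch_x c v = r.1.1 /\ ch_ysq c v = r.1.2 ^+ 2.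
Proof.
case: r => [[x y] z]; case: c => [|j pq|j] /=.
- by move=> ->; rewrite ch_ysq_interior /ch_x /= !mxE.
- move=> [s [t [_ ->]]]; rewrite /ch_x /ch_ysq /ysq /= !mxE /=; split=> //.
  by rewrite !exprMn -mulrDr cos2Dsin2 mulr1.
- move=> [r1 [r2 [s1 [s2 [[r10 r20] [xE yE] _ ->]]]]].
  rewrite ch_ysq_corner /ch_x /= /sqlen !mxE /= !exprMn -!mulrDr !cos2Dsin2 !mulr1 -xE yE.
  by split; ring.
Qed.

Lemma chart_dom_interior v : chart_dom alpha e Interior v <-> alpha < v 0 o0 /\ 0 < v 0 o1.
Proof.
split=> [[[[x y] z] /= ->]|H]; first by rewrite !mxE.
by exists ((v 0 o0, v 0 o1), (v 0 o2, v 0 o3)) => //=; exact: row4_eta.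
Qed.

Lemma chart_dom_edge j pq v : chart_dom alpha e (Edge j pq) v <->
  edge_basis j pq /\ edge_interior e j (v 0 o0).
Proof.
split=> [[[[x y] z] /= [s [t [_ ->]]] [H1 H2 _]]|[H1 H2]]; first by rewrite !mxE.
have [r [s [r0 E2 E3]]] := polar (v 0 o2) (v 0 o3).
exists ((v 0 o0, r), s *: vec R (mn e j) + v 0 o1 *: vec R pq) => /=; last by split.
by exists s, (v 0 o1); split=> //; rewrite -E2 -E3; exact: row4_eta.
Qed.

Lemma chart_dom_corner j v : chart_dom alpha e (Corner j) v <->
  a j.+1 < ch_x (Corner j) v /\ ((ch_x (Corner j) v)%:E < prev_corner R e j)%E.
Proof.
split=> [[r H [H1 H2 _]]|[H1 H2]]; first by have [-> _] := has_coords_base H.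
have [r1 [s1 [r10 E0 E1]]] := polar (v 0 o0) (v 0 o1).
have [r2 [s2 [r20 E2 E3]]] := polar (v 0 o2) (v 0 o3).
have xE : ch_x (Corner j) v = a j + (r2 ^+ 2 - r1 ^+ 2).
  rewrite /ch_x /= mxE /= /sqlen E0 E1 E2 E3 !exprMn -!mulrDr !cos2Dsin2; ring.
exists ((ch_x (Corner j) v, 2 * r1 * r2), s1 *: vec R (mn e j) + s2 *: vec R (mn e j.+1)) => /=.
  exists r1, r2, s1, s2; split=> //; first by rewrite xE; split=> //; ring.
  by rewrite -E0 -E1 -E2 -E3; exact: row4_eta.
by split=> //; rewrite !mulr_ge0.
Qed.

Lemma chart_dom_gt c v : chart_dom alpha e c v -> alpha < ch_x c v.
Proof.
case: c => [|j pq|j].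
- by move/chart_dom_interior => []; rewrite /ch_x mxE.
- by move/chart_dom_edge => [_ [H _]]; apply: lt_trans H; exact: corner_gt.
- by move/chart_dom_corner => []; move=> H _; apply: lt_trans H; exact: corner_gt.
Qed.

Lemma open_lt_prev_fun (F : V -> R) j : continuous F ->
  open [set v : V | ((F v)%:E < prev_corner R e j)%E].
Proof.
move=> cF; case: j => [|j].
  by rewrite (_ : mkset _ = setT); [exact: openT|apply/seteqP; split=> // v _ /=; rewrite ltry].
rewrite (_ : mkset _ = [set v : V | F v < a j]); first exact: open_lt_fun.
by apply/seteqP; split=> v /=; rewrite lte_fin.
Qed.

Lemma open_chart_dom c : open (chart_dom alpha e c).
Proof.
case: c => [|j pq|j].
- have -> : chart_dom alpha e Interior = [set v : V | alpha < v 0 o0] `&` [set v : V | 0 < v 0 o1].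
    by apply/seteqP; split=> v; rewrite chart_dom_interior.
  by apply: openI; apply: open_gt_fun; exact: coord_cont.
- have -> : chart_dom alpha e (Edge j pq) = [set v : V | edge_basis j pq] `&`
      ([set v : V | a j < v 0 o0] `&` [set v : V | ((v 0 o0)%:E < prev_corner R e j)%E]).
    by apply/seteqP; split=> v; rewrite chart_dom_edge.
  apply: openI; last by apply: openI; [apply: open_gt_fun; exact: coord_cont|exact: open_lt_prev].
  by have [H|H] := pselect (edge_basis j pq); [rewrite (_ : mkset _ = setT); [exact: openT|]
    |rewrite (_ : mkset _ = set0); [exact: open0|]]; apply/seteqP; split.
- have -> : chart_dom alpha e (Corner j) = [set v : V | a j.+1 < ch_x (Corner j) v]
      `&` [set v : V | ((ch_x (Corner j) v)%:E < prev_corner R e j)%E].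
    by apply/seteqP; split=> v; rewrite chart_dom_corner.
  have cx : continuous (ch_x (Corner j)) by exact: ch_base_cont.
  by apply: openI; [exact: open_gt_fun|exact: open_lt_prev_fun].
Qed.

Lemma chart_base_dom_edge j pq v : chart_dom alpha e (Edge j pq) v -> base_dom alpha e j j v.
Proof.
move=> /[dup] /chart_dom_gt; rewrite /ch_x /= => v0 /chart_dom_edge[_ [H1 H2]].
by split=> //; right.
Qed.

Lemma chart_base_dom_corner j v : chart_dom alpha e (Corner j) v ->
  base_dom alpha e j j.+1 (ch_base (Corner j) v).
Proof. by move=> /[dup] /chart_dom_gt v0 /chart_dom_corner H; split=> //; right. Qed.

Lemma chart_off_axis c v : chart_dom alpha e c v -> 0 < ch_ysq c v ->
  off_axis alpha (ch_base c v).
Proof. by move=> /chart_dom_gt. Qed.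

Lemma off_axis_dense c v r : chart_dom alpha e c v -> 0 < r ->
  exists2 u, `|u - v| <= r & 0 < ch_ysq c u.
Proof.
(* [pm x] has length [r] and points away from 0, so [x + pm x] is never 0. *)
move=> Dv r0; pose pm (x : R) := if 0 <= x then r else - r.
have pmE x : `|pm x| = r by rewrite /pm; case: ifP => _; rewrite ?normrN gtr0_norm.
have pmN x : x + pm x != 0.
  by rewrite /pm; case: leP => x0; [rewrite gt_eqF //|rewrite lt_eqF //]; lra.
have r00 := ltW r0.
case: c Dv => [|j pq|j] Dv.
- exists v; first by rewrite subrr normr0.
  by rewrite ch_ysq_interior exprn_gt0 //; have [] := (chart_dom_interior v).1 Dv.
- exists (v + row4 0 0 (pm (v 0 o2)) 0).
    rewrite addrAC subrr add0r; apply: norm_le_coord => // i; rewrite mxE.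
    by elim/ord4_ind: i => /=; rewrite ?normr0 ?pmE.
  rewrite /ch_ysq /ysq /= !mxE /=; apply: ltr_pwDl; last exact: sqr_ge0.
  by rewrite lt0r sqr_ge0 sqrf_eq0 pmN.
- exists (v + row4 (pm (v 0 o0)) 0 (pm (v 0 o2)) 0).
    rewrite addrAC subrr add0r; apply: norm_le_coord => // i; rewrite mxE.
    by elim/ord4_ind: i => /=; rewrite ?normr0 ?pmE.
  rewrite ch_ysq_corner /sqlen !mxE /= !mulr_gt0 //; apply: ltr_pwDl; try exact: sqr_ge0;
  by rewrite lt0r sqr_ge0 sqrf_eq0 pmN.
Qed.

(** A closed condition on continuous functions passes from the part off the axis to the whole chart.
    Curvature, isometries and the Lipschitz bounds are extended in this way. *)
Lemma dense_ge0 c v (F : V -> R) : chart_dom alpha e c v -> {for v, continuous F} ->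
  (forall u, chart_dom alpha e c u -> 0 < ch_ysq c u -> 0 <= F u) -> 0 <= F v.
Proof.
move=> Dv cF H; rewrite leNgt; apply/negP => Fv.
have N : \forall u \near v, chart_dom alpha e c u /\ F u < 0.
  apply: filterI; first by apply: open_nbhs_nbhs; split=> //; exact: open_chart_dom.
  exact: (cvgr_lt (F v) cF).
move: N => /nbhs_ballP[r /= r0 Br].
have [|u uv yu] := @off_axis_dense c v (r / 2) Dv; first by rewrite divr_gt0.
have [Du Fu] : chart_dom alpha e c u /\ F u < 0.
  by apply: Br; rewrite -ball_normE /= distrC; apply: le_lt_trans uv _; lra.
by move: Fu; rewrite ltNge H.
Qed.

Lemma dense_eq0 c v (F : V -> R) : chart_dom alpha e c v -> {for v, continuous F} ->
  (forall u, chart_dom alpha e c u -> 0 < ch_ysq c u -> F u = 0) -> F v = 0.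
Proof.
move=> Dv cF H; apply/eqP; rewrite eq_le; apply/andP; split.
  rewrite -oppr_ge0; apply: (dense_ge0 (F := fun u => - F u) Dv); first exact: continuousN.
  by move=> u Du yu; rewrite H // oppr0.
by apply: (dense_ge0 Dv cF) => u Du yu; rewrite H.
Qed.

End Charts.

Section ChartData.
Variables (R : realType) (alpha : R) (e : nat -> int).
Hypothesis cf : has_modified_cf alpha e.
Hypothesis e3 : forall j, (1 <= j)%N -> 3 <= e j.
Local Notation V := 'rV[R]_4.
Implicit Types (v : V) (c : chart).
Local Notation a := (corner R e).
Local Notation w := (wt R e).
Local Notation m := (mden R e).
Local Notation n_ := (nnum R e).
Local Notation sq01 := (sqlen o0 o1).
Local Notation sq23 := (sqlen o2 o3).
Local Notation dom := (chart_dom alpha e).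

(** The forms are dz_1 and - dz_2. With this sign [psi + x phi] takes on the collapsed vector (m_j,
    n_j) the value m_j x - n_j of [f] on the edge. *)
Definition ch_phi c (i : 'I_4) v : R :=
  match c with
  | Interior => (i == o2)%:R
  | Edge j pq => m j * angle_form o2 o3 i v + pq.1%:~R * (i == o1)%:R
  | Corner j => m j * angle_form o0 o1 i v + m j.+1 * angle_form o2 o3 i v
  end.

Definition ch_psi c (i : 'I_4) v : R :=
  match c with
  | Interior => - (i == o3)%:R
  | Edge j pq => - (n_ j * angle_form o2 o3 i v + pq.2%:~R * (i == o1)%:R)
  | Corner j => - (n_ j * angle_form o0 o1 i v + n_ j.+1 * angle_form o2 o3 i v)
  end.

Definition ch_td c := base_td alpha e (ch_base e c) (ch_phi c) (ch_psi c).

Definition off_dom c : set V := [set v : V | dom c v /\ 0 < ch_ysq e c v].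

Lemma open_off_dom c : open (off_dom c).
Proof.
have -> : off_dom c = dom c `&` [set v : V | 0 < ch_ysq e c v] by [].
by apply: openI; [exact: open_chart_dom|apply: open_gt_fun; exact: ch_ysq_cont].
Qed.

Lemma off_dom_base c v : off_dom c v -> off_axis alpha (ch_base e c v).
Proof. by move=> [Dv y0]; exact: chart_off_axis. Qed.

Lemma off_dom_edge j pq v : off_dom (Edge j pq) v -> 0 < sq23 v.
Proof. by case. Qed.

Lemma off_dom_corner j v : off_dom (Corner j) v -> 0 < sq01 v /\ 0 < sq23 v.
Proof.
move=> [_]; rewrite ch_ysq_corner.
have : 0 <= sq01 v by rewrite addr_ge0 ?sqr_ge0.
have : 0 <= sq23 v by rewrite addr_ge0 ?sqr_ge0.
by move: (sq01 v) (sq23 v) => s t *; split; nra.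
Qed.

Let Cc n U (r : R) : Ck n U (fun _ : V => r). Proof. exact: Ck_cst. Qed.

Lemma Ck_ch_forms c n i : Ck n (off_dom c) (ch_phi c i) /\ Ck n (off_dom c) (ch_psi c i).
Proof.
have oU := @open_off_dom c; case: c oU => [|j pq|j] oU /=.
- by split; exact: Cc.
- have C := Ck_angle_form oU (@off_dom_edge j pq) n i.
  by split; rewrite /ch_phi /ch_psi; ck oU.
- have C1 := Ck_angle_form oU (fun v H => (@off_dom_corner j v H).1) n i.
  have C2 := Ck_angle_form oU (fun v H => (@off_dom_corner j v H).2) n i.
  by split; rewrite /ch_phi /ch_psi; ck oU.
Qed.

Lemma partial_lin (U : set V) (x y : R) (f g : V -> R) i v : open U -> U v ->
  Ck 1 U f -> Ck 1 U g ->
  partial i (fun u => x * f u + y * g u) v = x * partial i f v + y * partial i g v.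
Proof.
move=> oU Uv Cf Cg.
have C1 : Ck 1 U (fun u => x * f u) by ck oU.
have C2 : Ck 1 U (fun u => y * g u) by ck oU.
rewrite (partial_addE i Uv C1 C2) (partial_mulE i Uv (Ck_cst U 1 x) Cf).
by rewrite (partial_mulE i Uv (Ck_cst U 1 y) Cg) !partial_cst !mul0r !add0r.
Qed.

Lemma ch_forms_closed c i j v : off_dom c v ->
  partial i (ch_phi c j) v = partial j (ch_phi c i) v /\
  partial i (ch_psi c j) v = partial j (ch_psi c i) v.
Proof.
have oU := @open_off_dom c; case: c oU => [|k pq|k] oU Uv.
- by split; rewrite !partial_cst.
- have C l := Ck_angle_form oU (@off_dom_edge k pq) 1 l.
  have cl := angle_form_closed oU (@off_dom_edge k pq) _ _ Uv.
  have P x y l l' : partial l (fun u => x * angle_form o2 o3 l' u + y * (l' == o1)%:R) v =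
      x * partial l (angle_form o2 o3 l') v.
    by rewrite (partial_lin x y l oU Uv (C l') (Cc 1 _ _)) partial_cst mulr0 addr0.
  have CC x y l' : Ck 1 (off_dom (Edge k pq))
     (fun u => x * angle_form o2 o3 l' u + y * (l' == o1)%:R) by ck oU.
  split; first by rewrite /ch_phi !P (cl i j).
  by rewrite /ch_psi !(partial_opp _ Uv (CC _ _ _)) !P (cl i j).
- have C1 l := Ck_angle_form oU (fun v H => (@off_dom_corner k v H).1) 1 l.
  have C2 l := Ck_angle_form oU (fun v H => (@off_dom_corner k v H).2) 1 l.
  have cl1 := angle_form_closed oU (fun v H => (@off_dom_corner k v H).1) _ _ Uv.
  have cl2 := angle_form_closed oU (fun v H => (@off_dom_corner k v H).2) _ _ Uv.
  have CC x y l' : Ck 1 (off_dom (Corner k))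
     (fun u => x * angle_form o0 o1 l' u + y * angle_form o2 o3 l' u) by ck oU.
  split; first by rewrite /ch_phi !(partial_lin _ _ _ oU Uv (C1 _) (C2 _)) (cl1 i j) (cl2 i j).
  rewrite /ch_psi !(partial_opp _ Uv (CC _ _ _)).
  by rewrite !(partial_lin _ _ _ oU Uv (C1 _) (C2 _)) (cl1 i j) (cl2 i j).
Qed.

Definition dx_form c (i : 'I_4) v : R :=
  match c with
  | Interior => (i == o0)%:R
  | Edge _ _ => (i == o0)%:R
  | Corner _ => 2 * ((i == o2)%:R * v 0 o2 + (i == o3)%:R * v 0 o3
                     - ((i == o0)%:R * v 0 o0 + (i == o1)%:R * v 0 o1))
  end.

(** The form y dy is half the differential of y^2, so it is polynomial in the coordinates, unlike
    dy. *)
Definition ydy_form c (i : 'I_4) v : R :=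
  match c with
  | Interior => v 0 o1 * (i == o1)%:R
  | Edge _ _ => (i == o2)%:R * v 0 o2 + (i == o3)%:R * v 0 o3
  | Corner _ => 4 * (sq23 v * ((i == o0)%:R * v 0 o0 + (i == o1)%:R * v 0 o1)
                     + sq01 v * ((i == o2)%:R * v 0 o2 + (i == o3)%:R * v 0 o3))
  end.

Lemma partial_ch_x c i v : partial i (fun u => ch_base e c u 0 o0) v = dx_form c i v.
Proof.
have oU := @openT V; have Tv : [set: V] v by [].
case: c => [|j pq|j].
- rewrite (partial_eq_on i oU Tv (g := fun u : V => u 0 o0)); last by move=> u _; rewrite mxE.
  by rewrite partial_coord eq_sym.
- by rewrite partial_coord eq_sym.
- have Cs (k l : 'I_4) : Ck 1 [set: V] (sqlen k l) by exact: Ck_sqlen.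
  have Cd : Ck 1 setT (fun u : V => sq23 u - sq01 u) by ck oU.
  rewrite (partial_eq_on i oU Tv (g := fun u : V => a j + (sq23 u - sq01 u))); last first.
    by move=> u _; rewrite mxE.
  rewrite (partial_addE i Tv (Cc 1 _ _) Cd) partial_cst add0r (partial_subE oU i Tv (Cs _ _) (Cs _ _)).
  rewrite !(partial_sqlen _ _ oU _ Tv) /=.
  by rewrite !(eq_sym _ i); ring.
Qed.

Lemma partial_ch_y c i v : off_dom c v ->
  Num.sqrt (ch_ysq e c v) * partial i (fun u => Num.sqrt (ysq (ch_base e c u))) v = ydy_form c i v.
Proof.
move=> Uv; have oU := @open_off_dom c.
have Cb n k : Ck n (off_dom c) (fun u => ch_base e c u 0 k) by exact: Ck_ch_base.
rewrite (partial_y_be oU Cb (@off_dom_base c) i Uv).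
have Tv : [set: V] v by []. have oT := @openT V.
have Cm k l : Ck 1 setT (fun u : V => u 0 k * u 0 l) by apply: Ck_mul => //; exact: Ck_coord.
have Pm k l : partial i (fun u : V => u 0 k * u 0 l) v = (i == k)%:R * v 0 l + v 0 k * (i == l)%:R.
  rewrite (partial_mulE i Tv (Ck_coord setT 1 k) (Ck_coord setT 1 l)) !partial_coord.
  by rewrite !(eq_sym _ i).
case: c Uv oU Cb => [|j pq|j] Uv oU Cb.
- rewrite (partial_eq_on i oT Tv (g := fun u : V => u 0 o1)); last by move=> u _; rewrite mxE.
  rewrite (partial_eq_on i oT Tv (f := fun u => ch_base e Interior u 0 o3) (g := fun u : V => 0)); last by move=> u _; rewrite mxE.
  by rewrite partial_coord partial_cst !mxE /= mulr0 addr0 eq_sym.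
- by rewrite !partial_coord /= !(eq_sym _ i) mulrC [v 0 o3 * _]mulrC.
- have E2 : partial i (fun u => ch_base e (Corner j) u 0 o2) v =
      partial i (fun u : V => 2 * (u 0 o0 * u 0 o2) + - 2 * (u 0 o1 * u 0 o3)) v.
    by apply: (partial_eq_on i oT Tv) => u _; rewrite mxE /=; ring.
  have E3 : partial i (fun u => ch_base e (Corner j) u 0 o3) v =
      partial i (fun u : V => 2 * (u 0 o0 * u 0 o3) + 2 * (u 0 o1 * u 0 o2)) v.
    by apply: (partial_eq_on i oT Tv) => u _; rewrite mxE /=; ring.
  rewrite E2 E3 !(partial_lin _ _ i oT Tv (Cm _ _) (Cm _ _)) !Pm !mxE /= /sqlen; ring.
Qed.

Lemma coframe_det c v : off_dom c v -> Num.sqrt (ch_ysq e c v) * \det (td_coframe (ch_td c) v) =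
  match c with
  | Interior => - v 0 o1
  | Edge j pq => - (m j * pq.2%:~R - n_ j * pq.1%:~R)
  | Corner j => - 8 * (sq01 v + sq23 v)
  end.
Proof.
move=> Uv; have y0 : Num.sqrt (ch_ysq e c v) != 0 by rewrite sqrtr_eq0 -ltNge; case: Uv.
have dx i := partial_ch_x c i v; have dy i := partial_ch_y i Uv.
rewrite det4E !mxE /= !dx.
have dy' i : partial i (fun u => Num.sqrt (ysq (ch_base e c u))) v =
   ydy_form c i v / Num.sqrt (ch_ysq e c v) by rewrite -dy mulrC mulKf.
rewrite !dy'; move: (Num.sqrt _) y0 {dx dy dy'} => y y0.
case: c Uv => [|j pq|j] Uv; rewrite /dx_form /ydy_form /ch_phi /ch_psi /=.
- by field.
- have := off_dom_edge Uv; rewrite /angle_form /sqlen /= => s0.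
  by field; rewrite y0 gt_eqF.
- have [s0 t0] := off_dom_corner Uv; have d := mn_det R e3 j.
  rewrite /angle_form /=.
  transitivity (- 8 * (sq01 v + sq23 v) * (m j * n_ j.+1 - m j.+1 * n_ j)); last by rewrite d mulr1.
  rewrite /sqlen in s0 t0 *; field; by rewrite y0 !gt_eqF.
Qed.

(** The sign of dx, dy, dz_1, - dz_2 against the coordinates. For an edge chart it is minus the
    determinant of the lattice vectors, which is 1 or -1 when they form a basis of Z^2. *)
Definition orient c : R :=
  match c with Edge j pq => - (m j * pq.2%:~R - n_ j * pq.1%:~R) | _ => -1 end.

Lemma edge_basis_real j pq : edge_basis e j pq ->
  m j * pq.2%:~R - n_ j * pq.1%:~R = 1 \/ m j * pq.2%:~R - n_ j * pq.1%:~R = -1 :> R.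
Proof.
rewrite /edge_basis -!intrM -intrB; set X := (_ - _ : int); have [H|H] := lerP 0 X.
  by rewrite ger0_norm // => ->; left.
by rewrite ltr0_norm // => /(congr1 -%R); rewrite opprK => ->; right; rewrite intrN.
Qed.

Lemma orient_sign c v : dom c v -> orient c = 1 \/ orient c = -1.
Proof.
case: c => [_|j pq /chart_dom_edge[/edge_basis_real H _]|j _]; [by right| |by right].
by rewrite /orient; case: H => ->; [right|left; rewrite opprK].
Qed.

Lemma coframe_sg c v : off_dom c v -> Num.sg (\det (td_coframe (ch_td c) v)) = orient c.
Proof.
move=> Uv; have y0 : 0 < Num.sqrt (ch_ysq e c v) by rewrite sqrtr_gt0; case: Uv.
have := congr1 Num.sg (coframe_det Uv); rewrite sgrM gtr0_sg // mul1r => ->.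
case: c Uv {y0} => [|j pq|j] Uv /=.
- have [_ H] := (chart_dom_interior alpha e v).1 Uv.1.
  by rewrite sgrN gtr0_sg.
- by have [] := orient_sign Uv.1 => /= ->; rewrite ?sgr1 ?sgrN1.
- have [s0 t0] := off_dom_corner Uv; rewrite ltr0_sg // mulNr oppr_lt0 mulr_gt0 // addr_gt0 //.
Qed.

Lemma ch_toric c : toric_axioms (off_dom c) (ch_td c).
Proof.
apply: (base_toric_axioms cf e3).
- exact: open_off_dom.
- by move=> n k; apply: Ck_ch_base; exact: open_off_dom.
- exact: off_dom_base.
- by move=> n i; exact: Ck_ch_forms.
- by move=> i j v; exact: ch_forms_closed.
- move=> v Uv; rewrite unitmxE unitfE -sgr_eq0 coframe_sg //.
  by have [->|->] := orient_sign Uv.1; rewrite ?oppr_eq0 oner_eq0.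
Qed.

End ChartData.

(** * The metric up to the axis *)

Section ChartMetric.
Variables (R : realType) (alpha : R) (e : nat -> int).
Hypothesis cf : has_modified_cf alpha e.
Hypothesis e3 : forall j, (1 <= j)%N -> 3 <= e j.
Local Notation V := 'rV[R]_4.
Implicit Types (v : V) (c : chart).
Local Notation a := (corner R e).
Local Notation w := (wt R e).
Local Notation m := (mden R e).
Local Notation n_ := (nnum R e).
Local Notation sq01 := (sqlen o0 o1).
Local Notation sq23 := (sqlen o2 o3).
Local Notation dom := (chart_dom alpha e).
Local Notation td c := (ch_td alpha e c).

Definition fam_h J1 J2 := pser alpha e (@hright R) (fam (@hright R) (@hleft R) J1 J2).
Definition fam_kap J1 J2 := pser alpha e (@kright R) (fam (@kright R) (@kleft R) J1 J2).
Definition fam_k J1 J2 := pser alpha e (@invr_rad R) (fam (@invr_rad R) (@invr_rad R) J1 J2).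

Lemma Ck_fam n J1 J2 : (J1 <= J2)%N -> [/\ Ck n (base_dom alpha e J1 J2) (fam_h J1 J2),
  Ck n (base_dom alpha e J1 J2) (fam_kap J1 J2) & Ck n (base_dom alpha e J1 J2) (fam_k J1 J2)].
Proof.
have [_ _ s3 s4 s5] := smooth_pairs R => J12.
by split; [exact: (Ck_pser cf e3 n J12 s4)|exact: (Ck_pser cf e3 n J12 s5)|exact: (Ck_pser cf e3 n J12 s3)].
Qed.

Section EdgeMetric.
Variables (j : nat) (pq : int * int).

Definition eH v := fam_h j j v.
Definition eKp v := fam_kap j j v.
Definition eK v := fam_k j j v.
Definition eF v := m j * v 0 o0 - n_ j + ysq v * eH v.
Definition eP v := m j + ysq v * eKp v.
Definition eV v := eP v ^+ 2 + ysq v * eK v ^+ 2 - eF v * eK v.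
(** The form y^2 ds, with s the angle in the plane of coordinates 2 and 3; it is smooth on the axis
    and vanishes there. *)
Definition eeta (i : 'I_4) v : R := (i == o3)%:R * v 0 o2 - (i == o2)%:R * v 0 o3.
Definition eA v := edge_A (v 0 o0) (ysq v) (m j) (n_ j) (eH v) (eKp v) (eK v).
Definition eB v := edge_B (v 0 o0) (ysq v) (m j) (n_ j) pq.1%:~R pq.2%:~R (eH v) (eKp v) (eK v).
Definition eC v := edge_C (v 0 o0) (ysq v) (m j) (n_ j) pq.1%:~R pq.2%:~R (eH v) (eKp v) (eK v).

(** The pole-free side of [edge_metric_algebra], in the coordinates (x, t, y e^(is)). *)
Definition met_edge v : 'M[R]_4 := \matrix_(i, k)
  ((eV v * ((i == o0)%:R * (k == o0)%:R + ((i == o2)%:R * (k == o2)%:R + (i == o3)%:R * (k == o3)%:R))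
    + (eA v * (eeta i v * eeta k v)
       + eB v * (eeta i v * (k == o1)%:R + (i == o1)%:R * eeta k v)
       + eC v * ((i == o1)%:R * (k == o1)%:R)) / eV v) / eF v ^+ 2).

Let D := dom (Edge j pq).

Lemma edge_base_eq v : D v ->
  [/\ base_f alpha e v = eF v, base_p alpha e v = eP v & base_k alpha e v = eK v].
Proof.
move=> /(chart_base_dom_edge cf e3) Dv.
have H1 := rad_expand cf e3 (leqnn j) Dv; have H2 := cosr_expand cf e3 (leqnn j) Dv.
rewrite fam_diag lin_edge in H1; rewrite fam_diag linc_edge in H2.
by split=> //; rewrite /eK /fam_k fam_diag.
Qed.

Lemma edge_pos v : D v -> [/\ 0 < eF v, eK v < 0 & 0 < eV v].
Proof.
move=> Dv; have Bv := chart_base_dom_edge cf e3 Dv.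
have [fE pE kE] := edge_base_eq Dv; rewrite /eV -fE -pE -kE.
have f0 := base_f_gt0 cf e3 Bv; have k0 := base_k_lt0 cf e3 Bv; split=> //.
have := sqr_ge0 (base_p alpha e v).
have : 0 <= ysq v * base_k alpha e v ^+ 2 by rewrite mulr_ge0 ?ysq_ge0 // sqr_ge0.
nra.
Qed.

Let oD : open D. Proof. exact: open_chart_dom. Qed.

Lemma Ck_met_edge n i k : Ck n D (fun v => met_edge v i k).
Proof.
have S : D `<=` base_dom alpha e j j by move=> v /(chart_base_dom_edge cf e3).
have [C1 C2 C3] := Ck_fam n (leqnn j).
have CH : Ck n D eH by exact: Ck_sub S C1.
have CKp : Ck n D eKp by exact: Ck_sub S C2.
have CK : Ck n D eK by exact: Ck_sub S C3.
have CY : Ck n D (@ysq R) by exact: Ck_ysq.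
have CF : Ck n D eF by rewrite /eF; ck oD.
have CP : Ck n D eP by rewrite /eP; ck oD.
have CV : Ck n D eV by rewrite /eV; ck oD.
have CA : Ck n D eA by rewrite /eA /edge_A /edge_c /edge_d; ck oD.
have CB : Ck n D eB by rewrite /eB /edge_B /edge_d /edge_b /edge_s1t /edge_taut; ck oD.
have CC : Ck n D eC by rewrite /eC /edge_C /edge_s1t /edge_taut; ck oD.
have Cet l : Ck n D (eeta l) by rewrite /eeta; ck oD.
have V0 v : D v -> eV v != 0 by move=> /edge_pos[_ _]; rewrite lt0r => /andP[].
have F0 v : D v -> eF v ^+ 2 != 0.
  by move=> /edge_pos[]; rewrite lt0r expf_eq0 /= => /andP[].
have CVi : Ck n D (fun v => (eV v)^-1) by exact: (Ck_inv oD V0 CV).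
have CF2 : Ck n D (fun v => eF v ^+ 2) by exact: (Ck_exp oD 2 CF).
have CFi : Ck n D (fun v => (eF v ^+ 2)^-1) by exact: (Ck_inv oD F0 CF2).
apply: (Ck_ext oD (f := fun v => (eV v * ((i == o0)%:R * (k == o0)%:R + ((i == o2)%:R * (k == o2)%:R + (i == o3)%:R * (k == o3)%:R))
    + (eA v * (eeta i v * eeta k v)
       + eB v * (eeta i v * (k == o1)%:R + (i == o1)%:R * eeta k v)
       + eC v * ((i == o1)%:R * (k == o1)%:R)) / eV v) / eF v ^+ 2)).
  by move=> v _; rewrite mxE.
ck oD.
Qed.

Lemma met_edge_td v : off_dom alpha e (Edge j pq) v -> met_edge v = td_metric (td (Edge j pq)) v.
Proof.
move=> Uv; have [Dv Y0] := Uv; have [fE pE kE] := edge_base_eq Dv.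
have [f0 _ V0] := edge_pos Dv.
have y2 : Num.sqrt (ysq v) ^+ 2 = ysq v by rewrite sqr_sqrtr // ysq_ge0.
have y0 : Num.sqrt (ysq v) != 0 by rewrite sqrtr_eq0 -ltNge.
have Yn : ysq v != 0 by rewrite gt_eqF.
apply/matrixP => i k; rewrite !mxE /td_V /td_s1 /td_s2 /= fE pE kE.
have dx l : partial l (fun u : V => u 0 o0) v = (l == o0)%:R.
  exact: (partial_ch_x e (Edge j pq) l v).
rewrite !dx y2.
have dy l : partial l (fun u => Num.sqrt (ysq u)) v =
   ydy_form (Edge j pq) l v / Num.sqrt (ysq v).
  by rewrite -(partial_ch_y cf e3 l Uv) mulrC mulKf.
rewrite !dy /ch_phi /ch_psi.
have ang l : angle_form o2 o3 l v = eeta l v / ysq v by [].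
rewrite !ang.
have yyE : ydy_form (Edge j pq) i v / Num.sqrt (ysq v) * (ydy_form (Edge j pq) k v / Num.sqrt (ysq v))
   = ((i == o2)%:R * (k == o2)%:R + (i == o3)%:R * (k == o3)%:R) - eeta i v * eeta k v / ysq v.
  rewrite mulrACA -invfM -expr2 y2 /ydy_form /eeta; apply: (mulIf Yn).
  rewrite mulrBl !divfK // /ysq; ring.
symmetry.
exact: (edge_metric_algebra (x := v 0 o0) (Y := ysq v) (m := m j) (n := n_ j) pq.1%:~R pq.2%:~R
  (h := eH v) (kp := eKp v) (k := eK v) (y := Num.sqrt (ysq v)) ((i == o0)%:R * (k == o0)%:R)
  (i == o1)%:R (k == o1)%:R Yn (lt0r_neq0 V0) (lt0r_neq0 f0) y2 yyE).
Qed.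

Lemma met_edge_sym v : (met_edge v)^T = met_edge v.
Proof. by apply/matrixP => i k; rewrite !mxE; congr ((_ * _ + _ / _) / _); ring. Qed.

(** On the axis [eeta] vanishes and the coefficient of dt^2 is the squared determinant of the
    lattice basis, hence 1. *)
Lemma met_edge_pos0 v (z : V) : D v -> ysq v = 0 -> z != 0 -> 0 < (z *m met_edge v *m z^T) 0 0.
Proof.
move=> Dv Y0 z0; have [f0 _ V0] := edge_pos Dv.
have [bas _] := (chart_dom_edge alpha e j pq v).1 Dv.
have [z2 z3] : v 0 o2 = 0 /\ v 0 o3 = 0.
  move: Y0; rewrite /ysq => Y0; have := sqr_ge0 (v 0 o2); have := sqr_ge0 (v 0 o3) => h1 h2.
  by split; apply/eqP; rewrite -sqrf_eq0; apply/eqP; lra.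
have C1 : eC v = 1.
  rewrite /eC /edge_C /edge_s1t /edge_taut Y0 !mul0r !addr0 !subr0.
  have -> : (m j * v 0 o0 - n_ j - v 0 o0 * m j) * pq.1%:~R + m j * pq.2%:~R =
     m j * pq.2%:~R - n_ j * pq.1%:~R by ring.
  by have [->|->] := edge_basis_real R bas; rewrite ?sqrrN expr1n.
have -> : (z *m met_edge v *m z^T) 0 0 =
   (eV v * (z 0 o0 ^+ 2 + z 0 o2 ^+ 2 + z 0 o3 ^+ 2) + z 0 o1 ^+ 2 / eV v) / eF v ^+ 2.
  rewrite mxE sum4E !mxE !sum4E !mxE /eeta /= z2 z3 C1; field.
  by rewrite !gt_eqF.
rewrite divr_gt0 ?exprn_gt0 //.
have [s0 s1 s2 s3] : [/\ 0 <= z 0 o0 ^+ 2, 0 <= z 0 o1 ^+ 2, 0 <= z 0 o2 ^+ 2 & 0 <= z 0 o3 ^+ 2].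
  by split; exact: sqr_ge0.
have [zz|zn] := eqVneq (z 0 o1) 0; last first.
  have A : 0 <= eV v * (z 0 o0 ^+ 2 + z 0 o2 ^+ 2 + z 0 o3 ^+ 2).
    by apply: mulr_ge0; [exact: ltW|lra].
  have B : 0 < z 0 o1 ^+ 2 / eV v by rewrite divr_gt0 // lt0r sqrf_eq0 zn.
  by lra.
rewrite zz expr0n mul0r addr0 mulr_gt0 //.
rewrite lt0r !addr_ge0 // andbT; apply: contra z0 => /eqP H.
have h i : z 0 i ^+ 2 = 0 -> z 0 i = 0 by move/eqP; rewrite sqrf_eq0 => /eqP.
by apply/eqP/rowP; elim/ord4_ind; rewrite [RHS]mxE ?zz //; apply: h; lra.
Qed.

End EdgeMetric.

Section CornerMetric.
Variable j : nat.
Local Notation be := (ch_base e (Corner j)).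
Let D := dom (Corner j).

Definition cH v := fam_h j j.+1 (be v).
Definition cKp v := fam_kap j j.+1 (be v).
Definition cK v := fam_k j j.+1 (be v).
Definition cmb : R := (m j + m j.+1) / 2.
Definition clb v : R :=
  ((m j * (a j + (sq23 v - sq01 v)) - n_ j) + (m j.+1 * (a j + (sq23 v - sq01 v)) - n_ j.+1)) / 2.
Definition cF v := crn_f (sq01 v) (sq23 v) (clb v) (cH v) - w j * (sq01 v + sq23 v).
Definition cV v := crn_V (sq01 v) (sq23 v) (w j) cmb (clb v) (cH v) (cKp v) (cK v).
Definition ceta1 (i : 'I_4) v : R := (i == o1)%:R * v 0 o0 - (i == o0)%:R * v 0 o1.
Definition cA1 v := crn_A (sq01 v) (sq23 v) (w j) cmb (clb v) (cH v) (cKp v) (cK v).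
Definition cA2 v := crn_A (sq23 v) (sq01 v) (w j) (- cmb) (clb v) (cH v) (- cKp v) (cK v).
Definition cB v := crn_B (sq01 v) (sq23 v) (w j) cmb (clb v) (cH v) (cKp v) (cK v).

Definition met_corner v : 'M[R]_4 := \matrix_(i, k)
  ((4 * cV v * (i == k)%:R
    + (cA1 v * (ceta1 i v * ceta1 k v)
       + cB v * (ceta1 i v * eeta k v + eeta i v * ceta1 k v)
       + cA2 v * (eeta i v * eeta k v)) / cV v) / cF v ^+ 2).

(** After [corner_eq] this is m_j n_(j+1) - m_(j+1) n_j = 1. *)
Lemma corner_rel v : 2 * w j * (clb v - (sq23 v - sq01 v) * cmb) = 1.
Proof.
have d := mn_det R e3 j; have ce := corner_eq R e3 j; have mw := mden_wt R e j.
transitivity ((2 * w j * a j) * (m j + m j.+1) / 2 - 2 * w j * (n_ j + n_ j.+1) / 2).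
  by rewrite /clb /cmb; field.
by rewrite ce -mw -[RHS]d; field.
Qed.

(** The modulus of (r_2 + i r_1)^2. *)
Lemma radius_corner v : radius (xshift (a j) (be v)) = sq01 v + sq23 v.
Proof.
have H : radius (xshift (a j) (be v)) ^+ 2 = (sq01 v + sq23 v) ^+ 2.
  rewrite rad_sqr ysq_xshift xshift_x -[ysq _]/(ch_ysq e (Corner j) v) ch_ysq_corner.
  by rewrite mxE /=; ring.
have h0 : 0 <= sq01 v + sq23 v by rewrite !addr_ge0 // sqr_ge0.
move/eqP: H; rewrite eqf_sqr => /orP[/eqP//|/eqP].
have := rad_ge0 (xshift (a j) (be v)); lra.
Qed.

(** [fam] omits the term of the corner a_j but keeps that of its mirror image; the omitted term is
    put back here. *)
Lemma pser_exclude (T : V -> R) v : smooth_pair T T -> base_dom alpha e j j.+1 v ->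
  pser alpha e T (fun=> T) v = pser alpha e T (fam T T j j.+1) v - w j * T (xshift (a j) v).
Proof.
move=> sT Bv; rewrite -[RHS]addrC -[X in _ = _ + X]mul1r.
apply: (@lim_series_affine R (fun i => if (i == j) then - (w j * T (xshift (a j) v)) else 0)).
- apply: (@cvg_trans _ ((fun=> - (w j * T (xshift (a j) v))) @ \oo)); last exact: cvg_cst.
  apply: near_eq_cvg; near=> n; have nj : (j < n)%N by near: n; exact: nbhs_infty_gt.
  rewrite /series /= big_mkord (bigD1 (Ordinal nj)) //= eqxx big1 ?addr0 // => i.
  by rewrite -val_eqE /= => /negbTE->.
- exact: (pser_cvg cf e3 (leqnSn j) sT Bv).
- move=> i; rewrite /fam ltnS; case: ltngtP => [_|_|->]; rewrite ?mul1r ?add0r //.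
  by ring.
Unshelve. all: by end_near. Qed.

Lemma corner_base_eq v : D v ->
  [/\ base_f alpha e (be v) = cF v,
     base_p alpha e (be v) = crn_p (sq01 v) (sq23 v) cmb (cKp v)
       - w j * (sq23 v - sq01 v) / (sq01 v + sq23 v) &
     base_k alpha e (be v) = cK v - w j / (sq01 v + sq23 v)].
Proof.
move=> /(chart_base_dom_corner cf e3) Bv; have [s1 s2 s3 _ _] := smooth_pairs R.
have H1 := rad_expand cf e3 (leqnSn j) Bv; have H2 := cosr_expand cf e3 (leqnSn j) Bv.
have yE : ysq (be v) = 4 * sq01 v * sq23 v by exact: (ch_ysq_corner e j v).
have xE : be v 0 o0 = a j + (sq23 v - sq01 v) by rewrite mxE.
rewrite (lin_corner _ e3) yE xE in H1; rewrite linc_corner yE in H2.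
split.
- rewrite /base_f (pser_exclude s1 Bv) H1 radius_corner /cF /crn_f /clb /cH /fam_h.
  by rewrite /fam_h; ring.
- rewrite /base_p (pser_exclude s2 Bv) H2 /crn_p /cmb /cKp /fam_kap.
  rewrite /cosr radius_corner xshift_x xE; congr (_ - _); last by rewrite mulrA; congr (_ * _ / _); ring.
- by rewrite /base_k (pser_exclude s3 Bv) /invr_rad radius_corner.
Qed.

(** Away from the corner itself a point of the chart is off the axis or inside one of the two
    adjacent edges, where the signs of [f] and [k] are known. *)
Lemma corner_base_dom v : D v -> sq01 v + sq23 v != 0 -> exists j', base_dom alpha e j' j' (be v).
Proof.
move=> Dv r0; have := chart_dom_gt cf e3 Dv; rewrite /ch_x => v0.
have [H1 H2] := (chart_dom_corner alpha e j v).1 Dv; rewrite /ch_x in H1 H2.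
have [yz|yp] := eqVneq (ysq (be v)) 0; last first.
  by exists 0%N; split=> //; left; rewrite lt0r yp ysq_ge0.
have [xj|xj|xj] := ltgtP (be v 0 o0) (a j).
- by exists j.+1; split=> //; right; split=> //; rewrite /prev_corner lte_fin.
- by exists j; split=> //; right.
- exfalso; move: r0; have := rad_sqr (xshift (a j) (be v)).
  rewrite radius_corner ysq_xshift xshift_x yz xj subrr expr0n addr0 => /eqP.
  by rewrite sqrf_eq0 => ->.
Qed.

(** Off the corner [cV] is the positive function V times |z - a_j|. At the corner V has a pole, but
    [cV] is 1 / 2 and [cF] is 1 / (2 w_j) by [corner_rel]. *)
Lemma corner_pos v : D v -> 0 < cF v /\ 0 < cV v.
Proof.
move=> Dv; have rel := corner_rel v; have w0 := wt_gt0 R e3 j.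
have [s0 t0] : 0 <= sq01 v /\ 0 <= sq23 v by split; rewrite addr_ge0 // sqr_ge0.
have [rz|rn] := eqVneq (sq01 v + sq23 v) 0.
  have [sz tz] : sq01 v = 0 /\ sq23 v = 0 by split; lra.
  rewrite /cF /crn_f /cV (crn_V_split _ _ _ rel) sz tz.
  rewrite sz tz subr0 mul0r subr0 in rel.
  split; last by rewrite !mul0r subr0 addr0 invr_gt0.
  rewrite !(mulr0, mul0r, addr0, subr0).
  by rewrite -(pmulr_rgt0 _ (_ : 0 < 2 * w j)) ?rel // mulr_gt0.
have rp : 0 < sq01 v + sq23 v by rewrite lt0r rn addr_ge0.
have [j' Bv] := corner_base_dom Dv rn; have [fE pE kE] := corner_base_eq Dv.
have f0 := base_f_gt0 cf e3 Bv; have k0 := base_k_lt0 cf e3 Bv.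
rewrite fE in f0; rewrite kE in k0; split=> //.
rewrite /cV -crn_V_eq // -/(cF v) mulr_gt0 //.
have h1 := sqr_ge0 (crn_p (sq01 v) (sq23 v) cmb (cKp v) - w j * (sq23 v - sq01 v) / (sq01 v + sq23 v)).
have h2 : 0 <= 4 * sq01 v * sq23 v * (cK v - w j / (sq01 v + sq23 v)) ^+ 2.
  by rewrite mulr_ge0 ?sqr_ge0 // !mulr_ge0.
have h3 : cF v * (cK v - w j / (sq01 v + sq23 v)) < 0 by rewrite pmulr_rlt0.
by lra.
Qed.

Let oD : open D. Proof. exact: open_chart_dom. Qed.

Lemma Ck_met_corner n i k : Ck n D (fun v => met_corner v i k).
Proof.
have [C1 C2 C3] := Ck_fam n (leqnSn j).
have oB := @open_base_dom R alpha e j j.+1.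
have S v : D v -> base_dom alpha e j j.+1 (be v) by exact: (chart_base_dom_corner cf e3).
have Cb l : Ck n D (fun v => be v 0 l) by exact: Ck_ch_base.
have CH : Ck n D cH by exact: (Ck_comp oD oB S C1 Cb).
have CKp : Ck n D cKp by exact: (Ck_comp oD oB S C2 Cb).
have CK : Ck n D cK by exact: (Ck_comp oD oB S C3 Cb).
have Cu : Ck n D sq01 by exact: Ck_sqlen.
have Cv : Ck n D sq23 by exact: Ck_sqlen.
have Cl : Ck n D clb by rewrite /clb; ck oD.
have Cf1 : Ck n D (fun v => crn_f (sq01 v) (sq23 v) (clb v) (cH v)) by rewrite /crn_f; ck oD.
have Cf2 : Ck n D (fun v => crn_f (sq23 v) (sq01 v) (clb v) (cH v)) by rewrite /crn_f; ck oD.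
have Cp1 : Ck n D (fun v => crn_p (sq01 v) (sq23 v) cmb (cKp v)) by rewrite /crn_p; ck oD.
have Cp2 : Ck n D (fun v => crn_p (sq23 v) (sq01 v) (- cmb) (- cKp v)) by rewrite /crn_p; ck oD.
have Cd1 : Ck n D (fun v => crn_d (sq01 v) (sq23 v) (w j) cmb (clb v) (cH v) (cKp v) (cK v)).
  by rewrite /crn_d; ck oD.
have Cd2 : Ck n D (fun v => crn_d (sq23 v) (sq01 v) (w j) (- cmb) (clb v) (cH v) (- cKp v) (cK v)).
  by rewrite /crn_d; ck oD.
have Cb1 : Ck n D (fun v => crn_b (sq01 v) (sq23 v) (w j) cmb (clb v) (cKp v) (cK v)).
  by rewrite /crn_b; ck oD.
have Cb2 : Ck n D (fun v => crn_b (sq23 v) (sq01 v) (w j) (- cmb) (clb v) (- cKp v) (cK v)).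
  by rewrite /crn_b; ck oD.
have CT1 : Ck n D (fun v => crn_T (sq01 v) (sq23 v) (w j) cmb (clb v) (cH v) (cKp v) (cK v)).
  by rewrite /crn_T; ck oD.
have CT2 : Ck n D (fun v => crn_T (sq23 v) (sq01 v) (w j) (- cmb) (clb v) (cH v) (- cKp v) (cK v)).
  by rewrite /crn_T; ck oD.
have CF : Ck n D cF by rewrite /cF; ck oD.
have CV : Ck n D cV by rewrite /cV /crn_V; ck oD.
have CA1 : Ck n D cA1 by rewrite /cA1 /crn_A; ck oD.
have CA2 : Ck n D cA2 by rewrite /cA2 /crn_A; ck oD.
have CB : Ck n D cB by rewrite /cB /crn_B; ck oD.
have Cet l : Ck n D (eeta l) by rewrite /eeta; ck oD.
have Cet1 l : Ck n D (ceta1 l) by rewrite /ceta1; ck oD.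
have V0 v : D v -> cV v != 0 by move=> /corner_pos[_]; rewrite lt0r => /andP[].
have F0 v : D v -> cF v ^+ 2 != 0.
  by move=> /corner_pos[]; rewrite lt0r expf_eq0 /= => /andP[].
have CVi : Ck n D (fun v => (cV v)^-1) by exact: (Ck_inv oD V0 CV).
have CF2' : Ck n D (fun v => cF v ^+ 2) by exact: (Ck_exp oD 2 CF).
have CFi : Ck n D (fun v => (cF v ^+ 2)^-1) by exact: (Ck_inv oD F0 CF2').
apply: (Ck_ext oD (f := fun v => (4 * cV v * (i == k)%:R
    + (cA1 v * (ceta1 i v * ceta1 k v)
       + cB v * (ceta1 i v * eeta k v + eeta i v * ceta1 k v)
       + cA2 v * (eeta i v * eeta k v)) / cV v) / cF v ^+ 2)).
  by move=> v _; rewrite mxE.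
ck oD.
Qed.

Lemma met_corner_sym v : (met_corner v)^T = met_corner v.
Proof.
by apply/matrixP => i k; rewrite !mxE eq_sym; congr ((_ * _ + _ / _) / _); ring.
Qed.

Lemma met_corner_td v : off_dom alpha e (Corner j) v -> met_corner v = td_metric (td (Corner j)) v.
Proof.
move=> Uv; have [Dv Y0] := Uv; have [fE pE kE] := corner_base_eq Dv.
have [f0 V0] := corner_pos Dv; have [s0 t0] := off_dom_corner Uv.
have yE : ysq (be v) = 4 * sq01 v * sq23 v by exact: (ch_ysq_corner e j v).
have y2 : Num.sqrt (ysq (be v)) ^+ 2 = 4 * sq01 v * sq23 v by rewrite sqr_sqrtr // ysq_ge0.
have y0 : Num.sqrt (ysq (be v)) != 0 by rewrite sqrtr_eq0 -ltNge.
have r0 : sq01 v + sq23 v != 0 by rewrite gt_eqF // addr_gt0.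
have F0 : cF v ^+ 2 != 0 by rewrite expf_neq0 // gt_eqF.
have rel := corner_rel v.
have dx l := partial_ch_x e (Corner j) l v.
have dy l : partial l (fun u => Num.sqrt (ysq (be u))) v =
   ydy_form (Corner j) l v / Num.sqrt (ysq (be v)).
  by rewrite -(partial_ch_y cf e3 l Uv) mulrC mulKf.
have xE : be v 0 o0 = a j + (sq23 v - sq01 v) by rewrite mxE.
apply/matrixP => i k; rewrite !mxE /td_V /td_s1 /td_s2 /= fE pE kE !dy.
rewrite -!/(be _) !dx /ch_phi /ch_psi.
have a1 l : angle_form o0 o1 l v = ceta1 l v / sq01 v by [].
have a2 l : angle_form o2 o3 l v = eeta l v / sq23 v by [].
rewrite !a1 !a2.
have mw := mden_wt R e j; have ce := corner_eq R e3 j.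
have GE : dx_form (Corner j) i v * dx_form (Corner j) k v +
    ydy_form (Corner j) i v / Num.sqrt (ysq (be v)) *
      (ydy_form (Corner j) k v / Num.sqrt (ysq (be v))) =
    4 * (sq01 v + sq23 v) * ((i == k)%:R - ceta1 i v * ceta1 k v / sq01 v
       - eeta i v * eeta k v / sq23 v).
  rewrite [X in _ + X]mulrACA -invfM -expr2 y2 /dx_form /ydy_form /ceta1 /eeta.
  rewrite /sqlen in s0 t0 *.
  by elim/ord4_ind: i; elim/ord4_ind: k => /=; field; rewrite !gt_eqF.
symmetry.
apply: (corner_metric_algebra (u := sq01 v) (v := sq23 v) (w := w j) (mb := cmb) (lb := clb v)
  (h := cH v) (kp := cKp v) (k := cK v) (lt0r_neq0 s0) (lt0r_neq0 t0) r0 rel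
  (lt0r_neq0 V0) F0 y2 _ _ _ _ GE).
- by rewrite /cmb; move: mw; move: (m j) (m j.+1) (w j) => *; lra.
- by rewrite /cmb; move: mw; move: (m j) (m j.+1) (w j) => *; lra.
- rewrite xE /clb; have mj : m j.+1 = m j + 2 * w j by rewrite -mw; ring.
  have nj : n_ j.+1 = n_ j + 2 * w j * a j by rewrite ce; ring.
  by rewrite nj mj; field.
- rewrite xE /clb; have mj : m j.+1 = m j + 2 * w j by rewrite -mw; ring.
  have nj : n_ j.+1 = n_ j + 2 * w j * a j by rewrite ce; ring.
  by rewrite nj mj; field.
Qed.

(* On the circle fibre through a point of an axis, [crn_A_eq] reads [r^2 A = 1 - 4 V^2]. *)
Lemma axis_pos (A W s t z1 z2 y1 y2 : R) : 0 <= s -> s * A = 1 - 4 * W ^+ 2 -> 0 < W ->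
  t ^+ 2 <= s * (z1 ^+ 2 + z2 ^+ 2) -> (y1 != 0 \/ y2 != 0) \/ (z1 != 0 \/ z2 != 0) ->
  0 < 4 * W ^+ 2 * (y1 ^+ 2 + y2 ^+ 2 + (z1 ^+ 2 + z2 ^+ 2)) + A * t ^+ 2.
Proof.
move=> s0 sA W0 ts nz.
have W2 : 0 < W ^+ 2 by rewrite exprn_gt0.
have [q1 q2 q3 q4] : [/\ 0 <= y1 ^+ 2, 0 <= y2 ^+ 2, 0 <= z1 ^+ 2 & 0 <= z2 ^+ 2].
  by split; exact: sqr_ge0.
have p (x : R) : x != 0 -> 0 < x ^+ 2 by move=> x0; rewrite lt0r sqrf_eq0 x0 sqr_ge0.
have N : 0 < y1 ^+ 2 + y2 ^+ 2 + (z1 ^+ 2 + z2 ^+ 2).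
  by move: nz => [[]|[]] /p; lra.
have t0 := sqr_ge0 t.
have [A0|A0] := lerP 0 A.
  have P1 : 0 < 4 * W ^+ 2 * (y1 ^+ 2 + y2 ^+ 2 + (z1 ^+ 2 + z2 ^+ 2)).
    by apply: mulr_gt0 => //; apply: mulr_gt0.
  have P2 : 0 <= A * t ^+ 2 by rewrite mulr_ge0.
  by lra.
have H : A * (s * (z1 ^+ 2 + z2 ^+ 2)) <= A * t ^+ 2 by rewrite ler_nM2l.
apply: lt_le_trans (lerD (lexx _) H).
have -> : A * (s * (z1 ^+ 2 + z2 ^+ 2)) = (1 - 4 * W ^+ 2) * (z1 ^+ 2 + z2 ^+ 2).
  by rewrite -sA; ring.
have -> : 4 * W ^+ 2 * (y1 ^+ 2 + y2 ^+ 2 + (z1 ^+ 2 + z2 ^+ 2)) +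
  (1 - 4 * W ^+ 2) * (z1 ^+ 2 + z2 ^+ 2) = 4 * W ^+ 2 * (y1 ^+ 2 + y2 ^+ 2) + (z1 ^+ 2 + z2 ^+ 2) by ring.
have h : 0 <= 4 * W ^+ 2 * (y1 ^+ 2 + y2 ^+ 2) by rewrite !mulr_ge0 ?addr_ge0 // ltW.
have [yz|yn] := eqVneq (y1 ^+ 2 + y2 ^+ 2) 0; first by lra.
rewrite ltr_pwDl ?addr_ge0 // !mulr_gt0 //.
by rewrite lt0r yn addr_ge0.
Qed.

Lemma row_neq0 (z : V) : z != 0 -> (z 0 o0 != 0 \/ z 0 o1 != 0) \/ (z 0 o2 != 0 \/ z 0 o3 != 0).
Proof.
move=> z0; have [h0|] := eqVneq (z 0 o0) 0; last by left; left.
have [h1|] := eqVneq (z 0 o1) 0; last by left; right.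
have [h2|] := eqVneq (z 0 o2) 0; last by right; left.
have [h3|] := eqVneq (z 0 o3) 0; last by right; right.
by case/eqP: z0; apply/rowP; elim/ord4_ind; rewrite mxE.
Qed.

(** On the axis at most one of the two forms [ceta1] and [eeta] is nonzero. The Cauchy-Schwarz
    inequality [cs] and [crn_A_eq] provide the hypotheses of [axis_pos]. *)
Lemma met_corner_pos0 v (z : V) : D v -> ysq (be v) = 0 -> z != 0 ->
  0 < (z *m met_corner v *m z^T) 0 0.
Proof.
move=> Dv Y0 z0; have [f0 V0] := corner_pos Dv; have rel := corner_rel v.
have rel2 : 2 * w j * (clb v - (sq01 v - sq23 v) * - cmb) = 1 by rewrite -[RHS]rel; ring.
have yE : ysq (be v) = 4 * sq01 v * sq23 v by exact: (ch_ysq_corner e j v).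
have E1 := crn_A_eq (cH v) (cKp v) (cK v) rel.
have E2 := crn_A_eq (cH v) (- cKp v) (cK v) rel2.
rewrite crn_V_sym -/(cV v) -/(cA2 v) in E2; rewrite -/(cV v) -/(cA1 v) in E1.
have [s0 t0] : 0 <= sq01 v /\ 0 <= sq23 v by split; rewrite addr_ge0 // sqr_ge0.
have z2 (k l : 'I_4) : sqlen k l v = 0 -> v 0 k = 0 /\ v 0 l = 0.
  rewrite /sqlen => H; have := sqr_ge0 (v 0 k); have := sqr_ge0 (v 0 l) => h1 h2.
  by split; apply/eqP; rewrite -sqrf_eq0; apply/eqP; lra.
have cs (x y p q : R) : (x * q - y * p) ^+ 2 <= (x ^+ 2 + y ^+ 2) * (p ^+ 2 + q ^+ 2).
  rewrite -subr_ge0; have -> : (x ^+ 2 + y ^+ 2) * (p ^+ 2 + q ^+ 2) - (x * q - y * p) ^+ 2 =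
    (x * p + y * q) ^+ 2 by ring.
  exact: sqr_ge0.
move: Y0; rewrite yE => /eqP; rewrite !mulf_eq0 pnatr_eq0 /= => /orP[] /eqP H.
- have [h0 h1] := z2 _ _ H; rewrite H !mul0r addr0 in E2.
  have := axis_pos t0 E2 V0 (cs (v 0 o2) (v 0 o3) (z 0 o2) (z 0 o3)) (row_neq0 z0).
  have -> : (z *m met_corner v *m z^T) 0 0 = (4 * cV v ^+ 2 * (z 0 o0 ^+ 2 + z 0 o1 ^+ 2
      + (z 0 o2 ^+ 2 + z 0 o3 ^+ 2)) + cA2 v * (v 0 o2 * z 0 o3 - v 0 o3 * z 0 o2) ^+ 2)
      / (cV v * cF v ^+ 2).
    rewrite mxE sum4E !mxE !sum4E !mxE /eeta /ceta1 /= h0 h1; field.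
    by rewrite !gt_eqF.
  by move=> P; rewrite divr_gt0 // mulr_gt0 // exprn_gt0.
- have [h2 h3] := z2 _ _ H; rewrite H !mul0r addr0 in E1.
  have nz : (z 0 o2 != 0 \/ z 0 o3 != 0) \/ (z 0 o0 != 0 \/ z 0 o1 != 0).
    by case: (row_neq0 z0); [right|left].
  have := axis_pos s0 E1 V0 (cs (v 0 o0) (v 0 o1) (z 0 o0) (z 0 o1)) nz.
  have -> : (z *m met_corner v *m z^T) 0 0 = (4 * cV v ^+ 2 * (z 0 o2 ^+ 2 + z 0 o3 ^+ 2
      + (z 0 o0 ^+ 2 + z 0 o1 ^+ 2)) + cA1 v * (v 0 o0 * z 0 o1 - v 0 o1 * z 0 o0) ^+ 2)
      / (cV v * cF v ^+ 2).
    rewrite mxE sum4E !mxE !sum4E !mxE /eeta /ceta1 /= h2 h3; field.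
    by rewrite !gt_eqF.
  by move=> P; rewrite divr_gt0 // mulr_gt0 // exprn_gt0.
Qed.

End CornerMetric.

Definition met : tensor2 R := fun c =>
  match c with
  | Interior => td_metric (td Interior)
  | Edge j pq => met_edge j pq
  | Corner j => met_corner j
  end.

Lemma off_dom_interior v : dom Interior v -> off_dom alpha e Interior v.
Proof.
by move=> Dv; split=> //; rewrite ch_ysq_interior exprn_gt0 //; case/chart_dom_interior: Dv.
Qed.

Lemma met_td c v : off_dom alpha e c v -> met c v = td_metric (td c) v.
Proof. by case: c => [|j pq|j] Uv //=; [exact: met_edge_td|exact: met_corner_td]. Qed.

Lemma Ck_met c n i k : Ck n (dom c) (fun v => met c v i k).
Proof.
case: c => [|j pq|j] /=; [|exact: Ck_met_edge|exact: Ck_met_corner].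
have S : dom Interior `<=` off_dom alpha e Interior by exact: off_dom_interior.
apply: (Ck_sub S); apply: Ck_td_metric; [exact: open_off_dom|exact: ch_toric].
Qed.

Lemma met_sym c v : dom c v -> (met c v)^T = met c v.
Proof.
case: c => [|j pq|j] Dv /=; [|exact: met_edge_sym|exact: met_corner_sym].
by rewrite (td_frame_gram (ch_toric cf e3 Interior) (off_dom_interior Dv)) trmx_mul trmxK.
Qed.

Lemma met_pos c v : dom c v -> forall z : V, z != 0 -> 0 < (z *m met c v *m z^T) 0 0.
Proof.
move=> Dv z z0; have [Y0|Yn] := eqVneq (ch_ysq e c v) 0.
  case: c Dv Y0 => [|j pq|j] Dv Y0 /=; [|exact: met_edge_pos0|exact: met_corner_pos0].
  by have := (off_dom_interior Dv).2; rewrite Y0 ltxx.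
have Uv : off_dom alpha e c v by split=> //; rewrite lt0r Yn ysq_ge0.
by rewrite met_td //; exact: (td_metric_pos (ch_toric cf e3 c) Uv z0).
Qed.

Lemma met_unit c v : dom c v -> met c v \in unitmx.
Proof.
move=> Dv; rewrite unitmxE unitfE; apply/negP => /det0P[z z0 H].
by have := met_pos Dv z0; rewrite H mul0mx mxE ltxx.
Qed.

End ChartMetric.

(** * Curvature across the axis *)

Section CurvatureLocal.
Variable R : realType.
Local Notation V := 'rV[R]_4.
Variables (U : set V) (G G' : V -> 'M[R]_4).
Hypothesis oU : open U.
Hypothesis GG' : forall v, U v -> G v = G' v.

Lemma partial_local (f g : V -> R) i v : U v -> (forall u, U u -> f u = g u) ->
  partial i f v = partial i g v.
Proof. by move=> Uv fg; exact: partial_eq_on oU Uv fg. Qed.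

Lemma christoffel_local k i j v : U v -> christoffel G k i j v = christoffel G' k i j v.
Proof.
move=> Uv; have P l p q : partial l (fun u => G u p q) v = partial l (fun u => G' u p q) v.
  by apply: partial_local => // u Uu; rewrite GG'.
rewrite /christoffel GG' //; congr (_ * _); apply: eq_bigr => l _.
by rewrite (P i j l) (P j i l) (P l i j).
Qed.

Lemma riemann_up_local l k i j v : U v -> riemann_up G l k i j v = riemann_up G' l k i j v.
Proof.
move=> Uv; rewrite /riemann_up.
have P p a b d : partial p (christoffel G a b d) v = partial p (christoffel G' a b d) v.
  by apply: partial_local => // u Uu; exact: christoffel_local.
rewrite (P i l j k) (P j l i k); congr (_ + _); apply: eq_bigr => q _.
by rewrite !christoffel_local.
Qed.

Lemma ricci_local v : U v -> ricci G v = ricci G' v.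
Proof.
by move=> Uv; apply/matrixP => i j; rewrite !mxE; apply: eq_bigr => k _; exact: riemann_up_local.
Qed.

Lemma scal_local v : U v -> scal G v = scal G' v.
Proof. by move=> Uv; rewrite /scal (GG' Uv) (ricci_local Uv). Qed.

Lemma weyl_local l k i j v : U v -> weyl G l k i j v = weyl G' l k i j v.
Proof.
move=> Uv; have Em : riemann G l k i j v = riemann G' l k i j v.
  by rewrite /riemann (GG' Uv); apply: eq_bigr => q _; rewrite riemann_up_local.
by rewrite /weyl Em (scal_local Uv) (ricci_local Uv) (GG' Uv).
Qed.

Lemma weyl_minus_local o l k v : U v -> weyl_minus o G l k v = weyl_minus o G' l k v.
Proof.
move=> Uv; rewrite /weyl_minus (GG' Uv).
have -> : \matrix_(i, j) weyl G l k i j v = \matrix_(i, j) weyl G' l k i j v.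
  by apply/matrixP => i j; rewrite !mxE weyl_local.
by [].
Qed.

End CurvatureLocal.

Section CurvatureSmooth.
Variable R : realType.
Local Notation V := 'rV[R]_4.
Variables (U : set V) (G : V -> 'M[R]_4).
Hypothesis oU : open U.
Hypothesis CG : forall n i j, Ck n U (fun v => G v i j).
Hypothesis unitG : forall v, U v -> G v \in unitmx.

Lemma Ck_riemann_up n l k i j : Ck n U (riemann_up G l k i j).
Proof.
have C m a b d : Ck m U (christoffel G a b d) by exact: Ck_christoffel.
have CP p a b d : Ck n U (partial p (christoffel G a b d)) by exact: Ck_partial (C n.+1 a b d).
have S : Ck n U (fun v => \sum_m (christoffel G l i m v * christoffel G m j k v
            - christoffel G l j m v * christoffel G m i k v)).
  apply: Ck_sum => // m _.
  exact: (Ck_sub_fun oU (Ck_mul oU (C n l i m) (C n m j k)) (Ck_mul oU (C n l j m) (C n m i k))).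
exact: (Ck_add oU (Ck_sub_fun oU (CP i l j k) (CP j l i k)) S).
Qed.

Lemma Ck_ricci n i j : Ck n U (fun v => ricci G v i j).
Proof.
have S : Ck n U (fun v => \sum_k riemann_up G k j k i v).
  by apply: Ck_sum => // k _; exact: Ck_riemann_up.
by apply: (Ck_ext oU _ S) => v _; rewrite mxE.
Qed.

Lemma Ck_scal n : Ck n U (scal G).
Proof.
apply: Ck_sum => // i _; apply: Ck_sum => // j _.
have Ci : Ck n U (fun v => invmx (G v) i j) by exact: Ck_invmx.
exact: (Ck_mul oU Ci (Ck_ricci n i j)).
Qed.

Lemma Ck_weyl n l k i j : Ck n U (weyl G l k i j).
Proof.
have Cr : Ck n U (riemann G l k i j).
  by apply: Ck_sum => // m _; exact: (Ck_mul oU (CG n l m) (Ck_riemann_up n m k i j)).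
have C1 a b p q : Ck n U (fun v => ricci G v a b * G v p q).
  exact: (Ck_mul oU (Ck_ricci n a b) (CG n p q)).
have C2 a b p q : Ck n U (fun v => G v a b * G v p q) by exact: (Ck_mul oU (CG n a b) (CG n p q)).
have Cs := Ck_scal n.
have C3 : Ck n U (fun v => scal G v / 6) by exact: (Ck_mul oU Cs (Ck_cst U n _)).
have C4 : Ck n U (fun v => 2^-1 * (ricci G v j k * G v i l - ricci G v i k * G v j l
    + ricci G v i l * G v j k - ricci G v j l * G v i k)).
  apply: (Ck_mul oU (Ck_cst U n _)).
  exact: (Ck_sub_fun oU (Ck_add oU (Ck_sub_fun oU (C1 _ _ _ _) (C1 _ _ _ _)) (C1 _ _ _ _)) (C1 _ _ _ _)).
have C5 : Ck n U (fun v => G v j k * G v i l - G v i k * G v j l).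
  exact: (Ck_sub_fun oU (C2 _ _ _ _) (C2 _ _ _ _)).
exact: (Ck_add oU (Ck_sub_fun oU Cr C4) (Ck_mul oU C3 C5)).
Qed.

Lemma Ck_sqrt_det : Ck 0 U (fun v => Num.sqrt (\det (G v))).
Proof.
split=> // v Uv; have Cd := Ck_det oU (CG 0).
apply: (@continuous_comp _ _ _ (fun v => \det (G v)) Num.sqrt); first exact: (Ck_cont Cd Uv).
exact: sqrt_continuous.
Qed.

Lemma Ck_weyl_minus o l k i j : Ck 0 U (fun v => weyl_minus o G l k v i j).
Proof.
have CW p q : Ck 0 U (fun v => (\matrix_(i, j) weyl G l k i j v) p q).
  by apply: (Ck_ext oU _ (Ck_weyl 0 l k p q)) => v _; rewrite mxE.
have Ci p q : Ck 0 U (fun v => invmx (G v) p q) by exact: Ck_invmx.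
have CM (A B : V -> 'M[R]_4) : (forall p q, Ck 0 U (fun v => A v p q)) ->
    (forall p q, Ck 0 U (fun v => B v p q)) -> forall p q, Ck 0 U (fun v => (A v *m B v) p q).
  move=> CA CB p q; have S : Ck 0 U (fun v => \sum_r A v p r * B v r q).
    by apply: Ck_sum => // r _; exact: (Ck_mul oU (CA p r) (CB r q)).
  by apply: (Ck_ext oU _ S) => v _; rewrite mxE.
have CH p q : Ck 0 U (fun v => hodge o (G v) (\matrix_(i, j) weyl G l k i j v) p q).
  have S : Ck 0 U (fun v => 2^-1 * \sum_r \sum_s o * Num.sqrt (\det (G v)) * levi_civita R r s p q
       * (invmx (G v) *m (\matrix_(i, j) weyl G l k i j v) *m invmx (G v)) r s).
    apply: (Ck_mul oU (Ck_cst U 0 _)); apply: Ck_sum => // r _; apply: Ck_sum => // s _.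
    have C1 := Ck_mul oU (Ck_mul oU (Ck_cst U 0 o) Ck_sqrt_det) (Ck_cst U 0 (levi_civita R r s p q)).
    exact: (Ck_mul oU C1 (CM _ _ (CM _ _ Ci CW) Ci r s)).
  by apply: (Ck_ext oU _ S) => v _; rewrite mxE.
have S := Ck_mul oU (Ck_cst U 0 2^-1) (Ck_sub_fun oU (CW i j) (CH i j)).
by apply: (Ck_ext oU _ S) => v _; rewrite /weyl_minus !mxE.
Qed.

End CurvatureSmooth.

Section MetricCurvature.
Variables (R : realType) (alpha : R) (e : nat -> int).
Hypothesis cf : has_modified_cf alpha e.
Hypothesis e3 : forall j, (1 <= j)%N -> 3 <= e j.
Local Notation V := 'rV[R]_4.
Local Notation dom := (chart_dom alpha e).
Local Notation G c := (met alpha e c).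

(** Off the axis the metric agrees with [td_metric] on an open set, hence so do the curvatures; on
    the axis both sides of each equation are continuous, and density applies. *)
Theorem met_curvature c v : dom c v ->
  [/\ ricci (G c) v = (- 3) *: G c v, scal (G c) v = - 12 &
    forall l k, weyl_minus (orient R e c) (G c) l k v = 0].
Proof.
move=> Dv; have oD := @open_chart_dom R alpha e c.
have CG := Ck_met cf e3 c; have uG := met_unit cf e3 (c := c).
have off u : dom c u -> 0 < ch_ysq e c u ->
  [/\ ricci (G c) u = (- 3) *: G c u, scal (G c) u = - 12 &
    forall l k, weyl_minus (orient R e c) (G c) l k u = 0].
  move=> Du y0; have Uu : off_dom alpha e c u by [].
  have oU := @open_off_dom R alpha e c.
  have E := met_td cf e3 (c := c).
  have [H1 H2 H3] := toric_self_dual_einstein oU (ch_toric cf e3 c) Uu.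
  rewrite (ricci_local oU E Uu) (scal_local oU E Uu) E //; split=> // l k.
  by rewrite (weyl_minus_local oU E _ _ _ Uu) -(coframe_sg cf e3 Uu) H3.
split.
- apply/matrixP => i j; rewrite [RHS]mxE; apply/eqP; rewrite -subr_eq0; apply/eqP.
  have C : Ck 0 (dom c) (fun u => ricci (G c) u i j - - 3 * G c u i j).
    exact: (Ck_sub_fun oD (Ck_ricci oD CG uG 0 i j) (Ck_mul oD (Ck_cst _ 0 _) (CG 0 i j))).
  apply: (dense_eq0 (F := fun u => ricci (G c) u i j - - 3 * G c u i j) Dv (Ck_cont C Dv)) => u Du y0.
  by have [-> _ _] := off u Du y0; rewrite mxE subrr.
- apply/eqP; rewrite -subr_eq0; apply/eqP.
  have C : Ck 0 (dom c) (fun u => scal (G c) u - - 12).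
    exact: (Ck_sub_fun oD (Ck_scal oD CG uG 0) (Ck_cst _ 0 _)).
  apply: (dense_eq0 (F := fun u => scal (G c) u - - 12) Dv (Ck_cont C Dv)) => u Du y0.
  by have [_ -> _] := off u Du y0; rewrite subrr.
- move=> l k; apply/matrixP => i j; rewrite [RHS]mxE.
  have C := Ck_weyl_minus oD CG uG (orient R e c) l k i j.
  apply: (dense_eq0 (F := fun u => weyl_minus (orient R e c) (G c) l k u i j) Dv (Ck_cont C Dv)) => u Du y0.
  by have [_ _ ->] := off u Du y0; rewrite mxE.
Qed.

End MetricCurvature.

(** * Points and coordinates *)

Arguments mn : simpl never.

Section Angles.
Variable R : realType.

Lemma cos_sin_turn (s : R) (k : int) :
  cos (s + 2 * pi * k%:~R) = cos s /\ sin (s + 2 * pi * k%:~R) = sin s.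
Proof.
have H (t : R) (n : nat) : cos (t + 2 * pi * n%:R) = cos t /\ sin (t + 2 * pi * n%:R) = sin t.
  have -> : 2 * pi * n%:R = (pi *+ 2) *+ n :> R by rewrite -[RHS]mulr_natr -[pi *+ 2]mulr_natl.
  by split; [rewrite (periodicn (@cosD2pi R))|rewrite (periodicn (@sinD2pi R))].
case: k => n; first exact: H.
have [<- <-] := H (s + 2 * pi * (Negz n)%:~R) n.+1.
by rewrite NegzE mulrNz mulrN -[n.+1%:R]/(n.+1%:~R) subrK.
Qed.

Lemma cos_sin_inj (s s' : R) : cos s = cos s' -> sin s = sin s' ->
  exists k : int, s' = s + 2 * pi * k%:~R.
Proof.
move=> Ec Es; have p0 : 0 < 2 * pi :> R by rewrite mulr_gt0 // pi_gt0.
pose k := Num.floor ((s' - s) / (2 * pi)).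
have := floor_le ((s' - s) / (2 * pi)); have := floorD1_gt ((s' - s) / (2 * pi)).
rewrite -/k ler_pdivlMr // ltr_pdivrMr // => H1 H2.
pose t := s' - s - 2 * pi * k%:~R.
have t0 : 0 <= t by rewrite /t; lra.
have t1 : t < 2 * pi by rewrite intrD in H1; rewrite /t; lra.
have ct : cos t = 1.
  have [E _] := cos_sin_turn t k; rewrite -E /t subrK cosB -Ec -Es -!expr2 cos2Dsin2 //.
have [tp|tp] := lerP t pi.
  have : t = 0.
    by apply: cos_inj; rewrite ?in_itv /= ?t0 ?tp ?lexx ?pi_ge0 // cos0.
  by rewrite /t => E; exists k; lra.
have : 2 * pi - t = 0.
  apply: cos_inj; rewrite ?in_itv /= ?lexx ?pi_ge0 //; first by apply/andP; split; lra.
  have [E _] := cos_sin_turn (- t) 1.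
  by rewrite cos0 -[RHS]ct -[cos t]cosN -E mulr1z mulr1 addrC.
by lra.
Qed.

Lemma polar_inj (r r' s s' : R) : 0 <= r -> 0 <= r' ->
  r * cos s = r' * cos s' -> r * sin s = r' * sin s' ->
  r = r' /\ (r = 0 \/ exists k : int, s' = s + 2 * pi * k%:~R).
Proof.
move=> r0 r0' Ec Es; have E : r = r'.
  have : r ^+ 2 = r' ^+ 2.
    by rewrite -[r ^+ 2]mulr1 -(cos2Dsin2 s) mulrDr -!exprMn Ec Es !exprMn -mulrDr cos2Dsin2 mulr1.
  by move/eqP; rewrite eqf_sqr => /orP[/eqP//|/eqP]; lra.
split=> //; subst r'; have [->|rn] := eqVneq r 0; first by left.
by right; apply: cos_sin_inj; [apply: (mulfI rn)|apply: (mulfI rn)].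
Qed.

End Angles.

Section Points.
Variables (R : realType) (alpha : R) (e : nat -> int).
Hypothesis cf : has_modified_cf alpha e.
Hypothesis e3 : forall j, (1 <= j)%N -> 3 <= e j.
Local Notation V := 'rV[R]_4.
Implicit Types (v : V) (c : chart) (r q : rep R).
Local Notation a := (corner R e).
Local Notation m := (mden R e).
Local Notation n_ := (nnum R e).
Local Notation dom := (chart_dom alpha e).
Local Notation base := (chart_base alpha e).

Lemma vecE j : vec R (mn e j) = (m j, n_ j). Proof. by []. Qed.

Lemma pair_scale (s x y : R) : s *: (x, y) = (s * x, s * y). Proof. by []. Qed.
Lemma pair_add (x y x' y' : R) : (x, y) + (x', y') = (x + x', y + y'). Proof. by []. Qed.

Lemma corner_lt_inv i j : a j < a i -> (i < j)%N.
Proof. by move=> H; rewrite ltnNge; apply/negP => /(corner_noninc R e3); rewrite leNgt H. Qed.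

Lemma edge_interior_inj i j (x : R) : edge_interior e i x -> edge_interior e j x -> i = j.
Proof.
wlog ij : i j / (i <= j)%N => [H Hi Hj|].
  by case/orP: (leq_total i j) => L; [exact: H|symmetry; exact: H].
move=> [ai _] [_ pj]; apply/eqP; rewrite eqn_leq ij leqNgt; apply/negP => L.
by have := lt_prev_corner e3 pj L; rewrite ltNge (ltW ai).
Qed.

Lemma edge_interior_corner i j : ~ edge_interior e i (a j).
Proof.
move=> [H1 H2]; have ij := corner_lt_inv H1.
by case: i H1 H2 ij => // i H1; rewrite /prev_corner lte_fin => /corner_lt_inv; lia.
Qed.

Lemma collapsedD b (z z' : R * R) : collapsed e b z -> collapsed e b z' -> collapsed e b (z + z').
Proof.
move=> [->|[b0 H]]; first by rewrite add0r.
move=> [->|[_ H']]; first by rewrite addr0; right.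
right; split=> //; case: H H' => [[j Ij [s ->]]|Hc]; last by right.
case=> [[i Ii [s' ->]]|Hc]; last by right.
rewrite (edge_interior_inj Ii Ij); left; exists j => //; exists (s + s').
by rewrite scalerDl.
Qed.

Lemma collapsedN b (z : R * R) : collapsed e b z -> collapsed e b (- z).
Proof.
move=> [->|[b0 H]]; first by rewrite oppr0; left.
right; split=> //; case: H => [[j Ij [s ->]]|Hc]; last by right.
by left; exists j => //; exists (- s); rewrite scaleNr.
Qed.

Lemma cls_refl q : cls e q q.
Proof.
split=> //; exists 0; first by left.
by exists 0, 0; rewrite !mulr0 !addr0.
Qed.

Lemma cls_eq q q' : cls e q q' -> cls e q = cls e q'.
Proof.
move=> [b [z cz [k [l E]]]]; apply/seteqP; split=> r [br [z' cz' [k' [l' E']]]].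
- split; first by rewrite br b.
  exists (z' - z); first by rewrite b; apply: collapsedD => //; exact: collapsedN.
  exists (k' - k), (l' - l); rewrite E' E.
  case: q z z' {E E' b br cz cz'} => [bq [q1 q2]] [z1 z2] [z1' z2'] /=.
  by rewrite !intrB; congr (_, _) => /=; ring.
- split; first by rewrite br b.
  exists (z' + z); first by apply: collapsedD => //; rewrite -b.
  exists (k' + k), (l' + l); rewrite E' E.
  case: q z z' {E E' b br cz cz'} => [bq [q1 q2]] [z1 z2] [z1' z2'] /=.
  by rewrite !intrD; congr (_, _) => /=; ring.
Qed.

(* From [(r_2 + i r_1)^2 = x - a_j + i y]. *)
Definition corner_r1 j (x y : R) := Num.sqrt ((Num.sqrt ((x - a j) ^+ 2 + y ^+ 2) - (x - a j)) / 2).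
Definition corner_r2 j (x y : R) := Num.sqrt ((Num.sqrt ((x - a j) ^+ 2 + y ^+ 2) + (x - a j)) / 2).

(** Cramer's rule, in which the determinant of the basis is its own inverse, being 1 or -1. *)
Definition edge_s j (pq : int * int) (z : R * R) : R :=
  (m j * pq.2%:~R - n_ j * pq.1%:~R) * (z.1 * pq.2%:~R - z.2 * pq.1%:~R).
Definition edge_t j (pq : int * int) (z : R * R) : R :=
  (m j * pq.2%:~R - n_ j * pq.1%:~R) * (m j * z.2 - n_ j * z.1).
Definition corner_s1 j (z : R * R) : R := z.1 * n_ j.+1 - z.2 * m j.+1.
Definition corner_s2 j (z : R * R) : R := m j * z.2 - n_ j * z.1.

(** A function choosing one value of the relation [has_coords]; by [has_coordsP] it is the only
    value for a given representative over the base of the chart. *)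
Definition kap c r : V :=
  let: ((x, y), z) := r in
  match c with
  | Interior => row4 x y z.1 z.2
  | Edge j pq => row4 x (edge_t j pq z) (y * cos (edge_s j pq z)) (y * sin (edge_s j pq z))
  | Corner j => row4 (corner_r1 j x y * cos (corner_s1 j z)) (corner_r1 j x y * sin (corner_s1 j z))
                     (corner_r2 j x y * cos (corner_s2 j z)) (corner_r2 j x y * sin (corner_s2 j z))
  end.

Lemma edge_st_decomp j pq z (s t : R) : edge_basis e j pq ->
  z = s *: vec R (mn e j) + t *: vec R pq <-> s = edge_s j pq z /\ t = edge_t j pq z.
Proof.
move=> /(edge_basis_real R) bas; rewrite /edge_s /edge_t vecE; case: z => z1 z2.
have d2 : (m j * pq.2%:~R - n_ j * pq.1%:~R) ^+ 2 = 1 by case: bas => ->; rewrite ?sqrrN expr1n.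
move: d2; rewrite /vec /=; move: (m j) (n_ j) (pq.1%:~R) (pq.2%:~R) => m' n' p q d2.
rewrite !pair_scale pair_add; split=> [[-> ->]|[-> ->]].
  by split; rewrite -[LHS]mulr1 -d2; ring.
by congr (_, _); rewrite -[LHS]mulr1 -d2; ring.
Qed.

Lemma corner_s_decomp j z (s1 s2 : R) : z = s1 *: vec R (mn e j) + s2 *: vec R (mn e j.+1) <->
  s1 = corner_s1 j z /\ s2 = corner_s2 j z.
Proof.
have d := mn_det R e3 j; rewrite /corner_s1 /corner_s2 !vecE; case: z => z1 z2 /=.
move: d; move: (m j) (n_ j) (m j.+1) (n_ j.+1) => m' n' p q d.
rewrite !pair_scale pair_add; split=> [[-> ->]|[-> ->]].
  by split; rewrite -[LHS]mulr1 -d; ring.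
by congr (_, _); rewrite -[LHS]mulr1 -d; ring.
Qed.

Lemma corner_radii j (x y r1 r2 : R) : 0 <= r1 -> 0 <= r2 ->
  x - a j = r2 ^+ 2 - r1 ^+ 2 -> y = 2 * r1 * r2 -> r1 = corner_r1 j x y /\ r2 = corner_r2 j x y.
Proof.
move=> r10 r20 xE yE; rewrite /corner_r1 /corner_r2 xE yE.
have -> : (r2 ^+ 2 - r1 ^+ 2) ^+ 2 + (2 * r1 * r2) ^+ 2 = (r2 ^+ 2 + r1 ^+ 2) ^+ 2 by ring.
rewrite sqrtr_sqr ger0_norm ?addr_ge0 ?sqr_ge0 //.
have -> : (r2 ^+ 2 + r1 ^+ 2 - (r2 ^+ 2 - r1 ^+ 2)) / 2 = r1 ^+ 2 by field.
have -> : (r2 ^+ 2 + r1 ^+ 2 + (r2 ^+ 2 - r1 ^+ 2)) / 2 = r2 ^+ 2 by field.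
by rewrite !sqrtr_sqr !ger0_norm.
Qed.

Lemma corner_radiiP j (x y : R) : 0 <= y -> let r1 := corner_r1 j x y in let r2 := corner_r2 j x y in
  [/\ 0 <= r1, 0 <= r2, x - a j = r2 ^+ 2 - r1 ^+ 2 & y = 2 * r1 * r2].
Proof.
move=> y0 r1 r2; pose S := Num.sqrt ((x - a j) ^+ 2 + y ^+ 2).
have S2 : S ^+ 2 = (x - a j) ^+ 2 + y ^+ 2 by rewrite sqr_sqrtr // addr_ge0 // sqr_ge0.
have S0 : 0 <= S by exact: sqrtr_ge0.
have y2 := sqr_ge0 y.
have h1 : 0 <= (S - (x - a j)) / 2 by rewrite divr_ge0 //; nra.
have h2 : 0 <= (S + (x - a j)) / 2 by rewrite divr_ge0 //; nra.
have E1 : r1 ^+ 2 = (S - (x - a j)) / 2 by rewrite sqr_sqrtr.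
have E2 : r2 ^+ 2 = (S + (x - a j)) / 2 by rewrite sqr_sqrtr.
have [r10 r20] : 0 <= r1 /\ 0 <= r2 by split; exact: sqrtr_ge0.
split=> //; first by rewrite E1 E2; field.
have : y ^+ 2 = (2 * r1 * r2) ^+ 2.
  rewrite !exprMn E1 E2.
  have -> : 2 ^+ 2 * ((S - (x - a j)) / 2) * ((S + (x - a j)) / 2) = S ^+ 2 - (x - a j) ^+ 2 by field.
  by rewrite S2; ring.
move/eqP; rewrite eqf_sqr => /orP[/eqP//|/eqP H].
have : 0 <= 2 * r1 * r2 by rewrite !mulr_ge0.
by lra.
Qed.

Lemma has_coordsP c r v : base c r.1 -> has_coords e c r v <-> v = kap c r.
Proof.
case: r => [[x y] z]; case: c => [|j pq|j] Hb //; rewrite /has_coords /kap.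
- case: Hb => bas _ _; split=> [[s [t [/(edge_st_decomp _ _ _ bas)[-> ->] ->]]]|->] //.
  exists (edge_s j pq z), (edge_t j pq z); split=> //; exact/edge_st_decomp.
- case: Hb => _ _ y0; split=> [[r1 [r2 [s1 [s2 [[r10 r20] [xE yE] /corner_s_decomp[-> ->] ->]]]]]|->].
    by have [-> ->] := corner_radii r10 r20 xE yE.
  have [r10 r20 xE yE] := @corner_radiiP j x y y0.
  exists (corner_r1 j x y), (corner_r2 j x y), (corner_s1 j z), (corner_s2 j z); split=> //.
  exact/corner_s_decomp.
Qed.

Lemma dom_kap c r : base c r.1 -> dom c (kap c r).
Proof. by move=> b; exists r => //; exact/has_coordsP. Qed.

Lemma domP c v : dom c v -> exists2 r, base c r.1 & v = kap c r.
Proof. by move=> [r H b]; exists r => //; apply/has_coordsP. Qed.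

Lemma base_ge0 c r : base c r.1 -> 0 <= r.1.2.
Proof. by case: c => [|j pq|j] => [[_ /ltW]|[_ _]|[_ _]]. Qed.

(** The ambiguity of the coordinates of a given point. Only angles used directly as coordinates
    contribute, so a corner chart has none. *)
Definition deck c : set V :=
  match c with
  | Interior => [set v : V | exists k l : int, v = row4 0 0 (2 * pi * k%:~R) (2 * pi * l%:~R)]
  | Edge _ _ => [set v : V | exists k : int, v = row4 0 (2 * pi * k%:~R) 0 0]
  | Corner _ => [set 0]
  end.

Lemma row4_inj (x y z t x' y' z' t' : R) : row4 x y z t = row4 x' y' z' t' ->
  [/\ x = x', y = y', z = z' & t = t'].
Proof.
move=> H; have E i : row4 x y z t 0 i = row4 x' y' z' t' 0 i by rewrite H.
by have := (E o0, E o1, E o2, E o3); rewrite !mxE /= => -[[[]]].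
Qed.

Lemma cls_shift (b z z' w : R * R) (k l : int) : collapsed e b w ->
  z' = z + w + (2 * pi * k%:~R, 2 * pi * l%:~R) -> cls e (b, z) = cls e (b, z').
Proof. by move=> cw E; apply: cls_eq; split=> //=; exists w => //; exists k, l. Qed.

Lemma mn_int j : exists k l : int, m j = k%:~R /\ n_ j = l%:~R.
Proof. by exists (mn e j).1, (mn e j).2. Qed.

Lemma edge_basis_det j pq : edge_basis e j pq ->
  (m j * pq.2%:~R - n_ j * pq.1%:~R) ^+ 2 = 1 :> R.
Proof. by move=> /(edge_basis_real R) => -[] ->; rewrite ?sqrrN expr1n. Qed.

(** Equal coordinates determine each angle modulo 2 pi unless the radius of its circle is 0, and
    then the circle is collapsed. *)
Lemma kap_fiber c r r' : base c r.1 -> base c r'.1 -> kap c r = kap c r' -> cls e r = cls e r'.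
Proof.
case: r r' => [[x y] z] [[x' y'] z'] /= b b'.
case: c b b' => [|j pq|j] b b'; rewrite /kap => /row4_inj[].
- by case: z z' => [z1 z2] [z1' z2'] /= -> -> -> ->.
- move=> xx' tt' Ec Es; have [bas Ij y0] := b; have [_ _ y0'] := b'.
  rewrite /= in Ij y0 y0'.
  have [yy' Hs] := polar_inj y0 y0' Ec Es; rewrite -xx' -yy'.
  have Ez : z = edge_s j pq z *: vec R (mn e j) + edge_t j pq z *: vec R pq.
    exact/edge_st_decomp.
  have Ez' : z' = edge_s j pq z' *: vec R (mn e j) + edge_t j pq z' *: vec R pq.
    exact/edge_st_decomp.
  case: Hs => [yz|[k Ek]].
    apply: (@cls_shift _ _ _ ((edge_s j pq z' - edge_s j pq z) *: vec R (mn e j)) 0 0).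
      right; split=> //; left; exists j => //; by exists (edge_s j pq z' - edge_s j pq z).
    rewrite [LHS]Ez' [X in X + _ + _]Ez tt' vecE /vec !pair_scale !pair_add !mulr0 !addr0.
    by congr (_, _) => /=; ring.
  have [km [kn [Em En]]] := mn_int j.
  apply: (@cls_shift _ _ _ 0 (k * km) (k * kn)); first by left.
  rewrite addr0 [LHS]Ez' [X in _ = X + _]Ez tt' Ek vecE /vec !pair_scale !pair_add !intrM -Em -En.
  by congr (_, _) => /=; ring.
- move=> E0 E1 E2 E3; have [aj pj y0] := b; have [_ _ y0'] := b'.
  rewrite /= in aj pj y0 y0'.
  have [r10 r20 xE yE] := @corner_radiiP j x y y0.
  have [r10' r20' xE' yE'] := @corner_radiiP j x' y' y0'.
  have [R1 H1] := polar_inj r10 r10' E0 E1; have [R2 H2] := polar_inj r20 r20' E2 E3.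
  have yy' : y = y' by rewrite yE yE' R1 R2.
  have xx' : x = x' by apply: (addIr (- a j)); rewrite xE xE' R1 R2.
  rewrite -xx' -yy'.
  have Ez : z = corner_s1 j z *: vec R (mn e j) + corner_s2 j z *: vec R (mn e j.+1).
    exact/corner_s_decomp.
  have Ez' : z' = corner_s1 j z' *: vec R (mn e j) + corner_s2 j z' *: vec R (mn e j.+1).
    exact/corner_s_decomp.
  have [km [kn [Em En]]] := mn_int j; have [km' [kn' [Em' En']]] := mn_int j.+1.
  have axis i : y = 0 -> edge_interior e i x -> forall s : R, collapsed e (x, y) (s *: vec R (mn e i)).
    by move=> yz Ii s; right; split=> //; left; exists i => //; exists s.
  (* Both radii 0 means the corner, where the whole torus is collapsed; one radius 0 means one of
     the two adjacent edges or the corner. *)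
  case: H1 H2 => [z1|[k1 K1]] [z2|[k2 K2]].
  + apply: (@cls_shift _ _ _ (z' - z) 0 0); last first.
      by rewrite !mulr0 addrCA subrr !addr0.
    right; split; first by rewrite yE z1 mulr0 mul0r.
    by right; exists j; apply/eqP; rewrite -subr_eq0 xE z1 z2 expr0n subrr.
  + have yz : y = 0 by rewrite yE z1 mulr0 mul0r.
    have [xj|xj] := eqVneq x (a j).
      apply: (@cls_shift _ _ _ (z' - z) 0 0); last by rewrite !mulr0 addrCA subrr !addr0.
      by right; split=> //; right; exists j.
    apply: (@cls_shift _ _ _ ((corner_s1 j z' - corner_s1 j z) *: vec R (mn e j))
       (k2 * km') (k2 * kn')).
      apply: axis => //; split=> //; rewrite -subr_gt0 lt0r subr_eq0 xj /=.
      by rewrite xE z1 expr0n subr0 sqr_ge0.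
    rewrite [LHS]Ez' [X in X + _ + _]Ez K2 !vecE !pair_scale !pair_add !intrM -Em' -En'.
    by congr (_, _) => /=; ring.
  + have yz : y = 0 by rewrite yE z2 mulr0.
    have [xj|xj] := eqVneq x (a j).
      apply: (@cls_shift _ _ _ (z' - z) 0 0); last by rewrite !mulr0 addrCA subrr !addr0.
      by right; split=> //; right; exists j.
    apply: (@cls_shift _ _ _ ((corner_s2 j z' - corner_s2 j z) *: vec R (mn e j.+1))
       (k1 * km) (k1 * kn)).
      apply: axis => //; split=> //; rewrite /prev_corner lte_fin -subr_lt0 lt_neqAle subr_eq0 xj /=.
      by rewrite xE z2 expr0n sub0r oppr_le0 sqr_ge0.
    rewrite [LHS]Ez' [X in X + _ + _]Ez K1 !vecE !pair_scale !pair_add !intrM -Em -En.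
    by congr (_, _) => /=; ring.
  + apply: (@cls_shift _ _ _ 0 (k1 * km + k2 * km') (k1 * kn + k2 * kn')); first by left.
    rewrite addr0 [LHS]Ez' [X in _ = X + _]Ez K1 K2 !vecE !pair_scale !pair_add !intrD !intrM.
    by rewrite -Em -En -Em' -En'; congr (_, _) => /=; ring.
Qed.

(** A collapsed vector changes only angles whose radius is 0, and an element of 2 pi Z^2 changes
    every angle by a multiple of 2 pi, as the lattice vectors are integral. *)
Lemma kap_deck c r r' : base c r.1 -> cls e r r' -> base c r'.1 /\
  exists2 d, deck c d & kap c r' = kap c r + d.
Proof.
case: r r' => [[x y] z] [[x' y'] z'] /= b [/= [-> ->] [w cw [k [l ->]]]]; split=> //.
have r4 (p1 p2 p3 p4 q1 q2 q3 q4 : R) : row4 p1 p2 p3 p4 + row4 q1 q2 q3 q4 =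
  row4 (p1 + q1) (p2 + q2) (p3 + q3) (p4 + q4).
  by apply/rowP; elim/ord4_ind; rewrite !mxE.
case: w cw => [w1 w2] cw; case: z => [z1 z2].
case: c b => [|j pq|j] b; rewrite /kap.
- case: cw => [[-> ->]|[/= yz _]]; last by move: b => /= [_]; rewrite yz ltxx.
  exists (row4 0 0 (2 * pi * k%:~R) (2 * pi * l%:~R)); first by exists k, l.
  by rewrite r4 !addr0.
- have [bas /= Ij /= y0] := b; have bR := edge_basis_real R bas.
  (* A collapsed vector is a multiple of (m_j, n_j), because a point lies in the interior of only
     one edge and no corner does. *)
  have tw : edge_t j pq (w1, w2) = 0 /\ (y = 0 \/ edge_s j pq (w1, w2) = 0).
    rewrite /edge_t /edge_s /=; case: cw => [[-> ->]|[/= yz [[/= i Ii [s]]|[/= i xi]]]].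
    + by split; [ring|right; ring].
    + rewrite -(edge_interior_inj Ij Ii) vecE pair_scale => -[-> ->].
      by split; [ring|left].
    + by case: (@edge_interior_corner j i); rewrite -xi.
  have [km [kn [Em En]]] := mn_int j.
  have [dl Ed] : exists dl : int, m j * pq.2%:~R - n_ j * pq.1%:~R = dl%:~R :> R.
    by exists (km * pq.2 - kn * pq.1); rewrite Em En intrB !intrM.
  exists (row4 0 (2 * pi * (dl * (km * l - kn * k))%:~R) 0 0).
    by exists (dl * (km * l - kn * k)).
  rewrite r4 !addr0; congr (row4 _ _ _ _).
  + have -> : edge_t j pq ((z1, z2) + (w1, w2) + (2 * pi * k%:~R, 2 * pi * l%:~R)) =
      edge_t j pq (z1, z2) + edge_t j pq (w1, w2) + 2 * pi * (dl * (km * l - kn * k))%:~R.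
      by rewrite /edge_t /= Ed !(intrM, intrB) -Em -En; ring.
    by rewrite tw.1 addr0.
  + case: tw => _ [->|tw]; first by rewrite !mul0r.
    congr (_ * _).
    have -> : edge_s j pq ((z1, z2) + (w1, w2) + (2 * pi * k%:~R, 2 * pi * l%:~R)) =
      edge_s j pq (z1, z2) + edge_s j pq (w1, w2) + 2 * pi * (dl * (k * pq.2 - l * pq.1))%:~R.
      by rewrite /edge_s /= Ed !(intrM, intrB); ring.
    by rewrite tw addr0; have [] := cos_sin_turn (edge_s j pq (z1, z2)) (dl * (k * pq.2 - l * pq.1)).
  + case: tw => _ [->|tw]; first by rewrite !mul0r.
    congr (_ * _).
    have -> : edge_s j pq ((z1, z2) + (w1, w2) + (2 * pi * k%:~R, 2 * pi * l%:~R)) =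
      edge_s j pq (z1, z2) + edge_s j pq (w1, w2) + 2 * pi * (dl * (k * pq.2 - l * pq.1))%:~R.
      by rewrite /edge_s /= Ed !(intrM, intrB); ring.
    by rewrite tw addr0; have [] := cos_sin_turn (edge_s j pq (z1, z2)) (dl * (k * pq.2 - l * pq.1)).
- have [/= aj /= pj /= y0] := b; exists 0; rewrite // addr0.
  have [r10 r20 xE yE] := @corner_radiiP j x y y0.
  have [km [kn [Em En]]] := mn_int j; have [km' [kn' [Em' En']]] := mn_int j.+1.
  have S1 : corner_s1 j ((z1, z2) + (w1, w2) + (2 * pi * k%:~R, 2 * pi * l%:~R)) =
      corner_s1 j (z1, z2) + corner_s1 j (w1, w2) + 2 * pi * (k * kn' - l * km')%:~R.
    by rewrite /corner_s1 /= !(intrM, intrB) -Em' -En'; ring.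
  have S2 : corner_s2 j ((z1, z2) + (w1, w2) + (2 * pi * k%:~R, 2 * pi * l%:~R)) =
      corner_s2 j (z1, z2) + corner_s2 j (w1, w2) + 2 * pi * (km * l - kn * k)%:~R.
    by rewrite /corner_s2 /= !(intrM, intrB) -Em -En; ring.
  have [H1 H2] : (corner_r1 j x y = 0 \/ corner_s1 j (w1, w2) = 0) /\
      (corner_r2 j x y = 0 \/ corner_s2 j (w1, w2) = 0).
    rewrite /corner_s1 /corner_s2 /=; case: cw => [[-> ->]|[/= yz [[/= i Ii [s]]|[/= i xi]]]].
    + by split; right; ring.
    + have xj : x != a j.
        by apply/eqP => xj; case: (@edge_interior_corner i j); rewrite -xj.
      have : 2 * corner_r1 j x y * corner_r2 j x y == 0 by rewrite -yE yz.
      rewrite !mulf_eq0 pnatr_eq0 /= => /orP[]/eqP rz.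
      * have Ij : edge_interior e j x.
          split=> //; rewrite -subr_gt0 lt0r subr_eq0 xj /=.
          by rewrite xE rz expr0n subr0 sqr_ge0.
        rewrite -(edge_interior_inj Ij Ii) vecE pair_scale => -[-> ->].
        by split; [left|right; ring].
      * have Ij : edge_interior e j.+1 x.
          split=> //; rewrite /prev_corner lte_fin -subr_lt0 lt_neqAle subr_eq0 xj /=.
          by rewrite xE rz expr0n sub0r oppr_le0 sqr_ge0.
        rewrite -(edge_interior_inj Ij Ii) vecE pair_scale => -[-> ->].
        by split; [right; ring|left].
    + have ij : i = j.
        have xij : a i = x by rewrite -xi.
        apply/eqP; rewrite eqn_leq; apply/andP; split.
          have : (i < j.+1)%N by apply: corner_lt_inv; rewrite xij.
          by rewrite ltnS.
        case: j pj {aj b xE yE r10 r20 S1 S2 Em En Em' En'} => // j'.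
        by rewrite /prev_corner lte_fin -xij; exact: corner_lt_inv.
      have xz : x - a j = 0 by rewrite -ij -xi subrr.
      have rr : corner_r1 j x y = corner_r2 j x y.
        by rewrite /corner_r1 /corner_r2 xz subr0 addr0.
      have : 2 * corner_r1 j x y * corner_r2 j x y == 0 by rewrite -yE yz.
      rewrite !mulf_eq0 pnatr_eq0 /= => /orP[]/eqP rz.
        by split; left=> //; rewrite -rr.
      by split; left=> //; rewrite rr.
  rewrite S1 S2; congr (row4 _ _ _ _).
  + case: H1 => ->; first by rewrite !mul0r.
    by rewrite addr0; have [-> _] := cos_sin_turn (corner_s1 j (z1, z2)) (k * kn' - l * km').
  + case: H1 => ->; first by rewrite !mul0r.
    by rewrite addr0; have [_ ->] := cos_sin_turn (corner_s1 j (z1, z2)) (k * kn' - l * km').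
  + case: H2 => ->; first by rewrite !mul0r.
    by rewrite addr0; have [-> _] := cos_sin_turn (corner_s2 j (z1, z2)) (km * l - kn * k).
  + case: H2 => ->; first by rewrite !mul0r.
    by rewrite addr0; have [_ ->] := cos_sin_turn (corner_s2 j (z1, z2)) (km * l - kn * k).
Qed.

(** By [kap_fiber] all classes in the union defining [param] are equal. *)
Lemma param_kap c r : base c r.1 -> param alpha e c (kap c r) = cls e r.
Proof.
move=> b; apply/seteqP; split=> q.
  move=> [r' [/= H b']]; have /has_coordsP-/(_ b') E := H.
  have Ek : kap c r = kap c r' by apply/has_coordsP.
  by rewrite (kap_fiber b b' Ek).
by move=> H; exists r => //; split=> //; exact/has_coordsP.
Qed.

Lemma param_deck c c' r v : base c r.1 -> dom c' v -> param alpha e c' v = param alpha e c (kap c r) ->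
  base c' r.1 /\ exists2 d, deck c' d & v = kap c' r + d.
Proof.
move=> b /domP[r' b' ->]; rewrite !param_kap // => E.
have H : cls e r r' by rewrite -E; exact: cls_refl.
have b1 : base c' r.1 by have [/= <- _] := H.
by split=> //; have [_] := kap_deck b1 H.
Qed.

End Points.

(** * Changes of charts *)

Section Jacobian.
Variable R : realType.
Local Notation V := 'rV[R]_4.
Implicit Types (T S : V -> V) (u v : V).

Lemma jacE T v i k : differentiable T v -> 'J T v i k = partial i (fun u => T u 0 k) v.
Proof.
move=> dT; have dv : derivable T v (delta_mx 0 i) by exact: diff_derivable.
rewrite partialE; have := derive_mx dv; rewrite deriveEjacobian // => /matrixP/(_ 0 k).
by rewrite -rowE !mxE.
Qed.

Lemma C1_map_differentiable (U : set V) T v : open U -> U v ->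
  (forall k, Ck 1 U (fun u => T u 0 k)) -> differentiable T v.
Proof.
move=> oU Uv CT; have -> : T = \sum_k (fun u => T u 0 k *: (delta_mx 0 k : V)).
  by apply/funext => u; rewrite fct_sumE; exact: row_base.
apply: differentiable_sum => k; apply: differentiableZl.
by have [] := C1_differentiable oU Uv (CT k).
Qed.

Lemma jac_comp T S v : differentiable T v -> differentiable S (T v) ->
  'J (S \o T) v = 'J T v *m 'J S (T v).
Proof.
move=> dT dS; have jd (F : V -> V) u w : w *m 'J F u = 'd F u w.
  by rewrite /jacobian mul_rV_lin1.
apply/row_matrixP => i; rewrite !rowE mulmxA.
apply: etrans (jd (S \o T) v _) _.
apply: etrans (congr1 (fun h : V -> V => h (delta_mx 0 i)) (diff_comp dT dS)) _.
symmetry; apply: etrans (congr1 (fun w => w *m 'J S (T v)) (jd T v _)) _.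
exact: jd.
Qed.

Lemma partial_add_cst (f : V -> R) i (c : R) v : derivable f v (delta_mx 0 i) ->
  partial i (fun u => f u + c) v = partial i f v.
Proof.
move=> df; have dc : derivable (cst c : V -> R) v (delta_mx 0 i) by exact: derivable_cst.
by have := deriveD df dc; rewrite derive_cst addr0.
Qed.

Lemma near_open (P : set V) v : nbhs v P -> exists2 W, open_nbhs v W & W `<=` P.
Proof. by rewrite nbhsE. Qed.

Lemma jac_translate T S (d v : V) : differentiable T v -> differentiable S v ->
  (\forall u \near v, S u = T u + d) -> 'J S v = 'J T v.
Proof.
move=> dT dS /near_open[W [oW Wv] HW]; apply/matrixP => i k.
apply: etrans (jacE i k dS) _; apply: etrans _ (esym (jacE i k dT)).
have dTk : derivable (fun u => T u 0 k) v (delta_mx 0 i).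
  by have /derivable_mxP := diff_derivable (v := delta_mx 0 i) dT; exact.
apply: etrans _ (partial_add_cst (d 0 k) dTk).
by apply: (partial_eq_on i oW Wv) => u /HW ->; rewrite mxE.
Qed.

Lemma jac_id v : 'J (@id V) v = 1%:M.
Proof.
have d : differentiable (@id V) v by [].
by apply/matrixP => i k; rewrite (jacE i k d) partial_coord mxE eq_sym.
Qed.

End Jacobian.

Section PolarPullback.
Variable R : realType.
Local Notation V := 'rV[R]_4.
Variables (U : set V) (rho th : V -> R).
Hypotheses (oU : open U) (Cr : forall n, Ck n U rho) (Ct : forall n, Ck n U th).

Lemma Ck_polar n : Ck n U (fun u => rho u * cos (th u)) /\ Ck n U (fun u => rho u * sin (th u)).
Proof.
have [Cs Cc] := Ck_sincos oU (Ct n).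
by split; [exact: (Ck_mul oU (Cr n) Cc)|exact: (Ck_mul oU (Cr n) Cs)].
Qed.

(** X dY - Y dX = rho^2 dtheta for X + i Y = rho e^(i theta). *)
Lemma polar_pullback i v : U v ->
  partial i (fun u => rho u * sin (th u)) v * (rho v * cos (th v))
  - partial i (fun u => rho u * cos (th u)) v * (rho v * sin (th v)) =
  rho v ^+ 2 * partial i th v.
Proof.
move=> Uv; have [Cs Cc] := Ck_sincos oU (Ct 1).
have dt : is_derive v (delta_mx 0 i) th (partial i th v).
  by apply: derivableP; exact: (Ck_derivable (Ct 1) Uv).
rewrite (partial_mulE i Uv (Cr 1) Cs) (partial_mulE i Uv (Cr 1) Cc).
have -> : partial i (fun u => sin (th u)) v = cos (th v) * partial i th v.
  by rewrite partialE; have [_ ->] := is_derive_comp1 dt (is_derive_sin (th v)).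
have -> : partial i (fun u => cos (th u)) v = - sin (th v) * partial i th v.
  by rewrite partialE; have [_ ->] := is_derive_comp1 dt (is_derive_cos (th v)).
have cs := cos2Dsin2 (th v).
transitivity (rho v ^+ 2 * partial i th v * (cos (th v) ^+ 2 + sin (th v) ^+ 2)); first by ring.
by rewrite cs mulr1.
Qed.

End PolarPullback.

Section CoframeForm.
Variable R : realType.
Local Notation V := 'rV[R]_4.

(** The metric in the coframe dx, dy, phi, psi. It depends on the base point alone, so comparing the
    metrics of two charts amounts to comparing their coframes. *)
Definition td_gram (x y f p k : R) : 'M[R]_4 :=
  let W := p ^+ 2 + y ^+ 2 * k ^+ 2 - f * k in
  let s := f - y * (y * k) - x * p in let t := y * (x * k - p) in let q := y * k in
  \matrix_(i, j) (match val i, val j with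
  | 0, 0 => W | 1, 1 => W
  | 2, 2 => (s ^+ 2 + t ^+ 2) / W
  | 2, 3 => (- s * p + t * q) / W | 3, 2 => (- s * p + t * q) / W
  | 3, 3 => (p ^+ 2 + q ^+ 2) / W
  | _, _ => 0 end / f ^+ 2).

Lemma td_metric_coframe (d : toric_data R) v : td_metric d v =
  td_coframe d v *m td_gram (td_x d v) (td_y d v) (td_f d v) (td_p d v) (td_k d v)
    *m (td_coframe d v)^T.
Proof.
apply/matrixP => i j; rewrite !mxE sum4E !mxE !sum4E !mxE /= /td_s1 /td_s2.
rewrite -!/(td_V d v); move: (td_V d v)^-1 => Vi; ring.
Qed.

End CoframeForm.

Section BaseDependence.
Variables (R : realType) (alpha : R) (e : nat -> int).
Local Notation V := 'rV[R]_4.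

Lemma pser_dep (T : V -> R) (T' : nat -> V -> R) (v v' : V) :
  (forall c, T (xshift c v) = T (xshift c v')) ->
  (forall i c, T' i (xshift c v) = T' i (xshift c v')) ->
  pser alpha e T T' v = pser alpha e T T' v'.
Proof.
move=> H H'; rewrite /pser /pair_series /fsum; congr (limn (series _)).
by apply/funext => i; rewrite H H'.
Qed.

Lemma base_dep (v v' : V) : v 0 o0 = v' 0 o0 -> ysq v = ysq v' ->
  [/\ base_f alpha e v = base_f alpha e v', base_p alpha e v = base_p alpha e v' &
      base_k alpha e v = base_k alpha e v'].
Proof.
move=> x y; have r c : radius (xshift c v) = radius (xshift c v').
  by rewrite /radius !ysq_xshift !xshift_x x y.
by split; apply: pser_dep => *; rewrite /cosr /invr_rad ?xshift_x ?r ?x.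
Qed.

End BaseDependence.

(** * Comparison with the interior chart *)

Section InteriorHub.
Variables (R : realType) (alpha : R) (e : nat -> int).
Hypothesis cf : has_modified_cf alpha e.
Hypothesis e3 : forall j, (1 <= j)%N -> 3 <= e j.
Local Notation V := 'rV[R]_4.
Implicit Types (u v : V) (c : chart).
Local Notation a := (corner R e).
Local Notation m := (mden R e).
Local Notation n_ := (nnum R e).
Local Notation dom := (chart_dom alpha e).
Local Notation base := (chart_base alpha e).
Local Notation td c := (ch_td alpha e c).
Local Notation G c := (met alpha e c).

Definition rep_of v : rep R := ((v 0 o0, v 0 o1), (v 0 o2, v 0 o3)).
(** Coordinates in the interior chart are already a representative, so [kap] gives the transition to
    any other chart. *)
Definition TK c v : V := kap e c (rep_of v).

Definition hub_dom c : set V := [set v : V | base c (v 0 o0, v 0 o1) /\ 0 < v 0 o1].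

Lemma hub_dom_interior c v : hub_dom c v -> hub_dom Interior v.
Proof.
move=> [b y0]; split=> //; split=> //.
by have := chart_dom_gt cf e3 (dom_kap e3 (r := rep_of v) b);
  have [-> _] := has_coords_base ((has_coordsP e3 _ (r := rep_of v) b).2 erefl).
Qed.

Lemma open_hub_dom c : open (hub_dom c).
Proof.
have cx := @coord_cont R o0; have cy := @coord_cont R o1.
have oy : open [set v : V | 0 < v 0 o1] by exact: open_gt_fun.
case: c => [|j pq|j].
- have -> : hub_dom Interior = [set v : V | alpha < v 0 o0] `&` [set v : V | 0 < v 0 o1].
    by apply/seteqP; split=> v [] => [[]|] *; do !split.
  by apply: openI => //; exact: open_gt_fun.
- have [bas|nb] := pselect (edge_basis e j pq); last first.
    rewrite (_ : hub_dom _ = set0); first exact: open0.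
    by apply/seteqP; split=> // v [[]].
  have -> : hub_dom (Edge j pq) = ([set v : V | a j < v 0 o0]
      `&` [set v : V | ((v 0 o0)%:E < prev_corner R e j)%E]) `&` [set v : V | 0 < v 0 o1].
    by apply/seteqP; split=> v => [[[_ [h1 h2] _] h3]|[[h1 h2] h3]]; do !split=> //; exact: ltW.
  by apply: openI => //; apply: openI; [exact: open_gt_fun|exact: open_lt_prev].
- have -> : hub_dom (Corner j) = ([set v : V | a j.+1 < v 0 o0]
      `&` [set v : V | ((v 0 o0)%:E < prev_corner R e j)%E]) `&` [set v : V | 0 < v 0 o1].
    by apply/seteqP; split=> v => [[[h1 h2 _] h3]|[[h1 h2] h3]]; do !split=> //; exact: ltW.
  by apply: openI => //; apply: openI; [exact: open_gt_fun|exact: open_lt_prev].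
Qed.

Lemma TK_base c v : hub_dom c v -> [/\ dom c (TK c v), ch_x e c (TK c v) = v 0 o0,
  ch_ysq e c (TK c v) = v 0 o1 ^+ 2 & param alpha e c (TK c v) = cls e (rep_of v)].
Proof.
move=> [b y0]; have d := dom_kap e3 (r := rep_of v) b.
have [x y] := has_coords_base ((has_coordsP e3 _ (r := rep_of v) b).2 erefl).
by split=> //; exact: (param_kap e3 (r := rep_of v) b).
Qed.

Lemma TK_off c v : hub_dom c v -> off_dom alpha e c (TK c v).
Proof.
by move=> Hv; have [d _ y _] := TK_base Hv; split=> //; rewrite y exprn_gt0 //; case: Hv.
Qed.

Lemma Ck_edge_st j pq n U : open U ->
  Ck n U (fun v => edge_s e j pq (v 0 o2, v 0 o3)) /\ Ck n U (fun v => edge_t e j pq (v 0 o2, v 0 o3)).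
Proof. by move=> oU; split; rewrite /edge_s /edge_t /=; ck oU. Qed.

Lemma Ck_corner_s j n U : open U ->
  Ck n U (fun v => corner_s1 e j (v 0 o2, v 0 o3)) /\ Ck n U (fun v => corner_s2 e j (v 0 o2, v 0 o3)).
Proof. by move=> oU; split; rewrite /corner_s1 /corner_s2 /=; ck oU. Qed.

Lemma Ck_corner_r j n (U : set V) : open U -> (forall v, U v -> 0 < v 0 o1) ->
  Ck n U (fun v => corner_r1 e j (v 0 o0) (v 0 o1)) /\ Ck n U (fun v => corner_r2 e j (v 0 o0) (v 0 o1)).
Proof.
move=> oU U0; pose q (v : V) := (v 0 o0 - a j) ^+ 2 + v 0 o1 ^+ 2.
have q0 v : U v -> 0 < q v by move=> /U0 y0; rewrite ltr_wpDl ?sqr_ge0 // exprn_gt0.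
have Cq : Ck n U q by rewrite /q; ck oU.
have Cs : Ck n U (fun v => Num.sqrt (q v)) by exact: (Ck_sqrt oU q0 Cq).
have b v : U v -> `|v 0 o0 - a j| < Num.sqrt (q v).
  move=> Uv; rewrite -sqrtr_sqr ltr_sqrt ?q0 // /q ltrDl exprn_gt0 //; exact: U0.
have p1 v : U v -> 0 < (Num.sqrt (q v) - (v 0 o0 - a j)) / 2.
  by move=> /b; rewrite ltr_norml => /andP[]; lra.
have p2 v : U v -> 0 < (Num.sqrt (q v) + (v 0 o0 - a j)) / 2.
  by move=> /b; rewrite ltr_norml => /andP[]; lra.
have C1 : Ck n U (fun v => (Num.sqrt (q v) - (v 0 o0 - a j)) / 2) by ck oU.
have C2 : Ck n U (fun v => (Num.sqrt (q v) + (v 0 o0 - a j)) / 2) by ck oU.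
by split; [exact: (Ck_sqrt oU p1 C1)|exact: (Ck_sqrt oU p2 C2)].
Qed.

Lemma hub_corner_r j v : hub_dom (Corner j) v ->
  0 < corner_r1 e j (v 0 o0) (v 0 o1) /\ 0 < corner_r2 e j (v 0 o0) (v 0 o1).
Proof.
move=> [_ y0]; have [r1 r2 _ yE] := corner_radiiP e j (v 0 o0) (ltW y0).
by move: y0; rewrite {1}yE; move: (corner_r1 _ _ _ _) (corner_r2 _ _ _ _) r1 r2 => x y *; split; nra.
Qed.

Lemma Ck_TK c n k : Ck n (hub_dom c) (fun v => TK c v 0 k).
Proof.
have oU := @open_hub_dom c; have y0 v : hub_dom c v -> 0 < v 0 o1 by case.
case: c oU y0 => [|j pq|j] oU y0.
- apply: (Ck_ext oU (f := fun v => v 0 k)); last exact: Ck_coord.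
  by move=> v _; rewrite /TK /= -row4_eta.
- have [Cs Ct] := (fun n => (Ck_edge_st j pq n oU).1, fun n => (Ck_edge_st j pq n oU).2).
  have Cy n' : Ck n' (hub_dom (Edge j pq)) (fun v : V => v 0 o1) by exact: Ck_coord.
  have [P1 P2] := Ck_polar oU Cy Cs n.
  by elim/ord4_ind: k; [apply: (Ck_ext oU (f := fun v => v 0 o0)) (Ck_coord _ _ _)
    |apply: (Ck_ext oU _ (Ct n))|apply: (Ck_ext oU _ P1)|apply: (Ck_ext oU _ P2)] => v _; rewrite mxE.
- have Cr1 n' := (Ck_corner_r j n' oU y0).1; have Cr2 n' := (Ck_corner_r j n' oU y0).2.
  have Cs1 n' := (Ck_corner_s j n' oU).1; have Cs2 n' := (Ck_corner_s j n' oU).2.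
  have [P1 P2] := Ck_polar oU Cr1 Cs1 n; have [P3 P4] := Ck_polar oU Cr2 Cs2 n.
  by elim/ord4_ind: k; [apply: (Ck_ext oU _ P1)|apply: (Ck_ext oU _ P2)|apply: (Ck_ext oU _ P3)
    |apply: (Ck_ext oU _ P4)] => v _; rewrite mxE.
Qed.

Lemma TK_differentiable c v : hub_dom c v -> differentiable (TK c) v.
Proof. by move=> Hv; exact: (C1_map_differentiable (@open_hub_dom c) Hv (Ck_TK c 1)). Qed.

Lemma chain_TK c (F : V -> R) i v : hub_dom c v -> Ck 1 (off_dom alpha e c) F ->
  \sum_k 'J (TK c) v i k * partial k F (TK c v) = partial i (fun u => F (TK c u)) v.
Proof.
move=> Hv CF; have dT := TK_differentiable Hv.
have D k : is_derive v (delta_mx 0 i) (fun u => TK c u 0 k) ('J (TK c) v i k).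
  rewrite (jacE i k dT); apply: derivableP; exact: (Ck_derivable (Ck_TK c 1 k) Hv).
by rewrite partialE; have [_ ->] := is_derive_chain (@open_off_dom R alpha e c) (TK_off Hv) CF D.
Qed.

Lemma TK_angle c (k l : 'I_4) (rho th : V -> R) i v : hub_dom c v ->
  (forall n, Ck n (hub_dom c) rho) -> (forall n, Ck n (hub_dom c) th) -> 0 < rho v -> k != l ->
  (forall u, TK c u 0 k = rho u * cos (th u)) -> (forall u, TK c u 0 l = rho u * sin (th u)) ->
  \sum_k' 'J (TK c) v i k' * angle_form k l k' (TK c v) = partial i th v.
Proof.
move=> Hv Cr Ct r0 kl Ek El; have dT := TK_differentiable Hv; have oU := @open_hub_dom c.
have Ik : 'J (TK c) v i k = partial i (fun u => rho u * cos (th u)) v.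
  by rewrite (jacE i k dT); apply: (partial_eq_on i oU Hv) => u _.
have Il : 'J (TK c) v i l = partial i (fun u => rho u * sin (th u)) v.
  by rewrite (jacE i l dT); apply: (partial_eq_on i oU Hv) => u _.
have pp := polar_pullback oU Cr Ct i Hv.
have s2 : sqlen k l (TK c v) = rho v ^+ 2.
  by rewrite /sqlen Ek El !exprMn -mulrDr cos2Dsin2 mulr1.
rewrite /angle_form s2 (bigD1 k) //= (bigD1 l) 1?eq_sym //= big1 ?addr0; last first.
  by move=> k' /andP[/negbTE-> /negbTE->]; rewrite !mul0r subrr mul0r mulr0.
rewrite !eqxx [l == k]eq_sym (negbTE kl) Ik Il Ek El.
have r2 : rho v ^+ 2 != 0 by rewrite expf_neq0 // gt_eqF.
rewrite /= !(mul0r, mul1r, sub0r, subr0); apply: (mulfI r2); rewrite -pp; field; exact: lt0r_neq0.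
Qed.

(** The angles s, t or s_1, s_2 are linear in z_1, z_2; pulling back their differentials and
    recombining them with the lattice vectors recovers dz_1 and - dz_2. *)
Lemma form_pullback c i v : hub_dom c v ->
  \sum_k 'J (TK c) v i k * ch_phi e c k (TK c v) = (i == o2)%:R /\
  \sum_k 'J (TK c) v i k * ch_psi e c k (TK c v) = - (i == o3)%:R.
Proof.
move=> Hv; have oU := @open_hub_dom c; have y0 u : hub_dom c u -> 0 < u 0 o1 by case.
have dT := TK_differentiable Hv; case: c Hv dT oU y0 => [|j pq|j] Hv dT oU y0.
- have Jk k : 'J (TK Interior) v i k = (i == k)%:R.
    rewrite (jacE i k dT) eq_sym -(@partial_coord R i k v); apply: (partial_eq_on i oU Hv) => u _.
    by rewrite /TK /= -row4_eta.
  by rewrite !sum4E !Jk /ch_phi /ch_psi /= !(mulr0, mulr1, addr0, add0r, mulrN, oppr0).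
- have Cs n := (Ck_edge_st j pq n oU).1; have Ct n := (Ck_edge_st j pq n oU).2.
  have Cy n : Ck n (hub_dom (Edge j pq)) (fun v : V => v 0 o1) by exact: Ck_coord.
  have bas : edge_basis e j pq by case: Hv => -[].
  have A := @TK_angle (Edge j pq) o2 o3 _ _ i v Hv Cy Cs (y0 v Hv) isT.
  have {}A : \sum_k 'J (TK (Edge j pq)) v i k * angle_form o2 o3 k (TK (Edge j pq) v) =
      partial i (fun v => edge_s e j pq (v 0 o2, v 0 o3)) v by apply: A => u; rewrite mxE.
  have Jt : 'J (TK (Edge j pq)) v i o1 = partial i (fun v => edge_t e j pq (v 0 o2, v 0 o3)) v.
    by rewrite (jacE i o1 dT); apply: (partial_eq_on i oU Hv) => u _; rewrite mxE.
  have S (x y : R) : \sum_k 'J (TK (Edge j pq)) v i k *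
      (x * angle_form o2 o3 k (TK (Edge j pq) v) + y * (k == o1)%:R) =
      x * partial i (fun v => edge_s e j pq (v 0 o2, v 0 o3)) v
      + y * partial i (fun v => edge_t e j pq (v 0 o2, v 0 o3)) v.
    rewrite -A -Jt !sum4E /=; ring.
  have Z u := (edge_st_decomp (u 0 o2, u 0 o3) _ _ bas).2 (conj erefl erefl).
  rewrite /ch_phi /ch_psi; split.
    apply: etrans (S _ _) _; rewrite -(partial_lin _ _ i oU Hv (Cs 1%N) (Ct 1%N)).
    rewrite eq_sym -(@partial_coord R i o2 v); apply: (partial_eq_on i oU Hv) => u _.
    rewrite [X in X + _]mulrC [pq.1%:~R * _]mulrC; exact: (esym (congr1 fst (Z u))).
  have E := S (n_ j) pq.2%:~R; rewrite -(partial_lin _ _ i oU Hv (Cs 1%N) (Ct 1%N)) in E.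
  transitivity (- \sum_k 'J (TK (Edge j pq)) v i k *
      (n_ j * angle_form o2 o3 k (TK (Edge j pq) v) + pq.2%:~R * (k == o1)%:R)).
    by rewrite -sumrN; apply: eq_bigr => k _; rewrite mulrN.
  rewrite E; congr (- _); rewrite eq_sym -(@partial_coord R i o3 v); apply: (partial_eq_on i oU Hv) => u _.
  rewrite [X in X + _]mulrC [pq.2%:~R * _]mulrC; exact: (esym (congr1 snd (Z u))).
- have Cs n := (Ck_corner_s j n oU).1; have Ct n := (Ck_corner_s j n oU).2.
  have Cr n := (Ck_corner_r j n oU y0).1; have Cq n := (Ck_corner_r j n oU y0).2.
  have [r1 r2] := hub_corner_r Hv.
  have A := @TK_angle (Corner j) o0 o1 _ _ i v Hv Cr Cs r1 isT.
  have B := @TK_angle (Corner j) o2 o3 _ _ i v Hv Cq Ct r2 isT.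
  have {}A : \sum_k 'J (TK (Corner j)) v i k * angle_form o0 o1 k (TK (Corner j) v) =
      partial i (fun v => corner_s1 e j (v 0 o2, v 0 o3)) v by apply: A => u; rewrite mxE.
  have {}B : \sum_k 'J (TK (Corner j)) v i k * angle_form o2 o3 k (TK (Corner j) v) =
      partial i (fun v => corner_s2 e j (v 0 o2, v 0 o3)) v by apply: B => u; rewrite mxE.
  have S (x y : R) : \sum_k 'J (TK (Corner j)) v i k *
      (x * angle_form o0 o1 k (TK (Corner j) v) + y * angle_form o2 o3 k (TK (Corner j) v)) =
      x * partial i (fun v => corner_s1 e j (v 0 o2, v 0 o3)) v
      + y * partial i (fun v => corner_s2 e j (v 0 o2, v 0 o3)) v.
    rewrite -A -B !mulr_sumr -big_split; apply: eq_bigr => k _ /=; ring.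
  have Z u := (corner_s_decomp e3 j (u 0 o2, u 0 o3) _ _).2 (conj erefl erefl).
  rewrite /ch_phi /ch_psi; split.
    apply: etrans (S _ _) _; rewrite -(partial_lin _ _ i oU Hv (Cs 1%N) (Ct 1%N)).
    rewrite eq_sym -(@partial_coord R i o2 v); apply: (partial_eq_on i oU Hv) => u _.
    rewrite [X in X + _]mulrC [m j.+1 * _]mulrC; exact: (esym (congr1 fst (Z u))).
  have E := S (n_ j) (n_ j.+1); rewrite -(partial_lin _ _ i oU Hv (Cs 1%N) (Ct 1%N)) in E.
  transitivity (- \sum_k 'J (TK (Corner j)) v i k *
      (n_ j * angle_form o0 o1 k (TK (Corner j) v) + n_ j.+1 * angle_form o2 o3 k (TK (Corner j) v))).
    by rewrite -sumrN; apply: eq_bigr => k _; rewrite mulrN.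
  rewrite E; congr (- _); rewrite eq_sym -(@partial_coord R i o3 v); apply: (partial_eq_on i oU Hv) => u _.
  rewrite [X in X + _]mulrC [n_ j.+1 * _]mulrC; exact: (esym (congr1 snd (Z u))).
Qed.

Lemma coframe_pullback c v : hub_dom c v ->
  'J (TK c) v *m td_coframe (td c) (TK c v) = td_coframe (td Interior) v.
Proof.
move=> Hv; have oU := @open_hub_dom c; have oO := @open_off_dom R alpha e c.
have Ht n := td_smooth (ch_toric cf e3 c) n.
apply/matrixP => i; elim/ord4_ind; rewrite [LHS]mxE [RHS]mxE.
- transitivity (\sum_k 'J (TK c) v i k * partial k (td_x (td c)) (TK c v)).
    by apply: eq_bigr => k _; congr (_ * _); rewrite mxE.
  have [Cx _ _ _ _] := Ht 1%N.
  apply: etrans (chain_TK i Hv Cx) _; apply: (partial_eq_on i oU Hv) => u Hu.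
  by have [_ H _ _] := TK_base Hu; apply: (etrans H); rewrite /= mxE.
- transitivity (\sum_k 'J (TK c) v i k * partial k (td_y (td c)) (TK c v)).
    by apply: eq_bigr => k _; congr (_ * _); rewrite mxE.
  have [_ Cy _ _ _] := Ht 1%N.
  apply: etrans (chain_TK i Hv Cy) _; apply: (partial_eq_on i oU Hv) => u Hu.
  have [_ _ H _] := TK_base Hu; have H' := ch_ysq_interior e u.
  by apply: (congr1 Num.sqrt); apply: etrans H (esym H').
- transitivity (\sum_k 'J (TK c) v i k * ch_phi e c k (TK c v)).
    by apply: eq_bigr => k _; congr (_ * _); rewrite mxE.
  exact: (form_pullback i Hv).1.
- transitivity (\sum_k 'J (TK c) v i k * ch_psi e c k (TK c v)).
    by apply: eq_bigr => k _; congr (_ * _); rewrite mxE.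
  exact: (form_pullback i Hv).2.
Qed.

Lemma TK_gram c v : hub_dom c v ->
  let G' d u := td_gram (td_x d u) (td_y d u) (td_f d u) (td_p d u) (td_k d u) in
  G' (td c) (TK c v) = G' (td Interior) v.
Proof.
move=> Hv; have [_ Ex Ey _] := TK_base Hv.
have Ex' : ch_base e c (TK c v) 0 o0 = ch_base e Interior v 0 o0.
  by apply: (etrans Ex); rewrite mxE.
have Ey' : ysq (ch_base e c (TK c v)) = ysq (ch_base e Interior v).
  exact: (etrans Ey (esym (ch_ysq_interior e v))).
have [Ef Ep Ek] := base_dep alpha e Ex' Ey'.
by rewrite /= Ex' Ey' Ef Ep Ek.
Qed.

(** Both metrics have the same matrix [td_gram], and [TK] pulls one coframe back to the other. *)
Lemma TK_metric c v : hub_dom c v ->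
  G Interior v = 'J (TK c) v *m G c (TK c v) *m ('J (TK c) v)^T.
Proof.
move=> Hv; have HI := hub_dom_interior Hv.
have DI : dom Interior v by apply/chart_dom_interior; case: HI => -[].
rewrite (met_td cf e3 (TK_off Hv)) (met_td cf e3 (off_dom_interior DI)).
rewrite (td_metric_coframe (td c)) (TK_gram Hv) (td_metric_coframe (td Interior)).
by rewrite -(coframe_pullback Hv) trmx_mul !mulmxA.
Qed.

Lemma TK_orient c v : hub_dom c v -> Num.sg (\det ('J (TK c) v)) * orient R e c = -1.
Proof.
move=> Hv; have HI := hub_dom_interior Hv.
have DI : dom Interior v by apply/chart_dom_interior; case: HI => -[].
have := congr1 (fun A : 'M[R]_4 => Num.sg (\det A)) (coframe_pullback Hv).
by rewrite det_mulmx sgrM (coframe_sg cf e3 (TK_off Hv)) (coframe_sg cf e3 (off_dom_interior DI)).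
Qed.

(** The torus invariance in its simplest form: in the interior chart neither the coframe nor the
    Gram matrix involves the angles. *)
Lemma met_interior_dep v v' : dom Interior v -> v 0 o0 = v' 0 o0 -> v 0 o1 = v' 0 o1 ->
  G Interior v = G Interior v'.
Proof.
move=> DI E0 E1; have DI' : dom Interior v'.
  by apply/chart_dom_interior; rewrite -E0 -E1; exact: (chart_dom_interior alpha e v).1 DI.
have O := off_dom_interior DI; have O' := off_dom_interior DI'.
have Ex : ch_base e Interior v 0 o0 = ch_base e Interior v' 0 o0 by rewrite !mxE.
have Ey : ysq (ch_base e Interior v) = ysq (ch_base e Interior v').
  exact: etrans (ch_ysq_interior e v) (etrans (congr1 (fun z => z ^+ 2) E1) (esym (ch_ysq_interior e v'))).
have [Ef Ep Ek] := base_dep alpha e Ex Ey.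
rewrite (met_td cf e3 O) (met_td cf e3 O') !td_metric_coframe /= Ex Ey Ef Ep Ek.
suff -> : td_coframe (td Interior) v = td_coframe (td Interior) v' by [].
apply/matrixP => i; elim/ord4_ind; rewrite [LHS]mxE [RHS]mxE //=.
- exact: etrans (partial_ch_x e Interior i v) (esym (partial_ch_x e Interior i v')).
- have y0 : Num.sqrt (ch_ysq e Interior v') != 0 by rewrite sqrtr_eq0 -ltNge; case: O'.
  apply: (mulfI y0); apply: etrans _ (esym (partial_ch_y cf e3 i O')).
  have yy : ch_ysq e Interior v' = ch_ysq e Interior v.
    exact: etrans (ch_ysq_interior e v') (etrans (congr1 (fun z => z ^+ 2) (esym E1)) (esym (ch_ysq_interior e v))).
  rewrite [X in Num.sqrt X * _]yy; apply: etrans (partial_ch_y cf e3 i O) _.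
  by rewrite /ydy_form E1.
Qed.

End InteriorHub.

(** * The torus action *)

Section Torus.
Variables (R : realType) (alpha : R) (e : nat -> int).
Hypothesis cf : has_modified_cf alpha e.
Hypothesis e3 : forall j, (1 <= j)%N -> 3 <= e j.
Local Notation V := 'rV[R]_4.
Implicit Types (u v : V) (c : chart) (r : rep R) (w : R * R).
Local Notation a := (corner R e).
Local Notation m := (mden R e).
Local Notation n_ := (nnum R e).
Local Notation dom := (chart_dom alpha e).
Local Notation base := (chart_base alpha e).
Local Notation G c := (met alpha e c).
Local Notation param := (param alpha e).

Definition turn (p q : R) : 'M[R]_4 := \matrix_(i, k) (match val i, val k with
  | 0, 0 => cos p | 0, 1 => sin p | 1, 0 => - sin p | 1, 1 => cos p
  | 2, 2 => cos q | 2, 3 => sin q | 3, 2 => - sin q | 3, 3 => cos q | _, _ => 0 end).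

Lemma turn0 : turn 0 0 = 1%:M.
Proof.
by apply/matrixP; elim/ord4_ind; elim/ord4_ind; rewrite !mxE /= ?cos0 ?sin0 ?oppr0.
Qed.

Lemma row4_turn (x y z t p q : R) : row4 x y z t *m turn p q =
  row4 (x * cos p - y * sin p) (x * sin p + y * cos p)
       (z * cos q - t * sin q) (z * sin q + t * cos q).
Proof. by apply/rowP; elim/ord4_ind; rewrite !mxE sum4E !mxE /=; ring. Qed.

Lemma row4D (p1 p2 p3 p4 q1 q2 q3 q4 : R) : row4 p1 p2 p3 p4 + row4 q1 q2 q3 q4 =
  row4 (p1 + q1) (p2 + q2) (p3 + q3) (p4 + q4).
Proof. by apply/rowP; elim/ord4_ind; rewrite !mxE. Qed.

(** In each chart the action is affine: it rotates the planes whose circles can collapse and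
    translates the remaining angles. *)
Definition act_mx c w : 'M[R]_4 := match c with
  | Interior => 1%:M
  | Edge j pq => turn 0 (edge_s e j pq w)
  | Corner j => turn (corner_s1 e j w) (corner_s2 e j w) end.

Definition act_shift c w : V := match c with
  | Interior => row4 0 0 w.1 w.2
  | Edge j pq => row4 0 (edge_t e j pq w) 0 0
  | Corner j => 0 end.

Definition act_map c w v : V := v *m act_mx c w + act_shift c w.

Lemma kap_act c r w : kap e c (r.1, r.2 + w) = act_map c w (kap e c r).
Proof.
case: r w => [[x y] [z1 z2]] [w1 w2]; rewrite /act_map /kap /=.
case: c => [|j pq|j] /=.
- by rewrite mulmx1 row4D !addr0.
- rewrite row4_turn row4D !addr0 cos0 sin0 !mulr0 !mulr1 subr0 add0r.
  have -> : edge_s e j pq (z1 + w1, z2 + w2) = edge_s e j pq (z1, z2) + edge_s e j pq (w1, w2).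
    by rewrite /edge_s /=; ring.
  have -> : edge_t e j pq (z1 + w1, z2 + w2) = edge_t e j pq (z1, z2) + edge_t e j pq (w1, w2).
    by rewrite /edge_t /=; ring.
  by rewrite cosD sinD; congr (row4 _ _ _ _); ring.
- rewrite row4_turn addr0.
  have -> : corner_s1 e j (z1 + w1, z2 + w2) = corner_s1 e j (z1, z2) + corner_s1 e j (w1, w2).
    by rewrite /corner_s1 /=; ring.
  have -> : corner_s2 e j (z1 + w1, z2 + w2) = corner_s2 e j (z1, z2) + corner_s2 e j (w1, w2).
    by rewrite /corner_s2 /=; ring.
  move: (corner_s1 _ _ _) (corner_s1 _ _ _) (corner_s2 _ _ _) (corner_s2 _ _ _) => p1 p2 q1 q2.
  by rewrite !cosD !sinD; congr (row4 _ _ _ _); ring.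
Qed.

Lemma act_cls r w : act w (cls e r) = cls e (r.1, r.2 + w).
Proof.
apply/seteqP; split=> q.
  move=> [q' [b [z cz [k [l E]]]] <-]; split=> //=; exists z => //; exists k, l.
  by rewrite E addrAC; congr (_ + _); rewrite addrAC.
move=> [b [z cz [k [l E]]]]; exists (q.1, q.2 - w).
  split=> //=; exists z => //; exists k, l.
  by rewrite E /= addrAC [r.2 + w + z]addrAC addrK.
by rewrite /= subrK; case: q {b E}.
Qed.

Lemma act_map_param c w v : dom c v ->
  dom c (act_map c w v) /\ param c (act_map c w v) = act w (param c v).
Proof.
move=> /(domP e3)[r b ->]; have b' : base c (r.1, r.2 + w).1 by [].
rewrite (param_kap e3 b) act_cls -kap_act; split; first exact: (dom_kap e3 b').
exact: (param_kap e3 b').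
Qed.

Lemma act_map_coord c w k v : act_map c w v 0 k =
  \sum_l v 0 l * act_mx c w l k + act_shift c w 0 k.
Proof. by rewrite !mxE. Qed.

Lemma Ck_act_map c w n k (U : set V) : open U -> Ck n U (fun v => act_map c w v 0 k).
Proof.
move=> oU; apply: (Ck_ext oU (f := fun v => (v 0 o0 * act_mx c w o0 k + v 0 o1 * act_mx c w o1 k
   + v 0 o2 * act_mx c w o2 k + v 0 o3 * act_mx c w o3 k) + act_shift c w 0 k)).
  by move=> v _; rewrite act_map_coord sum4E.
by ck oU.
Qed.

Lemma act_map_differentiable c w v : differentiable (act_map c w) v.
Proof. exact: (C1_map_differentiable openT I (fun k => Ck_act_map c w 1 k openT)). Qed.

Lemma jac_act_map c w v : 'J (act_map c w) v = act_mx c w.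
Proof.
have dL : forall u, differentiable (mulmxr (act_mx c w) : V -> V) u.
  move=> u; have d : forall x, mulmxr (act_mx c w) x = act_map c w x - act_shift c w.
    by move=> x; rewrite addrK.
  rewrite (_ : (mulmxr _ : V -> V) = act_map c w - cst (act_shift c w)); last exact/funext.
  by apply: differentiableB; [exact: act_map_differentiable|exact: differentiable_cst].
have cL : continuous (mulmxr (act_mx c w) : V -> V).
  by move=> u; exact: differentiable_continuous.
have -> : 'J (act_map c w) v = 'J (mulmxr (act_mx c w) : V -> V) v.
  apply: (jac_translate (d := act_shift c w)) => //; first exact: act_map_differentiable.
  have FF : Filter (nbhs v) by exact: nbhs_filter.
  by apply: (@filterE _ _ FF) => u.
apply/row_matrixP => i; rewrite !rowE /jacobian mul_rV_lin1.
by rewrite (diff_lin v cL).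
Qed.

Lemma TK_act c w v : TK e c (v + row4 0 0 w.1 w.2) = act_map c w (TK e c v).
Proof.
rewrite /TK -kap_act; congr (kap e c _); rewrite /rep_of !mxE /= !addr0.
by case: w.
Qed.

Lemma TK_kap c r : 0 < r.1.2 -> base c r.1 -> exists2 u, hub_dom alpha e c u & TK e c u = kap e c r.
Proof.
case: r => [[x y] [z1 z2]] /= y0 b; exists (row4 x y z1 z2); last first.
  by rewrite /TK /rep_of !mxE.
by split; rewrite /= !mxE.
Qed.

Lemma off_dom_TK c v : dom c v -> 0 < ch_ysq e c v ->
  exists2 u, hub_dom alpha e c u & TK e c u = v.
Proof.
move=> /(domP e3)[r b vE] Y0; have y0 := base_ge0 b.
have [_ Y] := has_coords_base ((has_coordsP e3 v b).2 vE).
have {}y0 : 0 < r.1.2 by rewrite lt0r y0 andbT -sqrf_eq0 gt_eqF // -Y.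
by rewrite vE; exact: TK_kap.
Qed.

Lemma jac_TK_unit c v : hub_dom alpha e c v -> 'J (TK e c) v \in unitmx.
Proof.
move=> /(TK_orient cf e3) H; rewrite unitmxE unitfE; apply/negP => /eqP d0.
by move: H; rewrite d0 sgr0 mul0r => /eqP; rewrite eq_sym oppr_eq0 oner_eq0.
Qed.

Lemma mx_cancel (A B C : 'M[R]_4) : A \in unitmx -> A *m B *m A^T = A *m C *m A^T -> B = C.
Proof.
move=> Au H; have At : A^T \in unitmx by rewrite unitmx_tr.
have := congr1 (fun X => X *m invmx A^T) H; rewrite !mulmxK // => {}H.
by have := congr1 (fun X => invmx A *m X) H; rewrite !mulKmx.
Qed.

(** In the interior chart the action is a translation that preserves the metric, and [TK]
    intertwines the two actions. *)
Lemma act_map_metric_off c w v : dom c v -> 0 < ch_ysq e c v ->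
  G c v = act_mx c w *m G c (act_map c w v) *m (act_mx c w)^T.
Proof.
move=> Dv Y0; have [u Hu Ev] := off_dom_TK Dv Y0.
pose s : V := row4 0 0 w.1 w.2.
have Hs : hub_dom alpha e c (u + s) by move: Hu; rewrite /hub_dom /= !mxE /= !addr0.
have DI : dom Interior u.
  by apply/chart_dom_interior; have [[]] := hub_dom_interior cf e3 Hu.
have E : G Interior u = G Interior (u + s).
  by apply: (met_interior_dep cf e3 DI); rewrite !mxE /= addr0.
have dsh : differentiable (fun x : V => x + s) u.
  by apply: differentiableD => //; exact: differentiable_cst.
have J1 : 'J (fun x : V => x + s) u = 1%:M.
  rewrite -(jac_id u); apply: (jac_translate (d := s)) => //; have FF : Filter (nbhs u) by exact: nbhs_filter.
  by apply: (@filterE _ _ FF) => x.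
have J2 : 'J (TK e c) (u + s) = 'J (TK e c) u *m act_mx c w.
  rewrite -(jac_act_map c w (TK e c u)) -jac_comp; last exact: act_map_differentiable.
    rewrite (_ : act_map c w \o TK e c = TK e c \o (fun x => x + s)).
      have dT : differentiable (TK e c) ((fun x : V => x + s) u) by exact: (TK_differentiable Hs).
      by rewrite (jac_comp dsh dT) J1 mul1mx.
    by apply/funext => x; rewrite /= TK_act.
  exact: (TK_differentiable Hu).
move: E; rewrite (TK_metric cf e3 Hu) (TK_metric cf e3 Hs) J2 TK_act Ev trmx_mul !mulmxA.
by move=> H; apply: (mx_cancel (jac_TK_unit Hu)); rewrite !mulmxA.
Qed.

Lemma act_map_metric c w v : dom c v ->
  G c v = act_mx c w *m G c (act_map c w v) *m (act_mx c w)^T.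
Proof.
move=> Dv; have oD := @open_chart_dom R alpha e c.
have S u : dom c u -> dom c (act_map c w u) by move=> /(act_map_param w)[].
have C i k : Ck 0 (dom c) (fun u => G c u i k) by exact: Ck_met.
have C' i k : Ck 0 (dom c) (fun u => G c (act_map c w u) i k).
  by apply: (Ck_comp oD oD S (C i k)) => l; exact: Ck_act_map.
apply/matrixP => i k.
pose F u := G c u i k - (act_mx c w *m G c (act_map c w u) *m (act_mx c w)^T) i k.
have CF : Ck 0 (dom c) F.
  apply: (Ck_sub_fun oD) => //.
  apply: (Ck_ext oD (f := fun u => \sum_p (\sum_q act_mx c w i q * G c (act_map c w u) q p)
       * act_mx c w k p)).
    by move=> u _; rewrite mxE; apply: eq_bigr => p _; rewrite !mxE.
  apply: (Ck_sum oD) => p _; apply: (Ck_mul oD); last exact: Ck_cst.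
  by apply: (Ck_sum oD) => q _; apply: (Ck_mul oD) => //; exact: Ck_cst.
apply/eqP; rewrite -subr_eq0; apply/eqP.
apply: (dense_eq0 (F := F) Dv); first exact: (Ck_cont CF Dv).
by move=> u Du Yu; rewrite /F -(act_map_metric_off w Du Yu) subrr.
Qed.

(** Deck transformations are the action of elements of 2 pi Z^2, which is trivial on points; hence
    the invariance under the torus covers them. *)
Lemma deckP c d v : dom c v -> deck c d -> exists w, [/\ act_mx c w = 1%:M, act_shift c w = d &
  forall P, act w (param c P) = param c P].
Proof.
have H r k l : act (2 * pi * k%:~R, 2 * pi * l%:~R) (cls e r) = cls e r.
  rewrite act_cls; symmetry; apply: (cls_eq e3); split=> //; exists 0; first by left.
  by exists k, l; rewrite /= addr0.
have H' (k l : int) P : act (2 * pi * k%:~R, 2 * pi * l%:~R) (param c P) = param c P.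
  apply/seteqP; split=> q.
    by move=> [q' [r Hr Hq] <-]; exists r => //; rewrite -(H r k l); exists q'.
  move=> [r Hr]; rewrite -(H r k l) => -[q' Hq <-]; exists q' => //; by exists r.
case: c H' => [|j pq|j] H' Dv /=.
- by move=> [k [l ->]]; exists (2 * pi * k%:~R, 2 * pi * l%:~R).
- move=> [k ->]; exists (2 * pi * (k * pq.1)%:~R, 2 * pi * (k * pq.2)%:~R).
  have bas : edge_basis e j pq by case/chart_dom_edge: Dv.
  split=> //; rewrite /edge_s /edge_t /= !intrM.
    by rewrite (_ : _ * _ = 0) ?turn0 //; ring.
  congr (row4 _ _ _ _); transitivity (2 * pi * k%:~R * (m j * pq.2%:~R - n_ j * pq.1%:~R) ^+ 2); first by ring.
  by rewrite (edge_basis_det R bas) mulr1.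
- move=> ->; exists (2 * pi * 0%:~R, 2 * pi * 0%:~R); split=> //; rewrite /= /corner_s1 /corner_s2 /=.
  by rewrite !mulr0 !mul0r subrr turn0.
Qed.

End Torus.

(** * Compatibility of the charts *)

Section Compatibility.
Variables (R : realType) (alpha : R) (e : nat -> int).
Hypothesis cf : has_modified_cf alpha e.
Hypothesis e3 : forall j, (1 <= j)%N -> 3 <= e j.
Local Notation V := 'rV[R]_4.
Implicit Types (u v : V) (c : chart) (r : rep R) (T tau : V -> V).
Local Notation a := (corner R e).
Local Notation m := (mden R e).
Local Notation n_ := (nnum R e).
Local Notation dom := (chart_dom alpha e).
Local Notation base := (chart_base alpha e).
Local Notation G := (met alpha e).
Local Notation param := (param alpha e).
Local Notation orient := (orient R e).

Definition compat c c' tau v := G c v = pullback G c' tau v /\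
  orient c = Num.sg (\det ('J tau v)) * orient c'.

(** An explicit smooth expression of the identity on an open set, in contrast to the [tau] of
    [represents], which is arbitrary near the point and only differentiable at it. *)
Definition transition (W : set V) c c' T :=
  [/\ open W, W `<=` dom c, forall n k, Ck n W (fun u => T u 0 k) &
      forall u, W u -> dom c' (T u) /\ param c' (T u) = param c u].

Lemma transition_differentiable W c c' T v : transition W c c' T -> W v -> differentiable T v.
Proof. by move=> [oW _ CT _] Wv; exact: (C1_map_differentiable oW Wv (CT 1%N)). Qed.

Lemma transition_represents W c c' T v : transition W c c' T -> W v ->
  represents alpha e id c c' T v.
Proof.
move=> [oW _ _ H] Wv; have N : nbhs v W by apply: open_nbhs_nbhs.
have FF : Filter (nbhs v) by exact: nbhs_filter.
by apply: filterS N => u /H.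
Qed.

Lemma param_inj c v v' : dom c v -> dom c v' -> param c v' = param c v -> deck c (v' - v).
Proof.
move=> /(domP e3)[r b ->] Dv' E; have [_ [d Dd ->]] := param_deck e3 b Dv' E.
by rewrite addrAC subrr add0r.
Qed.

(** Distinct multiples of 2 pi are at least 2 pi apart, and pi >= 2 suffices here. *)
Lemma turn_discrete (k l : int) : `|2 * pi * k%:~R - 2 * pi * l%:~R| < 1 :> R -> k = l.
Proof.
rewrite -mulrBr -intrB normrM -intr_norm => H; apply/eqP; rewrite -subr_eq0 -normr_eq0.
have p2 := @pi_ge2 R; rewrite eq_le normr_ge0 andbT -ltzD1 add0r -(ltr_int R).
have h0 : 0 <= (`|k - l|%:~R : R) by rewrite ler0z.
rewrite ger0_norm in H; last by lra.
nra.
Qed.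

Lemma deck_discrete c (d d' : V) : deck c d -> deck c d' -> `|d - d'| < 1 -> d = d'.
Proof.
have co (x y : V) i : `|x - y| < 1 -> `|x 0 i - y 0 i| < 1.
  by move=> H; apply: le_lt_trans H; have := coord_le_norm (x - y) i; rewrite !mxE.
case: c => [|j pq|j] /=; last by move=> -> ->.
- move=> [k [l ->]] [k' [l' ->]] H; have H2 := co _ _ o2 H; have H3 := co _ _ o3 H.
  move: H2 H3; rewrite !mxE /= => /turn_discrete-> /turn_discrete->; done.
- move=> [k ->] [k' ->] H; have H1 := co _ _ o1 H.
  by move: H1; rewrite !mxE /= => /turn_discrete->.
Qed.

Lemma deck_invariant c v d : dom c v -> deck c d ->
  [/\ dom c (v + d), param c (v + d) = param c v & G c (v + d) = G c v].
Proof.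
move=> Dv /(deckP e3 Dv)[w [A1 A2 A3]].
have [D P] := act_map_param e3 w Dv; have E := act_map_metric cf e3 w Dv.
have Em : act_map e c w v = v + d by rewrite /act_map A1 A2 mulmx1.
by rewrite Em A1 trmx1 mul1mx mulmx1 A3 in D P E; split.
Qed.

(* Two expressions of the same points differ by an element of the discrete group of deck
   transformations, which is constant near [u] by continuity. *)
Lemma transition_compose W W' c c1 c2 T T' tau u : transition W c c1 T -> transition W' c c2 T' ->
  W u -> W' u -> represents alpha e id c1 c2 tau (T u) -> differentiable tau (T u) ->
  exists2 d, deck c2 d & tau (T u) = T' u + d /\ 'J T' u = 'J T u *m 'J tau (T u).
Proof.
move=> HT HT' Wu Wu' Rt dt; have dT := transition_differentiable HT Wu.
have dT' := transition_differentiable HT' Wu'.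
have [oW _ _ HW] := HT; have [oW' _ _ HW'] := HT'.
have FF : Filter (nbhs u) by exact: nbhs_filter.
have dc : differentiable (tau \o T) u by exact: differentiable_comp.
pose delta x := tau (T x) - T' x.
have cd : {for u, continuous delta}.
  apply: (continuousB (f := tau \o T)).
    exact: (differentiable_continuous dc).
  exact: (differentiable_continuous dT').
have N : \forall x \near u, deck c2 (delta x) /\ `|delta x - delta u| < 1.
  apply: filterI; last first.
    have := @cvgrPdist_lt _ _ _ _ FF delta (delta u).
    move=> /iffLR/(_ cd 1 ltr01); apply: filterS => x; by rewrite distrC.
  have cT : {for u, continuous T} by exact: (differentiable_continuous dT).
  have N1 : nbhs u (fun x => dom c2 (tau (T x)) /\ param c2 (tau (T x)) = param c1 (T x)) := cT _ Rt.
  have N2 : nbhs u W by exact: open_nbhs_nbhs.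
  have N3 : nbhs u W' by exact: open_nbhs_nbhs.
  apply: (@filterS _ _ FF _ _ _ (@filterI _ _ FF _ _ N1 (@filterI _ _ FF _ _ N2 N3))) => x [[D1 P1] [/HW[_ P2] /HW'[D3 P3]]].
  by apply: param_inj => //; rewrite P1 P2 P3.
have [Du _] := nbhs_singleton N; exists (delta u) => //; split.
  by rewrite /delta addrC subrK.
rewrite -(jac_comp dT dt); symmetry; apply: (jac_translate (d := delta u)) => //.
apply: filterS N => x [D1 H]; rewrite -(deck_discrete D1 Du H) /delta addrC subrK //.
Qed.

Lemma compat_jac c c' T v : compat c c' T v -> dom c v -> 'J T v \in unitmx.
Proof.
move=> [_ E] Dv; rewrite unitmxE unitfE; apply/negP => /eqP d0.
move: E; rewrite d0 sgr0 mul0r; have [->|->] := orient_sign Dv => /eqP.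
  by rewrite oner_eq0.
by rewrite oppr_eq0 oner_eq0.
Qed.

(** The chain rule writes the Jacobian of [T'] as that of [T] times that of [tau]; the first factor
    is invertible and cancels, and the deck translation between [tau (T u)] and [T' u] does not
    change the metric. *)
Lemma compat_hub W W' c c1 c2 T T' tau u : transition W c c1 T -> transition W' c c2 T' ->
  W u -> W' u -> compat c c1 T u -> compat c c2 T' u ->
  represents alpha e id c1 c2 tau (T u) -> differentiable tau (T u) -> compat c1 c2 tau (T u).
Proof.
move=> HT HT' Wu Wu' C C' Rt dt.
have [d Dd [Et EJ]] := transition_compose HT HT' Wu Wu' Rt dt.
have Dc : dom c u by case: HT => _ S _ _; exact: S.
have [_ _ _ /(_ _ Wu')[D2 _]] := HT'.
have [_ _ Gd] := deck_invariant D2 Dd.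
have Ju := compat_jac C Dc; have [E O] := C; have [E' O'] := C'.
split.
  apply: (mx_cancel Ju); move: E; rewrite E' /pullback EJ Et Gd => E.
  apply: etrans (esym E) _.
  move: ('J T u) ('J tau (T u)) (G c2 _) => A B D; rewrite trmx_mul !mulmxA; reflexivity.
have J0 : Num.sg (\det ('J T u)) != 0 by rewrite sgr_eq0 -unitfE -unitmxE.
have E1 : Num.sg (\det ('J T' u)) = Num.sg (\det ('J T u)) * Num.sg (\det ('J tau (T u))).
  apply: etrans (congr1 (fun X => Num.sg (\det X)) EJ) _.
  exact: etrans (congr1 Num.sg (det_mulmx _ _)) (sgrM _ _).
have {E1}O' := etrans O' (congr1 (fun x => x * orient c2) E1).
have K (o o' o2 x y : R) : x != 0 -> o = x * o' -> o = x * y * o2 -> o' = y * o2.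
  by move=> x0 -> E2; apply: (mulfI x0); rewrite E2 mulrA.
exact: (K _ _ _ _ _ J0 O O').
Qed.

Lemma TK_transition c : transition (hub_dom alpha e c) Interior c (TK e c).
Proof.
split.
- exact: open_hub_dom.
- by move=> u /(hub_dom_interior cf e3)[[H _] H']; apply/chart_dom_interior.
- by move=> n k; exact: Ck_TK.
- move=> u Hu; have HI := hub_dom_interior cf e3 Hu.
  have [D _ _ P] := TK_base e3 Hu; have [_ _ _ P'] := TK_base e3 HI; split=> //.
  rewrite P -P'; congr (param Interior _).
  by rewrite /TK /= -row4_eta.
Qed.

Lemma compat_off c c' tau v : dom c v -> 0 < ch_ysq e c v ->
  represents alpha e id c c' tau v -> differentiable tau v -> compat c c' tau v.
Proof.
move=> Dv Y0 Rt dt; have [u Hu Ev] := off_dom_TK e3 Dv Y0.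
have [Dt Pt] := nbhs_singleton Rt.
have [[b y0] [D _ _ P]] := (Hu, TK_base e3 Hu).
have bu : base c (rep_of u).1 by [].
have Pt' : param c' (tau v) = param c (kap e c (rep_of u)) by rewrite Pt /= -Ev.
have [b' _] := param_deck e3 bu Dt Pt'.
have Hu' : hub_dom alpha e c' u by [].
have C c1 : hub_dom alpha e c1 u -> compat Interior c1 (TK e c1) u.
  by move=> H; split; [exact: (TK_metric cf e3 H)|rewrite (TK_orient cf e3 H)].
rewrite -Ev in Rt dt *.
exact: (compat_hub (TK_transition c) (TK_transition c') Hu Hu' (C _ Hu) (C _ Hu') Rt dt).
Qed.

Lemma det_pullback c c' T v : G c v = pullback G c' T v ->
  \det (G c v) = \det ('J T v) ^+ 2 * \det (G c' (T v)).
Proof. by move=> ->; rewrite /pullback !det_mulmx det_tr expr2; ring. Qed.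

(** Both sides of the metric equation are continuous, so it extends from off the axis. The
    orientation is a sign: its product with the Jacobian determinant is nonnegative by density and
    nonzero because the metrics are nondegenerate. *)
Lemma transition_compat c c' T v : transition (dom c) c c' T -> dom c v -> compat c c' T v.
Proof.
move=> HT Dv; have [oD _ CT HD] := HT.
have off u : dom c u -> 0 < ch_ysq e c u -> compat c c' T u.
  move=> Du Yu; apply: compat_off => //; first exact: (transition_represents HT Du).
  exact: (transition_differentiable HT Du).
have CJ i k : Ck 0 (dom c) (fun u => 'J T u i k).
  apply: (Ck_ext oD (f := partial i (fun u => T u 0 k))).
    by move=> u Du; rewrite (jacE i k (transition_differentiable HT Du)).
  exact: (Ck_partial i (CT 1%N k)).
have S u : dom c u -> dom c' (T u) by move=> /HD[].
have CG i k : Ck 0 (dom c) (fun u => G c' (T u) i k).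
  have CM : Ck 0 (dom c') (fun u => G c' u i k) by exact: Ck_met.
  exact: (Ck_comp oD (@open_chart_dom R alpha e c') S CM (CT 0%N)).
have E : G c v = pullback G c' T v.
  apply/matrixP => i k.
  pose F u := G c u i k - pullback G c' T u i k.
  have CF : Ck 0 (dom c) F.
    apply: (Ck_sub_fun oD); first exact: Ck_met.
    apply: (Ck_ext oD (f := fun u => \sum_p (\sum_q 'J T u i q * G c' (T u) q p) * 'J T u k p)).
      by move=> u _; rewrite mxE; apply: eq_bigr => p _; rewrite !mxE.
    apply: (Ck_sum oD) => p _; apply: (Ck_mul oD) => //.
    by apply: (Ck_sum oD) => q _; apply: (Ck_mul oD).
  apply/eqP; rewrite -subr_eq0; apply/eqP.
  apply: (dense_eq0 (F := F) Dv); first exact: (Ck_cont CF Dv).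
  by move=> u Du Yu; rewrite /F -(off u Du Yu).1 subrr.
split=> //; have Du := S v Dv.
have J0 : \det ('J T v) != 0.
  have : \det (G c v) != 0 by rewrite -unitfE -unitmxE; exact: met_unit.
  by rewrite (det_pullback E) mulf_eq0 negb_or sqrf_eq0 => /andP[].
have O2 : orient c * orient c = 1.
  by have [->|->] := orient_sign Dv; rewrite ?mulrNN mulr1.
have O2' : orient c' * orient c' = 1.
  by have [->|->] := orient_sign Du; rewrite ?mulrNN mulr1.
have P : 0 <= orient c * orient c' * \det ('J T v).
  pose F u := orient c * orient c' * \det ('J T u).
  have CF : Ck 0 (dom c) F by apply: (Ck_mul oD); [exact: Ck_cst|exact: Ck_det].
  apply: (dense_ge0 (F := F) Dv); first exact: (Ck_cont CF Dv).
  move=> u Duu Yu; rewrite /F (off u Duu Yu).2 -(mulrA (Num.sg _)) O2' mulr1.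
  by rewrite -normrEsg normr_ge0.
have : Num.sg (orient c * orient c' * \det ('J T v)) = 1.
  apply/gtr0_sg; rewrite lt0r P andbT !mulf_neq0 //.
    by apply/negP => /eqP z; move: O2; rewrite z mul0r => /eqP; rewrite eq_sym oner_eq0.
  by apply/negP => /eqP z; move: O2'; rewrite z mul0r => /eqP; rewrite eq_sym oner_eq0.
have sgo x : x = 1 \/ x = -1 -> Num.sg x = x :> R by move=> [->|->]; rewrite ?sgrN sgr1.
rewrite !sgrM (sgo _ (orient_sign Dv)) (sgo _ (orient_sign Du)) => H.
by rewrite -[LHS]mulr1 -H !mulrA O2 mul1r mulrC.
Qed.

End Compatibility.

(** * Transitions at points of the axis *)

Section AxisTransitions.
Variables (R : realType) (alpha : R) (e : nat -> int).
Hypothesis cf : has_modified_cf alpha e.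
Hypothesis e3 : forall j, (1 <= j)%N -> 3 <= e j.
Local Notation V := 'rV[R]_4.
Implicit Types (u v : V) (c : chart) (r : rep R) (T tau : V -> V).
Local Notation a := (corner R e).
Local Notation m := (mden R e).
Local Notation n_ := (nnum R e).
Local Notation dom := (chart_dom alpha e).
Local Notation base := (chart_base alpha e).
Local Notation param := (param alpha e).

(** With the next pair as complementary vector, the angles of the edge chart are those of the corner
    chart, and the basis has determinant 1. *)
Definition hub j : chart := Edge j (mn e j.+1).

Lemma hub_basis j : edge_basis e j (mn e j.+1).
Proof.
rewrite /edge_basis (_ : _ - _ = 1) ?normr1 //; apply: (@intr_inj R).
by rewrite intrB !intrM -[RHS](mn_det R e3 j); rewrite /mden /nnum; ring.
Qed.

Lemma hub_st j (z : R * R) : edge_s e j (mn e j.+1) z = corner_s1 e j z /\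
  edge_t e j (mn e j.+1) z = corner_s2 e j z.
Proof.
have d := mn_det R e3 j; rewrite /edge_s /edge_t /corner_s1 /corner_s2.
rewrite -/(nnum R e j.+1) -/(mden R e j.+1).
by rewrite [n_ j * _]mulrC [X in _ - X]mulrC in d *; rewrite (_ : _ - _ = 1) ?mul1r //; lra.
Qed.

Lemma hub_base j (b : R * R) : base (hub j) b <-> edge_interior e j b.1 /\ 0 <= b.2.
Proof. by split=> [[_ H1 H2]|[H1 H2]] //; split=> //; exact: hub_basis. Qed.

Lemma mk_transition j c T : (forall n k, Ck n (dom (hub j)) (fun u => T u 0 k)) ->
  (forall r, base (hub j) r.1 -> base c r.1 /\ T (kap e (hub j) r) = kap e c r) ->
  transition alpha e (dom (hub j)) (hub j) c T.
Proof.
move=> CT HT; split=> //; first exact: open_chart_dom.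
move=> u /(domP e3)[r b ->]; have [bc ->] := HT r b.
by split; [exact: (dom_kap e3)|rewrite (param_kap e3 bc) (param_kap e3 b)].
Qed.

(** Another complementary vector differs, up to sign, by a multiple of (m_j, n_j), so the collapsing
    angle changes by a multiple of the other angle. *)
Lemma edge_change (p q p' q' x y z1 z2 : R) : p * q' - p' * q = 1 -> (p * y - q * x) ^+ 2 = 1 ->
  (p * y - q * x) * (z1 * y - z2 * x) =
  (z1 * q' - z2 * p') - (p * y - q * x) * (x * q' - y * p') * (p * z2 - q * z1).
Proof.
move=> d1 d2; transitivity ((p * y - q * x) * ((p * q' - p' * q) * (z1 * y - z2 * x))).
  by rewrite d1 mul1r.
rewrite -[X in _ = X - _]mul1r -d2; ring.
Qed.

Lemma axis_transition_edge j pq : edge_basis e j pq ->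
  exists T, transition alpha e (dom (hub j)) (hub j) (Edge j pq) T.
Proof.
move=> bas; pose d : R := m j * pq.2%:~R - n_ j * pq.1%:~R.
pose k : R := pq.1%:~R * n_ j.+1 - pq.2%:~R * m j.+1.
pose th (u : V) := - (d * k) * u 0 o1.
pose T (u : V) : V := row4 (u 0 o0) (d * u 0 o1) (u 0 o2 * cos (th u) - u 0 o3 * sin (th u))
  (u 0 o2 * sin (th u) + u 0 o3 * cos (th u)).
have oD := @open_chart_dom R alpha e (hub j).
exists T; apply: mk_transition.
  move=> n; have [Cs Cc] : Ck n (dom (hub j)) (fun u => sin (th u)) /\ Ck n (dom (hub j)) (fun u => cos (th u)).
    by apply: (Ck_sincos oD); rewrite /th; ck oD.
  elim/ord4_ind.
  - by apply: (Ck_ext oD (f := fun u => u 0 o0)); [move=> u _; rewrite mxE|ck oD].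
  - by apply: (Ck_ext oD (f := fun u => d * u 0 o1)); [move=> u _; rewrite mxE|ck oD].
  - by apply: (Ck_ext oD (f := fun u => u 0 o2 * cos (th u) - u 0 o3 * sin (th u)));
      [move=> u _; rewrite mxE|ck oD].
  - by apply: (Ck_ext oD (f := fun u => u 0 o2 * sin (th u) + u 0 o3 * cos (th u)));
      [move=> u _; rewrite mxE|ck oD].
move=> [[x y] z] b; split; first by case: b => _ *; split.
have [Es Et] := hub_st j z; rewrite /kap /T /th !mxE /= Es Et.
have Es' : edge_s e j pq z = corner_s1 e j z - d * k * corner_s2 e j z.
  exact: (edge_change _ _ (mn_det R e3 j) (edge_basis_det R bas)).
have -> : edge_t e j pq z = d * corner_s2 e j z by [].
rewrite Es' !mulNr; move: (d * k * corner_s2 e j z) => t; rewrite cosD sinD.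
by congr (row4 _ _ _ _); ring.
Qed.

(** The radius r_2 for [sg = 1] and r_1 for [sg = -1]. On the side of [b] selected by [sg] the
    argument of the outer root stays positive, so it is smooth up to the axis. *)
Definition half_radius (sg b : R) (u : V) :=
  Num.sqrt ((Num.sqrt ((u 0 o0 - b) ^+ 2 + (u 0 o2 ^+ 2 + u 0 o3 ^+ 2)) + sg * (u 0 o0 - b)) / 2).

Lemma half_radius_gt0 sg b u : 0 < sg * (u 0 o0 - b) -> 0 < half_radius sg b u.
Proof.
move=> H; rewrite sqrtr_gt0 divr_gt0 // ltr_wpDl // sqrtr_ge0.
Qed.

Lemma Ck_half_radius sg b n (U : set V) : open U -> (forall u, U u -> 0 < sg * (u 0 o0 - b)) ->
  Ck n U (half_radius sg b).
Proof.
move=> oU H; have C1 : Ck n U (fun u : V => (u 0 o0 - b) ^+ 2 + (u 0 o2 ^+ 2 + u 0 o3 ^+ 2)) by ck oU.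
have p1 u : U u -> 0 < (u 0 o0 - b) ^+ 2 + (u 0 o2 ^+ 2 + u 0 o3 ^+ 2).
  move=> /H; have [->|ub] := eqVneq (u 0 o0 - b) 0; first by rewrite mulr0 ltxx.
  by rewrite ltr_pwDl ?addr_ge0 ?sqr_ge0 // lt0r sqrf_eq0 ub sqr_ge0.
have C2 := Ck_sqrt oU p1 C1.
apply: (Ck_sqrt oU); first by move=> u Uu; rewrite divr_gt0 // ltr_wpDl ?H // sqrtr_ge0.
by ck oU.
Qed.

Lemma kap_hub j (x y : R) z : kap e (hub j) ((x, y), z) =
  row4 x (corner_s2 e j z) (y * cos (corner_s1 e j z)) (y * sin (corner_s1 e j z)).
Proof. by have [Es Et] := hub_st j z; rewrite /kap /= Es Et. Qed.

Lemma half_radius_hub j i x y z : half_radius 1 (a i) (kap e (hub j) ((x, y), z)) = corner_r2 e i x y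
  /\ half_radius (-1) (a i) (kap e (hub j) ((x, y), z)) = corner_r1 e i x y.
Proof.
rewrite kap_hub /half_radius !mxE /=.
have -> : (y * cos (corner_s1 e j z)) ^+ 2 + (y * sin (corner_s1 e j z)) ^+ 2 = y ^+ 2.
  by rewrite !exprMn -mulrDr cos2Dsin2 mulr1.
by rewrite mul1r mulN1r.
Qed.

Lemma axis_transition_corner j : exists T, transition alpha e (dom (hub j)) (hub j) (Corner j) T.
Proof.
have oD := @open_chart_dom R alpha e (hub j).
have pos u : dom (hub j) u -> 0 < 1 * (u 0 o0 - a j).
  by move=> /chart_dom_edge[_ [H _]]; rewrite mul1r subr_gt0.
pose h := half_radius 1 (a j).
have h0 u : dom (hub j) u -> 0 < h u by move=> /pos; exact: half_radius_gt0.
(* As y = 2 r_1 r_2, the coordinate r_1 e^(i s_1) is y e^(i s_1) / (2 r_2), where r_2 > 0. *)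
pose T (u : V) : V := row4 (u 0 o2 * (2 * h u)^-1) (u 0 o3 * (2 * h u)^-1)
   (h u * cos (u 0 o1)) (h u * sin (u 0 o1)).
exists T; apply: mk_transition.
  move=> n; have Ch : Ck n (dom (hub j)) h by exact: Ck_half_radius.
  have [Cs Cc] : Ck n (dom (hub j)) (fun u => sin (u 0 o1)) /\ Ck n (dom (hub j)) (fun u => cos (u 0 o1)).
    by apply: (Ck_sincos oD); ck oD.
  have Ch2 : Ck n (dom (hub j)) (fun u => 2 * h u) by ck oD.
  have Ci : Ck n (dom (hub j)) (fun u => (2 * h u)^-1).
    by apply: (Ck_inv oD _ Ch2) => u /h0 H; rewrite mulf_neq0 // gt_eqF.
  elim/ord4_ind.
  - by apply: (Ck_ext oD (f := fun u => u 0 o2 * (2 * h u)^-1)); [move=> u _; rewrite mxE|ck oD].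
  - by apply: (Ck_ext oD (f := fun u => u 0 o3 * (2 * h u)^-1)); [move=> u _; rewrite mxE|ck oD].
  - by apply: (Ck_ext oD (f := fun u => h u * cos (u 0 o1))); [move=> u _; rewrite mxE|ck oD].
  - by apply: (Ck_ext oD (f := fun u => h u * sin (u 0 o1))); [move=> u _; rewrite mxE|ck oD].
move=> [[x y] z] b; have [[/= H1 H2] /= y0] := (hub_base j (x, y)).1 b; split.
  by split=> //=; apply: lt_trans H1; exact: (corner_decr R e3).
have hr := h0 _ (dom_kap e3 (r := ((x, y), z)) b).
rewrite /T; have [E _] := half_radius_hub j j x y z; rewrite /h in hr *; rewrite E in hr *.
have [Es Et] := hub_st j z; rewrite !mxE /= Es Et; have [r1 r2 _ yE] := corner_radiiP e j x y0.
have yE' : y * (2 * corner_r2 e j x y)^-1 = corner_r1 e j x y.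
  by rewrite {1}yE; field; rewrite gt_eqF.
by congr (row4 _ _ _ _); rewrite -[X in _ = X * _]yE'; ring.
Qed.

Lemma axis_transition_prev i : exists T, transition alpha e (dom (hub i.+1)) (hub i.+1) (Corner i) T.
Proof.
set j := i.+1; have oD := @open_chart_dom R alpha e (hub j).
have pos u : dom (hub j) u -> 0 < -1 * (u 0 o0 - a i).
  by move=> /chart_dom_edge[_ [_]]; rewrite /prev_corner lte_fin mulN1r oppr_gt0 subr_lt0.
pose h := half_radius (-1) (a i); pose E : R := (e j)%:~R.
have h0 u : dom (hub j) u -> 0 < h u by move=> /pos; exact: half_radius_gt0.
pose p (u : V) := u 0 o2 * cos (E * u 0 o1) - u 0 o3 * sin (E * u 0 o1).
pose q (u : V) := u 0 o2 * sin (E * u 0 o1) + u 0 o3 * cos (E * u 0 o1).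
(* To the left of the corner r_1 > 0 and r_2 = y / (2 r_1). The recursion of the pairs gives the
   corner angles as - t and s + e_j t. *)
pose T (u : V) : V := row4 (h u * cos (u 0 o1)) (- (h u * sin (u 0 o1)))
   (p u * (2 * h u)^-1) (q u * (2 * h u)^-1).
exists T; apply: mk_transition.
  move=> n; have Ch : Ck n (dom (hub j)) h by exact: Ck_half_radius.
  have [Cs Cc] : Ck n (dom (hub j)) (fun u => sin (u 0 o1)) /\ Ck n (dom (hub j)) (fun u => cos (u 0 o1)).
    by apply: (Ck_sincos oD); ck oD.
  have [Cs' Cc'] : Ck n (dom (hub j)) (fun u => sin (E * u 0 o1)) /\ Ck n (dom (hub j)) (fun u => cos (E * u 0 o1)).
    by apply: (Ck_sincos oD); ck oD.
  have Ch2 : Ck n (dom (hub j)) (fun u => 2 * h u) by ck oD.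
  have Ci : Ck n (dom (hub j)) (fun u => (2 * h u)^-1).
    by apply: (Ck_inv oD _ Ch2) => u /h0 H; rewrite mulf_neq0 // gt_eqF.
  have Cp : Ck n (dom (hub j)) p by rewrite /p; ck oD.
  have Cq : Ck n (dom (hub j)) q by rewrite /q; ck oD.
  elim/ord4_ind.
  - by apply: (Ck_ext oD (f := fun u => h u * cos (u 0 o1))); [move=> u _; rewrite mxE|ck oD].
  - by apply: (Ck_ext oD (f := fun u => - (h u * sin (u 0 o1)))); [move=> u _; rewrite mxE|ck oD].
  - by apply: (Ck_ext oD (f := fun u => p u * (2 * h u)^-1)); [move=> u _; rewrite mxE|ck oD].
  - by apply: (Ck_ext oD (f := fun u => q u * (2 * h u)^-1)); [move=> u _; rewrite mxE|ck oD].
move=> [[x y] z] b; have [[/= H1 H2] /= y0] := (hub_base j (x, y)).1 b; split.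
  split=> //=; apply: lt_le_trans H2 _; rewrite /prev_corner.
  by case: (i) => [|k]; rewrite ?leey // lee_fin; exact: (corner_noninc R e3).
have hr := h0 _ (dom_kap e3 (r := ((x, y), z)) b).
rewrite /T /p /q; have [_ Eh] := half_radius_hub j i x y z; rewrite /h in hr *; rewrite Eh in hr *.
have [Es Et] := hub_st j z; rewrite !mxE /= Es Et; have [r1 r2 _ yE] := corner_radiiP e i x y0.
have yE' : y * (2 * corner_r1 e i x y)^-1 = corner_r2 e i x y.
  by rewrite {1}yE; field; rewrite gt_eqF.
have S1 : corner_s1 e i z = - corner_s2 e j z by rewrite /corner_s1 /corner_s2; ring.
have S2 : corner_s2 e i z = corner_s1 e j z + E * corner_s2 e j z.
  by rewrite /corner_s1 /corner_s2 /j (mden_rec _ e3) (nnum_rec _ e3) /E /j; ring.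
rewrite S1 S2 cosN sinN mulrN.
move: (corner_s1 e j z) (E * _) => s t; rewrite cosD sinD.
by congr (row4 _ _ _ _); rewrite -[X in _ = X * _]yE'; ring.
Qed.

(** Inside an edge all charts are reached from [hub j]. A corner lies in a single chart, which
    serves as its own reference. *)
Lemma axis_cases c r : base c r.1 -> r.1.2 = 0 ->
  (exists j, edge_interior e j r.1.1 /\ exists T, transition alpha e (dom (hub j)) (hub j) c T) \/
  (exists j, c = Corner j /\ r.1.1 = a j).
Proof.
case: r => [[x y] z] /=; case: c => [|j pq|j] /=.
- by move=> [_ H] /= y0; move: H; rewrite /= y0 ltxx.
- by move=> [bas Ij _] _; left; exists j; split=> //; exact: axis_transition_edge.
- move=> [H1 H2 _] _; have [xj|xj|xj] := ltgtP x (a j).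
  + by left; exists j.+1; split; [split|exact: axis_transition_prev].
  + by left; exists j; split; [split|exact: axis_transition_corner].
  + by right; exists j.
Qed.

Lemma represents_compat c c' tau v : dom c v -> represents alpha e id c c' tau v ->
  differentiable tau v -> compat alpha e c c' tau v.
Proof.
move=> Dv Rt dt; have [Y0|] := eqVneq (ch_ysq e c v) 0; last first.
  by move=> Yn; apply: compat_off => //; rewrite lt0r Yn ysq_ge0.
have [r b vE] := domP e3 Dv.
have y0 : r.1.2 = 0.
  have [_ Y] := has_coords_base ((has_coordsP e3 v b).2 vE).
  by apply/eqP; rewrite -sqrf_eq0 -Y Y0.
have [Dt Pt] := nbhs_singleton Rt; rewrite /= in Pt.
have Pv : param c v = cls e r by rewrite vE (param_kap e3 b).
have [b' _] : base c' r.1 /\ exists2 d, deck c' d & tau v = kap e c' r + d.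
  by apply: (param_deck e3 b Dt); rewrite Pt Pv (param_kap e3 b).
(* A deck translation is added to the explicit transition so that it takes the prescribed value
   [v1]. *)
have lift j c1 v1 T : edge_interior e j r.1.1 -> dom c1 v1 -> param c1 v1 = cls e r ->
    transition alpha e (dom (hub j)) (hub j) c1 T ->
    dom (hub j) (kap e (hub j) r) /\ exists2 T', transition alpha e (dom (hub j)) (hub j) c1 T' &
      T' (kap e (hub j) r) = v1.
  move=> Ij D1 P1 [oD S CT HT]; have bh : base (hub j) r.1 by apply/hub_base; rewrite y0.
  have Dh := dom_kap e3 bh; have [D2 P2] := HT _ Dh; split=> //.
  have [d Dd E] : exists2 d, deck c1 d & v1 = T (kap e (hub j) r) + d.
    exists (v1 - T (kap e (hub j) r)); last by rewrite addrC subrK.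
    by apply: (param_inj e3 D2 D1); rewrite P1 P2 (param_kap e3 bh).
  exists (fun u => T u + d) => //; split=> //.
    move=> n k; apply: (Ck_ext oD (f := fun u => T u 0 k + d 0 k)).
      by move=> u _; rewrite mxE.
    by apply: (Ck_add oD (CT n k)); exact: Ck_cst.
  by move=> u /HT[D3 P3]; have [D4 P4 _] := deck_invariant cf e3 D3 Dd; rewrite P4.
have [[j [Ij [T HT]]]|[j [cE xj]]] := axis_cases b y0.
- have [[j' [Ij' [T' HT']]]|[j' [cE' xj']]] := axis_cases b' y0; last first.
    by case: (@edge_interior_corner R e e3 j j'); rewrite -xj'.
  have jj := edge_interior_inj e3 Ij' Ij; subst j'.
  have [Dh [T1 HT1 E1]] := lift j c v T Ij Dv Pv HT.
  have Pt' : param c' (tau v) = cls e r by rewrite Pt.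
  have [_ [T2 HT2 E2]] := lift j c' (tau v) T' Ij Dt Pt' HT'.
  have C1 := transition_compat cf e3 HT1 Dh; have C2 := transition_compat cf e3 HT2 Dh.
  rewrite -E1 in Rt dt *.
  exact: (compat_hub cf e3 HT1 HT2 Dh Dh C1 C2 Rt dt).
- have [[j' [Ij' [T' HT']]]|[j' [cE' xj']]] := axis_cases b' y0.
    by case: (@edge_interior_corner R e e3 j' j); rewrite -xj.
  have jj : j' = j.
    apply/eqP; rewrite eqn_leq; apply/andP; split; rewrite leqNgt; apply/negP => /(corner_decreasing R e3);
    by rewrite -xj -xj' ltxx.
  (* At a corner both charts are the same, and the common reference is this chart with the
     identity. *)
  have HI : transition alpha e (dom c) c c id.
    by split=> //; [exact: open_chart_dom|move=> n k; exact: Ck_coord].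
  have Cid := transition_compat cf e3 HI Dv.
  have cc : c' = c by rewrite cE cE' jj.
  rewrite {}cc in Rt *; exact: (@compat_hub R alpha e cf e3 _ _ _ _ _ id id tau v HI HI Dv Dv Cid Cid Rt dt).
Qed.

End AxisTransitions.

(** * Completeness *)

Section Barriers.
Variables (R : realType) (alpha : R) (e : nat -> int).
Hypothesis cf : has_modified_cf alpha e.
Hypothesis e3 : forall j, (1 <= j)%N -> 3 <= e j.
Local Notation V := 'rV[R]_4.
Implicit Types (u v w : V) (c : chart).
Local Notation dom := (chart_dom alpha e).
Local Notation G := (met alpha e).
Local Notation td c := (ch_td alpha e c).
Local Notation sq01 := (sqlen o0 o1).
Local Notation sq23 := (sqlen o2 o3).

Definition bf c v := base_f alpha e (ch_base e c v).
Definition rsq c v := (ch_x e c v - alpha) ^+ 2 + ch_ysq e c v.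

Lemma Ck_cF j n : Ck n (dom (Corner j)) (cF alpha e j).
Proof.
have oD := @open_chart_dom R alpha e (Corner j).
have [C1 _ _] := Ck_fam cf e3 n (leqnSn j); have oB := @open_base_dom R alpha e j j.+1.
have S v : dom (Corner j) v -> base_dom alpha e j j.+1 (ch_base e (Corner j) v).
  exact: (chart_base_dom_corner cf e3).
have Cb l : Ck n (dom (Corner j)) (fun v => ch_base e (Corner j) v 0 l) by exact: Ck_ch_base.
have CH : Ck n (dom (Corner j)) (cH alpha e j) by exact: (Ck_comp oD oB S C1 Cb).
have Cu : Ck n (dom (Corner j)) sq01 by exact: Ck_sqlen.
have Cv : Ck n (dom (Corner j)) sq23 by exact: Ck_sqlen.
have Cl : Ck n (dom (Corner j)) (clb e j) by rewrite /clb; ck oD.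
by rewrite /cF /crn_f; ck oD.
Qed.

Lemma Ck_bf c n : Ck n (dom c) (bf c).
Proof.
case: c => [|j pq|j].
- apply: (Ck_sub (U := off_dom alpha e Interior)); first exact: (off_dom_interior).
  by have [_ _ C _ _] := td_smooth (ch_toric cf e3 Interior) n.
- have [C _ _] := Ck_base cf e3 n j; apply: Ck_sub C => v; exact: (chart_base_dom_edge cf e3).
- have oD := @open_chart_dom R alpha e (Corner j).
  apply: (Ck_ext oD _ (Ck_cF j n)) => v Dv.
  by have [E _ _] := corner_base_eq cf e3 Dv.
Qed.

Lemma bf_gt0 c v : dom c v -> 0 < bf c v.
Proof.
case: c => [|j pq|j] Dv.
- by have [_ H _] := td_pos (ch_toric cf e3 Interior) (off_dom_interior Dv).
- exact: (base_f_gt0 cf e3 (chart_base_dom_edge cf e3 Dv)).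
- by have [H _] := corner_pos cf e3 Dv; have [E _ _] := corner_base_eq cf e3 Dv; rewrite /bf E.
Qed.

Lemma rsq_gt0 c v : dom c v -> 0 < rsq c v.
Proof.
move=> /(chart_dom_gt cf e3) H; rewrite /rsq ltr_pwDl ?ysq_ge0 //.
by rewrite exprn_gt0 // subr_gt0.
Qed.

Lemma Ck_rsq c n : Ck n (dom c) (rsq c).
Proof.
have oD := @open_chart_dom R alpha e c.
have C1 : Ck n (dom c) (ch_x e c) by exact: Ck_ch_base.
have C2 : Ck n (dom c) (ch_ysq e c) by exact: Ck_ch_ysq.
by rewrite /rsq; ck oD.
Qed.

(* [t = 0] and [t = 1] give the differentials of [log f] and of [log (f / |z - alpha|)]. *)
Definition dbar (t : R) c i v : R :=
  partial i (bf c) v / bf c v - t * (2^-1 * (partial i (rsq c) v / rsq c v)).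

Lemma Ck_dbar t c i : Ck 0 (dom c) (dbar t c i).
Proof.
have oD := @open_chart_dom R alpha e c.
have C1 : Ck 0 (dom c) (partial i (bf c)) by exact: (Ck_partial i (Ck_bf c 1)).
have C2 : Ck 0 (dom c) (partial i (rsq c)) by exact: (Ck_partial i (Ck_rsq c 1)).
have C3 : Ck 0 (dom c) (fun v => (bf c v)^-1).
  by apply: (Ck_inv oD _ (Ck_bf c 0)) => v /bf_gt0 H; rewrite gt_eqF.
have C4 : Ck 0 (dom c) (fun v => (rsq c v)^-1).
  by apply: (Ck_inv oD _ (Ck_rsq c 0)) => v /rsq_gt0 H; rewrite gt_eqF.
by rewrite /dbar; ck oD.
Qed.

Lemma quad_gram (w : V) (X Y S T : 'I_4 -> R) (W Wi f : R) :
  (w *m (\matrix_(i, j) ((W * (X i * X j + Y i * Y j) + (S i * S j + T i * T j) * Wi) / f)) *m w^T) 0 0 =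
  (W * ((\sum_i w 0 i * X i) ^+ 2 + (\sum_i w 0 i * Y i) ^+ 2) +
   ((\sum_i w 0 i * S i) ^+ 2 + (\sum_i w 0 i * T i) ^+ 2) * Wi) / f.
Proof.
by rewrite mxE !sum4E !mxE !sum4E !mxE; ring.
Qed.

(** The metric dominates V f^-2 (dx^2 + dy^2), so it suffices that f^2 times the squared Euclidean
    norm of the differential is at most V. For [t = 0] the difference is - f k > 0; for [t = 1] the
    inequality is [base_radial_ineq]. *)
Lemma dbar_bound_off t c v w : t = 0 \/ t = 1 -> dom c v -> 0 < ch_ysq e c v ->
  (\sum_i w 0 i * dbar t c i v) ^+ 2 <= (w *m G c v *m w^T) 0 0.
Proof.
move=> t01 Dv Y0; have Uv : off_dom alpha e c v by [].
have ax := ch_toric cf e3 c; have [y0 f0 W0] := td_pos ax Uv.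
rewrite (met_td cf e3 Uv) /td_metric quad_gram.
have df i := td_df ax i Uv.
set y := td_y (td c) v in y0 df *; set f := td_f (td c) v in f0 *; set W := td_V (td c) v in W0 *.
set p := td_p (td c) v in df; set k := td_k (td c) v in df.
have yE : y ^+ 2 = ch_ysq e c v by rewrite /y /= sqr_sqrtr // ysq_ge0.
pose X := ch_x e c v - alpha; pose rho := rsq c v.
have rE : rho = X ^+ 2 + y ^+ 2 by rewrite yE.
have r0 : 0 < rho by exact: rsq_gt0.
have k0 : k < 0.
  have Bv : base_dom alpha e 0 0 (ch_base e c v).
    by have [h1 h2] := chart_off_axis cf e3 Dv Y0; split=> //; left.
  exact: (base_k_lt0 cf e3 Bv).
have rad : - 2 * (p * X + y ^+ 2 * k) + f <= - rho * k.
  rewrite rE yE; exact: (base_radial_ineq cf e3 (chart_off_axis cf e3 Dv Y0) erefl).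
have WE : W = p ^+ 2 + y ^+ 2 * k ^+ 2 - f * k by [].
have drho i : partial i (rsq c) v = 2 * X * partial i (td_x (td c)) v + 2 * y * partial i (td_y (td c)) v.
  have oU := @open_off_dom R alpha e c; have [Cx Cy _ _ _] := td_smooth ax 1.
  have Cx' : Ck 1 (off_dom alpha e c) (fun u => td_x (td c) u - alpha) by ck oU.
  have C2 : Ck 1 (off_dom alpha e c) (fun u => (td_x (td c) u - alpha) * (td_x (td c) u - alpha)) by ck oU.
  have C3 : Ck 1 (off_dom alpha e c) (fun u => td_y (td c) u * td_y (td c) u) by ck oU.
  have Ca : Ck 1 (off_dom alpha e c) (fun _ : V => alpha) by exact: Ck_cst.
  apply: etrans (partial_eq_on i oU Uv (g := fun u => (td_x (td c) u - alpha) * (td_x (td c) u - alpha)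
     + td_y (td c) u * td_y (td c) u) _) _.
    by move=> u [Du Yu]; rewrite /rsq -!expr2 /= sqr_sqrtr // ysq_ge0.
  apply: etrans (partial_addE i Uv C2 C3) _.
  apply: etrans (congr2 +%R (partial_mulE i Uv Cx' Cx') (partial_mulE i Uv Cy Cy)) _.
  have -> : partial i (fun u => td_x (td c) u - alpha) v = partial i (td_x (td c)) v.
    by apply: etrans (partial_subE oU i Uv Cx Ca) _; rewrite partial_cst subr0.
  have XE : td_x (td c) v - alpha = X by [].
  rewrite XE -/y; move: (partial i (td_x (td c)) v) (partial i (td_y (td c)) v) => a1 a2; ring.
set ax' := \sum_i w 0 i * partial i (td_x (td c)) v; set ay := \sum_i w 0 i * partial i (td_y (td c)) v.
set s2 := (\sum_i w 0 i * td_s1 (td c) i v) ^+ 2 + _.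
have E : \sum_i w 0 i * dbar t c i v = (p / f - t * (X / rho)) * ax' + (y * k / f - t * (y / rho)) * ay.
  rewrite /ax' /ay !mulr_sumr -big_split; apply: eq_bigr => i _.
  rewrite /dbar drho -/rho [bf c v](_ : _ = f) // (df i : partial i (bf c) v = _) /=.
  field; by rewrite !gt_eqF.
rewrite E; set A := p / f - _; set B := y * k / f - _.
have AB : f ^+ 2 * (A ^+ 2 + B ^+ 2) <= W.
  have -> : f ^+ 2 * (A ^+ 2 + B ^+ 2) = p ^+ 2 + y ^+ 2 * k ^+ 2
     + t * f / rho * (t * f - 2 * (p * X + y ^+ 2 * k)).
    rewrite /A /B; transitivity (p ^+ 2 + y ^+ 2 * k ^+ 2 - 2 * t * f / rho * (p * X + y ^+ 2 * k)
      + t ^+ 2 * f ^+ 2 / rho ^+ 2 * (X ^+ 2 + y ^+ 2)); first by field; rewrite !gt_eqF.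
    by rewrite -rE; field; rewrite gt_eqF.
  rewrite WE lerD2l; case: t01 => ->; first by rewrite !mul0r -mulrN mulr_ge0 ?oppr_ge0 // ltW.
  rewrite !mul1r mulrAC ler_pdivrMr // -subr_ge0.
  have -> : - (f * k) * rho - f * (f - 2 * (p * X + y ^+ 2 * k)) =
    f * (- rho * k - (- 2 * (p * X + y ^+ 2 * k) + f)) by ring.
  by rewrite mulr_ge0 ?subr_ge0 // ltW.
have s20 : 0 <= s2 by rewrite addr_ge0 // sqr_ge0.
rewrite ler_pdivlMr ?exprn_gt0 //; apply: (@le_trans _ _ (W * (ax' ^+ 2 + ay ^+ 2))); last first.
  by rewrite lerDl divr_ge0 // ltW.
apply: (@le_trans _ _ (f ^+ 2 * (A ^+ 2 + B ^+ 2) * (ax' ^+ 2 + ay ^+ 2))); last first.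
  by rewrite ler_wpM2r // addr_ge0 // sqr_ge0.
(* The Cauchy-Schwarz inequality in the plane, with its explicit remainder. *)
rewrite -subr_ge0 (_ : _ - _ = f ^+ 2 * (A * ay - B * ax') ^+ 2); last by ring.
by rewrite mulr_ge0 // sqr_ge0.
Qed.

Lemma dbar_bound t c v w : t = 0 \/ t = 1 -> dom c v ->
  (\sum_i w 0 i * dbar t c i v) ^+ 2 <= (w *m G c v *m w^T) 0 0.
Proof.
move=> t01 Dv; have oD := @open_chart_dom R alpha e c.
have CG i k : Ck 0 (dom c) (fun u => G c u i k) by exact: Ck_met.
have CQ : Ck 0 (dom c) (fun u => (w *m G c u *m w^T) 0 0).
  apply: (Ck_ext oD (f := fun u => \sum_p (\sum_q w 0 q * G c u q p) * w 0 p)).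
    by move=> u _; rewrite mxE; apply: eq_bigr => p _; rewrite !mxE.
  apply: (Ck_sum oD) => p _; apply: (Ck_mul oD); last exact: Ck_cst.
  by apply: (Ck_sum oD) => q _; apply: (Ck_mul oD) => //; exact: Ck_cst.
have CS : Ck 0 (dom c) (fun u => \sum_i w 0 i * dbar t c i u).
  by apply: (Ck_sum oD) => p _; apply: (Ck_mul oD); [exact: Ck_cst|exact: Ck_dbar].
pose F u := (w *m G c u *m w^T) 0 0 - (\sum_i w 0 i * dbar t c i u) ^+ 2.
have CF : Ck 0 (dom c) F by rewrite /F; ck oD.
rewrite -subr_ge0; apply: (dense_ge0 (F := F) Dv); first exact: (Ck_cont CF Dv).
by move=> u Du Yu; rewrite subr_ge0; exact: dbar_bound_off.
Qed.

End Barriers.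

(** * Lengths of curves and the distance *)

Section Curves.
Variable R : realType.
Local Notation V := 'rV[R]_4.
Local Notation mu := (@lebesgue_measure R).

Lemma is_derive_curve (U : set V) (f : V -> R) (gam : R -> V) (t : R) : open U -> U (gam t) -> Ck 1 U f ->
  derivable gam t 1 ->
  is_derive t 1 (fun s => f (gam s)) (\sum_k derive1 gam t 0 k * partial k f (gam t)).
Proof.
move=> oU Ut Cf dg; have [dif Edif] := C1_differentiable oU Ut Cf.
have dp : differentiable gam t by exact/derivable1_diffP.
have dc : differentiable (f \o gam) t by exact: differentiable_comp.
split; first exact/derivable1_diffP.
rewrite -[LHS]/('D_1 (f \o gam) t) deriveE // diff_comp //= Edif.
have E : derive1 gam t = 'd gam t 1 := derive1E' dp.
by rewrite E.
Qed.

Lemma curve_cont (gam : R -> V) (t : R) : derivable gam t 1 -> {for t, continuous gam}.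
Proof.
move=> dg; have dp : differentiable gam t by exact/derivable1_diffP.
exact: (differentiable_continuous dp).
Qed.

Lemma within_continuous (f : R -> R) : (forall t : R, 0 <= t <= 1 -> {for t, continuous f}) ->
  {within `[0, 1], continuous f}.
Proof.
move=> H; apply: continuous_in_subspaceT => t; rewrite inE /= in_itv /=; exact: H.
Qed.

Lemma integrable01 (f : R -> R) : (forall t : R, 0 <= t <= 1 -> {for t, continuous f}) ->
  mu.-integrable `[0, 1] (EFin \o f).
Proof.
move=> H; apply: continuous_compact_integrable; first exact: segment_compact.
exact: within_continuous.
Qed.

Lemma increment_le_integral (h h' s : R -> R) :
  (forall t : R, 0 <= t <= 1 -> is_derive t 1 h (h' t)) ->
  (forall t : R, 0 <= t <= 1 -> {for t, continuous h'}) ->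
  (forall t : R, 0 <= t <= 1 -> {for t, continuous s}) ->
  (forall t : R, 0 <= t <= 1 -> `|h' t| <= s t) ->
  `|h 1 - h 0| <= \int[mu]_(t in `[0, 1]) s t.
Proof.
move=> dh ch' cs hs.
have i01 (t : R) : t \in `]0, 1[ -> 0 <= t <= 1 by rewrite in_itv /= => /andP[/ltW-> /ltW->].
have ch (t : R) : 0 <= t <= 1 -> {for t, continuous h}.
  by move=> /dh[/derivable1_diffP/differentiable_continuous].
have E : \int[mu]_(t in `[0, 1]) h' t = h 1 - h 0.
  rewrite /Rintegral (@continuous_FTC2 _ h' h) //; first exact: within_continuous.
    split; first by move=> t /i01/dh[].
      by apply: cvg_at_right_filter; apply: ch; rewrite lexx ler01.
    by apply: cvg_at_left_filter; apply: ch; rewrite lexx ler01.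
  by move=> t /i01/dh[d Ed]; rewrite derive1E Ed.
rewrite -E; apply: le_trans (le_normr_Rintegral _ _) _ => //; first exact: integrable01.
apply: le_Rintegral => //.
- apply: integrable01 => t /ch' H; exact: (continuous_comp H (@norm_continuous _ R^o _)).
- exact: integrable01.
Qed.

Lemma integral_le_cst (s : R -> R) (C : R) : (forall t : R, 0 <= t <= 1 -> {for t, continuous s}) ->
  (forall t : R, 0 <= t <= 1 -> s t <= C) -> \int[mu]_(t in `[0, 1]) s t <= C.
Proof.
move=> cs sC; apply: (@le_trans _ _ (\int[mu]_(t in `[0, 1]) C)).
  apply: le_Rintegral.
  - exact: measurable_itv.
  - exact: integrable01.
  - apply: (integrable01 (f := fun=> C)) => t _; exact: cst_continuous.
  - by move=> t; rewrite /= in_itv /=; exact: sC.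
have := lebesgue_measure_itv `[(0 : R), 1]; rewrite /= lte_fin ltr01 oppr0 adde0 => E.
rewrite Rintegral_cst //; have -> : fine (mu `[0, 1]) = 1 := congr1 fine E.
by rewrite mulr1.
Qed.

Lemma is_derive_ln_fun (F : R -> R) (s d : R) : 0 < F s -> is_derive s 1 F d ->
  is_derive s 1 (fun x => ln (F x)) (d / F s).
Proof. by move=> F0 dF; rewrite mulrC; exact: (is_derive1_comp (is_derive1_ln F0) dF). Qed.

Lemma is_derive_ln_diff (F H : R -> R) (s d d' b : R) : 0 < F s -> 0 < H s ->
  is_derive s 1 F d -> is_derive s 1 H d' ->
  is_derive s 1 (fun x => ln (F x) - b * (2^-1 * ln (H x))) (d / F s - b * (2^-1 * (d' / H s))).
Proof.
move=> F0 H0 /(is_derive_ln_fun F0) dF /(is_derive_ln_fun H0) dH.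
exact: (is_deriveB dF (is_deriveZ b (is_deriveZ 2^-1 dH))).
Qed.

End Curves.

Section Paths.
Variables (R : realType) (alpha : R) (e : nat -> int).
Hypothesis cf : has_modified_cf alpha e.
Hypothesis e3 : forall j, (1 <= j)%N -> 3 <= e j.
Local Notation V := 'rV[R]_4.
Implicit Types (u v w : V) (c : chart) (P Q : set (rep R)).
Local Notation dom := (chart_dom alpha e).
Local Notation base := (chart_base alpha e).
Local Notation G := (met alpha e).
Local Notation param := (param alpha e).
Local Notation joined := (joined alpha e G).

Definition bar (t : R) c v : R := ln (bf alpha e c v) - t * (2^-1 * ln (rsq alpha e c v)).

Definition speed c (gam : R -> V) (s : R) : R :=
  Num.sqrt ((derive1 gam s *m G c (gam s) *m (derive1 gam s)^T) 0 0).

Lemma segment_cont c gam (s : R) : C1_segment alpha e c gam -> 0 <= s <= 1 ->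
  (forall i, {for s, continuous (fun x => derive1 gam x 0 i)}) /\
  (forall F, Ck 0 (dom c) F -> {for s, continuous (fun x => F (gam x))}).
Proof.
move=> H s01; have [Dg dg cg] := H s s01; split.
  move=> i; exact: (continuous_comp cg (@coord_cont R i _)).
move=> F CF; have cgam : {for s, continuous gam} by exact: curve_cont.
exact: (continuous_comp cgam (Ck_cont CF Dg)).
Qed.

Lemma sum_cont (s : R) (f : 'I_4 -> R -> R) : (forall i, {for s, continuous (f i)}) ->
  {for s, continuous (fun x => \sum_i f i x)}.
Proof.
move=> H; have -> : (fun x => \sum_i f i x) = (fun x => f o0 x + f o1 x + f o2 x + f o3 x).
  by apply/funext => x; rewrite sum4E.
by apply: continuousD (H o3); apply: continuousD (H o2); apply: continuousD (H o0) (H o1).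
Qed.

Lemma speed_cont c gam (s : R) : C1_segment alpha e c gam -> 0 <= s <= 1 ->
  {for s, continuous (speed c gam)}.
Proof.
move=> H s01; have [c1 c2] := segment_cont H s01.
have C : {for s, continuous (fun x => (derive1 gam x *m G c (gam x) *m (derive1 gam x)^T) 0 0)}.
  rewrite (_ : (fun _ => _) = fun x => \sum_p (\sum_q derive1 gam x 0 q * G c (gam x) q p)
     * derive1 gam x 0 p); last first.
    by apply/funext => x; rewrite mxE; apply: eq_bigr => p _; rewrite !mxE.
  apply: sum_cont => p; apply: continuousM (c1 p); apply: sum_cont => q.
  apply: continuousM (c1 q) _; apply: (c2 (fun u => G c u q p)); exact: Ck_met.
exact: (continuous_comp C (@sqrt_continuous _ _)).
Qed.

Lemma segment_length_bar t c gam : t = 0 \/ t = 1 -> C1_segment alpha e c gam ->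
  `|bar t c (gam 1) - bar t c (gam 0)| <= segment_length G c gam.
Proof.
move=> t01 H; have oD := @open_chart_dom R alpha e c.
pose h' s := \sum_i derive1 gam s 0 i * dbar alpha e t c i (gam s).
apply: (@increment_le_integral R (fun s => bar t c (gam s)) h' (speed c gam)).
- move=> s s01; have [Dg dg _] := H s s01.
  have d1 := is_derive_curve oD Dg (Ck_bf cf e3 c 1) dg.
  have d2 := is_derive_curve oD Dg (Ck_rsq alpha e c 1) dg.
  have := @is_derive_ln_diff R (fun s => bf alpha e c (gam s)) (fun s => rsq alpha e c (gam s)) s _ _ t (bf_gt0 cf e3 Dg) (rsq_gt0 cf e3 Dg) d1 d2.
  have K (F : R -> R) (x d d' : R) : d = d' -> is_derive x 1 F d -> is_derive x 1 F d' by move=> ->.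
  apply: K; rewrite /h' /dbar !mulr_suml !mulr_sumr -sumrB; apply: eq_bigr => i _.
  have K2 (g a x b y : R) : g * a * x - t * (2^-1 * (g * b * y)) = g * (a * x - t * (2^-1 * (b * y))).
    by ring.
  exact: K2.
- move=> s s01; have [c1 c2] := segment_cont H s01.
  apply: sum_cont => i; apply: continuousM (c1 i) _; apply: c2; exact: Ck_dbar.
- by move=> s; exact: speed_cont.
- move=> s s01; have [Dg dg _] := H s s01.
  rewrite -sqrtr_sqr ler_wsqrtr //; exact: dbar_bound.
Qed.

Lemma joined_trans P S Q L L' : joined P S L -> joined S Q L' -> joined P Q (L + L').
Proof.
elim=> [P'|c gam S' M H _ IH] J; first by rewrite add0r.
by rewrite -addrA; apply: joined_cons => //; exact: IH.
Qed.

Lemma joined_ge0 P Q L : joined P Q L -> 0 <= L.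
Proof.
elim=> // c gam Q' M _ _ M0; rewrite addr_ge0 //; apply: Rintegral_ge0 => s _; exact: sqrtr_ge0.
Qed.

Definition base_bar (t : R) (b : R * R) : R := ln (base_f alpha e (row4 b.1 0 b.2 0)) -
  t * (2^-1 * ln ((b.1 - alpha) ^+ 2 + b.2 ^+ 2)).

Lemma bf_kap c r : base c r.1 -> bf alpha e c (kap e c r) = base_f alpha e (row4 r.1.1 0 r.1.2 0).
Proof.
move=> b; have [Ex Ey] := has_coords_base ((has_coordsP e3 _ b).2 erefl).
pose v : V := row4 r.1.1 0 r.1.2 0.
have Ex' : ch_base e c (kap e c r) 0 o0 = v 0 o0 by apply: etrans Ex _; rewrite mxE.
have Ey' : ysq (ch_base e c (kap e c r)) = ysq v.
  by apply: etrans Ey _; rewrite /ysq !mxE /=; ring.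
by rewrite /bf; have [-> _ _] := base_dep alpha e Ex' Ey'.
Qed.

Lemma bar_base t c r : base c r.1 -> bar t c (kap e c r) = base_bar t r.1.
Proof.
move=> b; have [Ex Ey] := has_coords_base ((has_coordsP e3 _ b).2 erefl).
by rewrite /bar /rsq Ex Ey /base_bar bf_kap.
Qed.

(** The bounds for the pieces add up, since [bar] depends only on the base point and therefore takes
    the same value at a junction in both charts. *)
Lemma joined_bar t P Q L : t = 0 \/ t = 1 -> joined P Q L ->
  forall r r', P = cls e r -> Q = cls e r' -> `|base_bar t r.1 - base_bar t r'.1| <= L.
Proof.
move=> t01; elim=> [P'|c gam Q' M H _ IH] r r' Er Er'.
  have [<- _] : cls e r r' by rewrite -Er Er'; exact: cls_refl.
  by rewrite subrr normr0.
have [D0 _ _] := H 0 (ltac:(by rewrite lexx ler01)).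
have [D1 _ _] := H 1 (ltac:(by rewrite lexx ler01)).
have [r0 b0 E0] := domP e3 D0; have [r1 b1 E1] := domP e3 D1.
rewrite E0 (param_kap e3 b0) in Er; rewrite E1 (param_kap e3 b1) in IH.
have [Eb _] : cls e r0 r by rewrite Er; exact: cls_refl.
have l1 := segment_length_bar t01 H; rewrite E0 E1 !bar_base // in l1.
rewrite Eb (_ : _ - _ = (base_bar t r0.1 - base_bar t r1.1) + (base_bar t r1.1 - base_bar t r'.1)).
  by apply: le_trans (ler_normD _ _) (lerD _ (IH r1 r' erefl Er')); rewrite distrC.
by rewrite addrA subrK.
Qed.

End Paths.

Section LocalDistance.
Variables (R : realType) (alpha : R) (e : nat -> int).
Hypothesis cf : has_modified_cf alpha e.
Hypothesis e3 : forall j, (1 <= j)%N -> 3 <= e j.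
Local Notation V := 'rV[R]_4.
Implicit Types (u v w : V) (c : chart) (P Q : set (rep R)).
Local Notation a := (corner R e).
Local Notation m := (mden R e).
Local Notation dom := (chart_dom alpha e).
Local Notation base := (chart_base alpha e).
Local Notation G := (met alpha e).
Local Notation param := (param alpha e).
Local Notation joined := (joined alpha e G).

(** Corners tend to [alpha], so there is a first corner to the left of the point. The chart of the
    preceding corner contains the point; if there is none, that of a_0 does. *)
Lemma base_exists (b : R * R) : alpha < b.1 -> 0 <= b.2 -> exists j, base (Corner j) b.
Proof.
move=> b1 b2; have H : exists j, a j < b.1.
  have /cvgrPdist_lt/(_ (b.1 - alpha)) := @corner_cvg R alpha e cf e3.
  rewrite subr_gt0 => /(_ b1)[N _ /(_ N (leqnn N))] /=; rewrite ltr_norml => /andP[Hn _].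
  by exists N; lra.
have [j Hj jmin] := ex_minnP H.
case: j Hj jmin => [|j] Hj jmin.
  exists 0%N; split=> //; last by rewrite ltry.
  by apply: lt_trans Hj; exact: (corner_decr R e3).
exists j; split=> //; have aj : b.1 <= a j.
  by rewrite leNgt; apply/negP => /jmin; rewrite ltnn.
case: j {Hj jmin} aj => [|j] aj; first by rewrite ltry.
by rewrite /prev_corner lte_fin; apply: le_lt_trans aj _; exact: (corner_decr R e3).
Qed.

Lemma base_f_bounds (b : R * R) j : alpha < b.1 -> 0 <= b.2 ->
  0 < base_f alpha e (row4 b.1 0 b.2 0) <= m j * (b.1 - alpha) + gap alpha e j.
Proof.
move=> b1 b2; have [i Bi] := base_exists b1 b2.
pose c := Corner i; pose r : rep R := (b, 0); have Br : base c r.1 by [].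
have Dv := dom_kap e3 Br; rewrite -(bf_kap e3 Br) (bf_gt0 cf e3 Dv) /=.
have oD := @open_chart_dom R alpha e c.
pose F v := m j * (ch_x e c v - alpha) + gap alpha e j - bf alpha e c v.
have Cx : Ck 0 (dom c) (ch_x e c) by exact: Ck_ch_base.
have Cf := Ck_bf cf e3 c 0; have CF : Ck 0 (dom c) F by rewrite /F; ck oD.
have [Ex _] := has_coords_base ((has_coordsP e3 _ Br).2 erefl).
have : 0 <= F (kap e c r).
  apply: (dense_ge0 (F := F) Dv); first exact: (Ck_cont CF Dv).
  by move=> u Du Yu; rewrite subr_ge0; exact: (base_f_le cf e3 j (chart_off_axis cf e3 Du Yu)).
by rewrite /F Ex subr_ge0.
Qed.

Lemma line_C1 u v (t : R) : derivable (fun s : R => u + s *: (v - u) : V) t 1 /\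
  derive1 (fun s : R => u + s *: (v - u) : V) t = v - u.
Proof.
have D i : is_derive t 1 (fun s : R => (u + s *: (v - u)) 0 i) ((v - u) 0 i).
  have -> : (fun s : R => (u + s *: (v - u)) 0 i) = (fun s : R => u 0 i + (v - u) 0 i * s).
    by apply/funext => s; rewrite !mxE mulrC.
  have := is_deriveD (is_derive_cst (u 0 i : R^o) (t : R^o) 1)
    (is_deriveZ ((v - u) 0 i) (is_derive_id (t : R^o) 1)).
  by rewrite add0r [_ *: 1]mulr1.
have d : derivable (fun s : R => u + s *: (v - u) : V) t 1.
  by apply/derivable_mxP => k i; rewrite (ord1 k); have [] := D i.
split=> //; rewrite derive1E derive_mx //; apply/rowP => i; rewrite mxE.
by have [_ ->] := D i.
Qed.

Lemma quad_le (M : 'M[R]_4) (B : R) w : (forall i k, `|M i k| <= B) ->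
  (w *m M *m w^T) 0 0 <= 16 * B * `|w| ^+ 2.
Proof.
move=> HB; have B0 : 0 <= B := le_trans (normr_ge0 _) (HB 0 0).
have -> : (w *m M *m w^T) 0 0 = \sum_p \sum_q w 0 q * M q p * w 0 p.
  by rewrite mxE; apply: eq_bigr => p _; rewrite !mxE mulr_suml.
have -> : 16 * B * `|w| ^+ 2 = \sum_(p < 4) \sum_(q < 4) B * `|w| ^+ 2.
  by rewrite !sumr_const !card_ord -!mulrnA -mulr_natl; ring.
apply: ler_sum => p _; apply: ler_sum => q _; apply: le_trans (ler_norm _) _.
rewrite !normrM mulrAC [X in X <= _]mulrC expr2; apply: ler_pM => //.
by apply: ler_pM => //; exact: coord_le_norm.
Qed.

(** Straight segments in a chart: near [v] the entries of the metric are bounded by [B], so a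
    segment has length at most [sqrt (16 B)] times its Euclidean length. *)
Lemma local_dist c v (eps : R) : dom c v -> 0 < eps ->
  \forall u \near v, dom c u /\ exists2 L, joined (param c u) (param c v) L & L < eps.
Proof.
move=> Dv e0; have oD := @open_chart_dom R alpha e c.
pose B := 1 + \sum_i \sum_k `|G c v i k|.
have GB i k : `|G c v i k| + 1 <= B.
  rewrite /B addrC lerD2l (bigD1 i) //= (bigD1 k) //= -addrA lerDl addr_ge0 //.
    by apply: sumr_ge0 => *.
  by apply: sumr_ge0 => *; apply: sumr_ge0 => *.
have B0 : 0 < B.
  by apply: lt_le_trans (GB 0 0); rewrite ltr_wpDl.
have N : \forall u \near v, dom c u /\ forall i k, `|G c u i k| <= B.
  apply: filterI; first exact: open_nbhs_nbhs.
  have FF : Filter (nbhs v) by exact: nbhs_filter.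
  apply: (@filter_forall _ _ (fun i u => forall k, is_true (`|G c u i k| <= B)) (nbhs v) _) => i.
  apply: (@filter_forall _ _ (fun k u => is_true (`|G c u i k| <= B)) (nbhs v) _) => k.
  have C : Ck 0 (dom c) (fun u => G c u i k) by exact: Ck_met.
  have /cvgrPdist_le/(_ _ ltr01) := Ck_cont C Dv.
  apply: filterS => u H; apply: le_trans (GB i k); rewrite -lerBlDl.
  by apply: le_trans (lerB_dist _ _) _; rewrite distrC.
move/nbhs_ballP: N => [r /= r0 Br].
pose S := Num.sqrt (16 * B); have S0 : 0 <= S by exact: sqrtr_ge0.
have r'0 : 0 < Num.min r (eps / (S + 1)).
  by rewrite lt_min r0 divr_gt0 // ltr_wpDl.
apply/nbhs_ballP; exists (Num.min r (eps / (S + 1))) => // u.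
rewrite -ball_normE /= lt_min => /andP[ur ue].
have Bl (t : R) : 0 <= t <= 1 -> dom c (u + t *: (v - u)) /\ forall i k, `|G c (u + t *: (v - u)) i k| <= B.
  move=> /andP[t0 t1]; apply: Br; rewrite -ball_normE /=.
  have -> : v - (u + t *: (v - u)) = (1 - t) *: (v - u) by rewrite scalerBl scale1r opprD addrA.
  rewrite normrZ ger0_norm ?subr_ge0 //; apply: le_lt_trans ur.
  by rewrite ler_piMl // lerBlDr lerDl.
have C1 : C1_segment alpha e c (fun t => u + t *: (v - u)).
  move=> t t01; have [d _] := line_C1 u v t; split; [by have [] := Bl t t01|exact: d|].
  have -> : derive1 (fun t : R => u + t *: (v - u) : V) = cst (v - u).
    by apply/funext => s; have [_ ->] := line_C1 u v s.
  exact: cst_continuous.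
split; first by have [] := Bl 0 (ltac:(by rewrite lexx ler01)); rewrite scale0r addr0.
have len : segment_length G c (fun t => u + t *: (v - u)) <= S * `|v - u|.
  apply: integral_le_cst; first by move=> t t01; exact: (speed_cont cf e3 C1 t01).
  move=> t t01; have [_ ->] := line_C1 u v t.
  rewrite -[`|v - u|]ger0_norm // -sqrtr_sqr /S -sqrtrM ?ler_wsqrtr //; last by rewrite mulr_ge0 // ltW.
  by apply: quad_le; have [_] := Bl t t01.
exists (segment_length G c (fun t => u + t *: (v - u)) + 0).
  have E0 : u + 0 *: (v - u) = u by rewrite scale0r addr0.
  have E1 : u + 1 *: (v - u) = v by rewrite scale1r addrC subrK.
  have J : joined (param c (u + 0 *: (v - u))) (param c (u + 1 *: (v - u)))
     (segment_length G c (fun t => u + t *: (v - u)) + 0) := joined_cons C1 (joined_refl alpha e G _).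
  by move: J; rewrite E0 E1.
rewrite addr0; apply: le_lt_trans len _.
apply: (@le_lt_trans _ _ ((S + 1) * `|v - u|)); first by rewrite ler_wpM2r // lerDl.
by rewrite mulrC -ltr_pdivlMr // ltr_wpDl.
Qed.

Lemma mx_cont (F : V -> V) v : (forall k, {for v, continuous (fun u => F u 0 k)}) ->
  {for v, continuous F}.
Proof.
move=> H; rewrite /prop_for /continuous_at.
have FF : Filter (nbhs v) by exact: nbhs_filter.
apply/(@cvgrPdist_le _ _ _ _ FF) => eps e0.
have N : \forall u \near v, forall k, `|F v 0 k - F u 0 k| <= eps.
  apply: (@filter_forall _ _ (fun k u => is_true (`|F v 0 k - F u 0 k| <= eps)) (nbhs v) _) => k.
  by have /cvgrPdist_le/(_ _ e0) := H k.
apply: filterS N => u Hu; apply: norm_le_coord => [|k]; first exact: ltW.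
by rewrite !mxE.
Qed.

(** Continuity holds on the axis and at the corner as well, where [TK] is not smooth, since the
    square root is continuous at 0. *)
Lemma TK_corner_cont j v : {for v, continuous (TK e (Corner j))}.
Proof.
have oT := @openT V.
have cT (F : V -> R) : Ck 0 setT F -> {for v, continuous F} by move=> C; exact: (Ck_cont C I).
have cq : {for v, continuous (fun u : V => Num.sqrt ((u 0 o0 - a j) ^+ 2 + u 0 o1 ^+ 2))}.
  have C : {for v, continuous (fun u : V => (u 0 o0 - a j) ^+ 2 + u 0 o1 ^+ 2)} by apply: cT; ck oT.
  exact: (continuous_comp C (@sqrt_continuous _ _)).
have cx : {for v, continuous (fun u : V => u 0 o0 - a j)} by apply: cT; ck oT.
have ch : {for v, continuous (fun u : V => (2^-1 : R))} by apply: cT; ck oT.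
have c1 : {for v, continuous (fun u : V => corner_r1 e j (u 0 o0) (u 0 o1))}.
  have C := continuousM (continuousB cq cx) ch.
  exact: (continuous_comp C (@sqrt_continuous _ _)).
have c2 : {for v, continuous (fun u : V => corner_r2 e j (u 0 o0) (u 0 o1))}.
  have C := continuousM (continuousD cq cx) ch.
  exact: (continuous_comp C (@sqrt_continuous _ _)).
have s1 : {for v, continuous (fun u : V => corner_s1 e j (u 0 o2, u 0 o3))}.
  by apply: cT; have [] := @Ck_corner_s R e j 0 _ oT.
have s2 : {for v, continuous (fun u : V => corner_s2 e j (u 0 o2, u 0 o3))}.
  by apply: cT; have [] := @Ck_corner_s R e j 0 _ oT.
have cc (F H : V -> R) : {for v, continuous F} -> {for v, continuous H} ->
    {for v, continuous (fun u => F u * cos (H u))} /\ {for v, continuous (fun u => F u * sin (H u))}.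
  move=> cF cH; split; apply: continuousM cF _.
    exact: (continuous_comp cH (@continuous_cos _ _)).
  exact: (continuous_comp cH (@continuous_sin _ _)).
have [P0 P1] := cc _ _ c1 s1; have [P2 P3] := cc _ _ c2 s2.
apply: mx_cont; elim/ord4_ind.
- rewrite (_ : (fun _ => _) = (fun u : V => corner_r1 e j (u 0 o0) (u 0 o1) * cos (corner_s1 e j (u 0 o2, u 0 o3)))) //.
  by apply/funext => u; rewrite mxE.
- rewrite (_ : (fun _ => _) = (fun u : V => corner_r1 e j (u 0 o0) (u 0 o1) * sin (corner_s1 e j (u 0 o2, u 0 o3)))) //.
  by apply/funext => u; rewrite mxE.
- rewrite (_ : (fun _ => _) = (fun u : V => corner_r2 e j (u 0 o0) (u 0 o1) * cos (corner_s2 e j (u 0 o2, u 0 o3)))) //.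
  by apply/funext => u; rewrite mxE.
- rewrite (_ : (fun _ => _) = (fun u : V => corner_r2 e j (u 0 o0) (u 0 o1) * sin (corner_s2 e j (u 0 o2, u 0 o3)))) //.
  by apply/funext => u; rewrite mxE.
Qed.

(** Angles in a compact interval are what the extraction of a cluster point requires. *)
Lemma Malpha_rep P : Malpha alpha e P -> exists r : rep R,
  [/\ P = cls e r, alpha < r.1.1, 0 <= r.1.2, 0 <= r.2.1 <= 2 * pi & 0 <= r.2.2 <= 2 * pi].
Proof.
move=> [[b [z1 z2]] [/= b1 b2] <-]; have p0 : 0 < 2 * pi :> R by rewrite mulr_gt0 // pi_gt0.
have fl (z : R) : exists k : int, 0 <= z + 2 * pi * k%:~R <= 2 * pi.
  exists (- Num.floor (z / (2 * pi))).
  have := floor_le (z / (2 * pi)); have := floorD1_gt (z / (2 * pi)).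
  rewrite ler_pdivlMr // ltr_pdivrMr // intrD intrN => H1 H2.
  by apply/andP; split; lra.
have [k Hk] := fl z1; have [l Hl] := fl z2.
exists (b, (z1 + 2 * pi * k%:~R, z2 + 2 * pi * l%:~R)); split=> //.
by apply: (cls_eq e3); split=> //; exists 0; [left|exists k, l; rewrite addr0].
Qed.

End LocalDistance.

Section Complete.
Variables (R : realType) (alpha : R) (e : nat -> int).
Hypothesis cf : has_modified_cf alpha e.
Hypothesis e3 : forall j, (1 <= j)%N -> 3 <= e j.
Local Notation V := 'rV[R]_4.
Implicit Types (u v w : V) (c : chart) (P Q : set (rep R)) (r : rep R).
Local Notation a := (corner R e).
Local Notation m := (mden R e).
Local Notation dom := (chart_dom alpha e).
Local Notation base := (chart_base alpha e).
Local Notation G := (met alpha e).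
Local Notation param := (param alpha e).
Local Notation joined := (joined alpha e G).
Local Notation rdist := (rdist alpha e G).

Lemma mul_expR_le (x y k : R) : 0 < x -> 0 < y -> ln x + k <= ln y -> x * expR k <= y.
Proof.
move=> x0 y0 H; have Ex : expR (ln x) = x by rewrite lnK.
have Ey : expR (ln y) = y by rewrite lnK.
by rewrite -Ex -Ey -expRD ler_expR.
Qed.

(** With [p] and [q] the values of log f, and [s] and [t] those of log |z - alpha|^2: half of s - t
    is at most 1 + 1 in absolute value, hence the 4. *)
Lemma log_bounds (p q s t : R) : `|p - q| <= 1 -> `|p - 2^-1 * s - (q - 2^-1 * t)| <= 1 ->
  p + -1 <= q /\ t + -4 <= s.
Proof. by rewrite !ler_norml => /andP[A B] /andP[C D]; split; lra. Qed.

(** The denominator is [k + 1] because [k] is a slope m_j, which may be 0. *)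
Lemma lower_bound (x k d g f : R) : 0 <= k -> 0 < d -> g < d / 2 -> d <= f ->
  f <= k * (x - alpha) + g -> alpha < x -> alpha + d / 2 / (k + 1) <= x.
Proof.
move=> k0 d0 gd df fk ax; have k1 : 0 < k + 1 by lra.
by rewrite -lerBrDl ler_pdivrMr //; nra.
Qed.

Lemma upper_bound (x y C : R) : (x - alpha) ^+ 2 + y ^+ 2 <= C ->
  x <= `|alpha| + 1 + C /\ y <= `|alpha| + 1 + C.
Proof.
move=> H; have q1 := sqr_ge0 (x - alpha); have q2 := sqr_ge0 y.
have hx (t : R) : t <= 1 + t ^+ 2.
  by have := sqr_ge0 (t - 1); have := sqr_ge0 t; rewrite sqrrB !mulr1; lra.
have al := ler_norm alpha; have al' := normr_ge0 alpha.
have h1 := hx (x - alpha); have h2 := hx y.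
by split; lra.
Qed.

(** Within distance 1 of the starting point [f] stays above a positive constant, which by
    [base_f_bounds] keeps x away from [alpha]; the bound on log (f / |z - alpha|) then bounds |z -
    alpha| from above. *)
Lemma confined r0 : alpha < r0.1.1 -> 0 <= r0.1.2 -> exists d M : R, 0 < d /\
  forall r, alpha < r.1.1 -> 0 <= r.1.2 -> (exists2 L, joined (cls e r0) (cls e r) L & L <= 1) ->
  alpha + d <= r.1.1 <= M /\ 0 <= r.1.2 <= M.
Proof.
move=> x0 y0; set b0 := r0.1 in x0 y0 *.
pose f (b : R * R) := base_f alpha e (row4 b.1 0 b.2 0).
pose rho (b : R * R) := (b.1 - alpha) ^+ 2 + b.2 ^+ 2.
have f0 : 0 < f b0 by have /andP[] := base_f_bounds cf e3 0 x0 y0.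
pose dl := f b0 * expR (-1).
have dl0 : 0 < dl by rewrite mulr_gt0 // expR_gt0.
(* For this edge the constant part of the upper bound of [f] is less than half the lower bound of
   [f], so the part m_j (x - alpha) must account for the rest. *)
have [j gj] : exists j, gap alpha e j < dl / 2.
  have /cvgrPdist_lt/(_ (dl / 2)) := @gap_cvg R alpha e cf e3.
  rewrite divr_gt0 // => /(_ isT)[N _ /(_ N (leqnn N))] /=; rewrite sub0r normrN ltr_norml.
  by move=> /andP[_ H]; exists N.
have m0 := mden_ge0 R e3 j.
exists (dl / 2 / (m j + 1)), (`|alpha| + 1 + rho b0 * expR 4); split.
  by rewrite !divr_gt0 // ltr_wpDl.
move=> r x1 y1 [L J L1]; set b := r.1 in x1 y1 *.
have rp (b' : R * R) : alpha < b'.1 -> 0 < rho b'.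
  by move=> h; rewrite ltr_pwDl ?sqr_ge0 // exprn_gt0 // subr_gt0.
have /andP[f1 fj] := base_f_bounds cf e3 j x1 y1; rewrite -/(f b) in f1 fj.
have B0 := joined_bar cf e3 (or_introl erefl : (0 : R) = 0 \/ (0 : R) = 1) J erefl erefl.
have B1 := joined_bar cf e3 (or_intror erefl : (1 : R) = 0 \/ (1 : R) = 1) J erefl erefl.
rewrite /base_bar -/(f r0.1) -/(f r.1) -/(rho r0.1) -/(rho r.1) -/b0 -/b in B0 B1.
rewrite !mul0r !subr0 in B0; rewrite !mul1r in B1.
have [lf lr] := log_bounds (le_trans B0 L1) (le_trans B1 L1).
have {}lf : dl <= f b by exact: mul_expR_le.
have {}lr : rho b * expR (- 4) <= rho b0 by apply: mul_expR_le => //; exact: rp.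
rewrite expRN ler_pdivrMr ?expR_gt0 // in lr.
have [h1 h2] := upper_bound lr.
by rewrite y1 h1 h2 (lower_bound m0 dl0 gj lf fj x1).
Qed.

Lemma rdist_ge0 P Q : (0%E <= rdist P Q)%E.
Proof. by apply: le_ereal_inf_tmp => _ [L J <-]; rewrite lee_fin; exact: joined_ge0 J. Qed.

Lemma rdist_lt P Q (eps : R) : (rdist P Q < eps%:E)%E <-> exists2 L, joined P Q L & L < eps.
Proof.
split=> [/ereal_inf_lt[_ [L J <-]]|[L J H]]; first by rewrite lte_fin; exists L.
by apply: (@le_lt_trans _ _ L%:E); [apply: ereal_inf_lbound; exists L|rewrite lte_fin].
Qed.

Lemma rdist_cvg0 (P : nat -> set (rep R)) Q :
  (forall eps : R, 0 < eps -> exists K, forall k, (K <= k)%N -> (rdist (P k) Q < eps%:E)%E) ->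
  (fun k => rdist (P k) Q) @ \oo --> (0%E : \bar R).
Proof.
move=> H; have fin k (x : R) : (rdist (P k) Q < x%:E)%E -> rdist (P k) Q \is a fin_num.
  by move=> h; rewrite ge0_fin_numE ?rdist_ge0 //; apply: lt_trans h _; rewrite ltry.
apply/fine_cvgP; split.
  have [K HK] := H 1 ltr01; exists K => // k /= Kk; exact: fin (HK k Kk).
apply/cvgrPdist_lt => eps e0; have [K HK] := H eps e0; exists K => // k /= Kk.
have h := HK k Kk; have hf := fin _ _ h.
rewrite sub0r normrN ger0_norm; last by apply: fine_ge0; exact: rdist_ge0.
by rewrite -lte_fin fineK.
Qed.

(** A full neighbourhood in R^4 contains points with negative y, hence the absolute value; it
    disappears when the statement is applied to actual points. *)
Lemma near_corner j (p : V) (eps : R) : base (Corner j) (rep_of p).1 -> 0 < eps ->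
  nbhs p [set u : V | base (Corner j) (u 0 o0, `|u 0 o1|) /\
    exists2 L, joined (param (Corner j) (TK e (Corner j) u)) (param (Corner j) (TK e (Corner j) p)) L
      & L < eps].
Proof.
move=> Bp e0; have FF : Filter (nbhs p) by exact: nbhs_filter.
have Dv : dom (Corner j) (TK e (Corner j) p) by exact: (dom_kap e3 Bp).
have cx := @coord_cont R o0.
have oO : open ([set u : V | a j.+1 < u 0 o0] `&` [set u : V | ((u 0 o0)%:E < prev_corner R e j)%E]).
  by apply: openI; [exact: open_gt_fun|exact: open_lt_prev].
have pO : ([set u : V | a j.+1 < u 0 o0] `&` [set u : V | ((u 0 o0)%:E < prev_corner R e j)%E]) p.
  by case: Bp.
have N1 := open_nbhs_nbhs (conj oO pO).
have N2 : nbhs p (fun u : V => dom (Corner j) (TK e (Corner j) u) /\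
    exists2 L, joined (param (Corner j) (TK e (Corner j) u)) (param (Corner j) (TK e (Corner j) p)) L
      & L < eps) := @TK_corner_cont R e j p _ (local_dist cf e3 Dv e0).
apply: (@filterS _ _ FF _ _ _ (@filterI _ _ FF _ _ N1 N2)) => u [[h1 h2] [_ H]].
by split=> //; split=> //; exact: normr_ge0.
Qed.

Lemma met_complete : complete_metric alpha e G.
Proof.
move=> P MP Cauchy; have [r Hr] := choice (fun k => Malpha_rep e3 (MP k)).
have [K0 HK0] := Cauchy 1 ltr01.
have [_ x0 y0 _ _] := Hr K0; have [d [M [d0 conf]]] := confined x0 y0.
have box k : (K0 <= k)%N -> alpha + d <= (r k).1.1 <= M /\ 0 <= (r k).1.2 <= M.
  move=> Kk; have [Ek xk yk _ _] := Hr k; apply: conf => //.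
  have [E0 _ _ _ _] := Hr K0; rewrite -Ek -E0.
  have [L J L1] := (rdist_lt _ _ _).1 (HK0 K0 k (leqnn _) Kk).
  by exists L => //; exact: ltW.
(* The representatives from [K0] on lie in a compact box of R^4, so they have a cluster point [p],
   which is a representative of the limit. *)
pose q k : V := row4 (r k).1.1 (r k).1.2 (r k).2.1 (r k).2.2.
pose A (i : 'I_4) : set R := match val i with 0 => [set` `[alpha + d, M]] | 1 => [set` `[0, M]] | _ => [set` `[0, 2 * pi]] end.
have cA i : compact (A i) by elim/ord4_ind: i; exact: segment_compact.
have cB := rV_compact cA.
pose F := (fun k => q (k + K0)%N) @ \oo.
have PF : ProperFilter F by exact: fmap_proper_filter.
have FB : F [set v : V | forall i, A i (v ord0 i)].
  exists 0%N => // k _ /= i; have [_ _ _ z1 z2] := Hr (k + K0)%N.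
  have [bx bY] := box (k + K0)%N (leq_addl _ _).
  by elim/ord4_ind: i; rewrite mxE /A /= in_itv.
have [p [pA pF]] := cB F PF FB.
have p0 : alpha < p 0 o0.
  by have := pA o0; rewrite /A /= in_itv /= => /andP[H _]; apply: lt_le_trans H; rewrite ltrDl.
have p1 : 0 <= p 0 o1 by have := pA o1; rewrite /A /= in_itv /= => /andP[].
have [j Bj] := @base_exists R alpha e cf e3 (p 0 o0, p 0 o1) p0 p1; pose c := Corner j.
have Bp : base c (rep_of p).1 by [].
have Dv : dom c (TK e c p) by exact: (dom_kap e3 Bp).
exists (cls e (rep_of p)); first by exists (rep_of p).
apply: rdist_cvg0 => eps e0; have e2 : 0 < eps / 2 by rewrite divr_gt0.
have [K1 HK1] := Cauchy _ e2.
have N := near_corner Bp e2.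
(* Some far term [q l] is close to [p] in coordinates, hence in distance; the Cauchy condition
   brings all later terms close to it. *)
have FK : F [set q k | k in [set k | (K1 <= k)%N /\ (K0 <= k)%N]].
  exists K1 => // k /= Kk; exists (k + K0)%N => //; split; last exact: leq_addl.
  exact: leq_trans Kk (leq_addr _ _).
have [u [[l [Kl Kl0] <-] [Bu [L J L2]]]] := pF _ _ FK N.
have [El _ yl _ _] := Hr l.
have ql : rep_of (q l) = r l.
  by rewrite /rep_of !mxE /=; case: (r l) => [[? ?] [? ?]].
have Bl : base c (rep_of (q l)).1.
  by move: Bu; rewrite /= !mxE /= ger0_norm.
rewrite (param_kap e3 Bp) (param_kap e3 Bl) ql -El in J.
exists K1 => k Kk; apply/rdist_lt.
have [L' J' L1] := (rdist_lt _ _ _).1 (HK1 k l Kk Kl).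
by exists (L' + L); [exact: joined_trans J' J|lra].
Qed.

End Complete.

Theorem mainTheorem1 (R : realType) (alpha : R) (e : nat -> int)
    (halpha0 : 0 < alpha) (halpha1 : alpha < 1)
    (hirr : irrational alpha)
    (hcf : has_modified_cf alpha e)
    (he : exists N : int, forall j : nat, (1 <= j)%N -> 3 <= e j <= N) :
  exists g : tensor2 R,
    [/\ riemannian_metric alpha e g /\ complete_metric alpha e g,
        self_dual alpha e g,
        einstein alpha e g,
        negative_scalar_curvature alpha e g &
        torus_invariant alpha e g].
Proof.
have e3 j : (1 <= j)%N -> 3 <= e j by case: he => N H /H /andP[].
have curv c v (Dv : chart_dom alpha e c v) := met_curvature hcf e3 Dv.
exists (met alpha e); split.
- split; last exact: met_complete.
  split.
  + by move=> c i j; apply/smooth_onP => n; exact: Ck_met.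
  + by move=> c v Dv; exact: met_sym.
  + by move=> c v Dv; exact: met_pos.
  + by move=> c c' tau v Dv Rt dt; have [] := represents_compat hcf e3 Dv Rt dt.
- exists (fun c _ => orient R e c); last by move=> c v /curv[].
  split.
  + by move=> c v; exact: orient_sign.
  + move=> c v _; have FF : Filter (nbhs v) by exact: nbhs_filter.
    by apply: (@filterE _ _ FF) => u.
  + by move=> c c' tau v Dv Rt dt; have [] := represents_compat hcf e3 Dv Rt dt.
- by exists (-3) => c v /curv[].
- by move=> c v /curv[_ -> _]; rewrite oppr_lt0.
- move=> w c v Dv; exists c, (act_map e c w); split.
  + have N : nbhs v (chart_dom alpha e c).
      by apply: open_nbhs_nbhs; split=> //; exact: open_chart_dom.
    have FF : Filter (nbhs v) by exact: nbhs_filter.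
    by apply: filterS N => u /(act_map_param e3 w).
  + exists setT; first by split=> //; exact: openT.
    by move=> i; apply/smooth_onP => n; apply: Ck_act_map; exact: openT.
  + by rewrite /pullback jac_act_map; exact: act_map_metric.
Qed.
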